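(* The binary quadratic operads $\mathsf 1_{\mathtt{ggGrc}}$, $\mathsf 1_{\mathtt{Tr}}$, $\mathsf 1_{\mathtt{RTr}}$ and $\mathsf 1_{\mathtt{Whe}}$ (the terminal operads over the operadic categories $\mathtt{ggGrc}$, $\mathtt{Tr}$, $\mathtt{RTr}$ and $\mathtt{Whe}$, respectively) are Koszul.
   Context: $\Bbbk$ is a field of characteristic $0$; everything takes values in (differential) graded $\Bbbk$-vector spaces, with Koszul signs. $\uparrow$, $\downarrow$ raise, resp. lower, degree by one; graded duals are $(V^* )_n=(V_n)^*$. **The operadic categories.** An ordered graph $\Gamma$ has vertices $V=\{1,\dots,n\}$, $n\ge1$, a finite set $\mathrm{Fl}$ of half-edges, a map $g:\mathrm{Fl}\to V$, an involution $\sigma$ of $\mathrm{Fl}$, a linear order on each $g^{-1}(v)$ (local orders) and a linear order on the set of fixed points of $\sigma$, called legs (global order); half-edges are taken to be $\{1,\dots,m\}$, ordered first by vertex and then locally. Two-element orbits of $\sigma$ are internal edges and $e(\Gamma)$ is their number. A morphism $\Gamma'\to\Gamma''$ is a pair $(\psi,\varphi)$: an injection $\psi:\mathrm{Fl}''\to\mathrm{Fl}'$ commuting with involutions and restricting to a bijection of legs preserving the global orders, and a surjection $\varphi:V'\to V''$ with $\varphi g'\psi=g''$, such that if $h\notin\mathrm{Im}\,\psi$ then $\varphi g'(h)=\varphi g'(\sigma'h)$, and all fibers are connected. The fiber over $v\in V''$ has vertices $\varphi^{-1}(v)$ (renumbered order-preservingly), half-edges $h\in\mathrm{Fl}'$ with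 $\varphi g'(h)=v$, involution $h\mapsto\sigma'(h)$ if $h\notin\mathrm{Im}\,\psi$ and $h\mapsto h$ if $h\in\mathrm{Im}\,\psi$, inherited local orders, and global order transported along $\psi$ from the local order at $v$. Put $|\Gamma|=V$, $|(\psi,\varphi)|=\varphi$; induced maps $f_v:(gf)^{-1}(v)\to g^{-1}(v)$ between fibers are restrictions. Local terminal objects (terminal in their connected component) are the one-vertex graphs without internal edges; the trivial (chosen local terminal) ones are those whose local and global orders agree. The categories are: - $\mathtt{ggGrc}$: connected ordered graphs with a genus $g(v)\in\mathbb N$ for each vertex; fibers inherit genera; morphisms must satisfy that the genus of each $v\in V''$ equals the genus $\sum_wg(w)+b_1$ of the fiber over $v$. - $\mathtt{Tr}$: ordered graphs that are trees (contractible). - $\mathtt{RTr}$: ordered trees with at least one leg such that at each vertex the half-edge pointing towards the smallest leg (the root) is smallest in the local order. - $\mathtt{Whe}$: connected graphs whose half-edges are partitioned into inputs and outputs so that each internal edge consists of one output and one input, with separate linear local orders of the inputs and of the outputs of each vertex and separate global orders of input and output legs; morphisms preserve inputs and outputs; fibers inherit the orientation. Let $\mathtt O$ be any of these categories. **Markl operads over $\mathtt O$.** $\mathtt O_{\rm iso}$ is the groupoid of isomorphisms. $\phi:T\to S$ with $|\phi|$ order-preserving is elementary (at $i\in|S|$) if all its fibers are trivial except $F=\phi^{-1}(i)$, and $e(F)\ge1$; notation $F\triangleright_iT\xrightarrow{\phi}S$. A (strictly unital) operad $M$ over $\mathtt O$ is a presheaf of graded vector spaces on $\mathtt O_{\rm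 iso}$ with degree $0$ maps $\circ_\phi:M(S)\otimes M(F)\to M(T)$ for all elementary $F\triangleright T\xrightarrow{\phi}S$ and $\eta_U:\Bbbk\to M(U)$ for trivial $U$, such that: (a) if $F\triangleright_jT\xrightarrow{\phi}S$, $G\triangleright_iS\xrightarrow{\psi}P$, $|\psi|(j)=i$, $\xi=\psi\phi$, then $\circ_\xi(\mathrm{id}\otimes\circ_{\phi_i})=\circ_\phi(\circ_\psi\otimes\mathrm{id})$ on $M(P)\otimes M(G)\otimes M(F)$; (b) if $\psi'\phi'=\psi''\phi'':T\to S$ with $\phi',\psi',\phi'',\psi''$ elementary at $j,i,l,k$ and $|\psi''|(l)=i\ne k=|\psi'|(j)$ (then $\phi',\psi''$ have the same nontrivial fiber $F$, and $\phi'',\psi'$ the same nontrivial fiber $G$), then $\circ_{\phi'}(\circ_{\psi'}\otimes\mathrm{id})(\mathrm{id}\otimes\tau)=\circ_{\phi''}(\circ_{\psi''}\otimes\mathrm{id})$ on $M(S)\otimes M(F)\otimes M(G)$, $\tau$ the symmetry; (u) with $\eta_u:=!^*\eta_U$ for $u$ local terminal, $!:u\to U$, $U$ trivial: whenever $F\triangleright T\xrightarrow{!}u$, $M(T)=M(F)$ and $\circ_!(\eta_u\otimes\mathrm{id})=\mathrm{id}$; (c) if $\phi''\omega=\sigma\phi'$ with $\omega,\sigma$ isomorphisms, $F'\triangleright_iT'\xrightarrow{\phi'}S'$, $F''\triangleright_jT''\xrightarrow{\phi''}S''$, then $\omega^*\circ_{\phi''}=\circ_{\phi'}(\sigma^*\otimes\omega_j^*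 )$, where $\omega_j:F\to F''$, $F=(\phi''\omega)^{-1}(j)$, and $M(F)=M(F')$ by (u). It is $1$-connected if all $\eta_U$ are isomorphisms. The terminal operad $\mathsf 1_{\mathtt O}$ has all components $\Bbbk$ and all structure maps canonical identifications. A degree $s$ derivation of $M$ is a degree $s$ presheaf endomorphism $\varpi$, zero on $M(T)$ with $e(T)=0$, with $\varpi_T\circ_\phi=\circ_\phi(\mathrm{id}\otimes\varpi_F)+\circ_\phi(\varpi_S\otimes\mathrm{id})$. A dg operad is an operad with a degree $-1$ derivation of square zero. **Quadratic operads, Koszul duals.** A $1$-connected collection is a presheaf $E$ of graded vector spaces on $\mathtt O_{\rm iso}$ with $E(T)=0$ if $e(T)=0$; $E(T)=E(F)$ whenever $F$ is the fiber of $T\to u$, $u$ local terminal; and $E(\phi')=E(\phi'')$ if $\phi''$ is the map induced between the fibers over a local terminal $t$ by an isomorphism $\phi'$ over $t$. $\mathbb F(E)$ is the free $1$-connected operad on $E$ (left adjoint to $M\mapsto\{M(T)\text{ if }e(T)\ge1;\,0\text{ otherwise}\}$), with weight grading $\mathbb F(E)=\bigoplus_{k\ge0}\mathbb F^k(E)$ additive under $\circ_\phi$, $\mathbb F^0$ the unit part, $\mathbb F^1(E)=E$. Explicitly $\mathbb F^2(E)(X)\cong\bigoplus_cE(t_1^c)\otimes E(t_2^c)$, where $c$ runs over the set $\pi(X)$ of isomorphism classes of pairs ($\ell:X\to T$ an isomorphism, $\tau:T\to S$ elementary with $e(S)\ge1$), $(\ell',\tau')\sim(\ell'',\tau'')$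 if there are isomorphisms $\sigma_1,\sigma_2$ with $\sigma_1\ell'=\ell''$, $\sigma_2\tau'=\tau''\sigma_1$; one representative is chosen in each class, $t_1$ is the nontrivial fiber of $\tau$, $t_2=S$, and $x\otimes y$ corresponds to $(-1)^{|x||y|}\ell^*\circ_\tau(y\otimes x)$. An ideal is a sub-presheaf $I$ with $\circ_\phi(a\otimes b)\in I$ if $a\in I$ or $b\in I$; $(R)$ is the smallest ideal containing $R$. A $1$-connected operad is quadratic if $M\cong\mathbb F(E)/(R)$ with $R\subset\mathbb F^2(E)$ a sub-presheaf, binary if moreover $E(T)\ne0$ implies $e(T)=1$. Its Koszul dual is $M^!=\mathbb F(\uparrow E^* )/(R^\perp)$, with $R^\perp\subset\mathbb F^2(\uparrow E^* )$ the annihilator of $R$ under the pairing $\mathbb F^2(\uparrow E^* )(X)\otimes\mathbb F^2(E)(X)\to\Bbbk$ for which summands of distinct classes $c$ are orthogonal and which on the same class is the evaluation $\uparrow E^*(t_1)\otimes\uparrow E^*(t_2)\otimes E(t_1)\otimes E(t_2)\to\Bbbk$. $\mathsf 1_{\mathtt O}$ is presented by $E(\Gamma)=\Bbbk$ if $e(\Gamma)=1$, $0$ otherwise (constant presheaf), and $R$ the kernel of $\mathbb F^2(E)\to\mathsf 1_{\mathtt O}$. **Dual dg operad, Koszulity.** Let $N$ be a $1$-connected operad with finite-dimensional components. Its dual $N^*$ has operations $\delta_\phi=(\circ_\phi)^*:N(T)^*\to N(S)^*\otimes N(F)^*$ and covariant actions $\ell_*=(\ell^* )^*$ of isomorphisms,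 regarded as a presheaf via $\ell^*:=(\ell^{-1})_*$. Let $\overline{N^*}(T)=N(T)^*$ if $e(T)\ge1$ and $0$ otherwise, with restricted operations $\overline\delta_\phi$, and put $\overline\delta{}^{\downarrow}_\phi=(\downarrow\otimes\downarrow)\,\overline\delta_\phi\uparrow$ on $\downarrow\overline{N^*}$. The dual dg operad is $\mathbb D(N)=(\mathbb F(\downarrow\overline{N^*}),\partial)$, $\partial$ being the unique degree $-1$ derivation with $\partial(x)=\sum_{[\ell,\tau]\in\pi(X)}\ell^*\circ_\tau(\overline\delta{}^{\downarrow}_\tau(\ell_*x))$ for $x\in\,\downarrow\overline{N^*}(X)$. For quadratic $M=\mathbb F(E)/(R)$, the canonical map $\mathrm{can}:\mathbb D(M^!)\to(M,0)$ is the morphism of dg operads extending $\downarrow\overline{(M^!)^*}\twoheadrightarrow E\hookrightarrow\mathbb F(E)\twoheadrightarrow M$, where the first map is the desuspended dual of $\uparrow E^*\hookrightarrow M^!$. $M$ is Koszul if $\mathrm{can}$ induces an isomorphism of homology of each component. *)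

(* Defs.v *)
From HB Require Import structures.
From mathcomp Require Import all_boot all_order all_algebra.
From mathcomp Require Import boolp classical_sets functions.

Set Implicit Arguments.
Unset Strict Implicit.
Unset Printing Implicit Defensive.

Import GRing.Theory.
Local Open Scope ring_scope.

(** * Graded vector spaces *)

(* A graded vector space is the direct sum of its components: [gproj n] is the
   projection onto the component of degree [n]. *)
Record gvs (K : fieldType) := Gvs {
  gcarrier :> lmodType K;
  gproj : int -> gcarrier -> gcarrier;
  gproj_lin : forall n, linear (gproj n);
  gprojE : forall m n x,
    gproj m (gproj n x) = if m == n then gproj n x else 0;
  gproj_sum : forall x, exists2 s : seq int,
    uniq s & x = \sum_(n <- s) gproj n x
}.

Section GradedSpaces.
Variable K : fieldType.
Implicit Types (V W : gvs K) (n d : int).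

Definition homog V n (x : V) : Prop := gproj n x = x.

Definition sgn n : K := (-1) ^ n.

Definition gcast V W (E : V = W) : V -> W :=
  match E in _ = U return V -> U with erefl => id end.

Definition fin_dim V : Prop := exists s : seq V,
  forall x : V, exists c : nat -> K, x = \sum_(i < size s) c i *: s`_i.

Lemma lin0 (U W : lmodType K) (f : U -> W) : linear f -> f 0 = 0.
Proof. by move=> /(_ (-1) 0 0); rewrite scaler0 addr0 scaleN1r addNr. Qed.

Lemma gproj_notin V (x : V) (s : seq int) n :
  x = \sum_(m <- s) gproj m x -> n \notin s -> gproj n x = 0.
Proof.
move=> xE; have lin := @gproj_lin K V n; rewrite xE.
elim: s {xE} => [_|m r IH]; first by rewrite big_nil (lin0 lin).
rewrite inE negb_or big_cons => /andP[nm /IH h].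
by rewrite -[gproj m x]scale1r lin scale1r h addr0 gprojE (negbTE nm).
Qed.

(* Suspension by [d]: (V[d])_n = V_(n-d).  The suspension map is the identity
   of the carrier. *)
Lemma gsusp_projE V d m n (x : V) :
  gproj (m - d) (gproj (n - d) x) = if m == n then gproj (n - d) x else 0.
Proof. by rewrite gprojE (inj_eq (addIr _)). Qed.

Lemma gsusp_sum V d (x : V) : exists2 s : seq int,
  uniq s & x = \sum_(n <- s) gproj (n - d) x.
Proof.
have [s us xE] := gproj_sum x.
exists [seq n + d | n <- s]; first by rewrite map_inj_uniq //; apply: addIr.
by rewrite big_map [LHS]xE; apply: eq_bigr => n _; rewrite addrK.
Qed.

Definition gsusp d V : gvs K :=
  @Gvs K V (fun n => gproj (n - d))
    (fun n => gproj_lin (n - d)) (@gsusp_projE V d) (@gsusp_sum V d).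

(* A space concentrated in degree 0. *)
Section Deg0.
Variable L : lmodType K.
Definition deg0_proj n (x : L) : L := if n == 0 then x else 0.
Lemma deg0_lin n : linear (deg0_proj n).
Proof. by move=> a x y; rewrite /deg0_proj; case: ifP => // _; rewrite scaler0 addr0. Qed.
Lemma deg0_projE m n x :
  deg0_proj m (deg0_proj n x) = if m == n then deg0_proj n x else 0.
Proof.
rewrite /deg0_proj; have [->|] := eqVneq m n; first by case: (n == 0).
by move=> mn; case: eqP => // m0; case: eqP => // n0; rewrite m0 n0 eqxx in mn.
Qed.
Lemma deg0_sum x : exists2 s : seq int, uniq s & x = \sum_(n <- s) deg0_proj n x.
Proof. by exists [:: 0] => //; rewrite big_seq1 /deg0_proj eqxx. Qed.
Definition gdeg0 : gvs K := Gvs deg0_lin deg0_projE deg0_sum.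
End Deg0.

(* The graded dual, (V^* )_n = (V_n)^*: linear forms supported in finitely many
   degrees.  When the flag [b] is false, the zero space. *)
Section Dual.
Variables (b : bool) (V : gvs K).

Definition is_dual (f : V -> K^o) : Prop :=
  [/\ linear f,
      exists s : seq int, forall n x, n \notin s -> f (gproj n x) = 0 &
      ~~ b -> forall x, f x = 0].

Definition dual_pred : {pred V -> K^o} := fun f => `[< is_dual f >].

Lemma dual_submod : GRing.submod_closed dual_pred.
Proof.
split=> [|a f g /asboolP[fl [s fs] fb] /asboolP[gl [t gt] gb]]; apply/asboolP.
  split=> //; last by exists [::].
  by move=> a x y /=; rewrite [RHS]addr0 scaler0.
have E x : (a *: f + g) x = a *: f x + g x by [].
split=> [c x y||nb x].
- rewrite !E fl gl !scalerDr !scalerA (mulrC a c) -!addrA; congr (_ + _).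
  by rewrite addrCA.
- exists (s ++ t) => n x; rewrite mem_cat negb_or => /andP[ns nt].
  by rewrite E fs // gt // scaler0 addr0.
- by rewrite E fb // gb // scaler0 addr0.
Qed.
HB.instance Definition _ := GRing.isSubmodClosed.Build K (V -> K^o) dual_pred dual_submod.

Record dualT := Dual { dual_fun :> V -> K^o; dual_funP : dual_fun \in dual_pred }.
HB.instance Definition _ := [isSub for dual_fun].
HB.instance Definition _ := [Choice of dualT by <:].
HB.instance Definition _ := [SubChoice_isSubLmodule of dualT by <:].

Lemma dual_proj_subproof n (f : dualT) : (f \o gproj n : V -> K^o) \in dual_pred.
Proof.
case: f => f fP /=; have /asboolP[fl [s fs] fb] := fP; apply/asboolP; split.
- by move=> a x y /=; rewrite gproj_lin fl.
- exists [:: n] => m x; rewrite inE eq_sym => /negbTE nm /=; rewrite gprojE nm.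
  exact: lin0 fl.
- by move=> nb x /=; rewrite fb.
Qed.

Definition dual_proj n (f : dualT) : dualT := Dual (dual_proj_subproof n f).

Lemma dual_eq (f g : dualT) : (forall x, f x = g x) -> f = g.
Proof. by move=> fg; apply/val_inj/funext. Qed.

Lemma dual_proj_lin n : linear (dual_proj n).
Proof. by move=> a f g; apply: dual_eq. Qed.

Lemma dual_fun0 (f : dualT) : f 0 = 0.
Proof.
have /asboolP[fl _ _] := dual_funP f; exact: lin0 fl.
Qed.

Lemma dual_fun_sum (f : dualT) (I : Type) (r : seq I) (F : I -> V) :
  f (\sum_(i <- r) F i) = \sum_(i <- r) f (F i).
Proof.
have /asboolP[fl _ _] := dual_funP f.
elim: r => [|i r IH]; first by rewrite !big_nil dual_fun0.
by rewrite !big_cons -IH -[F i]scale1r fl !scale1r.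
Qed.

Lemma dual_projE m n f :
  dual_proj m (dual_proj n f) = if m == n then dual_proj n f else 0.
Proof.
apply: dual_eq => x; rewrite /= gprojE eq_sym; case: (eqVneq m n) => [->|] //.
by rewrite dual_fun0.
Qed.

Lemma dual_sum_fun (I : Type) (r : seq I) (F : I -> dualT) x :
  (\sum_(i <- r) F i) x = \sum_(i <- r) F i x.
Proof. by elim: r => [|i r IH]; rewrite ?big_nil // !big_cons -IH. Qed.

Lemma dual_sum f : exists2 s : seq int, uniq s & f = \sum_(n <- s) dual_proj n f.
Proof.
have /asboolP[_ [s fs] _] := dual_funP f.
exists (undup s); first exact: undup_uniq.
apply: dual_eq => x; rewrite dual_sum_fun /=.
have [t ut xE] := gproj_sum x; rewrite [in LHS]xE dual_fun_sum.
rewrite (bigID (mem (undup s))) /= [X in _ + X]big1 ?addr0; last first.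
  by move=> n; rewrite mem_undup => /fs.
rewrite [RHS](bigID (mem t)) /= [X in _ + X]big1 ?addr0; last first.
  by move=> n nt; rewrite (gproj_notin xE nt) dual_fun0.
rewrite -[LHS]big_filter -[RHS]big_filter; apply: perm_big; apply: uniq_perm.
- by rewrite filter_uniq.
- by rewrite filter_uniq // undup_uniq.
- by move=> n; rewrite !mem_filter andbC.
Qed.

Definition gdual : gvs K := Gvs dual_proj_lin dual_projE dual_sum.

Definition dapp (a : gdual) (x : V) : K := dual_fun a x.

End Dual.

(* Elements of V (x) W are represented by finite lists of homogeneous pure
   tensors. *)
Record pure V W := Pure {
  dl : int; vl : V; dr : int; vr : W;
  pure_homl : homog dl vl;
  pure_homr : homog dr vr
}.

End GradedSpaces.

(** * The operadic categories of graphs *)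

(* Half-edges ['I_nh] are numbered first by vertex, then by the local order, so
   the local orders are the restrictions of the order of ['I_nh].  The global
   order is the order of the list [legs].  The labels [genus] are used in ggGrc
   only and the labels [outp] (outputs) in Whe only; they are constant in the
   other categories. *)
Record graph := Graph {
  nv : nat;
  nh : nat;
  vtx : {ffun 'I_nh -> 'I_nv};
  opp : {ffun 'I_nh -> 'I_nh};
  legs : seq 'I_nh;
  genus : {ffun 'I_nv -> nat};
  outp : {ffun 'I_nh -> bool}
}.

Definition ordered (T : graph) : Prop :=
  [/\ (0 < nv T)%N,
      forall h h' : 'I_(nh T), (h <= h')%N -> (vtx T h <= vtx T h')%N,
      involutive (opp T),
      uniq (legs T) &
      forall h, (h \in legs T) = (opp T h == h)].

(* An internal edge {h, opp h} is counted at its smaller half-edge. *)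
Definition nedge (T : graph) : nat := #|[pred h : 'I_(nh T) | (h < opp T h)%N]|.

Definition adj (T : graph) : rel 'I_(nv T) :=
  fun v w => [exists h, (vtx T h == v) && (vtx T (opp T h) == w)].

Definition connected (T : graph) : Prop := forall v w, connect (@adj T) v w.

(* The first Betti number of a connected graph. *)
Definition b1 (T : graph) : nat := ((nedge T).+1 - nv T)%N.

Record gmap (T S : graph) := GMap {
  psi : {ffun 'I_(nh S) -> 'I_(nh T)};
  phi : {ffun 'I_(nv T) -> 'I_(nv S)}
}.

Definition gid (T : graph) : gmap T T :=
  GMap (T := T) (S := T) [ffun h => h] [ffun v => v].

Definition gcomp (T S P : graph) (g : gmap S P) (f : gmap T S) : gmap T P :=
  GMap (T := T) (S := P) [ffun h => psi f (psi g h)] [ffun v => phi g (phi f v)].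

(* [F], included in [T] by [iv] and [ih], is the fiber of [f] over [v].  As
   [iv] and [ih] are increasing they are determined by [f] and [v], and so is
   [F]. *)
Record fiber_incl (T S : graph) (f : gmap T S) (v : 'I_(nv S)) (F : graph)
    (iv : 'I_(nv F) -> 'I_(nv T)) (ih : 'I_(nh F) -> 'I_(nh T)) : Prop := {
  fi_iv_incr : forall w w' : 'I_(nv F), (w < w')%N -> (iv w < iv w')%N;
  fi_iv_im : forall w, (w \in codom iv) = (phi f w == v);
  fi_ih_incr : forall h h' : 'I_(nh F), (h < h')%N -> (ih h < ih h')%N;
  fi_ih_im : forall h, (h \in codom ih) = (phi f (vtx T h) == v);
  fi_vtx : forall h, iv (vtx F h) = vtx T (ih h);
  fi_opp : forall h, ih (opp F h) =
    if ih h \in codom (psi f) then ih h else opp T (ih h);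
  fi_legs : [seq ih h | h <- legs F] =
    [seq psi f h | h <- enum 'I_(nh S) & vtx S h == v];
  fi_genus : forall w, genus F w = genus T (iv w);
  fi_outp : forall h, outp F h = outp T (ih h)
}.

Definition is_fiber (T S : graph) (f : gmap T S) (v : 'I_(nv S)) (F : graph) :=
  exists iv ih, @fiber_incl T S f v F iv ih.

(* For f : T -> S, g : S -> P with composite [gf], the map [fv] is the
   restriction (gf)^-1(v) -> g^-1(v) of [f]. *)
Definition is_induced (T S P : graph) (f : gmap T S) (g : gmap S P)
    (gf : gmap T P) (v : 'I_(nv P)) (H G : graph) (fv : gmap H G) : Prop :=
  exists iv ih jv jh,
    [/\ @fiber_incl T P gf v H iv ih,
        @fiber_incl S P g v G jv jh,
        forall w, jv (phi fv w) = phi f (iv w) &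
        forall h, ih (psi fv h) = psi f (jh h)].

Definition graph_map (T S : graph) (f : gmap T S) : Prop :=
  [/\ injective (psi f) /\ forall v, v \in codom (phi f),
      forall h, psi f (opp S h) = opp T (psi f h),
      [seq psi f h | h <- legs S] = legs T,
      (forall h, phi f (vtx T (psi f h)) = vtx S h) /\
      (forall h, h \notin codom (psi f) ->
        phi f (vtx T h) = phi f (vtx T (opp T h))) &
      forall v F, is_fiber f v F -> connected F].

Inductive opcat := ggGrc | Tr | RTr | Whe.

Definition tree (T : graph) : Prop := connected T /\ b1 T = 0%N.

(* [towards r h]: the half-edge [h] of the tree [T] points towards its leg [r];
   i.e. [h = r], or [opp h] and [r] are on the same side of the edge
   {h, opp h}. *)
Definition towards (T : graph) (r h : 'I_(nh T)) : bool :=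
  (h == r) ||
  (opp T h != h) &&
  connect (fun v w => [exists k, [&& k != h, k != opp T h,
                                     vtx T k == v & vtx T (opp T k) == w]])
          (vtx T (opp T h)) (vtx T r).

Definition rooted (T : graph) : Prop :=
  if legs T is r :: _ then
    forall h h' : 'I_(nh T), towards r h -> vtx T h' = vtx T h -> (h <= h')%N
  else False.

(* A pair of linear orders, of inputs and of outputs, is encoded by the linear
   order in which they are concatenated, inputs first. *)
Definition directed (T : graph) : Prop :=
  [/\ forall h, opp T h != h -> outp T (opp T h) = ~~ outp T h,
      forall h h' : 'I_(nh T),
        vtx T h = vtx T h' -> (h <= h')%N -> outp T h -> outp T h' &
      sorted (fun h h' => outp T h ==> outp T h') (legs T)].

Definition no_genus (T : graph) : Prop := forall v, genus T v = 0%N.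
Definition no_outp (T : graph) : Prop := forall h, outp T h = false.

Definition is_obj (O : opcat) (T : graph) : Prop :=
  ordered T /\ connected T /\
  match O with
  | ggGrc => no_outp T
  | Tr => [/\ no_genus T, no_outp T & tree T]
  | RTr => [/\ no_genus T, no_outp T, tree T & rooted T]
  | Whe => no_genus T /\ directed T
  end.

Definition is_arr (O : opcat) (T S : graph) (f : gmap T S) : Prop :=
  graph_map f /\
  match O with
  | ggGrc => forall v F, is_fiber f v F ->
      genus S v = (\sum_w genus F w + b1 F)%N
  | Tr | RTr => True
  | Whe => forall h, outp T (psi f h) = outp S h
  end.

Record obj (O : opcat) := Obj { ograph :> graph; obj_ok : is_obj O ograph }.
Record arr (O : opcat) (T S : obj O) :=
  Arr { amap :> gmap T S; arr_ok : is_arr O amap }.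

Definition loc_terminal (T : graph) : Prop := nv T = 1%N /\ forall h, opp T h = h.
Definition trivial (T : graph) : Prop :=
  loc_terminal T /\ legs T = enum 'I_(nh T).

Section Operads.
Variables (K : fieldType) (O : opcat).
Implicit Types (T S P F G H X U u : obj O).

Definition iso T S (f : arr T S) : Prop :=
  exists g : arr S T, gcomp g f = gid T /\ gcomp f g = gid S.

(* F |>_i T -f-> S; the trivial fibers have no internal edge, so [f] determines
   [i] and [F]. *)
Definition elementary T S (f : arr T S) (i : 'I_(nv S)) F : Prop :=
  [/\ forall w w' : 'I_(nv T), (w <= w')%N -> (phi f w <= phi f w')%N,
      is_fiber f i F,
      (0 < nedge F)%N &
      forall v G, v != i -> is_fiber f v G -> trivial G].

(* [F] is the fiber of a map from [T] to a local terminal object. *)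
Definition lt_fiber T F : Prop :=
  exists u (f : arr T u) i, loc_terminal u /\ is_fiber f i F.

(** * Presheaves and collections *)

(* The values of [pact] are meaningful on isomorphisms only; the value at
   [f : T -> S] is f^*. *)
Record presheaf := Presheaf {
  pobj :> obj O -> gvs K;
  pact : forall T S, arr T S -> pobj S -> pobj T
}.

(* [x] and [y] correspond under an equality M(T) = M(F). *)
Definition same (M : presheaf) T F (x : M T) (y : M F) : Prop :=
  exists E : M T = M F, gcast E x = y.

Record is_presheaf (M : presheaf) : Prop := {
  pact_lin : forall T S (f : arr T S), iso f -> linear (@pact M T S f);
  pact_deg : forall T S (f : arr T S), iso f ->
    forall n (x : M S), homog n x -> homog n (pact f x);
  pact_id : forall T (f : arr T T), amap f = gid T -> forall x : M T, pact f x = x;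
  pact_comp : forall T S P (f : arr T S) (g : arr S P) (h : arr T P),
    iso f -> iso g -> amap h = gcomp g f ->
    forall x : M P, pact h x = pact f (pact g x)
}.

(* 1-connected collections *)
Record is_coll (E : presheaf) : Prop := {
  coll_presheaf :> is_presheaf E;
  coll_red : forall T, nedge T = 0%N -> forall x : E T, x = 0;
  coll_eq : forall T F, lt_fiber T F -> E T = E F;
  coll_act : forall T' T'' t (f' : arr T' T'') (g'' : arr T'' t) (g' : arr T' t)
      i F' F'' (f'' : arr F' F''),
    loc_terminal t -> iso f' -> amap g' = gcomp g'' f' ->
    is_fiber g' i F' -> is_fiber g'' i F'' -> is_induced f' g'' g' i f'' ->
    forall (x : E T'') (y : E F''), same x y -> same (pact f' x) (pact f'' y)
}.

Definition family (E M : presheaf) := forall T, E T -> M T.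

(* degree [d] maps of presheaves *)
Record presheaf_map (d : int) (E M : presheaf) (f : family E M) : Prop := {
  pmap_lin : forall T, linear (f T);
  pmap_deg : forall T n (x : E T), homog n x -> homog (n + d) (f T x);
  pmap_act : forall T S (g : arr T S), iso g ->
    forall x : E S, f T (pact g x) = pact g (f S x)
}.

(* Maps from a 1-connected collection to a 1-connected operad truncated to
   graphs with an internal edge; they respect the equalities E(T) = E(F) and
   M(T) = M(F). *)
Definition coll_map (E M : presheaf) (f : family E M) : Prop :=
  presheaf_map 0 f /\
  forall T F, (0 < nedge T)%N -> lt_fiber T F ->
    forall (x : E T) (y : E F), same x y -> same (f T x) (f F y).

Record sub_presheaf (M : presheaf) (I : forall T, M T -> Prop) : Prop := {
  sub_0 : forall T, I T 0;
  sub_lin : forall T a (x y : M T), I T x -> I T y -> I T (a *: x + y);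
  sub_proj : forall T n (x : M T), I T x -> I T (gproj n x);
  sub_act : forall T S (f : arr T S), iso f -> forall x : M S, I S x -> I T (pact f x)
}.

(** * Markl operads *)

(* [circ f] is meaningful for elementary [f] with non-trivial fiber [F], and
   [eta U] (the image of 1 under the unit map) for trivial [U]. *)
Record operad := Operad {
  opsh :> presheaf;
  circ : forall T S F, arr T S -> opsh S -> opsh F -> opsh T;
  eta : forall U, opsh U
}.

Record is_operad (M : operad) : Prop := {
  op_presheaf :> is_presheaf M;
  op_linl : forall T S (f : arr T S) i F, elementary f i F ->
    forall y : M F, linear (fun x : M S => circ f x y : M T);
  op_linr : forall T S (f : arr T S) i F, elementary f i F ->
    forall x : M S, linear (fun y : M F => circ f x y : M T);
  op_deg : forall T S (f : arr T S) i F, elementary f i F ->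
    forall m n (x : M S) (y : M F),
    homog m x -> homog n y -> homog (m + n) (circ f x y);
  op_eta_deg : forall U, trivial U -> homog 0 (eta M U);
  op_assoc_seq : forall T S P F G H
      (f : arr T S) (g : arr S P) (gf : arr T P) j i (fi : arr H G),
    elementary f j F -> elementary g i G -> phi g j = i ->
    amap gf = gcomp g f -> is_fiber gf i H -> is_induced f g gf i fi ->
    forall (x : M P) (y : M G) (z : M F),
    circ gf x (circ fi y z) = circ f (circ g x y) z;
  op_assoc_par : forall T R' R'' S F G
      (f' : arr T R') (g' : arr R' S) (f'' : arr T R'') (g'' : arr R'' S) j i l k,
    gcomp g' f' = gcomp g'' f'' ->
    elementary f' j F -> elementary g' i G ->
    elementary f'' l G -> elementary g'' k F ->
    phi g'' l = i -> i <> k -> phi g' j = k ->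
    forall m n (x : M S) (y : M F) (z : M G), homog m y -> homog n z ->
    sgn K (m * n) *: circ f' (circ g' x z) y = circ f'' (circ g'' x y) z;
  op_unit : forall T F u U (b : arr u U) (f : arr T u) i,
    loc_terminal u -> trivial U -> elementary f i F ->
    forall y : M F, same (circ f (pact b (eta M U)) y : M T) y;
  op_equiv : forall T' T'' S' S'' F F' F''
      (w : arr T' T'') (s : arr S' S'') (f' : arr T' S') (f'' : arr T'' S'')
      (h : arr T' S'') (wj : arr F F'') i j,
    iso w -> iso s -> amap h = gcomp f'' w -> amap h = gcomp s f' ->
    elementary f' i F' -> elementary f'' j F'' ->
    is_fiber h j F -> is_induced w f'' h j wj ->
    forall (x : M S'') (y : M F''), exists2 y' : M F',
      same (pact wj y : M F) y' &
      pact w (circ f'' x y) = circ f' (pact s x) y'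
}.

Definition one_connected (M : operad) : Prop :=
  is_operad M /\ forall U, trivial U -> bijective (fun a : K => a *: eta M U).

Record operad_map (M N : operad) (f : family M N) : Prop := {
  omap_presheaf :> presheaf_map 0 f;
  omap_circ : forall T S (g : arr T S) i F, elementary g i F ->
    forall (x : M S) (y : M F), f T (circ g x y) = circ g (f S x) (f F y);
  omap_eta : forall U, trivial U -> f U (eta M U) = eta N U
}.

Record derivation (d : int) (M : operad) (D : family M M) : Prop := {
  der_map :> presheaf_map d D;
  der_0 : forall T, nedge T = 0%N -> forall x : M T, D T x = 0;
  der_circ : forall T S (g : arr T S) i F, elementary g i F ->
    forall n (x : M S) (y : M F), homog n x ->
    D T (circ g x y) =
      sgn K (d * n) *: circ g x (D F y) + circ g (D S x) y
}.

(** * Free operads, ideals, quotients *)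

(* [F], with unit [io], is the free 1-connected operad on [E]. *)
Definition is_free (E : presheaf) (F : operad) (io : family E F) : Prop :=
  [/\ one_connected F, coll_map io &
   forall (M : operad) (f : family E M), one_connected M -> coll_map f ->
     (exists2 g : family F M, operad_map g & forall T x, g T (io T x) = f T x) /\
     (forall g g' : family F M, operad_map g -> operad_map g' ->
       (forall T x, g T (io T x) = f T x) ->
       (forall T x, g' T (io T x) = f T x) ->
       forall T x, g T x = g' T x)].

(* [weight io k] is F^k(E), spanned by the composites of [k] generators. *)
Inductive weight (E : presheaf) (F : operad) (io : family E F) :
    nat -> forall T, F T -> Prop :=
| weight_eta U : trivial U -> weight io 0 (eta F U)
| weight_gen T (x : E T) : weight io 1 (io T x)
| weight_circ k l T S G (f : arr T S) i (x : F S) (y : F G) :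
    elementary f i G -> weight io k x -> weight io l y ->
    weight io (k + l) (circ f x y : F T)
| weight_act k T S (f : arr T S) (x : F S) :
    iso f -> weight io k x -> weight io k (pact f x)
| weight_0 k T : weight io k (0 : F T)
| weight_lin k T a (x y : F T) :
    weight io k x -> weight io k y -> weight io k (a *: x + y).

Definition ideal (M : operad) (I : forall T, M T -> Prop) : Prop :=
  sub_presheaf I /\
  forall T S (f : arr T S) i F, elementary f i F ->
  forall (x : M S) (y : M F), I S x \/ I F y -> I T (circ f x y).

Definition gen_ideal (M : operad) (R : forall T, M T -> Prop) T (x : M T) : Prop :=
  forall I : forall T, M T -> Prop,
    ideal I -> (forall S y, R S y -> I S y) -> I T x.

Definition is_quotient (M : operad) (I : forall T, M T -> Prop) (N : operad)
    (p : family M N) : Prop :=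
  [/\ operad_map p, forall T y, exists x, p T x = y &
      forall T x, p T x = 0 <-> I T x].

(** * Quadratic operads and their Koszul duals *)

(* M = F(E)/(R), with F(E) = (F, io) and quotient map p *)
Definition quadratic (E : presheaf) (F : operad) (io : family E F)
    (R : forall T, F T -> Prop) (M : operad) (p : family F M) : Prop :=
  [/\ is_coll E /\ is_free io,
      sub_presheaf R, forall T x, R T x -> weight io 2 x,
      one_connected M &
      is_quotient (gen_ideal R) p].

Definition binary (E : presheaf) : Prop :=
  forall T, (exists x : E T, x <> 0) -> nedge T = 1%N.

(* Pairs X -l-> T -t-> S; their classes form pi(X). *)
Record pipair X := PiPair {
  piT : obj O; piS : obj O; piF : obj O;
  pil : arr X piT; pit : arr piT piS; pii : 'I_(nv piS);
  pil_iso : iso pil;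
  pit_elem : elementary pit pii piF;
  pi_edge : (0 < nedge piS)%N
}.

Definition pi_equiv X (c c' : pipair X) : Prop :=
  exists (s1 : arr (piT c) (piT c')) (s2 : arr (piS c) (piS c')),
    [/\ iso s1, iso s2, gcomp s1 (pil c) = pil c' &
        gcomp s2 (pit c) = gcomp (pit c') s1].

Definition representatives X n (c : 'I_n -> pipair X) : Prop :=
  (forall p, exists i, pi_equiv p (c i)) /\
  (forall i j, pi_equiv (c i) (c j) -> i = j).

(* [z] corresponds to [t] under F^2(E)(X) = \bigoplus_c E(t_1^c) (x) E(t_2^c) *)
Definition decomposes (E : presheaf) (F : operad) (io : family E F) X n
    (c : 'I_n -> pipair X)
    (t : forall i, seq (pure (E (piF (c i))) (E (piS (c i))))) (z : F X) : Prop :=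
  z = \sum_i \sum_(q <- t i)
    sgn K (dl q * dr q) *:
      pact (pil (c i)) (circ (pit (c i)) (io _ (vr q)) (io _ (vl q))).

(* N^* in which f^* is ((f^* )^* )^-1: for an isomorphism [f : T -> S],
   f^* a is the unique linear form with (f^* a) o f^* = a.  With [b := true] the
   whole dual is taken; with [b := false] the value at [T] is replaced by 0 if
   [nedge T = 0]. *)
Definition dual_presheaf (b : bool) (N : presheaf) : presheaf :=
  @Presheaf (fun T => gdual (b || (0 < nedge T)%N) (N T))
    (fun T S f a =>
       xget 0 [set a' | forall x : N S, dapp a' (pact f x) = dapp a x]%classic).

Definition susp (d : int) (N : presheaf) : presheaf :=
  @Presheaf (fun T => gsusp d (N T)) (fun T S f => @pact N T S f).

(* \uparrow E^* *)
Definition sdual (E : presheaf) : presheaf := susp 1 (dual_presheaf true E).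

(* \downarrow \overline{N^*} *)
Definition bar_gen (N : presheaf) : presheaf := susp (-1) (dual_presheaf false N).

(* The underlying linear form of an element of a suspended dual. *)
Definition ev (b : bool) (V : gvs K) (d : int) (a : gsusp d (gdual b V)) (x : V) : K :=
  dapp (a : gdual b V) x.

Section Pairing.
Variables (E : presheaf) (F : operad) (io : family E F).
Variables (F' : operad) (io' : family (sdual E) F').

(* the pairing F^2(\uparrow E^* )(X) (x) F^2(E)(X) -> K, as a relation *)
Definition pairing X (z' : F' X) (z : F X) (k : K) : Prop :=
  exists n (c : 'I_n -> pipair X), representatives c /\
  exists t' t, [/\ @decomposes (sdual E) F' io' X n c t' z',
                   @decomposes E F io X n c t z &
   k = \sum_i \sum_(q' <- t' i) \sum_(q <- t i)
         sgn K (dr q' * dl q) * (ev (vl q') (vl q) * ev (vr q') (vr q))].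

Definition perp (R : forall T, F T -> Prop) T (z' : F' T) : Prop :=
  forall z : F T, R T z -> pairing z' z 0.
End Pairing.

(** * The dual dg operad and Koszulity *)

(* [t] represents \delta_f(a) in N(S)^* (x) N(F)^* *)
Definition cooperation (N : operad) T S F (f : arr T S) (a : N T -> K)
    bS bF (t : seq (pure (gdual bS (N S)) (gdual bF (N F)))) : Prop :=
  forall (y : N S) (z : N F),
    a (circ f y z) =
    \sum_(q <- t) sgn K (dl q * dr q) * (dapp (vl q) y * dapp (vr q) z).

(* \downarrow, respectively \downarrow (x) \downarrow *)
Definition down (b : bool) (V : gvs K) (a : gdual b V) : gsusp (-1) (gdual b V) := a.

(* [(D, io)] with the differential [pa] is the dual dg operad of [N].  The sign
   in [dual_dg_gen] is that of (\downarrow (x) \downarrow)(a (x) b). *)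
Record dual_dg (N D : operad) (io : family (bar_gen N) D) (pa : family D D) : Prop := {
  dual_dg_1conn : one_connected N;
  dual_dg_fin : forall T, fin_dim (N T);
  dual_dg_free : is_free io;
  dual_dg_der : derivation (-1) pa;
  dual_dg_sq : forall T x, pa T (pa T x) = 0;
  dual_dg_gen : forall X (a : bar_gen N X),
    exists n (c : 'I_n -> pipair X)
      (t : forall i, seq (pure (dual_presheaf false N (piS (c i)))
                               (dual_presheaf false N (piF (c i))))),
    [/\ representatives c,
        forall i, cooperation (pit (c i)) (fun x => ev a (pact (pil (c i)) x)) (t i) &
        pa X (io X a) = \sum_i \sum_(q <- t i)
          sgn K (dl q) *:
            pact (pil (c i)) (circ (pit (c i)) (io _ (down (vl q))) (io _ (down (vr q))))]
}.

(* [M] carries the zero differential. *)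
Definition quasi_iso (D : operad) (pa : family D D) (M : operad) (f : family D M) :=
  forall T,
    (forall x, pa T x = 0 -> f T x = 0 -> exists y, x = pa T y) /\
    (forall z, exists2 x, pa T x = 0 & f T x = z).

(* The Koszul dual M^! = F(\uparrow E^* )/(R^\perp) is (M', p'), with
   F(\uparrow E^* ) = (F', io'); the dual dg operad of M^! is (D, ioD, pa). *)
Definition koszul (E : presheaf) (F : operad) (io : family E F)
    (R : forall T, F T -> Prop) (M : operad) (p : family F M) : Prop :=
  exists (F' : operad) (io' : family (sdual E) F') (M' : operad) (p' : family F' M')
         (D : operad) (ioD : family (bar_gen M') D) (pa : family D D)
         (can : family D M),
  [/\ quadratic io' (perp io io' R) p',
      dual_dg ioD pa,
      operad_map can /\ (forall T x, can T (pa T x) = 0),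
      forall T (a : bar_gen M' T),
        exists2 e : E T, can T (ioD T a) = p T (io T e) &
          forall b : sdual E T, ev b e = ev a (p' T (io' T b)) &
      quasi_iso pa can].

(** * The terminal operad *)

Definition terminal_presheaf : presheaf :=
  @Presheaf (fun _ => gdeg0 (K^o)) (fun T S f x => x).

Definition terminal_operad : operad :=
  @Operad terminal_presheaf (fun T S F f x y => (x : K) * (y : K)) (fun U => (1 : K)).

(* The constant presheaf K on graphs with exactly one internal edge: the space
   ['rV_(nedge T == 1)] is K or 0. *)
Definition one_edge : presheaf :=
  @Presheaf (fun T => gdeg0 'rV[K]_(nedge T == 1%N))
    (fun T S f x => (conform_mx 0 (x : 'rV_(nedge S == 1%N)) : 'rV_(nedge T == 1%N))).

Definition one_edge_incl : family one_edge terminal_operad :=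
  fun T x => \sum_i (x : 'rV_(nedge T == 1%N)) 0 i.

(* The terminal operad, with its presentation by [one_edge] and the kernel of
   F^2(one_edge) -> terminal_operad, is binary quadratic and Koszul. *)
Definition terminal_koszul : Prop :=
  exists (F : operad) (io : family one_edge F) (p : family F terminal_operad),
  let R T (x : F T) := weight io 2 x /\ p T x = 0 in
  [/\ forall T x, p T (io T x) = one_edge_incl x,
      quadratic io R p, binary one_edge & koszul io R p].

End Operads.

(* Main.v *)
Require Import Defs.
From HB Require Import structures.
From mathcomp Require Import all_boot all_order all_algebra.
From mathcomp Require Import boolp.
From mathcomp Require Import zify ring.
Import Defs.

Set Implicit Arguments.
Unset Strict Implicit.
Unset Printing Implicit Defensive.

(* Every operad involved has a basis of sets of odd symbols attached to a graph:
   its edges, and the tubes (connected sets of edges) of a nesting.  Composition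
   is the exterior product along the maps induced by a contraction.  Nestings
   with or without the edges give the free operads, maximal ones when the
   generators have one edge; the edges alone give the Koszul dual of the terminal
   operad, and all nestings its dual dg operad, whose differential adds a tube.
   An acyclic matching, applied to one edge after the other, shows that the
   complex of nestings has one-dimensional homology. *)

(** * Connectivity and counting *)

(** Objects carry vertex, local and global orders that elementary morphisms must respect, so a given
    tube can be contracted only after a suitable reordering isomorphism. The arguments therefore
    work with the set [nz] of contracted half-edges, which by [factor] determines an arrow up to an
    isomorphism of its target. The four categories differ mainly in [contract], where rooted trees
    and directed graphs restrict the admissible local orders. Freeness is proved without trees of
    composites: a composite is followed together with its value in another operad, and any minimal
    tube can be brought to the innermost place by the two associativity axioms; hence the pair
    depends, up to a common scalar, only on the nesting. Odd symbols produce the Koszul signs: the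
    two contractions of a graph with two edges agree in the terminal operad and are opposite in the
    exterior operad of edges, which is the orthogonality of the two sets of relations. The matching
    only bounds the homology by dimension one; that it does not vanish comes from the canonical map,
    which kills boundaries and is nonzero on a composite of generators with one edge. *)

Lemma connect_cross (V : finType) (e : rel V) (A : {pred V}) v w : connect e v w -> v \in A -> w \notin A ->
 exists a b, [/\ a \in A, b \notin A, connect e v a & e a b].
Proof.
case/connectP=> p; elim: p v => [|u p IH] v /=; first by move=> _ -> ->.
case/andP=> vu up wE vA wA; have [uA|uA] := boolP (u \in A). have [a [b [aA bA ua ab]]] := IH u up wE uA wA.
 by exists a, b; split=> //; apply: connect_trans ua; apply: connect1.
by exists v, u; split=> //; apply: connect0.
Qed.

Lemma connect_ind (V : finType) (e : rel V) (P : V -> Prop) v w :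
 connect e v w -> P v -> (forall a b, P a -> e a b -> P b) -> P w.
Proof.
case/connectP=> p; elim: p v => [|u p IH] v /=; first by move=> _ ->.
by case/andP=> vu up wE Pv h; apply: (IH u) => //; apply: h vu.
Qed.

Lemma connect_map (V W : finType) (e : rel V) (e' : rel W) (f : V -> W) v w :
 connect e v w -> (forall a b, e a b -> connect e' (f a) (f b)) -> connect e' (f v) (f w).
Proof.
move=> vw h; apply: (connect_ind (P := fun w => connect e' (f v) (f w)) vw) => //.
by move=> a b va ab; apply: connect_trans va (h _ _ ab).
Qed.

Section Counting.
Variables (V H : finType) (vt : H -> V) (op : H -> H).
Implicit Types (q : {set H}) (W : {set V}).

Definition erel q : rel V := fun v w => [exists h in q, (vt h == v) && (vt (op h) == w)].

Lemma erelP q v w : reflect (exists2 h, h \in q & vt h = v /\ vt (op h) = w) (erel q v w).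
Proof.
apply: (iffP existsP) => [[h /and3P[hq /eqP hv /eqP hw]]|[h hq [hv hw]]]. by exists h.
by exists h; rewrite hq hv hw !eqxx.
Qed.

Lemma erel1 q h : h \in q -> erel q (vt h) (vt (op h)).
Proof. by move=> hq; apply/erelP; exists h. Qed.

Lemma sub_erel q q' v w : q \subset q' -> connect (erel q) v w -> connect (erel q') v w.
Proof.
move=> /subsetP qq'; apply: connect_sub => a b /erelP[h hq [<- <-]].
by apply/connect1/erel1/qq'.
Qed.

Hypothesis opK : involutive op.
Definition opclosed q := forall h, h \in q -> op h \in q.

Lemma erel_sym q : opclosed q -> connect_sym (erel q).
Proof.
move=> qc; apply: sym_connect_sym => v w; apply/erelP/erelP.
 by case=> h /qc hq [<- <-]; exists (op h) => //; rewrite opK.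
by case=> h /qc hq [<- <-]; exists (op h) => //; rewrite opK.
Qed.

(** Grow a tree inside [W]: every half-edge leaving the part reached so far adds one vertex and two
    half-edges. Counting half-edges instead of edges avoids division by 2. *)
Lemma conn_card q W : opclosed q -> (forall h, h \in q -> op h != h) -> (forall h, h \in q -> vt h \in W) ->
 (forall v w, v \in W -> w \in W -> connect (erel q) v w) -> #|W| * 2 <= #|q| + 2.
Proof.
move=> qc qn qW Wc.
have step k : k < #|W| -> exists (A : {set V}) (B : {set H}), [/\ A \subset W, B \subset q, #|A| = k.+1,
    (forall h, h \in B -> op h \in B /\ vt h \in A) & k * 2 <= #|B|]. elim: k => [|k IH] kW.
  have /card_gt0P[w wW] := kW; exists [set w], set0.
  by split; rewrite ?sub1set ?sub0set ?cards1 // => h; rewrite in_set0.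
 have [A [B [AW Bq cA AB cB]]] := IH (ltnW kW). have [v vA] : exists v, v \in A by apply/card_gt0P; rewrite cA.
 have [w wW wA] : exists2 w, w \in W & w \notin A. apply/subsetPn; apply/negP => WA; have := subset_leq_card WA.
  by rewrite cA leqNgt kW. have vw := Wc _ _ (subsetP AW _ vA) wW.
 have [a [b [aA bA _ /erelP[h hq [ha hb]]]]] := connect_cross vw vA wA.
 have hB : h \notin B by apply/negP => /AB[/AB[_]]; rewrite hb (negbTE bA).
 have ohB : op h \notin B by apply/negP => /AB[_]; rewrite hb (negbTE bA).
 exists (b |: A), (h |: (op h |: B)); split.
 - by rewrite subUset sub1set -hb qW ?qc.
 - by rewrite !subUset !sub1set hq qc //= Bq.
 - by rewrite cardsU1 bA cA.
 - move=> x; rewrite !inE => /or3P[/eqP->|/eqP->|/AB[oB xA]].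
  + by rewrite eqxx orbT ha aA orbT.
  + by rewrite opK eqxx hb eqxx.
  + by rewrite oB xA !orbT.
 - rewrite !cardsU1 ohB !inE (negbTE hB) orbF eq_sym qn //=; lia.
have [->|W0] := posnP #|W|; first by [].
have kW : #|W|.-1 < #|W| by rewrite prednK.
have [A [B [_ Bq _ _ cB]]] := step _ kW.
have := leq_trans cB (subset_leq_card Bq); lia.
Qed.

(* A family of half-edges with at most one member at each vertex of a connected
   part, which meets each of its edges, has no room for two further members. *)
Lemma sel_card q W (Sel : {set H}) x y : opclosed q -> (forall h, h \in q -> op h != h) ->
 (forall h, h \in q -> vt h \in W) -> (forall v w, v \in W -> w \in W -> connect (erel q) v w) ->
 (forall h h', h \in Sel -> h' \in Sel -> vt h = vt h' -> h = h') ->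
 (forall h, h \in q -> (h \in Sel) || (op h \in Sel)) ->
 x \in Sel -> y \in Sel -> x \notin q -> y \notin q -> vt x \in W -> vt y \in W -> x = y.
Proof.
move=> qc qn qW Wc Sel1 qSel xS yS xq yq xW yW; apply/eqP/negPn/negP => xy.
have cq := conn_card qc qn qW Wc.
(* [Sel] meets every edge in [q], whence [c1]; together with [x] and [y] the selected half-edges of
   [q] inject into [W], whence [c2]. The two bounds contradict [conn_card]. *)
have c1 : #|q| <= #|Sel :&: q| * 2. have sub : q \subset (Sel :&: q) :|: op @: (Sel :&: q).
  apply/subsetP => h hq; rewrite !inE hq andbT; case/orP: (qSel _ hq) => [->//|ohS].
  by apply/orP; right; apply/imsetP; exists (op h); rewrite ?opK // inE ohS qc.
 apply: leq_trans (subset_leq_card sub) _. apply: leq_trans (leq_card_setU _ _) _.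
 by rewrite muln2 -addnn leq_add2l leq_imset_card.
have c2 : #|x |: (y |: (Sel :&: q))| <= #|W|. rewrite -(card_in_imset (f := vt)) ?subset_leq_card //.
  apply/subsetP => _ /imsetP[h + ->]; rewrite !inE. by case/or3P=> [/eqP->|/eqP->|/andP[_ /qW]].
 have inS h : h \in x |: (y |: (Sel :&: q)) -> h \in Sel. by rewrite !inE => /or3P[/eqP->|/eqP->|/andP[]].
 by move=> h h' /inS hS /inS hS'; apply: Sel1.
move: c2; rewrite !cardsU1 !inE (negbTE xq) (negbTE yq) (negbTE xy) !andbF /=; lia.
Qed.
End Counting.

(** An arbitrary key replaces the order of ['I_n] because contractions renumber vertices and
    half-edges in orders that are not inherited. *)
Lemma enum_key n (A : {set 'I_n}) (k : 'I_n -> nat) : {in A &, injective k} -> exists e : 'I_#|A| -> 'I_n,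
  (forall i j : 'I_#|A|, (i < j)%N = (k (e i) < k (e j))%N) /\ (forall x, (x \in codom e) = (x \in A)).
Proof.
move=> kinj; set s := sort (relpre k leq) (enum A).
have sz : size s == #|A| by rewrite size_sort -cardE.
have ms x : (x \in s) = (x \in A) by rewrite mem_sort mem_enum.
have us : uniq s by rewrite sort_uniq enum_uniq.
have ss : sorted (relpre k leq) s by apply: sort_sorted => x y; apply: leq_total.
pose t := Tuple sz; exists (tnth t); split; last first.
 move=> x; rewrite -ms; apply/codomP/idP => [[i ->]|xs]; first by have := mem_tnth i t.
 by have /tnthP[i ->] : x \in t by []; exists i.
have tinj : injective (tnth t) by apply/tuple_uniqP.
have lt (i j : 'I_#|A|) : i < j -> k (tnth t i) < k (tnth t j). move=> ij; rewrite ltn_neqAle; apply/andP; split.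
  apply/negP => /eqP /kinj; rewrite -!ms => /(_ (mem_tnth i t) (mem_tnth j t)).
  by move/tinj=> E; rewrite E ltnn in ij. have x0 := tnth t i; rewrite !(tnth_nth x0).
 apply: (sorted_leq_nth (leT := relpre k leq)) => //.
 - by move=> y x z /=; apply: leq_trans.
 - by move=> x /=.
 - by rewrite inE (eqP sz).
 - by rewrite inE (eqP sz).
 - exact: ltnW.
move=> i j; apply/idP/idP => [|kij]; first exact: lt.
rewrite ltnNge leq_eqVlt; apply/negP => /orP[/eqP /ord_inj E|/lt]. by rewrite E ltnn in kij.
by rewrite ltnNge (ltnW kij).
Qed.

(** * Building graphs *)

(** Common specification of fibers and of contractions, both obtained from [mk_graph]: a part of [T]
    sorted by the keys [kv] and [kh], whose incidence, involution and labels are prescribed inside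
    [T]. *)
Record built (T G : graph) (A : {set 'I_(nv T)}) (kv : 'I_(nv T) -> nat)
  (H : {set 'I_(nh T)}) (kh : 'I_(nh T) -> nat)
  (vt : 'I_(nh T) -> 'I_(nv T)) (op : 'I_(nh T) -> 'I_(nh T)) (lg : seq 'I_(nh T))
  (gn : 'I_(nv T) -> nat) (ou : 'I_(nh T) -> bool)
  (ev : 'I_(nv G) -> 'I_(nv T)) (eh : 'I_(nh G) -> 'I_(nh T)) : Prop := { bt_nv : nv G = #|A|;
 bt_ev : forall w w' : 'I_(nv G), (w < w')%N = (kv (ev w) < kv (ev w'))%N;
 bt_evim : forall v, (v \in codom ev) = (v \in A);
 bt_eh : forall h h' : 'I_(nh G), (h < h')%N = (kh (eh h) < kh (eh h'))%N;
 bt_ehim : forall h, (h \in codom eh) = (h \in H); bt_vtx : forall h, ev (vtx G h) = vt (eh h);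
 bt_opp : forall h, eh (opp G h) = op (eh h); bt_legs : [seq eh h | h <- legs G] = lg;
 bt_genus : forall w, genus G w = gn (ev w); bt_outp : forall h, outp G h = ou (eh h)
}.

Lemma mk_graph (T : graph) (A : {set 'I_(nv T)}) kv (H : {set 'I_(nh T)}) kh vt op lg gn ou :
 {in A &, injective kv} -> {in H &, injective kh} ->
 {in H, forall h, vt h \in A} -> {in H, forall h, op h \in H} -> {subset lg <= H} ->
 exists G ev eh, @built T G A kv H kh vt op lg gn ou ev eh.
Proof.
move=> kvi khi vtA opH lgH.
have [ev [evlt evim]] := enum_key kvi; have [eh [ehlt ehim]] := enum_key khi.
have ehH h : eh h \in H by rewrite -ehim codom_f.
have /fin_all_exists[vG vGE] (h : 'I_#|H|) : exists j, ev j = vt (eh h).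
 have := vtA _ (ehH h); rewrite -evim => /codomP[j ->]. by exists j.
have /fin_all_exists[oG oGE] (h : 'I_#|H|) : exists j, eh j = op (eh h).
 have := opH _ (ehH h); rewrite -ehim => /codomP[j ->]. by exists j.
have [lG lGE] : exists l, [seq eh h | h <- l] = lg. elim: lg lgH => [|x l IH] lgH; first by exists [::].
 have [|l' <-] := IH; first by move=> y yl; apply: lgH; rewrite inE yl orbT.
 have := lgH _ (mem_head x l); rewrite -ehim => /codomP[j ->]. by exists (j :: l').
exists (@Graph #|A| #|H| [ffun h => vG h] [ffun h => oG h] lG [ffun w => gn (ev w)] [ffun h => ou (eh h)]), ev, eh.
by split=> // h; rewrite /= ffunE.
Qed.

Lemma incr_inj n m (e : 'I_n -> 'I_m) (k : 'I_m -> nat) :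
 (forall i j : 'I_n, (i < j)%N = (k (e i) < k (e j))%N) -> injective e.
Proof.
by move=> h i j E; apply: ord_inj; case: (ltngtP i j) => [||//]; rewrite h E ltnn.
Qed.

Lemma incr_inj' n m (e : 'I_n -> 'I_m) : (forall i j : 'I_n, (i < j)%N -> (e i < e j)%N) -> injective e.
Proof.
by move=> h i j E; apply: ord_inj; case: (ltngtP i j) => // /h; rewrite E ltnn.
Qed.

Lemma incr_iff n m (e : 'I_n -> 'I_m) : (forall i j : 'I_n, (i < j)%N -> (e i < e j)%N) ->
 forall i j : 'I_n, (i < j)%N = (e i < e j)%N.
Proof.
move=> h i j; apply/idP/idP => [/h//|eij]; rewrite ltnNge leq_eqVlt.
apply/negP => /orP[/eqP/ord_inj E|/h]; first by move: eij; rewrite E ltnn.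
by rewrite ltnNge (ltnW eij).
Qed.

(** Sorted lists with the same elements are equal. The sizes are not assumed equal, since the lemma
    serves to identify two fibers about which only their images are known. *)
Lemma incr_unique n n' m (e : 'I_n -> 'I_m) (e' : 'I_n' -> 'I_m) :
 (forall i j : 'I_n, (i < j)%N -> (e i < e j)%N) -> (forall i j : 'I_n', (i < j)%N -> (e' i < e' j)%N) ->
 codom e =i codom e' -> exists E : n = n', forall i, e i = e' (cast_ord E i).
Proof.
move=> h h' ee'.
have srt k (g : 'I_k -> 'I_m) : (forall i j : 'I_k, (i < j)%N -> (g i < g j)%N) ->
  sorted (fun x y : 'I_m => x < y) (codom g). move=> gi; rewrite /codom /image_mem sorted_map.
 have : sorted (fun i j : 'I_k => i < j) (enum 'I_k).
  by rewrite -(@sorted_map _ _ (fun i : 'I_k => nat_of_ord i) ltn) val_enum_ord iota_ltn_sorted.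
 by move=> H; apply: sub_sorted H => i j; apply: gi.
have cE : codom e = codom e'. apply: (@irr_sorted_eq _ (fun x y : 'I_m => x < y)); rewrite ?srt //.
 - by move=> y x z; apply: ltn_trans.
 - by move=> x; rewrite /= ltnn.
have nn' : n = n' by have := congr1 (fun s => size s) cE; rewrite !size_codom !card_ord.
move: e' h' cE {ee'}; rewrite -nn' => e' h' cE; exists erefl => i; rewrite cast_ord_id.
have := congr1 (fun s => nth (e i) s i) cE.
have nthE (g : 'I_n -> 'I_m) : nth (e i) (codom g) i = g i.
 by rewrite /codom /image_mem (nth_map i) ?nth_ord_enum // size_enum_ord.
by rewrite !nthE.
Qed.

(** * Ordered graphs *)

Notation eadj T q := (erel (vtx T) (opp T) q).

(** The half-edges of internal edges. Sets of edges are represented by sets of half-edges closed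
    under [opp], hence the factors 2 in all counts. *)
Definition full (T : graph) : {set 'I_(nh T)} := [set h | opp T h != h].

Section OrderedGraph.
Variable T : graph.
Hypothesis Tord : ordered T.

Lemma oppK : involutive (opp T). Proof. by case: Tord. Qed.
Lemma vtx_mono (h h' : 'I_(nh T)) : (h <= h')%N -> (vtx T h <= vtx T h')%N.
Proof. by case: Tord => _ + _ _ _; apply. Qed.
Lemma mem_legs h : (h \in legs T) = (opp T h == h).
Proof. by case: Tord. Qed.

Lemma full_closed : opclosed (opp T) (full T).
Proof. by move=> h; rewrite !inE oppK eq_sym. Qed.

Lemma card_full : #|full T| = (nedge T * 2)%N.
Proof.
have E : full T = [set h : 'I_(nh T) | (h < opp T h)%N] :|: opp T @: [set h : 'I_(nh T) | (h < opp T h)%N].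
 apply/setP => h; rewrite !inE; apply/idP/orP => [hh|[hh|/imsetP[k + ->]]].
 - have : nat_of_ord h != opp T h by rewrite eq_sym; apply: contra hh => /eqP/ord_inj->.
  rewrite neq_ltn => /orP[->|hh']; [by left|right]. by apply/imsetP; exists (opp T h); rewrite ?inE oppK.
 - by apply/eqP => E; rewrite E ltnn in hh.
 - rewrite inE oppK => kk; apply/eqP => E; by rewrite -E ltnn in kk.
rewrite E cardsU disjoint_setI0 ?cards0 ?subn0; last first.
 rewrite disjoint_subset; apply/subsetP => h; rewrite !inE => hh. apply/negP => /imsetP[k]; rewrite inE => kk E'.
 by move: hh; rewrite E' oppK ltnNge (ltnW kk).
rewrite card_imset; last exact: (can_inj oppK).
by rewrite cardsE addnn -muln2.
Qed.

Lemma conn_full : connected T <-> forall v w, connect (eadj T (full T)) v w.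
Proof.
split=> h v w; last first. apply: connect_sub (h v w) => a b /erelP[k _ [<- <-]].
 by apply/connect1/existsP; exists k; rewrite !eqxx.
apply: connect_sub (h v w) => a b /existsP[k /andP[/eqP<- /eqP<-]].
have [->|kn] := eqVneq (opp T k) k; first exact: connect0.
by apply/connect1/erel1; rewrite inE.
Qed.

Lemma conn_nv : connected T -> (nv T <= nedge T + 1)%N.
Proof.
move/conn_full => Tc.
have := @conn_card _ _ (vtx T) _ oppK (full T) setT full_closed.
rewrite cardsT card_ord card_full => h.
have : (nv T * 2 <= nedge T * 2 + 2)%N by apply: h => [h|h _|v w _ _ //]; rewrite inE.
lia.
Qed.

(** In a rooted tree these are the half-edges pointing towards the root; this description is local,
    and [rootedP] makes it replace the paths in [towards]. *)
Definition isMin (h : 'I_(nh T)) : bool := [forall h', (vtx T h' == vtx T h) ==> (h <= h')%N].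

Lemma isMinP h : reflect (forall h', vtx T h' = vtx T h -> (h <= h')%N) (isMin h).
Proof.
apply: (iffP forallP) => H h'; first by move=> E; apply: (implyP (H h')); rewrite E.
by apply/implyP => /eqP/H.
Qed.

Lemma isMin_inj h h' : isMin h -> isMin h' -> vtx T h = vtx T h' -> h = h'.
Proof.
move=> /isMinP hm /isMinP hm' E; apply/ord_inj/eqP; rewrite eqn_leq hm // hm' //.
Qed.

Definition eadj' (h : 'I_(nh T)) : rel 'I_(nv T) :=
 fun v w => [exists k, [&& k != h, k != opp T h, vtx T k == v & vtx T (opp T k) == w]].

Lemma towardsE r h : towards r h = (h == r) || (opp T h != h) && connect (eadj' h) (vtx T (opp T h)) (vtx T r).
Proof. by []. Qed.

Lemma eadj'_opp h : eadj' (opp T h) =2 eadj' h.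
Proof.
by move=> v w; apply: eq_existsb => k; rewrite oppK andbCA.
Qed.

Lemma eadj'_sym h : connect_sym (eadj' h).
Proof.
have S v w : eadj' h v w -> eadj' h w v. case/existsP=> k /and4P[kh kh' kv kw]; apply/existsP; exists (opp T k).
 rewrite oppK kv kw !andbT; apply/andP; split. by apply: contra kh' => /eqP<-; rewrite oppK.
 by rewrite (inj_eq (can_inj oppK)).
by apply: sym_connect_sym => v w; apply/idP/idP; apply: S.
Qed.

(* If [h] is not selected then [opp h] and the leg [r] are both selected in the
   component of [T] minus [h] containing [r], against [sel_card]. *)
Lemma towards_sel r (Sel : {set 'I_(nh T)}) h : opp T r = r -> r \in Sel ->
 (forall k k', k \in Sel -> k' \in Sel -> vtx T k = vtx T k' -> k = k') ->
 (forall k, opp T k != k -> (k \in Sel) || (opp T k \in Sel)) -> towards r h -> h \in Sel.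
Proof.
move=> rl rS Sel1 SelE; rewrite towardsE => /orP[/eqP->//|/andP[hn hr]].
apply/negPn/negP => hS; have ohS := SelE _ hn; rewrite (negbTE hS) /= in ohS.
pose W := [set w | connect (eadj' h) (vtx T (opp T h)) w].
pose q := [set k in full T | [&& k != h, k != opp T h & vtx T k \in W]].
have stepW k : k != h -> k != opp T h -> vtx T k \in W -> vtx T (opp T k) \in W.
 move=> k1 k2; rewrite !inE => c; apply: connect_trans c (connect1 _).
 by apply/existsP; exists k; rewrite k1 k2 !eqxx.
have qc : opclosed (opp T) q. move=> k; rewrite !in_set oppK eq_sym => /and4P[kn k1 k2 kW].
 rewrite kn (inj_eq (can_inj oppK)) k1 /=; apply/andP; split. by apply: contra k2 => /eqP<-; rewrite oppK.
 by have := stepW _ k1 k2; rewrite !in_set; apply.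
have base w : w \in W -> connect (eadj T q) (vtx T (opp T h)) w. rewrite inE => c.
 suff [] : w \in W /\ connect (eadj T q) (vtx T (opp T h)) w by [].
 apply: (connect_ind (P := fun w => w \in W /\ connect (eadj T q) (vtx T (opp T h)) w) c).
  by rewrite inE; split; apply: connect0.
 move=> a b [aW ca] /existsP[k /and4P[k1 k2 /eqP ka /eqP <-]]; subst a; split. exact: stepW.
 have [->|kn] := eqVneq (opp T k) k; first by []. have kq : k \in q by rewrite inE k1 k2 aW !inE kn.
 exact: connect_trans ca (connect1 (erel1 (vtx T) (opp T) kq)).
(* [sel_card] will identify the two selected half-edges [r] and [opp T h] that leave the component;
   as [r] is a leg, [h] would then be a leg as well. *)
suff E : r = opp T h by move: hn; rewrite -{2}[h]oppK -E rl E eqxx.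
apply: (@sel_card _ _ (vtx T) (opp T) oppK q W Sel) => //.
- by move=> k; rewrite !inE => /andP[].
- by move=> k; rewrite inE => /and4P[].
- move=> v w /base cv /base cw; apply: connect_trans cw. by rewrite (@erel_sym _ _ (vtx T) _ oppK _ qc).
- by move=> k; rewrite !inE => /andP[kn _]; apply: SelE.
- by rewrite !inE rl eqxx.
- by rewrite !inE eqxx !andbF.
- by rewrite inE.
- by rewrite inE; apply: connect0.
Qed.

(** Take the first half-edge of a simple path from [v] to the vertex of [r]: simplicity keeps the
    rest of the path away from [v], hence off that edge. *)
Lemma towards_ex r v : connected T -> exists2 h, vtx T h = v & towards r h.
Proof.
move=> Tc; have /connectP[p] := Tc v (vtx T r); case/shortenP=> p' + up _.
case: p' up => [|u p'] /=; first by move=> _ _ <-; exists r; rewrite // towardsE eqxx.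
case/andP=> vp up /andP[/existsP[h /andP[/eqP hv /eqP hu]] pu] rE.
exists h => //; rewrite towardsE; apply/orP; right; apply/andP; split.
 apply/eqP => E; move: vp; rewrite inE negb_or => /andP[+ _]. by rewrite -hv -hu E eqxx.
have nv x : x \in u :: p' -> x != v by move=> xp; apply: contraNneq vp => <-.
rewrite hu rE; apply/connectP; exists p' => //.
have : all (fun x => x != v) (u :: p') by apply/allP.
elim: p' u pu {rE up vp hu nv} => //= a s IH u /andP[/existsP[k]].
move=> /andP[/eqP ku /eqP ka] ap /and3P[uv av pv].
rewrite (IH a) //= ?av // andbT; apply/existsP; exists k; rewrite ku ka !eqxx !andbT.
apply/andP; split; first by apply: contraNneq uv => E; rewrite -ku E hv.
by apply: contraNneq av => E; rewrite -ka E oppK hv.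
Qed.

(** After removal of an edge every vertex is still connected to one of its two ends; this is applied
    to the vertex of [r]. *)
Lemma towards_edge r h : connected T -> opp T h != h -> towards r h || towards r (opp T h).
Proof.
move=> Tc hn; rewrite !towardsE oppK (eq_sym h (opp T h)) hn /=.
rewrite (eq_connect (eadj'_opp h)) (eadj'_sym h _ (vtx T r)) (eadj'_sym h (vtx T h)).
suff [->|->] : connect (eadj' h) (vtx T r) (vtx T (opp T h)) \/
  connect (eadj' h) (vtx T r) (vtx T h) by rewrite ?orbT.
pose P w := connect (eadj' h) w (vtx T h) || connect (eadj' h) w (vtx T (opp T h)).
suff /orP[] : P (vtx T r) by [right|left].
apply: (connect_ind (P := P) (Tc (vtx T h) _)); first by rewrite /P connect0.
move=> a b Pa /existsP[k /andP[/eqP ka /eqP kb]].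
have [kh|kh] := eqVneq k h; first by rewrite /P -kb kh connect0 orbT.
have [ko|ko] := eqVneq k (opp T h); first by rewrite /P -kb ko oppK connect0.
have ba : connect (eadj' h) b a. by rewrite eadj'_sym; apply/connect1/existsP; exists k; rewrite kh ko ka kb !eqxx.
by rewrite /P; case/orP: Pa => Pa; rewrite (connect_trans ba Pa) ?orbT.
Qed.

(** Each vertex has at most one minimal half-edge, so if each edge has one too, [towards_sel]
    applies to the set of minimal half-edges and shows that those towards the root are minimal. *)
Lemma rootedP : connected T -> rooted T <-> (exists r l, [/\ legs T = r :: l, isMin r &
  forall h, opp T h != h -> isMin h || isMin (opp T h)]).
Proof.
move=> Tc; rewrite /rooted; split=> [|[r [l [lE rM eM]]]]. case lE: (legs T) => [//|r l] rt; exists r, l.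
 have tM h : towards r h -> isMin h by move=> tr; apply/isMinP => h'; apply: rt.
 split=> //; first by apply: tM; rewrite towardsE eqxx.
 by move=> h hn; case/orP: (towards_edge r Tc hn) => /tM->; rewrite ?orbT.
rewrite lE => h h' tr.
have : h \in [set k | isMin k]. apply: (@towards_sel r) tr; rewrite ?inE //.
 - by apply/eqP; rewrite -mem_legs lE mem_head.
 - by move=> k k'; rewrite !inE; apply: isMin_inj.
 - by move=> k /eM; rewrite !inE.
by rewrite inE => /isMinP; apply.
Qed.

End OrderedGraph.

(** * Morphisms *)

(** The half-edges of the contracted edges. By [factor] this set determines an arrow out of [T] up
    to an isomorphism of the target, and most later arguments refer to arrows through it. *)
Definition nz (T S : graph) (f : gmap T S) : {set 'I_(nh T)} := [set h | h \notin codom (psi f)].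

Record gm0 (T S : graph) (f : gmap T S) : Prop := { psi_inj : injective (psi f);
 phi_surj : forall v, exists w, phi f w = v; psi_opp : forall h, psi f (opp S h) = opp T (psi f h);
 psi_legs : [seq psi f h | h <- legs S] = legs T; phi_vtx : forall h, phi f (vtx T (psi f h)) = vtx S h;
 nz_eq : forall h, h \in nz f -> phi f (vtx T h) = phi f (vtx T (opp T h))
}.

(** Connectedness of all fibers, stated inside [T] so that no fiber has to be built; [fconnP]
    compares the two forms. *)
Definition fconn (T S : graph) (f : gmap T S) : Prop :=
 forall v w, phi f v = phi f w -> connect (eadj T (nz f)) v w.

Section Morphism.
Variables (T S : graph) (f : gmap T S).
Hypotheses (Tord : ordered T) (f0 : gm0 f).

Lemma nzPn h : reflect (exists k, h = psi f k) (h \notin nz f).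
Proof. by rewrite inE negbK; apply: codomP. Qed.

Lemma psi_nz k : psi f k \notin nz f. Proof. by rewrite inE negbK codom_f. Qed.

Lemma nz_full : nz f \subset full T.
Proof.
apply/subsetP => h; rewrite !inE; apply: contra => hh.
have : h \in legs T by rewrite mem_legs.
by rewrite -(psi_legs f0) => /mapP[k _ ->]; apply: codom_f.
Qed.

Lemma nz_closed : opclosed (opp T) (nz f).
Proof.
move=> h; rewrite !inE; apply: contra => /codomP[k E]; apply/codomP; exists (opp S k).
by rewrite (psi_opp f0) -E oppK.
Qed.

Lemma fiber_ex v : exists F, is_fiber f v F.
Proof.
have [|||||F [iv [ih B]]] := @mk_graph T [set w | phi f w == v] (fun w => w)
 [set h | phi f (vtx T h) == v] (fun h => h) (vtx T) (fun h => if h \in codom (psi f) then h else opp T h)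
 [seq psi f h | h <- enum 'I_(nh S) & vtx S h == v] (genus T) (outp T).
- by move=> x y _ _ /ord_inj.
- by move=> x y _ _ /ord_inj.
- by move=> h; rewrite !inE.
- move=> h; rewrite !inE; case: ifP => // /negbT hn /eqP <-. by rewrite -(nz_eq f0) ?inE.
- by move=> _ /mapP[k + ->]; rewrite mem_filter inE (phi_vtx f0) => /andP[].
exists F, iv, ih; case: B => B0 B1 B2 B3 B4 B5 B6 B7 B8 B9; split=> //.
- by move=> w w'; rewrite B1.
- by move=> w; rewrite B2 inE.
- by move=> w w'; rewrite B3.
- by move=> w; rewrite B4 inE.
Qed.

Section Fiber.
Variables (v : 'I_(nv S)) (F : graph).
Variables (iv : 'I_(nv F) -> 'I_(nv T)) (ih : 'I_(nh F) -> 'I_(nh T)).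
Hypothesis I : fiber_incl f v iv ih.

Lemma iv_inj : injective iv. Proof. exact: incr_inj' (fi_iv_incr I). Qed.
Lemma ih_inj : injective ih. Proof. exact: incr_inj' (fi_ih_incr I). Qed.

Lemma phi_iv w : phi f (iv w) = v.
Proof. by apply/eqP; rewrite -(fi_iv_im I) codom_f. Qed.
Lemma phi_ih h : phi f (vtx T (ih h)) = v.
Proof. by apply/eqP; rewrite -(fi_ih_im I) codom_f. Qed.

Lemma iv_ex w : phi f w = v -> exists w', w = iv w'.
Proof. by move=> wv; apply/codomP; rewrite (fi_iv_im I) wv eqxx. Qed.
Lemma ih_ex h : phi f (vtx T h) = v -> exists h', h = ih h'.
Proof. by move=> wv; apply/codomP; rewrite (fi_ih_im I) wv eqxx. Qed.

Lemma ih_opp h : ih (opp F h) = if ih h \in nz f then opp T (ih h) else ih h.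
Proof. by rewrite (fi_opp I) inE; case: (_ \in _). Qed.

Lemma full_fiber h : (h \in full F) = (ih h \in nz f).
Proof.
rewrite inE -(inj_eq ih_inj) ih_opp; case: ifP => [hn|_]; last by rewrite eqxx.
by have := subsetP nz_full _ hn; rewrite inE.
Qed.

Lemma conn_fiber a b : connect (eadj F (full F)) a b <-> connect (eadj T (nz f)) (iv a) (iv b).
Proof.
split=> [c|c]. apply: connect_map c _ => x y /erelP[h hF [<- <-]].
 rewrite !(fi_vtx I) ih_opp -full_fiber hF; apply/connect1/erel1. by rewrite -full_fiber.
suff [b' /iv_inj-> //] : exists2 b', iv b = iv b' & connect (eadj F (full F)) a b'.
apply: (connect_ind (P := fun u => exists2 b', u = iv b' &
 connect (eadj F (full F)) a b') c); first by exists a => //; apply: connect0.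
move=> x y [b' -> cb] /erelP[h hn [hx <-]].
have [k E] : exists k, h = ih k by apply: ih_ex; rewrite hx phi_iv.
subst h; have E := ih_opp k; rewrite hn in E.
exists (vtx F (opp F k)); first by rewrite (fi_vtx I) E.
apply: connect_trans cb (connect1 _); apply/erelP; exists k; first by rewrite full_fiber.
by split=> //; apply: iv_inj; rewrite (fi_vtx I).
Qed.

Lemma nv_fiber : nv F = #|[set w | phi f w == v]|.
Proof.
rewrite -[LHS]card_ord -(card_imset _ iv_inj); apply: eq_card => w.
rewrite inE -(fi_iv_im I); apply/imsetP/codomP => [[x _ ->]|[x ->]]; first by exists x.
by exists x.
Qed.

Lemma full_fiber_im : ih @: full F = [set h in nz f | phi f (vtx T h) == v].
Proof.
apply/setP => h; rewrite inE; apply/imsetP/andP => [[k + ->]|[hn /eqP/ih_ex[k E]]].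
 by rewrite full_fiber phi_ih eqxx.
by exists k; rewrite // full_fiber -E.
Qed.

Lemma card_full_fiber : #|full F| = #|[set h in nz f | phi f (vtx T h) == v]|.
Proof. by rewrite -full_fiber_im card_imset //; apply: ih_inj. Qed.

Lemma fiber_ordered : ordered S -> ordered F.
Proof.
move=> Sord; split.
- by have [w wv] := phi_surj f0 v; have [w' _] := iv_ex wv; case: (nv F) w' => [[]|].
- move=> h h'; rewrite leq_eqVlt => /orP[/eqP/ord_inj->//|hh'].
 rewrite leqNgt; apply/negP => /(fi_iv_incr I); rewrite !(fi_vtx I) ltnNge.
 by rewrite vtx_mono // ltnW // (fi_ih_incr I).
- move=> h; apply: ih_inj; rewrite !ih_opp.
 by case: (boolP (ih h \in nz f)) => hn; rewrite ?(negbTE hn) ?nz_closed ?oppK.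
- rewrite -(map_inj_uniq ih_inj) (fi_legs I) (map_inj_uniq (psi_inj f0)). by rewrite filter_uniq // enum_uniq.
- move=> h; rewrite -(mem_map ih_inj) (fi_legs I).
 have -> : (opp F h == h) = (h \notin full F) by rewrite inE negbK.
 rewrite full_fiber; apply/mapP/nzPn => [[k _ ->]|[k E]]; first by exists k.
 exists k => //; rewrite mem_filter mem_enum inE andbT -(phi_vtx f0) -E phi_ih //.
Qed.

Lemma fiber_genus : \sum_w genus F w = \sum_(w | phi f w == v) genus T w.
Proof.
rewrite (eq_bigr (fun w => genus T (iv w))) => [|w _]; last by rewrite (fi_genus I).
rewrite -[LHS](big_imset _ (in2W iv_inj)) /=; apply: eq_bigl => w.
rewrite -(fi_iv_im I); apply/imsetP/codomP => [[x _ ->]|[x ->]]; first by exists x.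
by exists x.
Qed.

End Fiber.

Lemma fconnP : ordered S -> (forall v F, is_fiber f v F -> connected F) <-> fconn f.
Proof.
move=> Sord; split=> [h v w vw|h v F [iv [ih I]]]. have [F [iv [ih I]]] := fiber_ex (phi f w).
 have [v' ->] := iv_ex I vw; have [w' ->] := iv_ex I (erefl (phi f w)).
 apply/(conn_fiber I); move: v' w'; apply/conn_full. by apply: (h (phi f w)); exists iv, ih.
by apply/conn_full => a b; apply/(conn_fiber I)/h; rewrite !(phi_iv I).
Qed.

End Morphism.

(* With every genus lowered by 1, the genus condition becomes additive: it says
   that twice the genus at [v] is the sum over the fiber plus the number of its
   internal half-edges. *)
Definition genus_ok (T S : graph) (f : gmap T S) (v : 'I_(nv S)) : Prop :=
 (genus S v * 2 + #|[set w | phi f w == v]| * 2 = (\sum_(w | phi f w == v) genus T w) * 2 +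
  #|[set h in nz f | phi f (vtx T h) == v]| + 2)%N.

Record arrP (O : opcat) (T S : graph) (f : gmap T S) : Prop := { arr_gm0 : gm0 f; arr_conn : fconn f;
 arr_genus : O = ggGrc -> forall v, genus_ok f v; arr_outp : O = Whe -> forall h, outp T (psi f h) = outp S h
}.

(** On a connected fiber the truncated difference in [b1] is a true difference by [conn_nv]; this
    turns the genus condition into the additive [genus_ok]. *)
Lemma is_arrP (O : opcat) (T S : graph) (f : gmap T S) : ordered T -> ordered S -> is_arr O f <-> arrP O f.
Proof.
move=> Tord Sord; split=> [[[[pi ps] po pl [pv pn]] pc rest]|[f0 fc fg fo]].
- have f0 : gm0 f. split=> //; first by move=> v; have /codomP[w ->] := ps v; exists w.
  by move=> h; rewrite inE; apply: pn. have fc : fconn f by apply/fconnP. split=> // E; rewrite E in rest => //.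
 move=> v; have [F [iv [ih I]]] := fiber_ex f0 v. have Ford := fiber_ordered Tord f0 I Sord.
 have Fc : connected F by apply: (pc v); exists iv, ih.
 have := rest v F; rewrite /genus_ok -(nv_fiber I) -(fiber_genus I).
 rewrite -(card_full_fiber Tord f0 I) card_full // /b1 => ->; last by exists iv, ih. have := conn_nv Ford Fc; lia.
- split; last case: O fg fo => // [fg _|_ fo]; [|move=> v F [iv [ih I]]|exact: fo]. split=> //.
  + split; first exact: psi_inj f0. by move=> v; have [w <-] := phi_surj f0 v; apply: codom_f.
  + exact: psi_opp f0.
  + exact: psi_legs f0.
  + split; first exact: phi_vtx f0. by move=> h hn; apply: (nz_eq f0); rewrite inE.
  + exact/fconnP. have Ford := fiber_ordered Tord f0 I Sord. have Fc : connected F.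
  by apply: (iffRL (fconnP Tord f0 Sord) fc v); exists iv, ih.
 have := fg erefl v; rewrite /genus_ok -(nv_fiber I) -(fiber_genus I).
 rewrite -(card_full_fiber Tord f0 I) card_full // /b1. have := conn_nv Ford Fc; lia.
Qed.

Lemma gmap_eq (T S : graph) (f g : gmap T S) : psi f =1 psi g -> phi f =1 phi g -> f = g.
Proof. by case: f g => [a b] [c d] /= /ffunP-> /ffunP->. Qed.

Lemma gcompA (T S P Q : graph) (f : gmap T S) (g : gmap S P) (h : gmap P Q) :
 gcomp h (gcomp g f) = gcomp (gcomp h g) f.
Proof. by apply: gmap_eq => x; rewrite /= !ffunE. Qed.

Lemma gcompf1 (T S : graph) (f : gmap T S) : gcomp f (gid T) = f.
Proof. by apply: gmap_eq => x; rewrite /= !ffunE. Qed.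

Lemma gcomp1f (T S : graph) (f : gmap T S) : gcomp (gid S) f = f.
Proof. by apply: gmap_eq => x; rewrite /= !ffunE. Qed.

Lemma gcomp_epi (T S P : graph) (f : gmap T S) (g g' : gmap S P) : gm0 f -> gcomp g f = gcomp g' f -> g = g'.
Proof.
move=> f0 E; apply: gmap_eq => x. have := congr1 (fun e : gmap T P => psi e x) E; rewrite /= !ffunE.
 exact: psi_inj f0 _ _.
have [w <-] := phi_surj f0 x.
by have := congr1 (fun e : gmap T P => phi e w) E; rewrite /= !ffunE.
Qed.

Lemma nz_gid (T : graph) : nz (gid T) = set0.
Proof.
apply/setP => h; rewrite !inE; apply/negbTE; rewrite negbK.
by apply/codomP; exists h; rewrite /= ffunE.
Qed.

Lemma arrP_id (O : opcat) (T : graph) : arrP O (gid T).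
Proof.
split.
- split.
 + by move=> x y; rewrite /= !ffunE.
 + by move=> v; exists v; rewrite /= ffunE.
 + by move=> h; rewrite /= !ffunE.
 + by rewrite -[RHS]map_id; apply: eq_map => x; rewrite /= ffunE.
 + by move=> h; rewrite /= !ffunE.
 + by move=> h; rewrite nz_gid inE.
- by move=> v w; rewrite /= !ffunE => ->; apply: connect0.
- move=> _ v; rewrite /genus_ok /= (eq_bigl (pred1 v)) => [|w]; last by rewrite ffunE. rewrite big_pred1_eq.
 have -> : [set w | [ffun x => x] w == v] = [set v]. by apply/setP => w; rewrite !inE ffunE.
 by rewrite cards1 nz_gid (_ : [set h in _ | _] = set0) ?cards0 ?addn0 //; apply/setP => h; rewrite !inE.
- by move=> _ h; rewrite /= ffunE.
Qed.

Section Compose.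
Variables (T S P : graph) (f : gmap T S) (g : gmap S P).
Hypothesis f0 : gm0 f.

Lemma in_nz_comp h : (h \in nz (gcomp g f)) = (h \in nz f) || (h \in psi f @: nz g).
Proof.
apply/idP/idP. rewrite inE => hn; have [//|/nzPn[k hk]] := boolP (h \in nz f); subst h.
 rewrite mem_imset ?inE; last exact: psi_inj f0.
 by apply: contra hn => /codomP[l ->]; apply/codomP; exists l; rewrite /= ffunE.
case/orP=> [|/imsetP[k kn ->]]; rewrite !inE. by apply: contra => /codomP[l ->]; rewrite /= ffunE codom_f.
move: kn; rewrite inE; apply: contra => /codomP[l]; rewrite /= ffunE.
by move/(psi_inj f0) ->; apply: codom_f.
Qed.

Lemma card_nz_comp p : #|[set h in nz (gcomp g f) | phi (gcomp g f) (vtx T h) == p]| =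
 (#|[set h in nz f | phi g (phi f (vtx T h)) == p]| + #|[set k in nz g | phi g (vtx S k) == p]|)%N.
Proof.
rewrite -(card_imset _ (psi_inj f0)) -cardsUI (_ : _ :&: _ = set0) ?cards0 ?addn0.
 apply: eq_card => h; rewrite [LHS]inE [RHS]inE in_nz_comp /= ffunE.
 rewrite andb_orl [X in _ = X || _]inE; congr (_ || _). apply/andP/imsetP => [[/imsetP[k kn ->]]|[k]].
  by rewrite (phi_vtx f0) => kp; exists k; rewrite // inE kn.
 by rewrite inE => /andP[kn kp] ->; rewrite (phi_vtx f0) kp mem_imset //; exact: psi_inj f0.
apply/setP => h; rewrite !inE; apply/negP => /andP[/andP[hn _] /imsetP[k _ hk]].
by move: hn; rewrite hk codom_f.
Qed.

(** Summation of [genus_ok f s] over the vertices [s] of one fiber of [g]. Through [genus_arith] it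
    yields composition and, read backwards, the cancellation of [f] in [factor]. *)
Lemma genus_sum p : (forall s, genus_ok f s) ->
 ((\sum_(s | phi g s == p) genus S s) * 2 + #|[set w | phi g (phi f w) == p]| * 2 =
 (\sum_(w | phi g (phi f w) == p) genus T w) * 2 +
 #|[set h in nz f | phi g (phi f (vtx T h)) == p]| + #|[set s | phi g s == p]| * 2)%N.
Proof.
move=> ok; have E : (\sum_(s | phi g s == p) (genus S s * 2 + #|[set w | phi f w == s]| * 2) =
  \sum_(s | phi g s == p) ((\sum_(w | phi f w == s) genus T w) * 2 +
  #|[set h in nz f | phi f (vtx T h) == s]| + 2))%N by apply: eq_bigr => s _; apply: ok.
have E2 : (\sum_(s | phi g s == p) 2 = #|[set s | phi g s == p]| * 2)%N.
 by rewrite -sum_nat_const; apply: eq_bigl => s; rewrite inE.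
move: E; rewrite !big_split /= E2 -!big_distrl /=.
have -> : (\sum_(s | phi g s == p) \sum_(w | phi f w == s) genus T w = \sum_(w | phi g (phi f w) == p) genus T w)%N.
 rewrite [RHS](partition_big (phi f) (fun s => phi g s == p)) //=. apply: eq_bigr => s /eqP sp; apply: eq_bigl => w.
 by case: eqP => [->|]; rewrite ?andbF // sp eqxx.
have -> : (\sum_(s | phi g s == p) #|[set w | phi f w == s]| = #|[set w | phi g (phi f w) == p]|)%N.
 rewrite -sum1_card (partition_big (phi f) (fun s => phi g s == p)) /=; last first. by move=> w; rewrite inE.
 apply: eq_bigr => s /eqP sp; rewrite -sum1_card; apply: eq_bigl => w; rewrite !inE.
 by case: eqP => [->|]; rewrite ?andbF // sp eqxx.
have -> : (\sum_(s | phi g s == p) #|[set h in nz f | phi f (vtx T h) == s]| =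
  #|[set h in nz f | phi g (phi f (vtx T h)) == p]|)%N.
 rewrite -sum1_card (partition_big (fun h => phi f (vtx T h)) (fun s => phi g s == p)) /=;
  last by move=> w; rewrite inE => /andP[]. apply: eq_bigr => s /eqP sp; rewrite -sum1_card; apply: eq_bigl => w.
 rewrite [LHS]inE [in RHS]inE -andbA; congr (_ && _). by case: eqP => [->|]; rewrite ?andbF // sp eqxx.
by [].
Qed.
End Compose.

Lemma genus_arith (A nS nT GS GT ef eg : nat) : (GS * 2 + nT * 2 = GT * 2 + ef + nS * 2)%N ->
 (A + nS * 2 = GS * 2 + eg + 2 <-> A + nT * 2 = GT * 2 + (ef + eg) + 2)%N.
Proof. by move=> h; split; lia. Qed.

Lemma arrP_comp (O : opcat) (T S P : graph) (f : gmap T S) (g : gmap S P) :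
 arrP O f -> arrP O g -> arrP O (gcomp g f).
Proof.
move=> [f0 fc fg fo] [g0 gc gg go]; split.
- split.
 + by move=> x y; rewrite /= !ffunE => /(psi_inj f0)/(psi_inj g0).
 + move=> v; have [s <-] := phi_surj g0 v; have [w <-] := phi_surj f0 s. by exists w; rewrite /= ffunE.
 + by move=> h; rewrite /= !ffunE (psi_opp g0) (psi_opp f0).
 + rewrite -(psi_legs f0) -(psi_legs g0) -map_comp; apply: eq_map => h. by rewrite /= ffunE.
 + by move=> h; rewrite /= !ffunE (phi_vtx f0) (phi_vtx g0).
 + move=> h; rewrite (in_nz_comp _ f0) => /orP[hn|/imsetP[k kn ->]]; rewrite /= !ffunE. by rewrite (nz_eq f0 hn).
  by rewrite -(psi_opp f0) !(phi_vtx f0) (nz_eq g0 kn).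
- move=> v w; rewrite /= !ffunE => vw.
 have sub1 a b : connect (eadj T (nz f)) a b -> connect (eadj T (nz (gcomp g f))) a b.
  by apply: sub_erel; apply/subsetP => h hn; rewrite (in_nz_comp _ f0) hn.
 suff H : forall u, phi f u = phi f w -> connect (eadj T (nz (gcomp g f))) v u by apply: H.
 apply: (connect_ind (P := fun s => forall u, phi f u = s -> connect (eadj T (nz (gcomp g f))) v u) (gc _ _ vw)).
  by move=> u uv; apply/sub1/fc. move=> a b IH /erelP[k kn [ka kb]] u ub.
 have c1 : connect (eadj T (nz (gcomp g f))) v (vtx T (psi f k)). by apply: IH; rewrite (phi_vtx f0).
 apply: connect_trans c1 _; apply: (@connect_trans _ _ (vtx T (opp T (psi f k)))).
  apply/connect1/erel1; rewrite (in_nz_comp _ f0) mem_imset ?kn ?orbT //. exact: psi_inj f0.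
 by apply/sub1/fc; rewrite -(psi_opp f0) (phi_vtx f0) kb ub.
- move=> E p; have H := genus_arith _ _ (genus_sum g p (fg E)). rewrite /genus_ok (card_nz_comp g f0 p).
 have -> : [set w | phi (gcomp g f) w == p] = [set w | phi g (phi f w) == p].
  by apply/setP => w; rewrite !inE /= ffunE.
 rewrite (eq_bigl (fun w => phi g (phi f w) == p)) => [|w]; last by rewrite /= ffunE. exact/H/gg.
- by move=> E h; rewrite /= ffunE fo // go.
Qed.

(** * Factorization *)

(** Fibers of [f] are connected through [nz f], so [phi f0] is constant on them, and [psi f0] avoids
    [nz f] and lifts along [psi f]. Connectedness, genera and directions of the factor follow by
    cancelling [f]. *)
Lemma factor (O : opcat) (X S P : graph) (f : gmap X S) (f0 : gmap X P) :
 arrP O f -> arrP O f0 -> nz f \subset nz f0 -> exists g : gmap S P, gcomp g f = f0 /\ arrP O g.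
Proof.
move=> [fm fc fg fo] [hm hc hg ho] /subsetP sub.
have con v w : phi f v = phi f w -> phi f0 v = phi f0 w.
 move/fc => c; apply: (connect_ind (P := fun w => phi f0 v = phi f0 w) c) => //.
 by move=> a b -> /erelP[h /sub hn [<- <-]]; apply: (nz_eq hm).
have /fin_all_exists[gv gvE] (s : 'I_(nv S)) : exists p, forall v, phi f v = s -> phi f0 v = p.
 by have [v vs] := phi_surj fm s; exists (phi f0 v) => w ws; apply: con; rewrite ws vs.
have /fin_all_exists[gh ghE] (k : 'I_(nh P)) : exists h, psi f h = psi f0 k.
 have /nzPn[h ->] : psi f0 k \notin nz f; last by exists h. by apply: contra (psi_nz f0 k) => /sub.
pose g := @GMap S P [ffun k => gh k] [ffun s => gv s].
have gE : gcomp g f = f0. by apply: gmap_eq => x; rewrite /= !ffunE ?ghE // (gvE _ x erefl).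
have g1 v : phi g (phi f v) = phi f0 v by rewrite -gE /= [in RHS]ffunE.
have g2 k : psi f (psi g k) = psi f0 k by rewrite /= ffunE.
have gm : gm0 g. split.
 - by move=> x y E; apply: (psi_inj hm); rewrite -!g2 E.
 - by move=> p; have [v <-] := phi_surj hm p; exists (phi f v).
 - by move=> h; apply: (psi_inj fm); rewrite g2 (psi_opp fm) g2 (psi_opp hm).
 - apply: (inj_map (psi_inj fm)); rewrite (psi_legs fm) -(psi_legs hm) -map_comp. by apply: eq_map => h; apply: g2.
 - by move=> h; rewrite -(phi_vtx fm) g1 g2 (phi_vtx hm).
 - move=> h hn; rewrite -!(phi_vtx fm) (psi_opp fm) !g1; apply: (nz_eq hm).
  by rewrite -gE (in_nz_comp _ fm) mem_imset ?hn ?orbT //; apply: psi_inj fm.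
exists g; split=> //; split=> //.
- move=> a b; have [v <-] := phi_surj fm a; have [w <-] := phi_surj fm b.
 rewrite !g1 => /hc c; apply: connect_map c _ => x y /erelP[h + [<- <-]].
 rewrite -gE (in_nz_comp _ fm) => /orP[hn|/imsetP[k kn ->]]. by rewrite (nz_eq fm hn); apply: connect0.
 by rewrite -(psi_opp fm) !(phi_vtx fm); apply/connect1/erel1.
- move=> E p; have H := genus_arith _ _ (genus_sum g p (fg E)).
 have := hg E p; rewrite /genus_ok -gE (card_nz_comp g fm p) gE.
 have -> : [set w | phi f0 w == p] = [set w | phi g (phi f w) == p]. by apply/setP => w; rewrite !inE g1.
 rewrite (eq_bigl (fun w => phi g (phi f w) == p)) => [|w]; last by rewrite g1. by move/H.
- by move=> E h; rewrite -(fo E) g2 ho.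
Qed.

(** * Counting edges in fibers *)

Section TreeCount.
Variables (T S : graph) (f : gmap T S).
Hypotheses (Tord : ordered T) (Sord : ordered S) (f0 : gm0 f) (fc : fconn f).

Definition fib v := [set w | phi f w == v].
Definition nzv v := [set h in nz f | phi f (vtx T h) == v].

Lemma fib_card v : (#|fib v| * 2 <= #|nzv v| + 2)%N.
Proof.
apply: (@conn_card _ _ (vtx T) (opp T) (oppK Tord) (nzv v) (fib v)).
- move=> h; rewrite !in_set => /andP[hn /eqP hv]; apply/andP; split.
  by have := nz_closed Tord f0 (h := h); rewrite !inE; apply. by rewrite -(nz_eq f0) ?hv // inE.
- by move=> h; rewrite inE => /andP[/(subsetP (nz_full Tord f0))]; rewrite inE.
- by move=> h; rewrite !inE => /andP[].
- move=> a b; rewrite !inE => /eqP av /eqP bv. have /fc c : phi f a = phi f b by rewrite av bv.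
 have [] // : phi f b = v /\ connect (eadj T (nzv v)) a b.
 apply: (connect_ind (P := fun b => phi f b = v /\ connect (eadj T (nzv v)) a b) c). by split; last exact: connect0.
 move=> x y [xv ca] /erelP[h hn [hx hy]]; split. by rewrite -hy -(nz_eq f0 hn) hx xv.
 apply: connect_trans ca _; rewrite -hx -hy; apply/connect1/erel1. by rewrite inE hn hx xv eqxx.
Qed.

Lemma card_fib_sum : nv T = \sum_v #|fib v|.
Proof.
rewrite -[LHS]card_ord -sum1_card (partition_big (phi f) predT) //=.
by apply: eq_bigr => v _; rewrite -sum1_card; apply: eq_bigl => w; rewrite inE.
Qed.

Lemma card_nzv_sum : #|nz f| = \sum_v #|nzv v|.
Proof.
rewrite -sum1_card (partition_big (fun h => phi f (vtx T h)) predT) //=.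
by apply: eq_bigr => v _; rewrite -sum1_card; apply: eq_bigl => w; rewrite [RHS]inE.
Qed.

Lemma card_full_nz : #|full T| = (#|full S| + #|nz f|)%N.
Proof.
rewrite -(card_imset (full S) (psi_inj f0)) -cardsUI.
rewrite (_ : _ :&: _ = set0) ?cards0 ?addn0; last first.
 apply/setP => h; rewrite [LHS]inE in_set0; apply/negP => /andP[/imsetP[k _ ->]]. by rewrite (negbTE (psi_nz _ _)).
apply: eq_card => h; rewrite [RHS]inE orbC.
have [hn|/nzPn[k ->]] := boolP (h \in nz f). by rewrite (subsetP (nz_full Tord f0)).
rewrite /= mem_imset; last exact: psi_inj f0.
by rewrite !inE -(psi_opp f0) (inj_eq (psi_inj f0)).
Qed.

Lemma nedge_sum : (nedge T * 2 = nedge S * 2 + #|nz f|)%N.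
Proof. by rewrite -!card_full // card_full_nz. Qed.

(** A connected fiber has at most one vertex more than it has edges; summed over the vertices of [S]
    this bounds the number of edges of [S] from above. *)
Lemma tree_target : b1 T = 0%N -> b1 S = 0%N.
Proof.
rewrite /b1 => bT; have := nedge_sum; have := card_fib_sum; have := card_nzv_sum.
have : (\sum_v (#|fib v| * 2) <= \sum_v (#|nzv v| + 2))%N. by apply: leq_sum => v _; apply: fib_card.
rewrite big_split /= -big_distrl /= sum_nat_const card_ord; lia.
Qed.

(** The counts of [tree_target] with one fiber left out: since [S] is connected and the other fibers
    satisfy [fib_card], there is no edge to spare for a cycle over [v]. *)
Lemma tree_fiber v : connected S -> b1 T = 0%N -> (#|nzv v| + 2 <= #|fib v| * 2)%N.
Proof.
rewrite /b1 => Sc bT; have := nedge_sum; have := card_fib_sum; have := card_nzv_sum.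
have := conn_nv Sord Sc.
have : (\sum_(w | w != v) (#|fib w| * 2) <= \sum_(w | w != v) (#|nzv w| + 2))%N.
 by apply: leq_sum => w _; apply: fib_card.
have -> : (\sum_w #|fib w| = #|fib v| + \sum_(w | w != v) #|fib w|)%N by rewrite (bigD1 v).
have -> : (\sum_w #|nzv w| = #|nzv v| + \sum_(w | w != v) #|nzv w|)%N by rewrite (bigD1 v).
rewrite big_split /= -big_distrl /=.
have -> : (\sum_(w | w != v) 2 = (nv S).-1 * 2)%N.
 by rewrite sum_nat_const; congr (_ * _)%N; rewrite -[X in X.-1]card_ord -(cardC1 v).
have := ltn_ord v; lia.
Qed.

End TreeCount.

(** * Arrows, isomorphisms and induced maps in the four categories *)

Section Objects.
Variable O : opcat.
Implicit Types (T S P F G H X : obj O).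

Lemma objO X : ordered X. Proof. by have [] := obj_ok X. Qed.
Lemma objC X : connected X. Proof. by have [_ []] := obj_ok X. Qed.
Arguments objC : clear implicits.
Lemma arrO T S (f : arr T S) : arrP O f.
Proof. by apply/is_arrP; [apply: objO|apply: objO|apply: arr_ok]. Qed.
Lemma arr0 T S (f : arr T S) : gm0 f. Proof. exact: arr_gm0 (arrO f). Qed.

Lemma ex_arr T S (f : gmap T S) : arrP O f -> exists g : arr T S, amap g = f.
Proof.
by move=> /(is_arrP O f (objO T) (objO S)) ok; exists (Arr ok).
Qed.

Lemma factor_arr X S P (f : arr X S) (f0 : arr X P) : nz f \subset nz f0 -> exists g : arr S P, gcomp g f = f0.
Proof.
move=> /(factor (arrO f) (arrO f0))[g [gE /ex_arr[h hE]]].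
by exists h; rewrite hE.
Qed.

Lemma comp_arr T S P (f : arr T S) (g : arr S P) : exists h : arr T P, amap h = gcomp g f.
Proof. exact: ex_arr (arrP_comp (arrO f) (arrO g)). Qed.

Lemma id_arr T : exists f : arr T T, amap f = gid T.
Proof. exact: ex_arr (arrP_id O T). Qed.

(** If nothing is contracted, the identity factors through [f] by [factor_arr], and since [f] can be
    cancelled on the right the factor is a two-sided inverse. *)
Lemma iso_nz T S (f : arr T S) : iso f <-> nz f = set0.
Proof.
split=> [[g [gf fg]]|fn]. apply/setP => h; rewrite inE in_set0; apply/negbTE; rewrite negbK.
 have := congr1 (fun e : gmap T T => psi e h) gf; rewrite /= !ffunE => <-. exact: codom_f.
have [i iE] := id_arr T.
have [|g gf] := @factor_arr _ _ _ f i; first by rewrite fn sub0set.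
exists g; split; first by rewrite gf iE.
apply: (gcomp_epi (arr0 f)); rewrite -gcompA gf iE gcompf1 gcomp1f //.
Qed.

Lemma iso_phi_inj T S (f : arr T S) : iso f -> injective (phi f).
Proof.
move=> [g [gf _]] v w E.
have h u : phi g (phi f u) = u. by have := congr1 (fun e : gmap T T => phi e u) gf; rewrite /= !ffunE.
by rewrite -(h v) E h.
Qed.

Lemma iso_psi_surj T S (f : arr T S) h : iso f -> exists k, h = psi f k.
Proof. by move/iso_nz => fn; apply/nzPn; rewrite fn inE. Qed.

Lemma iso_inv T S (f : arr T S) : iso f -> exists g : arr S T, [/\ iso g, gcomp g f = gid T & gcomp f g = gid S].
Proof. by case=> g [a b]; exists g; split=> //; exists f. Qed.

Lemma iso_comp T S P (f : arr T S) (g : arr S P) (h : arr T P) : iso f -> iso g -> amap h = gcomp g f -> iso h.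
Proof.
move=> /iso_nz fn /iso_nz gn hE; apply/iso_nz; apply/setP => x.
by rewrite hE (in_nz_comp _ (arr0 f)) fn gn imset0 !inE.
Qed.

Lemma nz_iso_comp T S P (f : arr T S) (g : arr S P) : iso f -> nz (gcomp g f) = psi f @: nz g.
Proof.
by move/iso_nz => fn; apply/setP => x; rewrite (in_nz_comp _ (arr0 f)) fn inE.
Qed.

(** * Induced maps between fibers *)

Section Induced.
Variables (T S P : obj O) (f : arr T S) (g : arr S P) (gf : arr T P).
Hypothesis gfE : amap gf = gcomp g f.
Variables (i : 'I_(nv P)) (H G : obj O).
Variables (iv : 'I_(nv H) -> 'I_(nv T)) (ih : 'I_(nh H) -> 'I_(nh T)).
Variables (jv : 'I_(nv G) -> 'I_(nv S)) (jh : 'I_(nh G) -> 'I_(nh S)).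
Hypotheses (I : fiber_incl gf i iv ih) (J : fiber_incl g i jv jh).

Let phigf v : phi gf v = phi g (phi f v). Proof. by rewrite gfE /= ffunE. Qed.
Let psigf v : psi gf v = psi f (psi g v). Proof. by rewrite gfE /= ffunE. Qed.

Section Props.
Variable fi : gmap H G.
Hypothesis fiv : forall w, jv (phi fi w) = phi f (iv w).
Hypothesis fih : forall h, ih (psi fi h) = psi f (jh h).

Lemma nz_induced h : (h \in nz fi) = (ih h \in nz f).
Proof.
apply/negb_inj; apply/nzPn/nzPn => [[k ->]|[k hk]]; first by exists (jh k); rewrite fih.
have [k' E] : exists k', k = jh k'. by apply: (ih_ex J); rewrite -(phi_vtx (arr0 f)) -phigf -hk (phi_ih I).
by exists k'; apply: (ih_inj I); rewrite fih hk E.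
Qed.

Lemma fib_induced s : iv @: [set w | phi fi w == s] = [set w | phi f w == jv s].
Proof.
apply/setP => w; rewrite inE; apply/imsetP/eqP => [[w' + ->]|ws]. by rewrite inE => /eqP <-; rewrite fiv.
have [w' E] : exists w', w = iv w' by apply: (iv_ex I); rewrite phigf ws (phi_iv J).
by exists w'; rewrite // inE; apply/eqP/(iv_inj J); rewrite fiv -E.
Qed.

Lemma nzv_induced s : ih @: [set h in nz fi | phi fi (vtx H h) == s] = [set h in nz f | phi f (vtx T h) == jv s].
Proof.
apply/setP => h; rewrite inE; apply/imsetP/andP => [[h' + ->]|[hn /eqP hs]].
 by rewrite inE nz_induced => /andP[-> /eqP <-]; rewrite fiv (fi_vtx I).
have [h' E] : exists h', h = ih h' by apply: (ih_ex I); rewrite phigf hs (phi_iv J).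
exists h'; rewrite // inE nz_induced -E hn; apply/eqP/(iv_inj J).
by rewrite fiv (fi_vtx I) -E.
Qed.

Lemma induced_arrP : arrP O fi.
Proof.
have [f0 fc fg fo] := arrO f; have g0 := arr0 g; have gf0 := arr0 gf.
split.
- split.
 + move=> x y E; apply: (ih_inj J); apply: (psi_inj f0). by rewrite -!fih E.
 + move=> s; have [v vs] := phi_surj f0 (jv s).
  have [w E] : exists w, v = iv w by apply: (iv_ex I); rewrite phigf vs (phi_iv J).
  by exists w; apply: (iv_inj J); rewrite fiv -E.
 + move=> h; apply: (ih_inj I); rewrite fih (ih_opp J) (ih_opp I) fih.
  rewrite gfE (in_nz_comp _ f0) (negbTE (psi_nz f _)) mem_imset; last exact: psi_inj f0.
  by case: ifP => //; rewrite (psi_opp f0).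
 + apply: (inj_map (ih_inj I)); rewrite (fi_legs I) -map_comp.
  transitivity [seq psi f h | h <- [seq jh h | h <- legs G]]. by rewrite -map_comp; apply: eq_map => h; apply: fih.
  by rewrite (fi_legs J) -map_comp; apply: eq_map => h; rewrite /= psigf.
 + move=> h; apply: (iv_inj J); rewrite fiv (fi_vtx J) (fi_vtx I) fih. exact: phi_vtx f0 _.
 + move=> h; rewrite nz_induced => hn; apply: (iv_inj J); rewrite !fiv !(fi_vtx I).
  by rewrite (ih_opp I) gfE (in_nz_comp _ f0) hn /= (nz_eq f0 hn).
- move=> v w vw; have /fc c : phi f (iv v) = phi f (iv w) by rewrite -!fiv vw.
 suff [w' /(iv_inj I)->//] : exists2 w', iv w = iv w' & connect (eadj H (nz fi)) v w'.
 apply: (connect_ind (P := fun u => exists2 w', u = iv w' &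
  connect (eadj H (nz fi)) v w') c); first by exists v => //; apply: connect0.
 move=> a b [w' -> cw] /erelP[h hn [ha hb]]. have [h' E] : exists h', h = ih h'.
  by apply: (ih_ex I); rewrite ha (phi_iv I). exists (vtx H (opp H h')).
  by rewrite (fi_vtx I) (ih_opp I) gfE (in_nz_comp _ f0) -E hn.
 apply: connect_trans cw (connect1 _); apply/erelP; exists h'. by rewrite nz_induced -E.
 by split=> //; apply: (iv_inj I); rewrite (fi_vtx I) -E.
- move=> E s; have := fg E (jv s); rewrite /genus_ok -fib_induced -nzv_induced.
 rewrite (card_imset _ (iv_inj I)) (card_imset _ (ih_inj I)) (fi_genus J) => ->. congr (_ * 2 + _ + _)%N.
 transitivity (\sum_(w in iv @: [set w | phi fi w == s]) genus T w).
  by rewrite fib_induced; apply: eq_bigl => w; rewrite inE. rewrite big_imset; last by apply: in2W; apply: iv_inj I.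
 by apply: eq_big => w; [rewrite inE | rewrite (fi_genus I)].
- by move=> E h; rewrite (fi_outp I) fih fo // (fi_outp J).
Qed.
End Props.

Lemma induced_ex : exists fi : arr H G,
 (forall w, jv (phi fi w) = phi f (iv w)) /\ (forall h, ih (psi fi h) = psi f (jh h)).
Proof.
have /fin_all_exists[gv gvE] (w : 'I_(nv H)) : exists s, jv s = phi f (iv w).
 have [s E] : exists s, phi f (iv w) = jv s. by apply: (iv_ex J); rewrite -phigf (phi_iv I). by exists s.
have /fin_all_exists[gh ghE] (h : 'I_(nh G)) : exists k, ih k = psi f (jh h).
 have [s E] : exists k, psi f (jh h) = ih k. by apply: (ih_ex I); rewrite phigf (phi_vtx (arr0 f)) (phi_ih J).
 by exists s.
have fv w : jv (phi (GMap [ffun h => gh h] [ffun w => gv w] : gmap H G) w) = phi f (iv w). by rewrite /= ffunE.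
have fh h : ih (psi (GMap [ffun h => gh h] [ffun w => gv w] : gmap H G) h) = psi f (jh h). by rewrite /= ffunE.
have [fi fiE] := ex_arr (induced_arrP fv fh).
by exists fi; rewrite fiE.
Qed.
End Induced.
End Objects.
Arguments objC {O} X v w.
Arguments objO {O} X.

(** * The order at a vertex *)

(* The half-edges at a vertex are sorted by [prio]: in [RTr] the root half-edge
   comes before the others, in [Whe] the inputs come before the outputs. *)
Definition prio (O : opcat) (T : graph) (h : 'I_(nh T)) : bool := if O is RTr then ~~ isMin h else outp T h.

Section Rooted.
Implicit Types X S : obj RTr.

Lemma rtrP X : exists r l, [/\ legs X = r :: l, isMin r & forall h, opp X h != h -> isMin h || isMin (opp X h)].
Proof. by have [Xo [Xc [_ _ _ Xr]]] := obj_ok X; apply/rootedP. Qed.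

(** [sel_card] for the minimal half-edges in the component of [x]: each of its edges already has one
    of them, so at most one is left outside [q]. *)
Lemma outer_min_uniq X (q : {set 'I_(nh X)}) x y : opclosed (opp X) q -> q \subset full X ->
 isMin x -> isMin y -> x \notin q -> y \notin q -> connect (eadj X q) (vtx X x) (vtx X y) -> x = y.
Proof.
move=> qc qf xm ym xq yq c; have [r [l [lE rm em]]] := rtrP X.
have oK := oppK (objO X); have cs := @erel_sym _ _ (vtx X) _ oK _ qc.
pose W := [set w | connect (eadj X q) (vtx X x) w].
pose q' := [set h in q | vtx X h \in W].
have qn h : h \in q -> opp X h != h by move/(subsetP qf); rewrite inE.
have q'c : opclosed (opp X) q'. move=> h; rewrite !inE => /andP[hq ch]; rewrite qc //=.
 by apply: connect_trans ch (connect1 (erel1 _ _ hq)).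
have base w : w \in W -> connect (eadj X q') (vtx X x) w. rewrite inE => cw.
 suff [] : w \in W /\ connect (eadj X q') (vtx X x) w by [].
 apply: (connect_ind (P := fun w => w \in W /\ connect (eadj X q') (vtx X x) w) cw).
  by rewrite inE; split; apply: connect0. move=> a b [aW ca] /erelP[h hq [ha hb]].
 have hq' : h \in q' by rewrite inE hq ha. rewrite -hb; split; first by have := q'c _ hq'; rewrite inE => /andP[].
 by apply: connect_trans ca _; rewrite -ha; apply: connect1 (erel1 _ _ hq').
apply: (@sel_card _ _ (vtx X) _ oK q' W [set h | isMin h]) => //.
- by move=> h; rewrite inE => /andP[/qn].
- by move=> h; rewrite inE => /andP[].
- move=> v w /base cv /base cw; apply: connect_trans cw. by rewrite (@erel_sym _ _ (vtx X) _ oK _ q'c).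
- by move=> h h'; rewrite !inE; apply: isMin_inj.
- by move=> h; rewrite !inE => /andP[/qn/em].
- by rewrite inE.
- by rewrite inE.
- by rewrite inE negb_and xq.
- by rewrite inE negb_and yq.
- by rewrite inE; apply: connect0.
- by rewrite inE.
Qed.

Lemma min_ex X v : exists2 h, vtx X h = v & isMin h.
Proof.
have [r [l [lE rm em]]] := rtrP X.
have [h hv tr] := towards_ex (objO X) r v (objC X); exists h => //.
suff: h \in [set k | isMin k] by rewrite inE.
apply: (towards_sel (objO X)) tr; rewrite ?inE //.
- by apply/eqP; rewrite -mem_legs ?lE ?mem_head //; apply: objO.
- by move=> k k'; rewrite !inE; apply: isMin_inj.
- by move=> k /em; rewrite !inE.
Qed.

(* Both the minimal half-edges of [S] and the outer minimal half-edges of [X]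
   select at each vertex of [S] the half-edge towards the root. *)
Lemma arr_min X S (f : arr X S) k : isMin (psi f k) = isMin k.
Proof.
have f0 := arr0 f; have fc := arr_conn (arrO f).
have [r [l [lE rm em]]] := rtrP X; have [s [l' [lE' sm em']]] := rtrP S.
have rs : psi f s = r by have := psi_legs f0; rewrite lE lE' /=; case.
have uq a b : isMin (psi f a) -> isMin (psi f b) -> vtx S a = vtx S b -> a = b.
 move=> am bm ab; apply: (psi_inj f0). apply: (outer_min_uniq (q := nz f)) => //.
 - exact: nz_closed (objO X) f0.
 - exact: nz_full (objO X) f0.
 - exact: psi_nz.
 - exact: psi_nz.
 - by apply: fc; rewrite !(phi_vtx f0).
have imp h : towards s h -> isMin (psi f h). move=> tr; suff: h \in [set k | isMin (psi f k)] by rewrite inE.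
 apply: (towards_sel (objO S)) tr; rewrite ?inE ?rs //.
 - by apply/eqP; rewrite -mem_legs ?lE' ?mem_head //; apply: objO.
 - by move=> a b; rewrite !inE; apply: uq.
 - move=> a an; rewrite !inE (psi_opp f0); apply: em. by rewrite -(psi_opp f0) (inj_eq (psi_inj f0)).
have [h hv tr] := towards_ex (objO S) s (vtx S k) (objC S).
have hm : isMin h. suff: h \in [set k | isMin k] by rewrite inE. apply: (towards_sel (objO S)) tr; rewrite ?inE //.
 - by apply/eqP; rewrite -mem_legs ?lE' ?mem_head //; apply: objO.
 - by move=> a b; rewrite !inE; apply: isMin_inj.
 - by move=> a /em'; rewrite !inE.
apply/idP/idP => km; first by rewrite -(uq h k) // imp.
by rewrite -(isMin_inj hm km hv); apply: imp.
Qed.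
End Rooted.

Lemma prio_arr O (X S : obj O) (f : arr X S) k : prio O (psi f k) = prio O k.
Proof.
case: O X S f k => X S f k; rewrite /prio.
- by have [_ [_ Xo]] := obj_ok X; have [_ [_ So]] := obj_ok S; rewrite Xo So.
- by have [_ [_ [_ Xo _]]] := obj_ok X; have [_ [_ [_ So _]]] := obj_ok S; rewrite Xo So.
- by rewrite arr_min.
- by rewrite (arr_outp (arrO f)).
Qed.

Lemma prio_local O (X : obj O) (h h' : 'I_(nh X)) : vtx X h = vtx X h' -> ~~ prio O h -> prio O h' -> (h < h')%N.
Proof.
case: O X h h' => X h h'; rewrite /prio.
- by have [_ [_ Xo]] := obj_ok X; rewrite !Xo.
- by have [_ [_ [_ Xo _]]] := obj_ok X; rewrite !Xo.
- rewrite negbK => E /isMinP hm hm'; rewrite ltn_neqAle hm // andbT.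
 apply: contra hm' => /eqP/ord_inj <-; exact/isMinP.
- have [_ [_ [_ [_ dl _]]]] := obj_ok X => E ho ho'; rewrite ltnNge. by apply: contra ho => hh; apply: (dl h' h).
Qed.

Lemma leq_bigmax_ord n (F : 'I_n -> nat) i : F i < (\max_(j < n) F j).+1.
Proof. by rewrite ltnS; apply: (@leq_bigmax _ F i). Qed.

Lemma card_closed (X : graph) (q : {set 'I_(nh X)}) : ordered X -> opclosed (opp X) q -> q \subset full X ->
 #|q| = (#|[set h : 'I_(nh X) in q | (h < opp X h)%N]| * 2)%N.
Proof.
move=> Xo qc qf; set A := [set _ in q | _]; have oK := oppK Xo.
have AE : q = A :|: opp X @: A. apply/setP => h; rewrite !inE; apply/idP/orP => [hq|[/andP[]//|/imsetP[k + ->]]].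
  have : nat_of_ord h != opp X h. have := subsetP qf _ hq; rewrite inE eq_sym; apply: contra => /eqP/ord_inj <-.
   by []. rewrite neq_ltn hq => /orP[->|hh']; [by left|right].
  by apply/imsetP; exists (opp X h); rewrite ?inE ?oK ?qc. by rewrite inE => /andP[kq _]; apply: qc.
rewrite {1}AE cardsU disjoint_setI0 ?cards0 ?subn0; last first.
 rewrite disjoint_subset; apply/subsetP => h; rewrite !inE => /andP[_ hh].
 apply/negP => /imsetP[k]; rewrite inE => /andP[_ kk] E'. by move: hh; rewrite E' oK ltnNge (ltnW kk).
by rewrite card_imset ?addnn ?muln2 //; apply: can_inj oK.
Qed.

(** For trees the number of edges of a fiber is bounded by [tree_fiber]. In [RTr] the least
    half-edge of [S] at [v] becomes the first leg of the fiber and is minimal by [arr_min]; in [Whe]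
    the legs are sorted because they follow the local order of [S] at [v]. *)
Lemma fiber_obj O (T S : obj O) (f : arr T S) (v : 'I_(nv S)) (F : graph)
  (iv : 'I_(nv F) -> 'I_(nv T)) (ih : 'I_(nh F) -> 'I_(nh T)) : fiber_incl f v iv ih -> is_obj O F.
Proof.
move=> I; have [f0 fc fg fo] := arrO f; have To := objO T; have So := objO S.
have Fo : ordered F := fiber_ordered To f0 I So.
have Fc : connected F. by apply: (iffRL (fconnP To f0 So) fc v); exists iv, ih.
have Ft : b1 T = 0%N -> b1 F = 0%N. move=> bT; have := tree_fiber To So f0 fc v (objC S) bT.
 rewrite /fib /nzv -(card_full_fiber To f0 I) -(nv_fiber I) card_full // /b1; lia.
have ng : no_genus T -> no_genus F by move=> h w; rewrite (fi_genus I).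
have no : no_outp T -> no_outp F by move=> h w; rewrite (fi_outp I).
split=> //; split=> //.
case: O T S f v iv ih I f0 fc fg fo To So Fo Fc Ft ng no => T S f v iv ih I f0 fc fg fo To So Fo Fc Ft ng no.
- by have [_ [_ /no]] := obj_ok T.
- by have [_ [_ [/ng ? /no ? [_ /Ft]]]] := obj_ok T.
- have [_ [_ [/ng ? /no ? [_ /Ft ?] _]]] := obj_ok T; split=> //. have imin h : isMin (ih h) -> isMin h.
  move=> /isMinP hm; apply/isMinP => h' E; rewrite leqNgt; apply/negP => /(fi_ih_incr I).
  by rewrite ltnNge hm // -!(fi_vtx I) E. apply/rootedP => //; have [r [l [lE _ em]]] := rtrP T.
 have [m mv mm] := min_ex v. have ms : exists l', [seq h <- enum 'I_(nh S) | vtx S h == v] = m :: l'.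
  have : m \in [seq h <- enum 'I_(nh S) | vtx S h == v]. by rewrite mem_filter mem_enum mv eqxx.
  have : {in [seq h <- enum 'I_(nh S) | vtx S h == v], forall h : 'I_(nh S), (m <= h)%N}.
   move=> h; rewrite mem_filter => /andP[/eqP hv _]. by apply: (isMinP _ mm); rewrite hv mv.
  have : sorted (fun x y : 'I_(nh S) => (x < y)%N) [seq h <- enum 'I_(nh S) | vtx S h == v].
   apply: sorted_filter; first by move=> y x z; apply: ltn_trans.
   by rewrite -(@sorted_map _ _ (fun i : 'I_(nh S) => nat_of_ord i) ltn) val_enum_ord iota_ltn_sorted.
  case: [seq _ <- _ | _] => [//|a s] /= sa le; rewrite inE => /orP[/eqP->|ms]. by exists s.
  have := order_path_min _ sa => /(_ (fun _ _ _ => @ltn_trans _ _ _))/allP/(_ _ ms).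
  by rewrite ltnNge le // mem_head. have [l' E] := ms; have := fi_legs I; rewrite E /=.
 case lF: (legs F) => [//|r' l''] /= [rE _]; exists r', l''; split=> //. by apply: imin; rewrite rE arr_min.
 move=> h hn. have hF : h \in full F by rewrite inE. have hz : ih h \in nz f by rewrite -(full_fiber To f0 I).
 have := subsetP (nz_full To f0) _ hz; rewrite inE => /em /orP[/imin->//|].
 by have := ih_opp I h; rewrite hz => <- /imin->; rewrite orbT.
- have [_ [_ [/ng ? [d1 d2 d3]]]] := obj_ok T; split=> //; split.
 + move=> h hn; have hF : h \in full F by rewrite inE. have hz : ih h \in nz f by rewrite -(full_fiber To f0 I).
  rewrite !(fi_outp I) (ih_opp I) hz d1 //. by have := subsetP (nz_full To f0) _ hz; rewrite inE.
 + move=> h h' E; rewrite leq_eqVlt => /orP[/eqP/ord_inj->//|/(fi_ih_incr I) hh].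
  by rewrite !(fi_outp I); apply: d2 (ltnW hh); rewrite -!(fi_vtx I) E.
 + have [_ [_ [_ [_ s2 _]]]] := obj_ok S.
  have : sorted (fun h h' => outp T h ==> outp T h') [seq ih h | h <- legs F]. rewrite (fi_legs I) sorted_map.
   have : sorted (fun h h' : 'I_(nh S) => (h <= h')%N && (vtx S h == vtx S h'))
     [seq h <- enum 'I_(nh S) | vtx S h == v]. have : sorted (fun h h' : 'I_(nh S) => (h <= h')%N)
      [seq h <- enum 'I_(nh S) | vtx S h == v]. apply: sorted_filter; first by move=> y x z; apply: leq_trans.
     by rewrite -(@sorted_map _ _ (fun i : 'I_(nh S) => nat_of_ord i) leq) val_enum_ord iota_sorted.
    have : all (fun h => vtx S h == v) [seq h <- enum 'I_(nh S) | vtx S h == v]. exact: filter_all.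
    case: [seq _ <- _ | _] => [//|a s] /=; elim: s a => //= b s IH a.
    move=> /and3P[av bv sv] /andP[ab sb]; rewrite ab (eqP av) (eqP bv) eqxx /=. by apply: IH; rewrite ?bv.
   apply: sub_sorted => a b /andP[ab /eqP vab] /=. by rewrite !fo //; apply/implyP; apply: s2.
  by rewrite sorted_map; apply: sub_sorted => a b /=; rewrite !(fi_outp I).
Qed.

Lemma fiber_objE O (T S : obj O) (f : arr T S) v : exists F : obj O, is_fiber f v F.
Proof.
have [F [iv [ih I]]] := fiber_ex (arr0 f) v.
by exists (Obj (fiber_obj I)), iv, ih.
Qed.

(** * Contraction of edges *)

Lemma is_obj_gg O T : is_obj O T -> O = ggGrc -> no_outp T.
Proof. by move=> + E; rewrite E => -[_ []]. Qed.
Lemma is_obj_Tr O T : is_obj O T -> O = Tr -> [/\ no_genus T, no_outp T & tree T].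
Proof. by move=> + E; rewrite E => -[_ []]. Qed.
Lemma is_obj_RTr O T : is_obj O T -> O = RTr -> is_obj RTr T.
Proof. by move=> + E; rewrite E. Qed.
Lemma is_obj_Whe O T : is_obj O T -> O = Whe -> no_genus T /\ directed T.
Proof. by move=> + E; rewrite E => -[_ []]. Qed.
Lemma prio_RTr O (T : graph) (h : 'I_(nh T)) : O = RTr -> prio O h = ~~ isMin h.
Proof. by move->. Qed.
Lemma prio_Whe O (T : graph) (h : 'I_(nh T)) : O = Whe -> prio O h = outp T h.
Proof. by move->. Qed.

Lemma prio_gg O (T : graph) (h : 'I_(nh T)) : O = ggGrc -> prio O h = outp T h.
Proof. by move->. Qed.
Lemma prio_Tr O (T : graph) (h : 'I_(nh T)) : O = Tr -> prio O h = outp T h.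
Proof. by move->. Qed.

Section Contract.
Variables (O : opcat) (X : obj O) (q : {set 'I_(nh X)}).
Variables (kv : 'I_(nv X) -> nat) (kl : 'I_(nh X) -> nat).
Hypotheses (qf : q \subset full X) (qc : opclosed (opp X) q).
Hypothesis kvE : forall v w, kv v = kv w <-> connect (eadj X q) v w.
Hypothesis kl_inj : forall h h', h \notin q -> h' \notin q ->
 kv (vtx X h) = kv (vtx X h') -> kl h = kl h' -> h = h'.
Hypothesis kl_prio : forall h h', h \notin q -> h' \notin q ->
 kv (vtx X h) = kv (vtx X h') -> ~~ prio O h -> prio O h' -> (kl h < kl h')%N.

Let Xo := objO X.
Let oK := oppK Xo.
Let cs := @erel_sym _ _ (vtx X) _ oK _ qc.
Let rt := fingraph.root (eadj X q).

Let rtE v w : (rt v == rt w) = connect (eadj X q) v w.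
Proof. exact: (root_connect cs). Qed.

Let rtK v : rt (rt v) = rt v.
Proof. by apply/eqP; rewrite rtE cs connect_root. Qed.

Let isgg := if O is ggGrc then true else false.
(** Genus of a contracted component: the sum of its genera plus its first Betti number, [q]
    containing two half-edges for each edge. Outside [ggGrc] the label is kept at zero. *)
Let gn v := if isgg then (\sum_(w | rt w == v) genus X w +
 (#|[set h in q | rt (vtx X h) == v]|./2 + 1 - #|[set w | rt w == v]|))%N else 0%N.

(** The vertices of the target are the components of [q], represented by their roots; the keys [kv]
    and [kl] prescribe its vertex order and its local orders. All later contractions and reorderings
    are instances. Compatibility of [kl] with [prio] keeps roots first and inputs before outputs. *)
Lemma contract : exists (S : obj O) (f : arr X S), [/\ nz f = q,
 (forall v w, (phi f v < phi f w)%N = (kv v < kv w)%N) & (forall h h' : 'I_(nh S), vtx S h = vtx S h' ->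
  (h < h')%N = (kl (psi f h) < kl (psi f h'))%N)].
Proof.
have kvrt v : kv (rt v) = kv v. by apply/kvE; rewrite cs; apply: connect_root.
(* [B] exceeds every value of [kl], so the key [kv * B + kl] sorts half-edges first by vertex and
   then by [kl]. *)
pose B := (\max_h kl h).+1.
have lex a b (h h' : 'I_(nh X)) : (a * B + kl h < b * B + kl h')%N = (a < b)%N || (a == b) && (kl h < kl h')%N.
 have := leq_bigmax_ord kl h; have := leq_bigmax_ord kl h'; rewrite -/B => H1 H2.
 by case: (ltngtP a b) => [ab|ab|->] /=; [nia|apply/negbTE; nia|lia].
have [||h _|h|h|S0 [ev [eh BT]]] := @mk_graph X [set v | rt v == v] kv (~: q)
 (fun h => kv (vtx X h) * B + kl h)%N (fun h => rt (vtx X h)) (opp X) (legs X) gn (outp X).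
- move=> v w; rewrite !inE => /eqP vr /eqP wr /kvE; rewrite -rtE vr wr => /eqP//.
- move=> h h'; rewrite !in_setC => hq hq' E. have kk : kv (vtx X h) = kv (vtx X h').
  have := lex (kv (vtx X h)) (kv (vtx X h')) h h'. have := lex (kv (vtx X h')) (kv (vtx X h)) h' h.
  by rewrite E !ltnn; case: ltngtP. by apply: kl_inj => //; move: E; rewrite kk => /addnI.
- by rewrite inE rtK.
- by rewrite !in_setC; apply: contra => /qc; rewrite oK.
- rewrite mem_legs // in_setC => /eqP hl; apply/negP => /(subsetP qf). by rewrite inE hl eqxx.
case: BT => b_nv b_ev b_evim b_eh b_ehim b_vtx b_opp b_legs b_gn b_out.
have evI : injective ev := incr_inj b_ev.
have ehI : injective eh := incr_inj (k := fun h => (kv (vtx X h) * B + kl h)%N) b_eh.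
have rev s : rt (ev s) = ev s. by apply/eqP; have := b_evim (ev s); rewrite codom_f inE.
have /fin_all_exists[pf pfE] (v : 'I_(nv X)) : exists s, ev s = rt v.
 have : rt v \in codom ev by rewrite b_evim inE rtK. by move=> /codomP[s ->]; exists s.
pose f : gmap X S0 := GMap [ffun h => eh h] [ffun v => pf v].
have ph v : ev (phi f v) = rt v by rewrite /= ffunE.
have ps h : psi f h = eh h by rewrite /= ffunE.
have fnz : nz f = q. apply/setP => h; rewrite inE; apply/negb_inj; rewrite negbK -in_setC -b_ehim.
 by apply/codomP/codomP => [[k ->]|[k ->]]; exists k; rewrite ps.
have phs v s : (phi f v == s) = (rt v == ev s) by rewrite -(inj_eq evI) ph.
have f0 : gm0 f. split.
 - by move=> x y; rewrite !ps; apply: ehI.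
 - by move=> s; exists (ev s); apply: evI; rewrite ph rev.
 - by move=> h; rewrite !ps b_opp.
 - by rewrite -b_legs; apply: eq_map => h; apply: ps.
 - by move=> h; apply: evI; rewrite ph ps b_vtx.
 - move=> h; rewrite fnz => hq; apply: evI; rewrite !ph; apply/eqP; rewrite rtE. exact: connect1 (erel1 _ _ hq).
have fc : fconn f. by move=> v w E; rewrite fnz -rtE -!ph E.
have So : ordered S0. split.
 - rewrite b_nv; have := Xo => -[+ _ _ _ _]; case: (nv X) rt rtK => // n rt' rtK' _.
  by apply/card_gt0P; exists (rt' ord0); rewrite inE rtK'.
 - move=> h h' hh; rewrite leqNgt b_ev !b_vtx !kvrt; apply/negP => lt.
  by have := b_eh h' h; rewrite lex lt /= ltnNge hh.
 - by move=> h; apply: ehI; rewrite !b_opp oK.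
 - by rewrite -(map_inj_uniq ehI) b_legs; case: Xo.
 - by move=> h; rewrite -(mem_map ehI) b_legs mem_legs // -b_opp (inj_eq ehI).
have Sc : connected S0. move=> a b; have [v <-] := phi_surj f0 a; have [w <-] := phi_surj f0 b.
 apply: connect_map (objC X v w) _ => x y /existsP[h /andP[/eqP<- /eqP<-]].
 have [hq|/nzPn[k ->]] := boolP (h \in nz f). by rewrite (nz_eq f0 hq); apply: connect0.
 rewrite -(psi_opp f0) !(phi_vtx f0); apply: connect1. by apply/existsP; exists k; rewrite !eqxx.
have fa : arrP O f. split=> //; last by move=> _ h; rewrite b_out ps. move=> E s; have gg : isgg by rewrite /isgg E.
 rewrite /genus_ok b_gn /gn gg. have := fib_card Xo f0 fc s; rewrite /fib /nzv fnz.
 have -> : [set w | phi f w == s] = [set w | rt w == ev s]. by apply/setP => w; rewrite !inE phs.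
 have -> : [set h in q | phi f (vtx X h) == s] = [set h in q | rt (vtx X h) == ev s].
  by apply/setP => h; rewrite !in_set phs.
 have -> : (\sum_(w | phi f w == s) genus X w = \sum_(w | rt w == ev s) genus X w)%N.
  by apply: eq_bigl => w; rewrite phs. set n := #|[set w | rt w == ev s]|; set m := #|[set h in q | _]| => nm.
 have [k mk] : exists k, m = (k * 2)%N. eexists; apply: card_closed => //.
   move=> h; rewrite !in_set => /andP[hq /eqP <-]; rewrite qc //= rtE cs. exact: connect1 (erel1 _ _ hq).
  by apply/subsetP => h; rewrite inE => /andP[/(subsetP qf)]. have k2 : (k * 2)./2 = k by rewrite muln2 doubleK.
 by move: nm; rewrite mk k2; lia.
have kpf v w : (phi f v < phi f w)%N = (kv v < kv w)%N. by rewrite b_ev !ph !kvrt.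
have kph (h h' : 'I_(nh S0)) : vtx S0 h = vtx S0 h' -> (h < h')%N = (kl (psi f h) < kl (psi f h'))%N.
 move=> E; rewrite b_eh lex !ps -(kvrt (vtx X (eh h))) -b_vtx E b_vtx kvrt. by rewrite ltnn eqxx.
suff Sobj : is_obj O S0. have [g gE] := @ex_arr O X (Obj Sobj) f fa. by exists (Obj Sobj), g; rewrite gE.
split=> //; split=> //.
have no : no_outp X -> no_outp S0 by move=> H h; rewrite b_out.
have tr : tree X -> tree S0. by move=> [_ b0]; split=> //; apply: (tree_target Xo So f0 fc).
have ng : O <> ggGrc -> no_genus S0. move=> On h; rewrite b_gn /gn; have -> // : isgg = false.
 by rewrite /isgg; case: (O) On.
have pS h h' : vtx S0 h = vtx S0 h' -> ~~ prio O (eh h) -> prio O (eh h') -> (h < h')%N.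
 move=> E p1 p2; rewrite kph // !ps; apply: kl_prio => //.
 - by rewrite -in_setC -b_ehim codom_f.
 - by rewrite -in_setC -b_ehim codom_f.
 - by rewrite -(kvrt (vtx X (eh h))) -b_vtx E b_vtx kvrt.
have lS : map eh (legs S0) = legs X by [].
have Xok := obj_ok X.
case EO: O => //.
- exact: no (is_obj_gg Xok EO).
- have [_ Xno Xtr] := is_obj_Tr Xok EO. by split; [apply: ng; rewrite EO|apply: no|apply: tr].
- have Yok := is_obj_RTr Xok EO; have [_ [_ [_ Xno Xtr _]]] := Yok.
 split; [by apply: ng; rewrite EO|exact: no|exact: tr|].
 (* For [imin]: another half-edge at the contracted vertex either is not minimal in [X], and then
    comes later by [pS], or equals the given one by [outer_min_uniq]. *)
 have [r [l [lE rm em]]] := rtrP (Obj Yok); rewrite /= in lE rm em. have imin h : isMin (eh h) -> isMin h.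
  move=> hm; apply/isMinP => h' E; rewrite leq_eqVlt orbC. have [//|nm] := boolP (h < h')%N.
  have [hm'|hm'] := boolP (isMin (eh h')); last first. by rewrite pS // ?(prio_RTr _ EO) ?negbK ?hm in nm.
  suff -> : h' = h by rewrite eqxx. apply: ehI; apply: (@outer_min_uniq (Obj Yok) q) => //.
  - by rewrite -in_setC -b_ehim codom_f.
  - by rewrite -in_setC -b_ehim codom_f.
  - by apply/kvE; rewrite -(kvrt (vtx X (eh h))) -b_vtx -E b_vtx kvrt. apply/rootedP => //; move: lS; rewrite lE.
 case lF: (legs S0) => [//|r' l''] [rE _]; exists r', l''; split=> //. by apply: imin; rewrite rE.
 move=> h; rewrite -(inj_eq ehI) b_opp => /em; rewrite -b_opp. by case/orP=> /imin->; rewrite ?orbT.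
- have [_ [d1 d2 d3]] := is_obj_Whe Xok EO. split; first by apply: ng; rewrite EO. split.
 + move=> h; rewrite -(inj_eq ehI) b_opp => /d1; rewrite -b_opp -!b_out //.
 + move=> h h' E hh ho; apply/negPn/negP => ho'. have : (h' < h)%N by apply: pS; rewrite // (prio_Whe _ EO) -b_out.
  by rewrite ltnNge hh.
 + by move: d3; rewrite -lS sorted_map; apply: sub_sorted => a b /=; rewrite !b_out.
Qed.
End Contract.

(** * Elementary morphisms *)

(** Triviality of the fiber over [v], stated without constructing that fiber; see [tf_trivial]. *)
Definition tf (T S : graph) (f : gmap T S) (v : 'I_(nv S)) : Prop :=
 [/\ forall w w', phi f w = v -> phi f w' = v -> w = w', forall h, phi f (vtx T h) = v -> h \notin nz f &
   forall h h' : 'I_(nh S), vtx S h = v -> vtx S h' = v -> (h < h')%N -> (psi f h < psi f h')%N].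

Lemma sorted_enum_ord n : sorted (fun x y : 'I_n => (x < y)%N) (enum 'I_n).
Proof.
by rewrite -(@sorted_map _ _ (fun i : 'I_n => nat_of_ord i) ltn) val_enum_ord iota_ltn_sorted.
Qed.

Lemma filter_ord n (p : pred 'I_n) : sorted (fun x y : 'I_n => (x < y)%N) [seq x <- enum 'I_n | p x].
Proof.
apply: sorted_filter; last exact: sorted_enum_ord.
by move=> y x z; apply: ltn_trans.
Qed.

Lemma sorted_key_eq (A : eqType) (k : A -> nat) (s t : seq A) :
 sorted (fun x y => (k x < k y)%N) s -> sorted (fun x y => (k x < k y)%N) t -> s =i t -> s = t.
Proof.
move=> ss st; apply: (@irr_sorted_eq _ (fun x y => (k x < k y)%N)) => //.
- by move=> y x z; apply: ltn_trans.
- by move=> x /=; rewrite ltnn.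
Qed.

Lemma sorted_map_in (A B : eqType) (eA : rel A) (eB : rel B) (g : A -> B) (s : seq A) :
 sorted eA s -> {in s &, forall x y, eA x y -> eB (g x) (g y)} -> sorted eB (map g s).
Proof.
case: s => //= a s; elim: s a => //= b s IH a /andP[ab sb] H.
rewrite H ?inE ?eqxx ?orbT //=; apply: IH => // x y xs ys.
by apply: H; rewrite inE ?xs ?ys orbT.
Qed.

Section Tf.
Variable O : opcat.
Implicit Types T S P F G X : obj O.

Lemma tf_list T S (f : arr T S) v : tf f v -> [seq psi f h | h <- enum 'I_(nh S) & vtx S h == v] =
 [seq h <- enum 'I_(nh T) | phi f (vtx T h) == v].
Proof.
move=> [t1 t2 t3]; have f0 := arr0 f.
apply: (@sorted_key_eq _ (fun h : 'I_(nh T) => nat_of_ord h)).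
- apply: sorted_map_in (filter_ord _) _ => x y; rewrite !mem_filter.
 by move=> /andP[/eqP xv _] /andP[/eqP yv _]; apply: t3.
- exact: filter_ord.
- move=> h; rewrite mem_filter mem_enum andbT; apply/mapP/eqP => [[k + ->]|hv].
  by rewrite mem_filter (phi_vtx f0) => /andP[/eqP]. have /nzPn[k E] := t2 _ hv; exists k => //.
 by rewrite mem_filter mem_enum andbT -(phi_vtx f0) -E hv.
Qed.

Lemma tf_trivial T S (f : arr T S) v G : is_fiber f v G -> trivial G <-> tf f v.
Proof.
move=> [iv [ih I]]; have f0 := arr0 f; have To := objO T; split.
- move=> [[nv1 op1] lg]; split.
 + move=> w w' /(iv_ex I)[a ->] /(iv_ex I)[b ->].
  by congr iv; apply: ord_inj; have := ltn_ord a; have := ltn_ord b; lia.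
 + move=> h /(ih_ex I)[h' ->]; rewrite -(full_fiber To f0 I) inE op1 eqxx //.
 + move=> h h' hv hv' hh. have s1 : sorted (fun x y : 'I_(nh T) => (x < y)%N)
    [seq psi f h | h <- enum 'I_(nh S) & vtx S h == v].
   rewrite -(fi_legs I) lg; apply: sorted_map_in (sorted_enum_ord _) _ => x y _ _. exact: (fi_ih_incr I).
  rewrite sorted_map in s1. set L := [seq _ <- _ | _] in s1.
  have mL k : vtx S k = v -> k \in L by move=> kv; rewrite mem_filter mem_enum kv eqxx.
  have tr : transitive (relpre (psi f) (fun x y : 'I_(nh T) => (x < y)%N)). by move=> y x z /=; apply: ltn_trans.
  have tr' : transitive (fun x y : 'I_(nh S) => (x < y)%N). by move=> y x z /=; apply: ltn_trans.
  suff /(sorted_ltn_index tr s1 _ _ (mL _ hv) (mL _ hv')) : (index h L < index h' L)%N by [].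
  rewrite ltnNge; apply/negP; rewrite leq_eqVlt => /orP[/eqP E|lt].
   have E' : h' = h by rewrite -(nth_index h (mL _ hv')) E nth_index ?mL. by move: hh; rewrite E' ltnn.
  have := sorted_ltn_index tr' (filter_ord _) _ _ (mL _ hv') (mL _ hv) lt. by rewrite ltnNge (ltnW hh).
- move=> tfv; have [t1 t2 t3] := tfv; split; first split.
 + rewrite (nv_fiber I); apply/eqP/cards1P; have [w wv] := phi_surj f0 v.
  exists w; apply/setP => w'; rewrite !inE; apply/eqP/eqP => [w'v|->//]. exact: t1.
 + move=> h; apply: (ih_inj I); rewrite (ih_opp I) ifN //. by apply: t2; rewrite (phi_ih I).
 + apply: (inj_map (ih_inj I)); rewrite (fi_legs I) (tf_list tfv).
  apply: (@sorted_key_eq _ (fun h : 'I_(nh T) => nat_of_ord h)).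
  * exact: filter_ord.
  * apply: sorted_map_in (sorted_enum_ord _) _ => x y _ _; exact: (fi_ih_incr I).
  * move=> h; rewrite mem_filter mem_enum andbT -(fi_ih_im I).
   by apply/codomP/mapP => [[k ->]|[k _ ->]]; exists k; rewrite ?mem_enum.
Qed.

Lemma nedge_gt0 (T : graph) : ordered T -> (0 < nedge T)%N = (full T != set0).
Proof. by move=> To; rewrite -card_gt0 (card_full To) muln_gt0 andbT. Qed.

Lemma nedge_eq0 (T : graph) : ordered T -> nedge T = 0%N <-> full T = set0.
Proof.
move=> To; split=> E; first by apply/eqP/negPn; rewrite -nedge_gt0 // E.
by have := nedge_gt0 To; rewrite E eqxx; case: (nedge T).
Qed.

Lemma elemP T S (f : arr T S) i F : elementary f i F <->
 [/\ forall w w' : 'I_(nv T), (w <= w')%N -> (phi f w <= phi f w')%N,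
   is_fiber f i F, (0 < nedge F)%N & forall v, v != i -> tf f v].
Proof.
split=> -[e1 e2 e3 e4]; split=> // v. move=> vi; have [G Gf] := fiber_objE f v.
 by apply/(tf_trivial Gf); apply: (e4 _ _ vi Gf).
by move=> G vi Gf; apply/(tf_trivial Gf); apply: e4.
Qed.

Lemma elem_nz T S (f : arr T S) i F h : elementary f i F -> h \in nz f -> phi f (vtx T h) = i.
Proof.
case/elemP=> _ _ _ t hn; apply/eqP/negPn/negP => /t[_ /(_ h erefl)].
by rewrite hn.
Qed.

Lemma fiber_nz T S (f : arr T S) i F iv ih : @fiber_incl T S f i F iv ih ->
 (forall h, h \in nz f -> phi f (vtx T h) = i) -> ih @: full F = nz f.
Proof.
move=> I H; rewrite (full_fiber_im (objO T) (arr0 f) I); apply/setP => h.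
by rewrite inE andb_idr // => /H ->.
Qed.

Lemma elementaryI T S (f : arr T S) i : (forall w w' : 'I_(nv T), (w <= w')%N -> (phi f w <= phi f w')%N) ->
 nz f != set0 -> (forall v, v != i -> tf f v) -> exists F : obj O, elementary f i F.
Proof.
move=> fm fn ft; have [F FF] := fiber_objE f i; exists F; apply/elemP; split=> //.
have [iv [ih I]] := FF; rewrite (nedge_gt0 (objO F)).
have H h : h \in nz f -> phi f (vtx T h) = i. by move=> hn; apply/eqP/negPn/negP => /ft[_ /(_ h erefl)]; rewrite hn.
by apply: contraNneq fn => E; rewrite -(fiber_nz I H) E imset0.
Qed.
End Tf.

(** * Contraction over a given morphism *)

Definition qconn (T : graph) (q : {set 'I_(nh T)}) : Prop :=
 forall h h', h \in q -> h' \in q -> connect (eadj T q) (vtx T h) (vtx T h').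

Lemma connect_q (T : graph) (q : {set 'I_(nh T)}) v w : opclosed (opp T) q -> qconn q ->
 connect (eadj T q) v w <-> v = w \/ (v \in vtx T @: q /\ w \in vtx T @: q).
Proof.
move=> qo qc; split=> [c|[->|[/imsetP[h hq ->] /imsetP[h' hq' ->]]]]; last 1 first.
- exact: qc.
- apply: (connect_ind (P := fun w => v = w \/ (v \in vtx T @: q /\ w \in vtx T @: q)) c). by left.
 move=> a b [->|[vq aq]] /erelP[h hq [ha hb]]; right; split=> //.
 + by rewrite -ha imset_f.
 + by rewrite -hb imset_f ?qo.
 + by rewrite -hb imset_f ?qo.
- exact: connect0.
Qed.

Lemma lex_lt B a b x y : (x < B -> a < b -> a * B + x < b * B + y)%N.
Proof.
move=> xB ab; have h : (a.+1 * B <= b * B)%N by rewrite leq_mul2r ab orbT.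
by rewrite mulSn in h; lia.
Qed.

Section ContrOver.
Variables (O : opcat) (X P : obj O) (f0 : arr X P) (i0 : 'I_(nv P)).
Variable q : {set 'I_(nh X)}.
Hypotheses (qn : q \subset nz f0) (qo : opclosed (opp X) q) (qc : qconn q).
Hypothesis qi : forall h, h \notin q -> phi f0 (vtx X h) <> i0 -> h \notin nz f0.

(* Half-edges away from the fiber of [i0] are ordered as in [P]; over [i0] those
   of the contracted vertex are sorted by [prio], the others as in [X]. *)
Lemma contr_over : exists (S : obj O) (f : arr X S) (g : arr S P), [/\ [/\ gcomp g f = f0, nz f = q &
    forall w w' : 'I_(nv S), (w <= w')%N -> (phi g w <= phi g w')%N],
   forall v w : 'I_(nv X), v \notin vtx X @: q -> w \notin vtx X @: q ->
    phi f0 v = phi f0 w -> (v < w)%N -> (phi f v < phi f w)%N,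
   forall l l' : 'I_(nh P), vtx S (psi g l) = vtx S (psi g l') -> vtx P l <> i0 ->
    (l < l')%N -> (psi g l < psi g l')%N & forall k k' : 'I_(nh S), vtx S k = vtx S k' -> phi g (vtx S k) = i0 ->
    vtx X (psi f k) \notin vtx X @: q -> (k < k')%N = (psi f k < psi f k')%N].
Proof.
have F0 := arr0 f0; pose B := (nv X).+1.
(* All vertices of the tube receive the same key [nv X], larger than that of any other vertex; [kv]
   is then lexicographic in the image under [f0] and this key. *)
pose c (v : 'I_(nv X)) := if v \in vtx X @: q then nv X else v : nat.
have cB v : (c v < B)%N by rewrite /c /B; case: ifP => // _; rewrite ltnS ltnW.
pose kv v := (phi f0 v * B + c v)%N.
(* [pk] inverts [psi f0]. It is consulted only away from [i0], where by [qi] the half-edges outside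
   [q] lie in the image, so the default 0 does not occur there. *)
pose pk h := if [pick k | psi f0 k == h] is Some k then nat_of_ord k else 0%N.
have pkE k : pk (psi f0 k) = k. rewrite /pk; case: pickP => [k' /eqP/(psi_inj F0)->//|/(_ k)]. by rewrite eqxx.
pose kl h := if phi f0 (vtx X h) != i0 then pk h else if vtx X h \in vtx X @: q then (prio O h * nh X + h)%N else h.
have kvc v w : kv v = kv w <-> phi f0 v = phi f0 w /\ c v = c w. rewrite /kv; split=> [E|[-> ->]//].
 have E' : nat_of_ord (phi f0 v) = phi f0 w. by case: (ltngtP (phi f0 v) (phi f0 w)) => // lt;
   [have := lex_lt (c w) (cB v) lt | have := lex_lt (c v) (cB w) lt]; rewrite E ltnn.
 by split; [exact: ord_inj | move: E; rewrite E' => /addnI].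
have cE v w : c v = c w <-> v = w \/ (v \in vtx X @: q /\ w \in vtx X @: q).
 rewrite /c; case: ifP => vq; case: ifP => wq; split=> //; try by [right|left].
 - by move=> E; have := ltn_ord w; rewrite -E ltnn.
 - by case=> [E|[]//]; rewrite E wq in vq.
 - by move=> E; have := ltn_ord v; rewrite E ltnn.
 - by case=> [E|[]//]; rewrite E wq in vq.
 - by move/ord_inj; left.
 - by case=> [->|[]].
have kvE v w : kv v = kv w <-> connect (eadj X q) v w.
 split=> [/kvc[_ /cE]|cvw]; first by move/(connect_q _ _ qo qc).
 apply/kvc; split; last exact/cE/(connect_q _ _ qo qc).
 apply: (connect_ind (P := fun w => phi f0 v = phi f0 w) cvw) => // a b ->.
 by case/erelP=> h /(subsetP qn) hn [<- <-]; apply: nz_eq hn.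
have kv_phi v w : kv v = kv w -> phi f0 v = phi f0 w by move/kvc=> [].
have out h : h \notin q -> phi f0 (vtx X h) != i0 -> exists k, h = psi f0 k. by move=> hq /eqP hi; apply/nzPn/qi.
have [|||S [f [fnz kvO klO]]] := @contract O X q kv kl _ qo kvE.
- exact: subset_trans qn (nz_full (objO X) F0).
- move=> h h' hq hq' E; rewrite /kl -(kv_phi _ _ E); case: ifP => hi.
  have [k hk] := out h hq hi; have [k' hk'] : exists k, h' = psi f0 k. by apply: out; rewrite // -(kv_phi _ _ E).
  by rewrite hk hk' !pkE => /ord_inj->. have /kvc[_ /cE[->|[-> ->]]] := E; first case: ifP => _; last 1 first.
 + by have := ltn_ord h; have := ltn_ord h'; case: prio; case: prio => /= *; apply: ord_inj; lia.
 + by have := ltn_ord h; have := ltn_ord h'; case: prio; case: prio => /= *; apply: ord_inj; lia.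
 + exact: ord_inj.
- move=> h h' hq hq' E p1 p2; rewrite /kl -(kv_phi _ _ E); case: ifP => hi.
  have [k hk] := out h hq hi; have [k' hk'] : exists k, h' = psi f0 k. by apply: out; rewrite // -(kv_phi _ _ E).
  have := kv_phi _ _ E; rewrite hk hk' !(phi_vtx F0) !pkE => kk.
  by apply: prio_local => //; rewrite -(prio_arr f0) -?hk -?hk'. have /kvc[_ /cE[E'|[-> ->]]] := E; last first.
  rewrite (negbTE p1) p2 /=; have := ltn_ord h; lia. rewrite -E' (negbTE p1) p2 /=; have lt := prio_local E' p1 p2.
 by case: ifP => _ //; have := ltn_ord h; lia.
have [|g gE] := @factor_arr O X S P f f0; first by rewrite fnz.
have gv v : phi g (phi f v) = phi f0 v by rewrite -gE /= [RHS]ffunE.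
have gh h : psi f (psi g h) = psi f0 h by rewrite -gE /= [RHS]ffunE.
have f00 := arr0 f.
exists S, f, g; split; first split=> //.
- move=> a b ab; have [v vE] := phi_surj f00 a; have [w wE] := phi_surj f00 b; subst a b.
 rewrite !gv leqNgt; apply/negP => lt. have : (phi f w < phi f v)%N. by rewrite kvO /kv; apply: lex_lt.
 by rewrite ltnNge ab.
- move=> v w vq wq E vw; rewrite kvO /kv E /c (negbTE vq) (negbTE wq). by rewrite ltn_add2l.
- move=> l l' E li ll; rewrite klO // !gh /kl !pkE !(phi_vtx F0).
 have <- : vtx P l = vtx P l' by rewrite -!(phi_vtx (arr0 g)) E. by move/eqP: li => ->.
- move=> k k' E ki kq; rewrite klO // /kl -!gv !(phi_vtx f00) -E ki eqxx /=.
 have : kv (vtx X (psi f k)) = kv (vtx X (psi f k')). apply/kvE; rewrite -fnz; apply: (arr_conn (arrO f)).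
  by rewrite !(phi_vtx f00). by case/kvc=> _ /cE[<-|[]]; rewrite (negbTE kq).
Qed.
End ContrOver.

(** * Changing the global order *)

(** By [lt_relegs] the fiber of a map to a local terminal object differs from the source in its
    global order alone, so the identifications M(T) = M(F) always compare graphs of this form. *)
Definition relegs (T : graph) (lg : seq 'I_(nh T)) : graph := Graph (vtx T) (opp T) lg (genus T) (outp T).

Lemma opcatP (O : opcat) : [\/ O = ggGrc, O = Tr, O = RTr | O = Whe].
Proof. by case: O; [apply: Or41|apply: Or42|apply: Or43|apply: Or44]. Qed.

Lemma sorted_index (A : eqType) (s : seq A) : uniq s -> sorted (fun x y => (index x s < index y s)%N) s.
Proof.
case: s => // x0 s us; set l := x0 :: s.
have {3}-> : l = mkseq (nth x0 l) (size l) by rewrite mkseq_nth.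
rewrite /mkseq.
apply: sorted_map_in (iota_ltn_sorted 0 _) _ => x y.
by rewrite !mem_iota !add0n => /andP[_ xs] /andP[_ ys] xy; rewrite !index_uniq.
Qed.

Section Terminal.
Variables (O : opcat) (X : obj O) (lg : seq 'I_(nh X)).
Hypothesis Xlg : is_obj O (relegs lg).

Let Xo := objO X.
Let X'o := objO (Obj Xlg).

Let lgE h : (h \in lg) = (h \in legs X).
Proof. by rewrite mem_legs // -(mem_legs X'o). Qed.

Let lgu : uniq lg. Proof. by case: X'o. Qed.

Lemma index_sorted h h' : h \in lg -> h' \in lg -> ~~ prio O h -> prio O h' -> (index h lg < index h' lg)%N.
Proof.
move=> hl hl' p1 p2.
have hh : h' != h by apply: contraTneq p2 => ->.
have [EO|EO|EO|EO] := opcatP O.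
- by have /(_ h') /= no := is_obj_gg Xlg EO; move: p2; rewrite (prio_gg _ EO) no.
- by have [_ /(_ h') /= no _] := is_obj_Tr Xlg EO; move: p2; rewrite (prio_Tr _ EO) no.
- have := is_obj_RTr Xlg EO => Y; have [r [l [/= lE rm em]]] := rtrP (Obj Y).
 move: p1 p2; rewrite !(prio_RTr _ EO) negbK => p1 p2. have lf k : k \in lg -> k \notin full X.
  by rewrite lgE mem_legs // inE negbK. suff E : h = r by rewrite lE /= E eqxx eq_sym -E (negbTE hh).
 apply: (@outer_min_uniq (Obj Y) (full X)) => //.
 - exact: full_closed Xo.
 - exact: lf.
 - by apply: lf; rewrite lE mem_head.
 - exact: (iffLR (conn_full X) (objC X)).
- have [_ [_ _ sl]] := is_obj_Whe Xlg EO; move: p1 p2; rewrite !(prio_Whe _ EO) => p1 p2.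
 rewrite ltnNge leq_eqVlt; apply/negP => /orP[/eqP E|lt].
  by move: hh; rewrite -(nth_index h hl') E nth_index // eqxx.
 have tr : transitive (fun h h' : 'I_(nh X) => outp X h ==> outp X h'). by move=> y x z; do 3!case: (outp X _).
 have := sorted_ltn_index tr sl _ _ hl' hl lt. by rewrite p2 (negbTE p1).
Qed.

(** Contract all edges and sort the remaining half-edges by their place in [lg]. The fiber takes its
    global order from the local order of the target, so it is [X] with legs listed as in [lg]. *)
Lemma terminal_arr : exists (u : obj O) (t : arr X u),
 [/\ loc_terminal u, nz t = full X, forall v, is_fiber t v (relegs lg) & lg = legs X -> trivial u].
Proof.
have cf := iffLR (conn_full X) (objC X).
have [|||||u [t [tn tv tl]]] := @contract O X (full X) (fun _ => 0%N) (fun h => index h lg).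
- by [].
- exact: full_closed.
- by move=> v w; split.
- move=> h h'; rewrite !inE !negbK -!mem_legs // -!lgE => hl hl' _ E. by rewrite -(nth_index h hl) E nth_index.
- move=> h h'; rewrite !inE !negbK -!mem_legs // -!lgE => hl hl' _. exact: index_sorted.
have t0 := arr0 t.
have one v w : phi t v = phi t w. by apply: ord_inj; case: (ltngtP (phi t v) (phi t w)) => //; rewrite tv.
have u1 : forall v w : 'I_(nv u), v = w.
 move=> v w; have [a <-] := phi_surj t0 v; have [b <-] := phi_surj t0 w; exact: one.
have lt : loc_terminal u. split. case: (objO u) => + _ _ _ _; case: (nv u) u1 => [//|[//|n]] u1 _.
  by have := u1 ord0 ord_max => /(congr1 (fun i => nat_of_ord i)).
 move=> h; apply: (psi_inj t0); rewrite (psi_opp t0); apply/eqP. by have := psi_nz t h; rewrite tn inE negbK.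
have fE v : [seq psi t h | h <- enum 'I_(nh u) & vtx u h == v] = lg.
 have -> : [seq h <- enum 'I_(nh u) | vtx u h == v] = enum 'I_(nh u).
  by apply/all_filterP/allP => h _; apply/eqP/u1. apply: (@sorted_key_eq _ (fun h => index h lg)).
 - apply: sorted_map_in (sorted_enum_ord _) _ => x y _ _; rewrite tl //; exact: u1.
 - exact: sorted_index.
 - move=> h; rewrite lgE mem_legs //; apply/mapP/idP => [[k _ ->]|hl]. by have := psi_nz t k; rewrite tn inE negbK.
  have /nzPn[k ->] : h \notin nz t by rewrite tn inE negbK. by exists k; rewrite ?mem_enum.
exists u, t; split=> //.
- move=> v; exists id, id; split=> //=.
 + by move=> w; rewrite (u1 (phi t w) v) eqxx; apply/codomP; exists w.
 + by move=> h; rewrite (u1 (phi t _) v) eqxx; apply/codomP; exists h.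
 + move=> h; case: ifP => // hc. have : h \notin nz t by rewrite inE negbK. by rewrite tn inE negbK => /eqP.
 + by rewrite map_id fE.
- move=> E; split=> //; apply: (inj_map (psi_inj t0)); rewrite (psi_legs t0) -E.
 have v : 'I_(nv u) by case: (objO u) => + _ _ _ _; case: (nv u) => // n _; exact: ord0. rewrite -(fE v).
 have -> // : [seq h <- enum 'I_(nh u) | vtx u h == v] = enum 'I_(nh u).
 by apply/all_filterP/allP => h _; apply/eqP/u1.
Qed.
End Terminal.

Lemma terminal_ex (O : opcat) (X : obj O) : exists (u : obj O) (t : arr X u),
 [/\ trivial u, nz t = full X & forall v, is_fiber t v X].
Proof.
have E : relegs (legs X) = X by case: X => -[].
have ok : is_obj O (relegs (legs X)) by rewrite E; apply: obj_ok.
have [u [t [_ tn tfib tt]]] := terminal_arr ok; exists u, t; split=> //; first exact: tt.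
by move=> v; have := tfib v; rewrite E.
Qed.

Lemma relegs_lt_fiber (O : opcat) (X F : obj O) lg : ograph F = @relegs X lg -> lt_fiber X F.
Proof.
move=> E; have ok : is_obj O (relegs lg) by rewrite -E; apply: obj_ok.
have [u [t [ut _ tfib _]]] := terminal_arr ok.
have v : 'I_(nv u) by case: (objO u) => + _ _ _ _; case: (nv u) => // n _; exact: ord0.
by exists u, t, v; split=> //; rewrite E.
Qed.

(* Fibers with the same half-edges differ by their global orders only. *)
Lemma fiber_relegs (T S S' F F' : graph) (f : gmap T S) (f' : gmap T S') v v' iv ih iv' ih' :
 @fiber_incl T S f v F iv ih -> @fiber_incl T S' f' v' F' iv' ih' ->
 (forall w, (phi f w == v) = (phi f' w == v')) -> (forall h, phi f (vtx T h) = v -> (h \in nz f) = (h \in nz f')) ->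
 exists lg, F' = @relegs F lg.
Proof.
move=> I I' vv hh.
have [E1 iE] : exists E, forall w, iv w = iv' (cast_ord E w).
 apply: incr_unique; [exact: fi_iv_incr I|exact: fi_iv_incr I'|]. by move=> w; rewrite (fi_iv_im I) (fi_iv_im I').
have [E2 hE] : exists E, forall h, ih h = ih' (cast_ord E h).
 apply: incr_unique; [exact: fi_ih_incr I|exact: fi_ih_incr I'|]. by move=> w; rewrite (fi_ih_im I) (fi_ih_im I').
case: F iv ih I E1 iE E2 hE => n m vt op lg gn ou; case: F' iv' ih' I' => n' m' vt' op' lg' gn' ou'.
move=> iv' ih' I' iv ih I /= E1; subst n'; move=> iE E2; subst m' => hE.
have iE' w : iv w = iv' w by rewrite iE cast_ord_id.
have hE' w : ih w = ih' w by rewrite hE cast_ord_id.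
exists lg'; rewrite /relegs /=.
have -> : vt' = vt. apply/ffunP => h; apply: (iv_inj I').
 by have /= -> := fi_vtx I' h; rewrite -iE' -hE'; have /= -> := fi_vtx I h.
have -> : op' = op. apply/ffunP => h; apply: (ih_inj I').
 have /= -> := ih_opp I' h; rewrite -hE'; have /= := ih_opp I h; rewrite hE' => ->.
 by rewrite -hh // hE' -hE' (phi_ih I).
have -> : gn' = gn. by apply/ffunP => h; have /= -> := fi_genus I' h; rewrite -iE'; have /= -> := fi_genus I h.
have -> // : ou' = ou.
by apply/ffunP => h; have /= -> := fi_outp I' h; rewrite -hE'; have /= -> := fi_outp I h.
Qed.

(** Every arrow to a local terminal object contracts all edges, so [fiber_relegs] compares its fiber
    with the one in [terminal_ex], which is [T] itself. *)
Lemma lt_relegs (O : opcat) (T F : obj O) : lt_fiber T F -> exists lg, ograph F = @relegs T lg.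
Proof.
move=> [u [f [i [[u1 uo] [iv [ih I]]]]]].
have [u' [t [[[u'1 _] _] tn tfib]]] := terminal_ex T.
have [iv' [ih' I']] := tfib (cast_ord (esym u'1) ord0).
have one (x y : 'I_(nv u)) : x = y by apply: ord_inj; have := ltn_ord x; have := ltn_ord y; lia.
have one' (x y : 'I_(nv u')) : x = y by apply: ord_inj; have := ltn_ord x; have := ltn_ord y; lia.
have [||lg E] := fiber_relegs I' I.
- by move=> w; rewrite (one (phi f w) i) eqxx; apply/eqP/one'.
- move=> h _; rewrite tn; apply/idP/idP => [hf|]; last exact: (subsetP (nz_full (objO T) (arr0 f))).
 apply/negPn/negP => /nzPn[k hk]; move: hf; rewrite inE hk -(psi_opp (arr0 f)) uo eqxx //.
by exists lg.
Qed.

(** * Chains of contractions *)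

Section Chains.
Variable O : opcat.
Implicit Types T S P F G H X R : obj O.

Lemma phi_comp (T S P : graph) (f : gmap T S) (g : gmap S P) (h : gmap T P) v :
 h = gcomp g f -> phi h v = phi g (phi f v).
Proof. by move->; rewrite /= ffunE. Qed.

Lemma psi_comp (T S P : graph) (f : gmap T S) (g : gmap S P) (h : gmap T P) v :
 h = gcomp g f -> psi h v = psi f (psi g v).
Proof. by move->; rewrite /= ffunE. Qed.

Lemma arr_outpE T R (u : arr T R) m : outp T (psi u m) = outp R m.
Proof.
have [E|E|E|E] := opcatP O.
- by rewrite (is_obj_gg (obj_ok T) E) (is_obj_gg (obj_ok R) E).
- have [_ t _] := is_obj_Tr (obj_ok T) E; have [_ r _] := is_obj_Tr (obj_ok R) E. by rewrite t r.
- have [_ [_ [_ t _ _]]] := is_obj_RTr (obj_ok T) E.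
 by have [_ [_ [_ r _ _]]] := is_obj_RTr (obj_ok R) E; rewrite t r.
- exact: (arr_outp (arrO u)).
Qed.

Lemma tf_genus T R (u : arr T R) w : tf u (phi u w) -> genus R (phi u w) = genus T w.
Proof.
move=> [t1 t2 _]; have [E|E|E|E] := opcatP O.
- have := arr_genus (arrO u) E (phi u w); rewrite /genus_ok. have -> : [set x | phi u x == phi u w] = [set w].
  by apply/setP => x; rewrite !inE; apply/eqP/eqP => [e|->//]; apply: t1.
 have -> : [set h in nz u | phi u (vtx T h) == phi u w] = set0.
  apply/setP => h; rewrite [LHS]inE in_set0; apply/negbTE. by rewrite negb_and orbC; case: eqP => //= /t2.
 rewrite cards1 cards0 (eq_bigl (pred1 w)) ?big_pred1_eq; last first.
  by move=> x; apply/eqP/eqP => [e|->//]; apply: t1. lia.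
- have [t _ _] := is_obj_Tr (obj_ok T) E; have [r _ _] := is_obj_Tr (obj_ok R) E. by rewrite t r.
- have [_ [_ [t _ _ _]]] := is_obj_RTr (obj_ok T) E.
 by have [_ [_ [r _ _ _]]] := is_obj_RTr (obj_ok R) E; rewrite t r.
- have [t _] := is_obj_Whe (obj_ok T) E; have [r _] := is_obj_Whe (obj_ok R) E. by rewrite t r.
Qed.

Section FiberTransfer.
Variables (T R S1 S2 : obj O) (u : arr T R) (f : arr T S1) (g : arr R S2).
Variables (v1 : 'I_(nv S1)) (v2 : 'I_(nv S2)).
Hypothesis h1 : forall w, phi f w = v1 <-> phi g (phi u w) = v2.
Hypothesis h2 : forall s, phi g s = v2 -> tf u s.
Hypothesis h3 : forall w w' : 'I_(nv T), phi f w = v1 -> phi f w' = v1 -> (w < w')%N -> (phi u w < phi u w')%N.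
Hypothesis h4 : forall m, phi g (vtx R m) = v2 -> (psi u m \in nz f) = (m \in nz g).
Hypothesis h5 : [seq psi f k | k <- enum 'I_(nh S1) & vtx S1 k == v1] =
 [seq psi u (psi g k) | k <- enum 'I_(nh S2) & vtx S2 k == v2].

Let u0 := arr0 u.

Let vlt (w w' : 'I_(nv T)) : phi f w = v1 -> phi f w' = v1 -> (w < w')%N = (phi u w < phi u w')%N.
Proof.
move=> wv wv'; case: (ltngtP w w') => [lt|lt|/ord_inj->]; last by rewrite ltnn. by rewrite h3.
by apply/esym/negbTE; rewrite -leqNgt ltnW // h3.
Qed.

Let over m : phi g (vtx R m) = v2 -> phi f (vtx T (psi u m)) = v1.
Proof. by move=> mv; apply/h1; rewrite (phi_vtx u0). Qed.

Let hlt1 (m m' : 'I_(nh R)) : phi g (vtx R m) = v2 -> phi g (vtx R m') = v2 -> (m < m')%N -> (psi u m < psi u m')%N.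
Proof.
move=> mv mv' mm; have := vtx_mono (objO R) (ltnW mm); rewrite leq_eqVlt.
case/orP=> [/eqP/ord_inj E|lt]. by have [_ _ t] := h2 mv; apply: t.
rewrite -!(phi_vtx u0) -vlt ?over // in lt.
rewrite ltnNge; apply/negP => /(vtx_mono (objO T)); by rewrite leqNgt lt.
Qed.

Let hlt (m m' : 'I_(nh R)) : phi g (vtx R m) = v2 -> phi g (vtx R m') = v2 -> (m < m')%N = (psi u m < psi u m')%N.
Proof.
move=> mv mv'; case: (ltngtP m m') => [lt|lt|/ord_inj->]; last by rewrite ltnn. by rewrite hlt1.
by apply/esym/negbTE; rewrite -leqNgt ltnW // hlt1.
Qed.

(** The axioms require literally the same fiber along different routes. Here [u] is a bijection
    between the two preimages that respects orders, contracted half-edges and labels, so inclusions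
    of a fiber are carried across it both ways. *)
Lemma fiber_transfer F : is_fiber f v1 F <-> is_fiber g v2 F.
Proof.
split=> [[iv [ih I]]|[jv [jh J]]].
- pose jv w := phi u (iv w). have jv2 w : phi g (jv w) = v2 by apply/h1; apply: phi_iv I w.
 have /fin_all_exists[jh jhE] (h : 'I_(nh F)) : exists m, psi u m = ih h.
  have hv : phi g (phi u (vtx T (ih h))) = v2 by apply/h1; apply: phi_ih I h.
  have [_ t _] := h2 hv; have /nzPn[m ->] := t _ erefl; by exists m. have jvt h : jv (vtx F h) = vtx R (jh h).
  by rewrite /jv (fi_vtx I) -jhE (phi_vtx u0). have jh2 h : phi g (vtx R (jh h)) = v2 by rewrite -jvt.
 exists jv, jh; split=> //.
 + by move=> w w' /(fi_iv_incr I); rewrite vlt // (phi_iv I).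
 + move=> s; apply/codomP/eqP => [[w ->]//|sv].
  have [w ws] := phi_surj u0 s; have /h1/(iv_ex I)[a aE] : phi g (phi u w) = v2 by rewrite ws.
  by exists a; rewrite /jv -aE ws.
 + by move=> h h' /(fi_ih_incr I); rewrite -!jhE -hlt.
 + move=> m; apply/codomP/eqP => [[h ->]//|mv]. have [h hE] := ih_ex I (over mv).
  by exists h; apply: (psi_inj u0); rewrite jhE.
 + move=> h; apply: (psi_inj u0); rewrite jhE (ih_opp I) -jhE h4 // inE.
  by case: (_ \in codom _); rewrite //= (psi_opp u0).
 + apply: (inj_map (psi_inj u0)); rewrite -!map_comp -[RHS]h5 -(fi_legs I). by apply: eq_map => h /=; rewrite jhE.
 + by move=> w; rewrite (fi_genus I) /jv tf_genus //; apply: h2 (jv2 w).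
 + by move=> h; rewrite (fi_outp I) -jhE arr_outpE.
- have /fin_all_exists[iv ivE] (w : 'I_(nv F)) : exists x, phi u x = jv w. exact: phi_surj u0 _.
 have iv1 w : phi f (iv w) = v1 by apply/h1; rewrite ivE (phi_iv J).
 have one x y : phi f x = v1 -> phi u x = phi u y -> x = y. by move=> /h1/h2[t _ _] E; apply: t.
 exists iv, (fun h => psi u (jh h)); split=> //.
 + by move=> w w' /(fi_iv_incr J); rewrite vlt ?iv1 // !ivE.
 + move=> x; apply/codomP/eqP => [[w ->]//|xv]. have /(iv_ex J)[a aE] : phi g (phi u x) = v2 by apply/h1.
  by exists a; apply: one; rewrite ?ivE.
 + by move=> h h' /(fi_ih_incr J); rewrite hlt ?(phi_ih J).
 + move=> h; apply/codomP/eqP => [[k ->]|hv]; first by rewrite over // (phi_ih J).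
  have hv' := iffLR (h1 _) hv; have [_ t _] := h2 hv'; have /nzPn[m mE] := t _ erefl.
  have [k kE] : exists k, m = jh k. by apply: (ih_ex J); rewrite -(phi_vtx u0) -mE. by exists k; rewrite -kE.
 + move=> h; apply: one; rewrite ?iv1 // ivE (fi_vtx J) (phi_vtx u0) //.
 + move=> h; rewrite (ih_opp J) -(h4 (phi_ih J h)) inE. by case: (_ \in codom _); rewrite //= (psi_opp u0).
 + by rewrite h5 map_comp (fi_legs J) -map_comp.
 + by move=> w; rewrite (fi_genus J) -ivE tf_genus //; apply: h2; rewrite ivE (phi_iv J).
 + by move=> h; rewrite (fi_outp J) arr_outpE.
Qed.
End FiberTransfer.

(** * Elementary morphisms between fibers *)

Section ElementaryInduced.
Variables (T S P : obj O) (f : arr T S) (g : arr S P) (gf : arr T P).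
Hypothesis gfE : amap gf = gcomp g f.
Variables (i : 'I_(nv P)) (H G : obj O).
Variables (iv : 'I_(nv H) -> 'I_(nv T)) (ih : 'I_(nh H) -> 'I_(nh T)).
Variables (jv : 'I_(nv G) -> 'I_(nv S)) (jh : 'I_(nh G) -> 'I_(nh S)).
Hypotheses (I : fiber_incl gf i iv ih) (J : fiber_incl g i jv jh).
Variable fi : arr H G.
Hypothesis fiv : forall w, jv (phi fi w) = phi f (iv w).
Hypothesis fih : forall h, ih (psi fi h) = psi f (jh h).

Let phigf v : phi gf v = phi g (phi f v). Proof. exact: phi_comp. Qed.

Lemma fiber_induced s F a b : @fiber_incl T S f (jv s) F a b ->
 exists c d, [/\ @fiber_incl H G fi s F c d, forall w, a w = iv (c w) & forall h, b h = ih (d h)].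
Proof.
move=> A.
have /fin_all_exists[c cE] (w : 'I_(nv F)) : exists x, a w = iv x.
 by apply: (iv_ex I); rewrite phigf (phi_iv A) (phi_iv J).
have /fin_all_exists[d dE] (h : 'I_(nh F)) : exists x, b h = ih x.
 by apply: (ih_ex I); rewrite phigf (phi_ih A) (phi_iv J).
have ivlt := incr_iff (fi_iv_incr I); have ihlt := incr_iff (fi_ih_incr I).
exists c, d; split=> //; split.
- by move=> w w' /(fi_iv_incr A); rewrite !cE -ivlt.
- move=> w; rewrite -(inj_eq (iv_inj J)) fiv -(fi_iv_im A).
 apply/codomP/codomP => [[x ->]|[x xE]]; first by exists x. by exists x; apply: (iv_inj I); rewrite xE.
- by move=> w w' /(fi_ih_incr A); rewrite !dE -ihlt.
- move=> h; rewrite -(inj_eq (iv_inj J)) fiv (fi_vtx I) -(fi_ih_im A).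
 apply/codomP/codomP => [[x ->]|[x xE]]; first by exists x. by exists x; apply: (ih_inj I); rewrite xE.
- by move=> h; apply: (iv_inj I); rewrite -cE (fi_vtx A) (fi_vtx I) dE.
- move=> h; apply: (ih_inj I); rewrite -dE (ih_opp A) dE -(nz_induced gfE I J fih).
 have -> : (d h \in codom (psi fi)) = (d h \notin nz fi) by rewrite inE negbK.
 case: (boolP (d h \in nz fi)) => hn //=.
 by rewrite (ih_opp I) gfE (in_nz_comp _ (arr0 f)) -(nz_induced gfE I J fih) hn.
- apply: (inj_map (ih_inj I)); rewrite -!map_comp.
 transitivity [seq b h | h <- legs F]; first by apply: eq_map => h; rewrite /= dE. rewrite (fi_legs A).
 transitivity [seq psi f m | m <- [seq jh k | k <- enum 'I_(nh G) & vtx G k == s]].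
  congr map; apply: (@sorted_key_eq _ (fun h : 'I_(nh S) => nat_of_ord h)).
  + exact: filter_ord.
  + by apply: sorted_map_in (filter_ord _) _ => x y _ _; apply: (fi_ih_incr J).
  + move=> m; rewrite mem_filter mem_enum andbT; apply/eqP/mapP => [ms|[k + ->]].
    have [k kE] : exists k, m = jh k by apply: (ih_ex J); rewrite ms (phi_iv J).
    exists k => //; rewrite mem_filter mem_enum andbT -(inj_eq (iv_inj J)). by rewrite (fi_vtx J) -kE ms.
   by rewrite mem_filter => /andP[/eqP<- _]; rewrite (fi_vtx J).
 by rewrite -map_comp; apply: eq_map => k /=; rewrite fih.
- by move=> w; rewrite (fi_genus A) (fi_genus I) cE.
- by move=> h; rewrite (fi_outp A) (fi_outp I) dE.
Qed.

Lemma tf_induced s : tf f (jv s) -> tf fi s.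
Proof.
have ihlt := incr_iff (fi_ih_incr I).
move=> [t1 t2 t3]; split.
- move=> w w' ws ws'; apply: (iv_inj I); apply: t1; by rewrite -fiv ?ws ?ws'.
- move=> h hs; rewrite (nz_induced gfE I J fih); apply: t2. by rewrite -(fi_vtx I) -fiv hs.
- move=> h h' hs hs' hh; rewrite ihlt !fih; apply: t3; rewrite -?(fi_vtx J) ?hs ?hs' //. exact: fi_ih_incr J _ _ hh.
Qed.

Lemma elementary_induced j F : elementary f j F -> phi g j = i -> exists j', jv j' = j /\ elementary fi j' F.
Proof.
move=> /elemP[e1 [a [b A]] e3 e4] ji.
have [j' jE] := iv_ex J ji; exists j'; split=> //; apply/elemP; split=> //.
- have jvlt := incr_iff (fi_iv_incr J). move=> w w' ww; rewrite leqNgt jvlt !fiv -leqNgt; apply: e1.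
 rewrite leqNgt; apply/negP; rewrite -(incr_iff (fi_iv_incr I)). by rewrite ltnNge ww.
- by rewrite jE in A; have [c [d [C _ _]]] := fiber_induced A; exists c, d.
- move=> v vj; apply: tf_induced; apply: e4. by rewrite jE (inj_eq (iv_inj J)).
Qed.
End ElementaryInduced.

(** * Tubes *)

Definition tube (T : graph) (q : {set 'I_(nh T)}) : bool :=
 [&& q != set0, q \subset full T, [forall h in q, opp T h \in q] &
  [forall h in q, forall h' in q, connect (eadj T q) (vtx T h) (vtx T h')]].

Lemma tubeP (T : graph) (q : {set 'I_(nh T)}) :
 reflect [/\ q != set0, q \subset full T, opclosed (opp T) q & qconn q] (tube q).
Proof.
apply: (iffP and4P) => -[a b c d]; split=> //.
- by move=> h hq; apply: (forall_inP c).
- by move=> h h' hq hq'; apply: (forall_inP (forall_inP d _ hq)).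
- by apply/forall_inP.
- by apply/forall_inP => h hq; apply/forall_inP => h'; apply: d.
Qed.

Lemma contr_tube X (q : {set 'I_(nh X)}) : tube q -> exists S (f : arr X S), nz f = q /\
 forall k k' : 'I_(nh S), vtx S k = vtx S k' -> vtx X (psi f k) \notin vtx X @: q ->
  (k < k')%N = (psi f k < psi f k')%N.
Proof.
move=> /tubeP[q0 qf qo qc]; have [u [t [[[u1 uo] _] tn _]]] := terminal_ex X.
have one (x y : 'I_(nv u)) : x = y by apply: ord_inj; have := ltn_ord x; have := ltn_ord y; lia.
have i : 'I_(nv u) by rewrite u1; exact: ord0.
have [||S [f [g [[gf fq _] _ _ o]]]] := @contr_over O X u t i q _ qo qc.
- by rewrite tn.
- by move=> h _ []; apply: one.
by exists S, f; split=> // k k' E kq; apply: o => //; apply: one.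
Qed.

(** [contr_over] with nothing to contract only reorders [X]: the isomorphism [l] sorts vertices by
    their images and, away from [i], half-edges as in [S], which makes the other fibers trivial. *)
Lemma elementarize X S (f : arr X S) i : nz f != set0 -> (forall h, h \in nz f -> phi f (vtx X h) = i) ->
 exists T (l : arr X T) (t : arr T S) F, [/\ iso l, gcomp t l = f, elementary t i F,
   forall v w : 'I_(nv X), phi f v = i -> phi f w = i -> (v < w)%N -> (phi l v < phi l w)%N &
   forall k k' : 'I_(nh T), vtx T k = vtx T k' -> phi t (vtx T k) = i -> (k < k')%N = (psi l k < psi l k')%N].
Proof.
move=> fn fi; have f0 := arr0 f.
have [||||T [l [t [[tl ln tm] o1 o2 o3]]]] := @contr_over O X S f i set0.
- exact: sub0set.
- by move=> h; rewrite inE.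
- by move=> h h'; rewrite inE.
- by move=> h _ hi; apply/negP => /fi.
have li : iso l by apply/iso_nz.
have l0 := arr0 l; have t0 := arr0 t.
have tlv v : phi f v = phi t (phi l v) by apply: phi_comp.
have single v a b : v <> i -> phi t a = v -> phi t b = v -> a = b.
 move=> vi; have [x <-] := phi_surj l0 a; have [y <-] := phi_surj l0 b. rewrite -!tlv => xv yv; congr (phi l _).
 have c : connect (eadj X (nz f)) x y by apply: (arr_conn (arrO f)); rewrite xv yv.
 case/connectP: c => -[//|z p] /= /andP[/erelP[h /fi hi [hx _]] _]. by rewrite -xv -hx hi in vi.
have [||v vi|F tF] := @elementaryI O T S t i; last by exists T, l, t, F; split=> //;
 move=> *; [apply: o1; rewrite ?imset0 ?inE //; congruence | apply: o3; rewrite ?imset0 ?inE].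
- exact: tm.
- apply: contraNneq fn => E; by rewrite -tl nz_iso_comp // E imset0.
- move/eqP in vi; split; first by move=> w w'; apply: single. move=> h hv; apply/negP => hn; apply: vi; rewrite -hv.
  rewrite -(phi_vtx l0) -tlv; apply: fi; rewrite -tl nz_iso_comp //. exact: imset_f.
 move=> h h' hv hv' hh; apply: o2; rewrite ?hv //. by apply: (single v); rewrite ?(phi_vtx t0).
Qed.

Lemma contr_ex X (q : {set 'I_(nh X)}) : tube q -> exists T S F (l : arr X T) (t : arr T S) i,
 [/\ iso l, elementary t i F & nz (gcomp t l) = q].
Proof.
move=> qt; have [S [f [fq _]]] := contr_tube qt; have [q0 _ _ qc] := tubeP _ qt.
have [h0 hq] := set0Pn _ q0.
have [||T [l [t [F [li tl tF _ _]]]]] := @elementarize X S f (phi f (vtx X h0)).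
- by rewrite fq.
- move=> h; rewrite fq => hh. apply: (connect_ind (P := fun w => phi f w = phi f (vtx X h0)) (qc _ _ hq hh)) => //.
 move=> a b <- /erelP[k kq [<- <-]]; apply/esym/(nz_eq (arr0 f)); by rewrite fq.
by exists T, S, F, l, t, (phi f (vtx X h0)); rewrite tl.
Qed.
End Chains.

(** * Contractions of nested tubes and of tubes apart from each other *)

Section Refine.
Variable O : opcat.
Implicit Types T S P F G H X R : obj O.

(** Both composites contract the same half-edges, so each factors through the other by [factor_arr];
    the square commutes after cancelling [l]. *)
Lemma contr_unique X T S T' S' (l : arr X T) (t : arr T S) (l' : arr X T') (t' : arr T' S') :
 iso l -> iso l' -> nz (gcomp t l) = nz (gcomp t' l') -> exists (w : arr T T') (s : arr S S'),
  [/\ iso w, iso s, gcomp w l = l' & gcomp s t = gcomp t' w].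
Proof.
move=> li li' E.
have [f fE] := comp_arr l t; have [f' fE'] := comp_arr l' t'.
have [|w wE] := @factor_arr O X T T' l l'; first by rewrite (iffLR (iso_nz _) li) sub0set.
have wi : iso w. apply/iso_nz/setP => h; rewrite in_set0; apply/negP => hw. have : psi l h \in nz (gcomp w l).
  by rewrite (in_nz_comp _ (arr0 l)) imset_f ?orbT. by rewrite wE (iffLR (iso_nz _) li') inE.
have [|s sE] := @factor_arr O X S S' f f'; first by rewrite fE fE' E.
have si : iso s. apply/iso_nz/setP => h; rewrite in_set0; apply/negP => hw. have : psi f h \in nz (gcomp s f).
  by rewrite (in_nz_comp _ (arr0 f)) imset_f ?orbT. by rewrite sE fE' -E -fE (negbTE (psi_nz _ _)).
exists w, s; split=> //; apply: (gcomp_epi (arr0 l)).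
by rewrite -!gcompA wE -fE sE fE'.
Qed.

Lemma nz_lift T S (f : arr T S) P (g : arr S P) h : h \in nz g -> psi f h \in nz (gcomp g f).
Proof. by move=> hn; rewrite (in_nz_comp _ (arr0 f)) imset_f ?orbT. Qed.

Lemma connect_phi X (q : {set 'I_(nh X)}) S (f : arr X S) v w : q \subset nz f ->
 connect (eadj X q) v w -> phi f v = phi f w.
Proof.
move=> qf c; apply: (connect_ind (P := fun w => phi f v = phi f w) c) => // a b ->.
by case/erelP=> h /(subsetP qf) hn [<- <-]; apply: nz_eq (arr0 f) _ hn.
Qed.

(** Provides the data of the sequential associativity axiom: the smaller tube [q] is contracted
    first by [t], the rest of [nz t0] by [g], and inside the fiber [F0] the same step is the
    elementary [fi]. *)
Lemma refine_in X S0 (t0 : arr X S0) i0 F0 (q : {set 'I_(nh X)}) : elementary t0 i0 F0 ->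
 tube q -> q \proper nz t0 -> exists T S F G H (l : arr X T) (t : arr T S) (g : arr S S0) (xi : arr T S0) j
  (fi : arr H G) (li : arr F0 H), [/\ [/\ iso l, elementary t j F, elementary g i0 G & phi g j = i0],
   [/\ amap xi = gcomp g t, gcomp xi l = t0, elementary xi i0 H & is_induced t g xi i0 fi],
   [/\ is_induced l xi t0 i0 li, iso li & exists j', elementary fi j' F] & nz (gcomp t l) = q].
Proof.
move=> t0F qt /properP[qn [h1 h1n h1q]]; have [q0 qf qo qc] := tubeP _ qt.
have [e1 e2 e3 e4] := iffLR (elemP _ _ _) t0F.
have t00 := arr0 t0; have [h0 hq] := set0Pn _ q0.
have [|S [f [g [[gf fq gm] o1 o2 o3]]]] := @contr_over O X S0 t0 i0 q qn qo qc.
 by move=> h _ hi; apply/negP => /(elem_nz t0F).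
have f0 := arr0 f; have g0 := arr0 g.
have gfv v : phi t0 v = phi g (phi f v) by apply: phi_comp.
have gfh h : psi t0 h = psi f (psi g h) by apply: psi_comp.
pose j := phi f (vtx X h0).
have ji : phi g j = i0 by rewrite /j -gfv; apply: (elem_nz t0F); apply: (subsetP qn).
have [||T [l [t [F [li tl tF _ _]]]]] := @elementarize O X S f j.
- by rewrite fq.
- by move=> h; rewrite fq => hh; apply: (@connect_phi X q); rewrite ?fq //; apply: qc.
have l0 := arr0 l; have t1 := arr0 t.
have [xi xE] := comp_arr t g.
have xl : gcomp xi l = t0 by rewrite xE -gcompA tl gf.
have xlv v : phi t0 v = phi xi (phi l v) by apply: phi_comp.
have g_single v a b : v <> i0 -> phi g a = v -> phi g b = v -> a = b.
 move=> /eqP/e4[s1 _ _]; have [x <-] := phi_surj f0 a; have [y <-] := phi_surj f0 b.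
 by rewrite -!gfv => xv yv; congr (phi f _); apply: s1 yv.
have [|v vi|G gG] := @elementaryI O S S0 g i0 gm.
- have := h1n; rewrite -gf (in_nz_comp _ f0) fq (negbTE h1q) => /imsetP[k kn _]. by apply/set0Pn; exists k.
- move: (e4 _ vi) => [s1 s2 s3]; move/eqP in vi; split.
 + by move=> a b; apply: g_single.
 + move=> h hv; apply/negP => /(nz_lift f); rewrite gf => hn.
  by move: (s2 (psi f h)); rewrite gfv (phi_vtx f0) hn => /(_ hv).
 + move=> h h' hv hv' hh; apply: o2; rewrite ?hv //. by apply: (g_single v); rewrite ?(phi_vtx g0).
have [tm [iv [ih I]] tn ts] := iffLR (elemP _ _ _) tF.
have [gm' _ _ gs] := iffLR (elemP _ _ _) gG.
have [||v vi|H xH] := @elementaryI O T S0 xi i0.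
- by move=> w w' ww; rewrite !(phi_comp _ xE); apply/gm/tm.
- apply/set0Pn; have : h1 \in nz (gcomp xi l) by rewrite xl. rewrite nz_iso_comp // => /imsetP[k kn _]; by exists k.
- move: (e4 _ vi) => [s1 s2 s3]; have vi' := elimN eqP vi; split.
 + move=> a b; have [x <-] := phi_surj l0 a; have [y <-] := phi_surj l0 b.
  by rewrite -!xlv => xv yv; congr (phi l _); apply: s1 yv.
 + move=> h hv; apply/negP => /(nz_lift l); rewrite xl => hn.
  by move: (s2 (psi l h)); rewrite xlv (phi_vtx l0) hn => /(_ hv).
 + move=> h h' hv hv' hh; rewrite !(psi_comp _ xE). have sj : phi g (vtx S (psi g h)) = v by rewrite (phi_vtx g0).
  have sj' : phi g (vtx S (psi g h')) = v by rewrite (phi_vtx g0).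
  have nj : vtx S (psi g h) != j by apply: contraNneq vi => E; rewrite -sj E ji.
  have [_ _ m] := ts _ nj; apply: m => //; first exact: (g_single v). by have [_ _ m'] := gs _ vi; apply: m'.
have [_ [kv [kh J]] _ _] := iffLR (elemP _ _ _) xH.
have [_ [mv [mh M]] _ _] := iffLR (elemP _ _ _) gG.
have [_ [nv' [nh' N]] _ _] := iffLR (elemP _ _ _) t0F.
have [fi [fiv fih]] := induced_ex xE J M.
have [lif [liv lih]] := induced_ex (esym xl) N J.
have lii : iso lif. apply/iso_nz/setP => h; rewrite in_set0 (nz_induced (esym xl) N J lih).
 by rewrite (iffLR (iso_nz _) li) inE.
have [j' [_ fF]] := elementary_induced xE J M fiv fih tF ji.
exists T, S, F, G, H, l, t, g, xi, j, fi, lif; split.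
- by split.
- by split=> //; exists kv, kh, mv, mh.
- by split=> //; [exists nv', nh', kv, kh | exists j'].
- by rewrite tl.
Qed.

(** Provides the square of the parallel axiom for two contractions at different vertices. Both
    routes must have literally the fibers [F0] and [G]; this is where [fiber_transfer] is used. *)
Lemma refine_out X S0 (t0 : arr X S0) i0 F0 (q : {set 'I_(nh S0)}) :
 elementary t0 i0 F0 -> tube q -> i0 \notin vtx S0 @: q ->
 exists T R' R'' S G (l : arr X T) (r : arr S0 R') (f' : arr T R') (g' : arr R' S)
  (f'' : arr T R'') (g'' : arr R'' S) (h : arr X R') j i l0 k,
 [/\ [/\ iso l, iso r, amap h = gcomp f' l & amap h = gcomp r t0],
   gcomp g' f' = gcomp g'' f'' /\ nz (gcomp g' r) = q,
   [/\ elementary f' j F0, elementary g' i G, elementary f'' l0 G & elementary g'' k F0],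
   [/\ phi g'' l0 = i, i <> k & phi g' j = k] & is_fiber h j F0].
Proof.
move=> t0F qt iq; have [q0 qf qo qc] := tubeP _ qt.
have [e1 e2 e3 e4] := iffLR (elemP _ _ _) t0F.
have t00 := arr0 t0; have [h0 hq] := set0Pn _ q0.
have [S [fS [fq P3]]] := contr_tube qt; have fS0 := arr0 fS.
pose i := phi fS (vtx S0 h0).
have qi h : h \in q -> phi fS (vtx S0 h) = i. by move=> hh; apply: (@connect_phi S0 q); rewrite ?fq //; apply: qc.
have [||R' [r [g' [G [ri gr g'G _ _]]]]] := @elementarize O S0 S fS i.
- by rewrite fq.
- by rewrite fq.
have r0 := arr0 r; have g'0 := arr0 g'.
have grv v : phi fS v = phi g' (phi r v) by apply: phi_comp.
have grh v : psi fS v = psi r (psi g' v) by apply: psi_comp.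
have [g'm _ _ g't] := iffLR (elemP _ _ _) g'G.
have [h hE] := comp_arr t0 r.
have nzh : nz h = nz t0.
 by apply/setP => x; rewrite hE (in_nz_comp _ t00) (iffLR (iso_nz _) ri) imset0 in_set0 orbF.
pose j := phi r i0; pose k := phi g' j.
have hv v : phi h v = phi r (phi t0 v) by apply: phi_comp.
have hh v : psi h v = psi t0 (psi r v) by apply: psi_comp.
have vqi v : phi fS v = i -> v \in vtx S0 @: q. move=> vi; have c : connect (eadj S0 q) v (vtx S0 h0).
  by rewrite -fq; apply: (arr_conn (arrO fS)); rewrite vi.
 by case: (iffLR (connect_q _ _ qo qc) c) => [->|[]//]; apply: imset_f.
have ik : i <> k. by move=> E; move: iq; rewrite vqi // grv -/j -/k -E.
have t0n : nz t0 != set0. have [iv [ih I]] := e2; have := e3; rewrite (nedge_gt0 (objO F0)).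
 rewrite -(imset_eq0 ih) (fiber_nz I) // => x; exact: elem_nz t0F.
have [||T [l [f' [F1 [li fl f'F1 l1 l3]]]]] := @elementarize O X R' h j.
- by rewrite nzh.
- by move=> x; rewrite nzh => /(elem_nz t0F) xi; rewrite hv xi.
have l0 := arr0 l; have f'0 := arr0 f'.
have flv v : phi h v = phi f' (phi l v) by apply: phi_comp.
have flh v : psi h v = psi l (psi f' v) by apply: psi_comp.
have [f'm _ _ f't] := iffLR (elemP _ _ _) f'F1.
have nzl : nz l = set0 by apply/iso_nz.
(* Off the tube [contr_tube] leaves the local orders of [S0] unchanged, and [g'] has a trivial fiber
   over [k]; so [r] preserves the local order at [i0] and the fiber of [h] over [j] is [F0]
   itself. *)
have r_mono (x y : 'I_(nh R')) : vtx R' x = j -> vtx R' y = j -> (x < y)%N -> (psi r x < psi r y)%N.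
 move=> xj yj xy. have [s1 s2 s3] := g't k (introN eqP (fun e => ik (esym e))).
 have [m mE] : exists m, x = psi g' m by apply/nzPn/s2; rewrite xj.
 have [n nE] : exists n, y = psi g' n by apply/nzPn/s2; rewrite yj.
 have mk : vtx S m = k by rewrite -(phi_vtx g'0) -mE xj. have nk : vtx S n = k by rewrite -(phi_vtx g'0) -nE yj.
 have mn : (m < n)%N. case: (ltngtP m n) => // [nm|/ord_inj E].
   by have := s3 _ _ nk mk nm; rewrite -mE -nE ltnNge (ltnW xy). by move: xy; rewrite mE nE E ltnn.
 rewrite mE nE -!grh -P3 ?mk ?nk //. have -> // : vtx S0 (psi fS m) = i0.
 apply: (iso_phi_inj ri); rewrite grh (phi_vtx r0) -mE xj //.
have hF0 : is_fiber h j F0. have [iv [ih I]] := e2; exists iv, ih.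
 case: I => I1 I2 I3 I4 I5 I6 I7 I8 I9; split=> //.
 - by move=> w; rewrite I2 hv (inj_eq (iso_phi_inj ri)).
 - by move=> x; rewrite I4 hv (inj_eq (iso_phi_inj ri)).
 - move=> x; rewrite I6. have E : (ih x \notin nz t0) = (ih x \notin nz h) by rewrite nzh.
  by move: E; rewrite !inE !negbK => ->.
 - rewrite I7; transitivity [seq psi t0 z | z <- [seq psi r y | y <- [seq y <- enum 'I_(nh R') | vtx R' y == j]]].
   congr map; apply: (@sorted_key_eq _ (fun z : 'I_(nh S0) => nat_of_ord z)).
   + exact: filter_ord.
   + apply: sorted_map_in (filter_ord _) _ => x y; rewrite !mem_filter.
    by move=> /andP[/eqP xj _] /andP[/eqP yj _]; apply: r_mono.
   + move=> z; rewrite mem_filter mem_enum andbT; apply/eqP/mapP => [zi|[y + ->]].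
     have [y yE] := iso_psi_surj z ri; exists y => //. by rewrite mem_filter mem_enum -(phi_vtx r0) -yE zi eqxx.
    rewrite mem_filter => /andP[/eqP yj _]; apply: (iso_phi_inj ri). by rewrite (phi_vtx r0).
  by rewrite -map_comp; apply: eq_map => y; rewrite /= hh.
have f'F0 : elementary f' j F0. apply/elemP; split=> //.
 apply: (iffLR (@fiber_transfer O X T R' R' l h f' j j _ _ _ _ _ F0)) => //.
 - by move=> w; rewrite flv.
 - move=> s sj; split.
  + move=> w w' ws ws'; apply: (iso_phi_inj li); by rewrite ws ws'.
  + by move=> x _; rewrite nzl inE.
  + by move=> x y xs ys xy; rewrite -l3 ?xs ?ys.
 - by move=> m mj; rewrite -fl nz_iso_comp // mem_imset //; apply: psi_inj l0.
 - by apply: eq_map => y; rewrite flh.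
have [e eE] := comp_arr f' g'.
have ev v : phi e v = phi g' (phi f' v) by apply: phi_comp.
have eh v : psi e v = psi f' (psi g' v) by apply: psi_comp.
have jn h' : h' \in nz f' -> phi f' (vtx T h') = j by apply: elem_nz f'F0.
have in' h' : h' \in nz g' -> phi g' (vtx R' h') = i by apply: elem_nz g'G.
pose q2 := psi f' @: nz g'.
have nze x : (x \in nz e) = (x \in nz f') || (x \in q2) by rewrite eE (in_nz_comp _ f'0).
have q2e : q2 \subset nz e by apply/subsetP => x xq; rewrite nze xq orbT.
have q2i x : x \in q2 -> phi e (vtx T x) = i. by case/imsetP=> m mn ->; rewrite ev (phi_vtx f'0) in'.
have q2o : opclosed (opp T) q2. move=> x /imsetP[m mn ->]; rewrite -(psi_opp f'0) imset_f //.
 exact: (nz_closed (objO R') g'0).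
have e_conn v w : phi e v <> k -> phi e v = phi e w -> connect (eadj T q2) v w.
 move=> vk vw; have c := arr_conn (arrO e) vw. suff [] : phi e w = phi e v /\ connect (eadj T q2) v w by [].
 apply: (connect_ind (P := fun w => phi e w = phi e v /\ connect (eadj T q2) v w) c).
  by split; last exact: connect0. move=> a b [av ca] /erelP[x xn [xa xb]]. have xq : x \in q2.
  move: xn; rewrite nze => /orP[/jn xj|//]. by case: vk; rewrite -av -xa ev xj.
 rewrite -xb -(nz_eq (arr0 e)) ?xa; last by rewrite nze xq orbT.
 by split=> //; apply: connect_trans ca _; rewrite -xa; apply: connect1 (erel1 _ _ xq).
have q2c : qconn q2. move=> x y xq yq; apply: e_conn; rewrite ?(q2i _ xq) ?(q2i _ yq) //.
(* The other order of contraction. With [k] as the distinguished vertex, half-edges over [k] keep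
   their order in [T] and the others take the one of [S], which makes both [f''] and [g'']
   elementary. *)
have [|R'' [f'' [g'' [[gf fq2 gm] o1 o2 o3]]]] := @contr_over O T S e k q2 q2e q2o q2c.
 move=> x xq xk; rewrite nze (negbTE xq) orbF; apply/negP => /jn xj. by case: xk; rewrite ev xj.
have f''0 := arr0 f''; have g''0 := arr0 g''.
have gfv v : phi e v = phi g'' (phi f'' v) by apply: phi_comp.
have gfh v : psi e v = psi f'' (psi g'' v) by apply: psi_comp.
have same v w : phi e v <> k -> phi e v = phi e w -> phi f'' v = phi f'' w.
 by move=> vk vw; apply: (@connect_phi T q2); rewrite ?fq2 //; apply: e_conn.
have kq v : phi e v = k -> v \notin vtx T @: q2.
 by move=> vk; apply/negP => /imsetP[x /q2i xi vE]; apply: ik; rewrite -xi -vE.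
have [m0 m0n] : exists m, m \in nz g'. have : h0 \in nz (gcomp g' r) by rewrite gr fq.
 by rewrite nz_iso_comp // => /imsetP[m mn _]; exists m.
pose h2 := psi f' m0; have h2q : h2 \in q2 by apply: imset_f.
pose l2 := phi f'' (vtx T h2).
have l2i : phi g'' l2 = i by rewrite /l2 -gfv q2i.
have iNk : i != k by apply/eqP.
have over_i s : phi g'' s = i -> s = l2. have [w <-] := phi_surj f''0 s; rewrite -gfv => wi.
 by apply: same; rewrite wi ?q2i.
have f''m (w w' : 'I_(nv T)) : (w <= w')%N -> (phi f'' w <= phi f'' w')%N.
 rewrite leq_eqVlt => /orP[/eqP/ord_inj->//|ww]. have [E|E] := eqVneq (phi e w) (phi e w').
  have [wk|/eqP wk] := eqVneq (phi e w) k; last by rewrite (same _ _ wk E).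
  by apply/ltnW/o1 => //; apply: kq; rewrite -?E. have : (phi e w <= phi e w')%N by rewrite !ev; apply/g'm/f'm/ltnW.
 rewrite leq_eqVlt => /orP[/eqP/ord_inj E'|lt]; first by rewrite E' eqxx in E.
 rewrite leqNgt; apply/negP => /ltnW/gm; rewrite -!gfv; by rewrite leqNgt lt.
have g''single v a b : v <> k -> phi g'' a = v -> phi g'' b = v -> a = b.
 move=> vk; have [x <-] := phi_surj f''0 a; have [y <-] := phi_surj f''0 b.
 by rewrite -!gfv => xv yv; apply: same; rewrite xv ?yv.
have g''t v : v != k -> tf g'' v. move=> /eqP vk; split; first by move=> a b; apply: g''single.
 - move=> x xv; apply/negP => /(nz_lift f''); rewrite gf nze -fq2 (negbTE (psi_nz _ _)) orbF.
  by move=> /jn xj; apply: vk; rewrite -xv -(phi_vtx f''0) -gfv ev xj.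
 - move=> x y xv yv xy; apply: o2; rewrite ?xv //. by apply: (g''single v); rewrite ?(phi_vtx g''0).
have f''t s : s != l2 -> tf f'' s. move=> /eqP sl. have qs x : x \in q2 -> phi f'' (vtx T x) = l2.
  by move=> xq; apply: over_i; rewrite -gfv q2i. split.
 - move=> w w' ws ws'. have c : connect (eadj T q2) w w'.
   by rewrite -fq2; apply: (arr_conn (arrO f'')); rewrite ws ws'.
  case: (iffLR (connect_q _ _ q2o q2c) c) => // -[/imsetP[x xq wE] _]. by case: sl; rewrite -ws wE qs.
 - by move=> x xs; rewrite fq2; apply/negP => /qs; rewrite xs.
 - move=> m n ms ns mn; have [sk|sk] := eqVneq (phi g'' s) k.
   by rewrite -o3 ?ms ?ns //; apply: kq; rewrite gfv (phi_vtx f''0) ms. have [t1 t2 t3] := g''t _ sk.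
  have [m' mE] : exists m', m = psi g'' m' by apply/nzPn/t2; rewrite ms.
  have [n' nE] : exists n', n = psi g'' n' by apply/nzPn/t2; rewrite ns.
  have ms' : vtx S m' = phi g'' s by rewrite -(phi_vtx g''0) -mE ms.
  have ns' : vtx S n' = phi g'' s by rewrite -(phi_vtx g''0) -nE ns. have mn' : (m' < n')%N.
   case: (ltngtP m' n') => // [nm|/ord_inj E]. by have := t3 _ _ ns' ms' nm; rewrite -mE -nE ltnNge (ltnW mn).
   by move: mn; rewrite mE nE E ltnn. have si : phi g'' s != i by apply/eqP => /over_i. have [u1 u2 u3] := g't _ si.
  rewrite mE nE -!gfh !eh. have vm : phi g' (vtx R' (psi g' m')) = phi g'' s by rewrite (phi_vtx g'0).
  have vn : phi g' (vtx R' (psi g' n')) = phi g'' s by rewrite (phi_vtx g'0).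
  have nj : vtx R' (psi g' m') != j by apply: contraNneq sk => E; rewrite -vm E.
  have [w1 w2 w3] := f't _ nj; apply: w3 => //; first exact: u1. exact: u3.
have f''G : elementary f'' l2 G. apply/elemP; split=> //; last by case: (iffLR (elemP _ _ _) g'G).
 have [_ gG _ _] := iffLR (elemP _ _ _) g'G.
 have nj s : phi g' s = i -> s != j by move=> si; apply: contraNneq iNk => E; rewrite -si E.
 apply: (iffRL (@fiber_transfer O T R' R'' S f' f'' g' l2 i _ _ _ _ _ G)) => //.
 - move=> w; rewrite -ev gfv; split=> [->//|]; exact: over_i.
 - by move=> s /nj/f't.
 - move=> w w' wl wl' ww; rewrite ltn_neqAle f'm ?(ltnW ww) // andbT. apply/negP => /eqP/ord_inj E.
  have si : phi g' (phi f' w) = i by rewrite -ev gfv wl. have [t1 _ _] := f't _ (nj _ si).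
  by move: ww; rewrite (t1 w w') ?ltnn.
 - by move=> m _; rewrite fq2 mem_imset //; apply: psi_inj f'0.
 - have tl := tf_list (g''t _ iNk).
  transitivity [seq psi f'' z | z <- [seq psi g'' y | y <- enum 'I_(nh S) & vtx S y == i]].
   rewrite tl; congr map; apply: eq_filter => z. by apply/eqP/eqP => [->//|]; apply: over_i.
  by rewrite -map_comp; apply: eq_map => y; rewrite /= -gfh eh.
have kNi : k != i by rewrite eq_sym.
have jk s : phi g' s = k -> s = j. by have [t1 _ _] := g't _ kNi; move=> sk; apply: t1 sk _.
have g''F : elementary g'' k F0. apply/elemP; split=> //; have [_ fF _ _] := iffLR (elemP _ _ _) f'F0.
 apply: (iffLR (@fiber_transfer O T R'' R' S f'' f' g'' j k _ _ _ _ _ F0)) => //.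
 - move=> w; rewrite -gfv ev; split=> [->//|]; exact: jk.
 - move=> s sk; apply: f''t; apply: contraNneq iNk => E; by rewrite -l2i -E sk.
 - move=> w w' wj wj' ww; apply: o1 => //; last by rewrite !ev wj wj'.
  + by apply: kq; rewrite ev wj.
  + by apply: kq; rewrite ev wj'.
 - move=> m mk; have nzE := nze (psi f'' m).
  have q2N : (psi f'' m \in q2) = false by rewrite -fq2 (negbTE (psi_nz _ _)).
  rewrite q2N orbF -gf (in_nz_comp _ f''0) (negbTE (psi_nz f'' m)) /= in nzE.
  by rewrite -nzE mem_imset //; apply: psi_inj f''0.
 - have tl := tf_list (g't _ kNi).
  transitivity [seq psi f' z | z <- [seq psi g' y | y <- enum 'I_(nh S) & vtx S y == k]].
   rewrite tl; congr map; apply: eq_filter => z. by apply/eqP/eqP => [->//|]; apply: jk.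
  by rewrite -map_comp; apply: eq_map => y; rewrite /= -eh gfh.
exists T, R', R'', S, G, l, r, f', g', f'', g'', h, j, i, l2, k.
by split=> //; split=> //; rewrite ?gr // -eE gf.
Qed.
End Refine.

(** * Exterior algebras on finite sets *)

Import GRing.Theory.
Local Open Scope ring_scope.

Section Linear.
Variables (K : fieldType) (U V : lmodType K) (f : U -> V).
Hypothesis fl : linear f.

Lemma linZ a x : f (a *: x) = a *: f x.
Proof. by rewrite -[a *: x]addr0 fl (lin0 fl) addr0. Qed.
Lemma linD x y : f (x + y) = f x + f y.
Proof. by rewrite -[x]scale1r fl !scale1r. Qed.
Lemma linN x : f (- x) = - f x.
Proof. by rewrite -scaleN1r linZ scaleN1r. Qed.
Lemma lin_sum (I : Type) (r : seq I) (P : pred I) (F : I -> U) :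
 f (\sum_(i <- r | P i) F i) = \sum_(i <- r | P i) f (F i).
Proof. by apply: (big_morph f linD (lin0 fl)). Qed.
End Linear.

Section Exterior.
Variable K : fieldType.
Implicit Types I J : finType.

Definition ext I := {ffun {set I} -> K^o}.

Definition before I (i : I) : seq I := take (index i (enum I)) (enum I).
Definition pos I (i : I) (A : {set I}) : nat := #|[set j in A | (index j (enum I) < index i (enum I))%N]|.

Definition delta I (A : {set I}) : ext I := [ffun B => (B == A)%:R].

(** Left multiplication by the generator [i] in the exterior algebra with basis [delta]; the sign
    moves [i] past the smaller elements. *)
Definition emul I (i : I) (x : ext I) : ext I :=
 [ffun B : {set I} => if i \in B then (-1) ^+ pos i B * x (B :\ i) else 0].

Lemma emul_lin I (i : I) : linear (emul i).
Proof.
move=> a x y; apply/ffunP => B; rewrite !ffunE.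
by case: ifP => _; rewrite ?scaler0 ?addr0 // mulrDr scalerAr.
Qed.

Lemma ext_delta I (x : ext I) : x = \sum_A x A *: delta A.
Proof.
apply/ffunP => B; rewrite sum_ffunE (bigD1 B) //= big1 => [|A AB].
 by rewrite !ffunE eqxx addr0; apply: esym (mulr1 _).
by rewrite !ffunE eq_sym (negbTE AB); apply: mulr0.
Qed.

Lemma posU1 I (i : I) A : pos i (i |: A) = pos i A.
Proof.
by apply: eq_card => j; rewrite !inE; case: eqP => [->|//]; rewrite ltnn !andbF.
Qed.

Lemma pos_split I (i j : I) A : pos i A = ((j \in A) && (index j (enum I) < index i (enum I))%N + pos i (A :\ j))%N.
Proof.
rewrite {1}/pos (cardsD1 j) inE; congr (_ + _)%N.
by apply: eq_card => k; rewrite !inE andbA.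
Qed.

Lemma emul_delta I (i : I) A : emul i (delta A) = if i \in A then 0 else (-1) ^+ pos i A *: delta (i |: A).
Proof.
apply/ffunP => B; rewrite ffunE; case: ifPn => iB; last first.
 by case: ifP => _; rewrite !ffunE // (_ : B == _ = false) ?scaler0 //;
  apply: contraNF iB => /eqP->; rewrite setU11.
have -> : delta A (B :\ i) = ((i \notin A) && (B == i |: A))%:R.
 rewrite ffunE; congr (nat_of_bool _)%:R; apply/eqP/andP => [<-|[iA /eqP->]]. by rewrite !inE eqxx setD1K.
 by rewrite setU1K.
case: ifP => iA; rewrite ?mulr0 !ffunE //=; case: eqP => [->|_]; last by rewrite mulr0 scaler0.
by rewrite posU1.
Qed.

Lemma enum_in I (A : {set I}) : enum A = [seq x <- enum I | x \in A].
Proof. by rewrite enumT. Qed.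

Lemma enum_in_split I (i : I) A (s := drop (index i (enum I)).+1 (enum I)) :
 [seq x <- before i | x \in i |: A] = [seq x <- before i | x \in A] /\
 [seq x <- s | x \in i |: A] = [seq x <- s | x \in A].
Proof.
have E : enum I = before i ++ i :: s. rewrite /s -{2}[i](nth_index i (mem_enum I i)) -drop_nth ?cat_take_drop //.
 by rewrite index_mem mem_enum.
have := enum_uniq I; rewrite E cat_uniq /= => /and4P[_ + iS _].
rewrite negb_or => /andP[ib _].
split; apply: eq_in_filter => x xs; rewrite !inE; case: eqP => // xi; subst x. by rewrite xs in ib.
by rewrite xs in iS.
Qed.

(* A family of anticommuting operators of square zero extends to the exterior
   algebra. *)
Section Universal.
Variables (I : finType) (W : lmodType K) (n : I -> W -> W) (w0 : W).
Hypothesis nl : forall i, linear (n i).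
Hypothesis nn : forall i w, n i (n i w) = 0.
Hypothesis nC : forall i j w, n i (n j w) = - n j (n i w).

Definition evl (x : ext I) : W := \sum_A x A *: foldr n w0 (enum A).

Lemma evl_lin : linear evl.
Proof.
move=> a x y; rewrite /evl scaler_sumr -big_split; apply: eq_bigr => A _.
by rewrite !ffunE scalerDl scalerA.
Qed.

Lemma evl_delta A : evl (delta A) = foldr n w0 (enum A).
Proof.
rewrite /evl (bigD1 A) //= big1 => [|B BA]; first by rewrite ffunE eqxx scale1r addr0.
by rewrite ffunE (negbTE BA) scale0r.
Qed.

Lemma foldr_lin l : linear (fun w => foldr n w l).
Proof. by elim: l => //= i l IH a x y; rewrite IH nl. Qed.

Lemma foldr_swap i l w : n i (foldr n w l) = (-1) ^+ size l *: foldr n (n i w) l.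
Proof.
elim: l => /= [|j l IH]; first by rewrite scale1r.
by rewrite nC IH (linZ (nl j)) exprS mulN1r scaleNr.
Qed.

(** Split the enumeration at [i]: the sign [pos i A] is that of moving [n i] past the operators of
    the smaller elements of [A], after which it either meets itself or stands in its place. *)
Lemma evl_emul i x : evl (emul i x) = n i (evl x).
Proof.
rewrite [x]ext_delta (lin_sum (@emul_lin I i)) !(lin_sum evl_lin) (lin_sum (nl i)).
apply: eq_bigr => A _; rewrite (linZ (@emul_lin I i)) !(linZ evl_lin) (linZ (nl i)).
congr (_ *: _); rewrite emul_delta evl_delta.
set s := drop (index i (enum I)).+1 (enum I).
have E : enum I = before i ++ i :: s. rewrite /s -{2}[i](nth_index i (mem_enum I i)) -drop_nth ?cat_take_drop //.
 by rewrite index_mem mem_enum.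
have sz : size [seq x <- before i | x \in A] = pos i A. have u : uniq (before i) by rewrite take_uniq // enum_uniq.
 rewrite -(card_uniqP (filter_uniq _ u)); apply: eq_card => k. by rewrite mem_filter !inE /before in_take ?mem_enum.
have eA : foldr n w0 (enum A) = foldr n (foldr n w0
  ((if i \in A then [:: i] else [::]) ++ [seq x <- s | x \in A])) [seq x <- before i | x \in A].
 by rewrite enum_in E filter_cat /= -foldr_cat; case: ifP.
rewrite eA foldr_swap sz; case: ifP => iA /=. by rewrite nn (lin0 (foldr_lin _)) scaler0 (lin0 evl_lin).
rewrite (linZ evl_lin) evl_delta; congr (_ *: _).
have [E1 E2] := enum_in_split i A.
by rewrite enum_in E filter_cat /= setU11 E1 E2 foldr_cat.
Qed.
End Universal.

Lemma emul_nn I (i : I) x : emul i (emul i x) = 0.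
Proof. by apply/ffunP => B; rewrite !ffunE; case: ifP; rewrite // !inE eqxx mulr0. Qed.

Lemma emulC I (i j : I) x : emul i (emul j x) = - emul j (emul i x).
Proof.
have [->|ij] := eqVneq i j; first by rewrite !emul_nn oppr0.
apply/ffunP => B; rewrite !ffunE !inE (eq_sym j i) ij /=.
case: (boolP (i \in B)) => iB; case: (boolP (j \in B)) => jB; rewrite ?mulr0 ?oppr0 //.
rewrite !mulrA -!exprD -mulNr; congr (_ * x _); last first. by apply/setP => k; rewrite !inE andbCA.
rewrite (pos_split i j B) (pos_split j i B) iB jB /=.
have : index i (enum I) != index j (enum I).
 by apply: contra ij => /eqP E; rewrite -(nth_index i (mem_enum I i)) E nth_index ?mem_enum.
rewrite neq_ltn; case: ltngtP => // _ _; rewrite !add0n. by rewrite add1n addSn exprS mulN1r opprK addnC.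
by rewrite add1n addSn exprS mulN1r addnC.
Qed.

Definition mon I (l : seq I) : ext I := foldr (@emul I) (delta set0) l.

Lemma mon_enum I (A : {set I}) : mon (enum A) = delta A.
Proof.
suff H s p : enum I = p ++ s -> mon [seq x <- s | x \in A] = delta [set x in s | x \in A].
 rewrite enum_in (H _ [::]) //; congr delta; apply/setP => x. by rewrite inE mem_enum.
elim: s p => [|i s IH] p E. by rewrite /mon /=; congr delta; apply/setP => x; rewrite !inE.
have /IH Hs : enum I = rcons p i ++ s by rewrite E cat_rcons.
have u := enum_uniq I; rewrite E in u.
have [ip iS ps] : [/\ i \notin p, i \notin s & forall x, x \in s -> x \notin p].
 move: u; rewrite cat_uniq /= => /and4P[_ + -> _]. by rewrite negb_or => /andP[-> /hasPn].
rewrite /=; case: ifP => iA; last first. rewrite Hs; congr delta; apply/setP => x; rewrite !inE.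
 by case: eqP => // ->; rewrite iA andbF.
rewrite /mon /= -/(mon _) Hs emul_delta inE (negbTE iS) /=.
have -> : pos i [set x in s | x \in A] = 0%N. apply/eqP; rewrite cards_eq0; apply/eqP/setP => x; rewrite !inE.
 apply/negbTE; rewrite -andbA; apply/negP => /and3P[xs _].
 rewrite E !index_cat (negbTE ip) (negbTE (ps _ xs)) /= eqxx addn0. by rewrite ltnNge leq_addr.
rewrite scale1r; congr delta; apply/setP => x; rewrite !inE.
by case: eqP => // ->; rewrite iA.
Qed.

(** By [mon_enum] monomials span, so identities of linear maps can be checked on lists, where no
    sign occurs until letters are exchanged. *)
Lemma lin_mon I (W : lmodType K) (f g : ext I -> W) : linear f -> linear g ->
 (forall l, f (mon l) = g (mon l)) -> f =1 g.
Proof.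
move=> fl gl H x; rewrite [x]ext_delta (lin_sum fl) (lin_sum gl).
by apply: eq_bigr => A _; rewrite (linZ fl) (linZ gl) -mon_enum H.
Qed.

Lemma evl_mon I (W : lmodType K) (n : I -> W -> W) w0 l : (forall i, linear (n i)) ->
 (forall i w, n i (n i w) = 0) -> (forall i j w, n i (n j w) = - n j (n i w)) -> evl n w0 (mon l) = foldr n w0 l.
Proof.
move=> nl nn nC; elim: l => [|i l IH] /=; last by rewrite /mon /= evl_emul // -IH.
by rewrite /mon /= evl_delta enum_set0.
Qed.

(** ** Products and functoriality *)

(** The universal property with the operators [emul] and starting vector [y]: [x] acts on [y] by
    multiplication. *)
Definition wedge I (x y : ext I) : ext I := evl (@emul I) y x.

Lemma wedge_linl I (y : ext I) : linear (fun x => wedge x y).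
Proof. exact: evl_lin. Qed.

Lemma wedge_linr I (x : ext I) : linear (wedge x).
Proof.
move=> a y z; rewrite /wedge /evl scaler_sumr -big_split; apply: eq_bigr => A _.
by rewrite (foldr_lin (@emul_lin I)) scalerDr !scalerA mulrC.
Qed.

Lemma wedge_mon I l (y : ext I) : wedge (mon l) y = foldr (@emul I) y l.
Proof. by apply: evl_mon; [apply: emul_lin|apply: emul_nn|apply: emulC]. Qed.

Lemma wedge_mon2 I (l l' : seq I) : wedge (mon l) (mon l') = mon (l ++ l').
Proof. by rewrite wedge_mon /mon foldr_cat. Qed.

Lemma lin_comp (U V W : lmodType K) (f : U -> V) (g : V -> W) : linear f -> linear g -> linear (fun x => g (f x)).
Proof. by move=> fl gl a x y; rewrite fl gl. Qed.

Lemma wedgeA I (x y z : ext I) : wedge x (wedge y z) = wedge (wedge x y) z.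
Proof.
apply: (lin_mon (f := fun x => wedge x (wedge y z)) (g := fun x => wedge (wedge x y) z)).
- exact: wedge_linl.
- exact: (lin_comp (wedge_linl y) (wedge_linl z)).
move=> l; apply: (lin_mon (f := fun y => wedge (mon l) (wedge y z)) (g := fun y => wedge (wedge (mon l) y) z)).
- exact: (lin_comp (wedge_linl z) (wedge_linr _)).
- exact: (lin_comp (wedge_linr _) (wedge_linl z)).
by move=> l'; rewrite wedge_mon2 !wedge_mon foldr_cat.
Qed.

Lemma wedge0 I (x : ext I) : wedge (delta set0) x = x.
Proof. exact: (wedge_mon [::]). Qed.

(** The algebra map induced by [p]. It is defined for all [p]: monomials whose letters collide
    vanish because [emul] squares to zero. *)
Definition emap I J (p : I -> J) : ext I -> ext J := evl (fun i => @emul J (p i)) (delta set0).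

Lemma emap_lin I J (p : I -> J) : linear (emap p).
Proof. exact: evl_lin. Qed.

Lemma emap_mon I J (p : I -> J) l : emap p (mon l) = mon (map p l).
Proof.
rewrite /emap evl_mon; first by rewrite /mon foldr_map.
- by move=> i; apply: emul_lin.
- by move=> i w; apply: emul_nn.
- by move=> i j w; apply: emulC.
Qed.

Lemma emap_wedge I J (p : I -> J) x y : emap p (wedge x y) = wedge (emap p x) (emap p y).
Proof.
have el := emap_lin p.
apply: (lin_mon (f := fun x => emap p (wedge x y)) (g := fun x => wedge (emap p x) (emap p y))).
- exact: (lin_comp (wedge_linl y) el).
- exact: (lin_comp el (wedge_linl _)).
move=> l; apply: (lin_mon (f := fun y => emap p (wedge (mon l) y))
 (g := fun y => wedge (emap p (mon l)) (emap p y))).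
- exact: (lin_comp (wedge_linr _) el).
- exact: (lin_comp el (wedge_linr _)).
by move=> l'; rewrite wedge_mon2 !emap_mon wedge_mon2 map_cat.
Qed.

Lemma emap_comp I J (L : finType) (p : I -> J) (r : J -> L) x : emap r (emap p x) = emap (r \o p) x.
Proof.
apply: (lin_mon (f := fun x => emap r (emap p x)) (g := emap (r \o p))).
- exact: (lin_comp (emap_lin p) (emap_lin r)).
- exact: emap_lin.
by move=> l; rewrite !emap_mon map_comp.
Qed.

Lemma eq_emap I J (p r : I -> J) : p =1 r -> emap p =1 emap r.
Proof.
move=> pr; apply: lin_mon; [exact: emap_lin|exact: emap_lin|].
by move=> l; rewrite !emap_mon (eq_map pr).
Qed.

Lemma emap_id I x : emap (@id I) x = x.
Proof.
apply: (lin_mon (f := emap id) (g := id)) => //; first exact: emap_lin.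
by move=> l; rewrite emap_mon map_id.
Qed.

Lemma emap0 I J (p : I -> J) : emap p (delta set0) = delta set0.
Proof. exact: (emap_mon p [::]). Qed.

Lemma mon_swap I (l l' : seq I) : mon (l ++ l') = (-1) ^+ (size l * size l') *: mon (l' ++ l).
Proof.
have one i (k : seq I) w : emul i (foldr (@emul I) w k) = (-1) ^+ size k *: foldr (@emul I) (emul i w) k.
 by apply: foldr_swap; [apply: emul_lin|apply: emulC].
elim: l => [|i l IH]; first by rewrite cats0 scale1r.
rewrite /mon /= -/(mon _) IH (linZ (@emul_lin I i)) /mon foldr_cat one scalerA -exprD.
by rewrite foldr_cat mulSn addnC.
Qed.

(** ** Supports *)

Definition supp I (P : {set I} -> Prop) (x : ext I) : Prop := forall A, x A != 0 -> P A.

Lemma supp_lin I (P : {set I} -> Prop) a x y : supp P x -> supp P y -> supp P (a *: x + y).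
Proof.
move=> Px Py A; rewrite !ffunE; have [xA|/Px//] := eqVneq (x A) 0.
by rewrite xA scaler0 add0r => /Py.
Qed.

Lemma supp_sum I (P : {set I} -> Prop) (T : Type) (r : seq T) (Q : pred T) F :
 (forall t, Q t -> supp P (F t)) -> supp P (\sum_(t <- r | Q t) F t).
Proof.
move=> H; apply: (big_ind (supp P)) => // [A|x y Px Py]. by rewrite ffunE eqxx.
by rewrite -[x]scale1r; apply: supp_lin.
Qed.

Lemma supp_delta I (P : {set I} -> Prop) A : P A -> supp P (delta A).
Proof. by move=> PA B; rewrite ffunE; case: (eqVneq B A) => [->|_]; rewrite ?eqxx. Qed.

Lemma suppZ I (P : {set I} -> Prop) a x : supp P x -> supp P (a *: x).
Proof. by move=> Px A; rewrite ffunE; have [->|/Px] := eqVneq (x A) 0; rewrite ?scaler0 ?eqxx. Qed.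

Lemma mon_uniq I (l : seq I) : uniq l -> exists b : bool, mon l = (-1) ^+ b *: delta [set:: l].
Proof.
elim: l => [|i l IH] /=. by move=> _; exists false; rewrite scale1r; congr delta; apply/setP => x; rewrite !inE.
case/andP=> il /IH[b E]; exists (b (+) odd (pos i [set:: l])).
rewrite /mon /= -/(mon l) E (linZ (@emul_lin I i)) emul_delta inE (negbTE il) scalerA.
rewrite -[X in _ * X]signr_odd signr_addb; congr (_ *: delta _).
by apply/setP => x; rewrite !inE.
Qed.

Lemma mon_nuniq I (l : seq I) : ~~ uniq l -> mon l = 0.
Proof.
elim: l => [|i l IH] //=; rewrite negb_and negbK => /orP[il|/IH E].
 have [s1 [s2 ->]] : exists s1 s2, l = s1 ++ i :: s2 by case/splitPr: il => s1 s2; exists s1, s2.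
 rewrite /mon /= foldr_cat /= foldr_swap; [|exact: emul_lin|exact: emulC].
 by rewrite emul_nn (lin0 (foldr_lin (@emul_lin I) _)) scaler0.
by rewrite /mon /= -/(mon l) E (lin0 (@emul_lin I i)).
Qed.

Lemma delta_wedge I (A B : {set I}) : [disjoint A & B] ->
 exists b : bool, wedge (delta A) (delta B) = (-1) ^+ b *: delta (A :|: B).
Proof.
move=> AB; rewrite -!mon_enum wedge_mon2 mon_enum.
have [|b ->] := @mon_uniq I (enum A ++ enum B).
 rewrite cat_uniq !enum_uniq andbT /=; apply/hasPn => x; rewrite !mem_enum => xB. by rewrite (disjointFl AB).
exists b; congr (_ *: delta _); apply/setP => x.
by rewrite !inE mem_cat !mem_enum.
Qed.

Lemma delta_wedge0 I (A B : {set I}) : ~~ [disjoint A & B] -> wedge (delta A) (delta B) = 0.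
Proof.
move=> AB; rewrite -!mon_enum wedge_mon2 mon_nuniq //.
rewrite cat_uniq !enum_uniq andbT /=; apply: contra AB => /hasPn h.
rewrite disjoint_subset; apply/subsetP => x xA; rewrite !inE; apply/negP => xB.
by have := h x; rewrite !mem_enum xB xA => /(_ isT).
Qed.

Lemma emap_delta I J (p : I -> J) (A : {set I}) : {in A &, injective p} ->
 exists b : bool, emap p (delta A) = (-1) ^+ b *: delta (p @: A).
Proof.
move=> pi; rewrite -mon_enum emap_mon.
have [|b ->] := @mon_uniq J (map p (enum A)).
 by rewrite map_inj_in_uniq ?enum_uniq // => x y; rewrite !mem_enum; apply: pi.
exists b; congr (_ *: delta _); apply/setP => y; rewrite inE.
by apply/mapP/imsetP => -[x]; rewrite ?mem_enum => xA ->; exists x; rewrite ?mem_enum.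
Qed.

Lemma emap_delta0 I J (p : I -> J) (A : {set I}) : ~ {in A &, injective p} -> emap p (delta A) = 0.
Proof.
move=> pi; rewrite -mon_enum emap_mon mon_nuniq //; apply/negP => u; apply: pi => x y xA yA E.
have xe : x \in enum A by rewrite mem_enum.
have ye : y \in enum A by rewrite mem_enum.
suff E2 : index x (enum A) = index y (enum A) by rewrite -(nth_index x ye) -E2 nth_index.
apply/eqP; rewrite -(nth_uniq (p x) _ _ u) ?size_map ?index_mem //.
by rewrite !(nth_map x) ?index_mem // !nth_index // E.
Qed.

Lemma supp_wedge I (P Q R : {set I} -> Prop) x y : supp P x -> supp Q y ->
 (forall A B, P A -> Q B -> [disjoint A & B] -> R (A :|: B)) -> supp R (wedge x y).
Proof.
move=> Px Qy H; rewrite [x]ext_delta [y]ext_delta (lin_sum (wedge_linl _)).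
apply: supp_sum => A _; rewrite (linZ (wedge_linl _)) (lin_sum (wedge_linr _)).
have [->|/Px PA] := eqVneq (x A) 0; first by rewrite scale0r => B; rewrite ffunE eqxx.
apply: suppZ; apply: supp_sum => B _; rewrite (linZ (wedge_linr _)).
have [->|/Qy QB] := eqVneq (y B) 0; first by rewrite scale0r => C; rewrite ffunE eqxx.
apply: suppZ; have [AB|AB] := boolP [disjoint A & B].
 by have [b ->] := delta_wedge AB; apply: suppZ; apply: supp_delta; apply: H.
by rewrite delta_wedge0 // => C; rewrite ffunE eqxx.
Qed.

Lemma supp_emap I J (p : I -> J) (P : {set I} -> Prop) (R : {set J} -> Prop) x : supp P x ->
 (forall A, P A -> {in A &, injective p} -> R (p @: A)) -> supp R (emap p x).
Proof.
move=> Px H; rewrite [x]ext_delta (lin_sum (emap_lin p)).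
apply: supp_sum => A _; rewrite (linZ (emap_lin p)).
have [->|/Px PA] := eqVneq (x A) 0; first by rewrite scale0r => B; rewrite ffunE eqxx.
apply: suppZ; have [pi|pi] := pselect {in A &, injective p}.
 by have [b ->] := emap_delta pi; apply: suppZ; apply: supp_delta; apply: H.
by rewrite emap_delta0 // => C; rewrite ffunE eqxx.
Qed.

(** Only the parities of the supports enter, so that the Koszul sign of homogeneous elements of any
    integer degree is obtained through [deg_odd]. *)
Lemma wedge_comm I (a b : nat) (x y : ext I) :
 supp (fun A => odd #|A| = odd a) x -> supp (fun A => odd #|A| = odd b) y ->
 wedge x y = (-1) ^+ (a * b) *: wedge y x.
Proof.
move=> xa yb; rewrite [x in LHS]ext_delta [in RHS](ext_delta x).
rewrite (lin_sum (wedge_linl _)) (lin_sum (wedge_linr _)) scaler_sumr.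
apply: eq_bigr => A _; rewrite (linZ (wedge_linl _)) (linZ (wedge_linr _)).
have [->|/xa cA] := eqVneq (x A) 0; first by rewrite !scale0r scaler0.
rewrite [RHS]scalerA [_ ^+ _ * _]mulrC -scalerA; congr (_ *: _); rewrite [y in LHS]ext_delta [in RHS](ext_delta y).
rewrite (lin_sum (wedge_linl _)) (lin_sum (wedge_linr _)) scaler_sumr.
apply: eq_bigr => B _; rewrite (linZ (wedge_linl _)) (linZ (wedge_linr _)).
have [->|/yb cB] := eqVneq (y B) 0; first by rewrite !scale0r scaler0.
rewrite [RHS]scalerA [_ ^+ _ * _]mulrC -scalerA; congr (_ *: _); rewrite -!mon_enum !wedge_mon2 mon_swap -!cardE.
by congr (_ *: _); rewrite -signr_odd -[RHS]signr_odd !oddM cA cB.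
Qed.
End Exterior.

(** * Nestings *)

(** The preimage of a set of edges under a contraction: a contracted edge is absorbed as soon as [q]
    meets the vertex to which it shrinks. In this way tubes lift to tubes, and inclusion and
    compatibility are preserved and reflected. *)
Definition lift (T S : graph) (f : gmap T S) (q : {set 'I_(nh S)}) : {set 'I_(nh T)} :=
 psi f @: q :|: [set h in nz f | phi f (vtx T h) \in vtx S @: q].

(** The direct image as a function of the set, so that it can itself be mapped over families of
    sets. *)
Definition himg (A B : finType) (g : A -> B) (q : {set A}) : {set B} := g @: q.

Definition compat (T : graph) (q q' : {set 'I_(nh T)}) : bool :=
 [|| q \subset q', q' \subset q | [disjoint vtx T @: q & vtx T @: q']].

(** A nesting with [k] tubes encodes a composite of [k] generators. Its outermost generator is
    labelled by [full T], which is therefore required whenever there is an edge. *)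
Definition nest (T : graph) (N : {set {set 'I_(nh T)}}) : bool :=
 [&& [forall q in N, tube q], [forall q in N, forall q' in N, compat q q'] & (full T != set0) ==> (full T \in N)].

Lemma nestP (T : graph) (N : {set {set 'I_(nh T)}}) : reflect [/\ forall q, q \in N -> tube q,
   forall q q', q \in N -> q' \in N -> compat q q' & full T != set0 -> full T \in N] (nest N).
Proof.
apply: (iffP and3P) => -[a b c]; split.
- by move=> q qN; apply: (forall_inP a).
- by move=> q q' qN qN'; apply: (forall_inP (forall_inP b _ qN)).
- by move/implyP: c.
- exact/forall_inP.
- by apply/forall_inP => q qN; apply/forall_inP => q'; apply: b.
- exact/implyP.
Qed.

(* The half-edges of the corolla at [q] in the iterated contraction along [N]. *)
Definition resid (T : graph) (N : {set {set 'I_(nh T)}}) (q : {set 'I_(nh T)}) :=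
 q :\: \bigcup_(q' in N | q' \proper q) q'.

(** A local form of maximality: every generator of the corresponding composite lives on a graph with
    one edge. *)
Definition maximal (T : graph) (N : {set {set 'I_(nh T)}}) : bool :=
 [forall q in N, [exists h, resid N q == [set h; opp T h]]].

Definition eset (T : graph) : {set {set 'I_(nh T)}} := [set [set h; opp T h] | h in full T].

Lemma compat_sym (T : graph) (q q' : {set 'I_(nh T)}) : compat q q' = compat q' q.
Proof. by rewrite /compat orbCA disjoint_sym. Qed.

Lemma lift_gid (T : graph) q : lift (gid T) q = q.
Proof.
apply/setP => h; rewrite inE in_set nz_gid in_set0 orbF.
by apply/imsetP/idP => [[k kq ->]|hq]; [|exists h]; rewrite /= ?ffunE.
Qed.

Lemma lift0 (T S : graph) (f : gmap T S) : lift f set0 = set0.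
Proof.
apply/setP => h; rewrite !inE imset0 inE; apply/negbTE.
by rewrite imset0 inE andbF.
Qed.

Section Lift.
Variables (O : opcat).
Implicit Types T S P F G H X : obj O.

Lemma vtx_lift T S (f : arr T S) q v : (v \in vtx T @: lift f q) = (phi f v \in vtx S @: q).
Proof.
have f0 := arr0 f; apply/imsetP/imsetP => [[h + ->]|[k kq vk]].
 rewrite !inE => /orP[/imsetP[k kq ->]|/andP[_ /imsetP[k kq E]]]. by exists k; rewrite // (phi_vtx f0). by exists k.
have c : connect (eadj T (nz f)) v (vtx T (psi f k)). by apply: (arr_conn (arrO f)); rewrite (phi_vtx f0).
case/connectP: c => -[_ E|z p /= /andP[/erelP[h hn [hv _]] _] _]. by exists (psi f k) => //; rewrite inE imset_f.
by exists h => //; rewrite inE; apply/orP; right; rewrite in_set hn hv vk imset_f.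
Qed.

Lemma psi_lift T S (f : arr T S) q k : (psi f k \in lift f q) = (k \in q).
Proof.
rewrite !inE mem_imset; last exact: psi_inj (arr0 f).
by rewrite codom_f /= orbF.
Qed.

Lemma nz_in_lift T S (f : arr T S) q h : h \in nz f -> (h \in lift f q) = (phi f (vtx T h) \in vtx S @: q).
Proof.
move=> hn; rewrite inE in_set hn /= orb_idl // => /imsetP[k _ hk].
by rewrite hk (negbTE (psi_nz f k)) in hn.
Qed.

Lemma lift_comp T S P (f : arr T S) (g : arr S P) (gf : gmap T P) q :
 gf = gcomp g f -> lift gf q = lift f (lift g q).
Proof.
move=> E; apply/setP => h.
have psiE k : psi gf k = psi f (psi g k) by rewrite E /= ffunE.
have phiE v : phi gf v = phi g (phi f v) by rewrite E /= ffunE.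
have psgi : injective (psi gf). by move=> x y; rewrite !psiE => /(psi_inj (arr0 f))/(psi_inj (arr0 g)).
have nzE x : (x \in nz gf) = (x \in nz f) || (x \in psi f @: nz g). by rewrite E (in_nz_comp _ (arr0 f)).
have [hn|/nzPn[k ->]] := boolP (h \in nz f). rewrite nz_in_lift // vtx_lift -phiE inE in_set nzE hn /=.
 rewrite orb_idl // => /imsetP[k _ hk]. by move: hn; rewrite hk psiE (negbTE (psi_nz _ _)).
rewrite psi_lift; have [kn|/nzPn[l ->]] := boolP (k \in nz g).
 rewrite nz_in_lift // inE in_set nzE imset_f // orbT /=.
 rewrite phiE (phi_vtx (arr0 f)) orb_idl // => /imsetP[l _].
 rewrite psiE => /(psi_inj (arr0 f)) kl; by rewrite kl (negbTE (psi_nz _ _)) in kn.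
rewrite psi_lift -psiE inE mem_imset // in_set.
by rewrite (negbTE (psi_nz gf l)) /= orbF.
Qed.

Lemma lift_sub T S (f : arr T S) q q' : (lift f q \subset lift f q') = (q \subset q').
Proof.
apply/subsetP/subsetP => H h. by rewrite -(psi_lift f) => /H; rewrite psi_lift.
have [hn|/nzPn[k ->]] := boolP (h \in nz f); last by rewrite !psi_lift => /H.
rewrite !nz_in_lift // => /imsetP[k kq ->]; by rewrite imset_f // H.
Qed.

Lemma lift_inj T S (f : arr T S) : injective (lift f).
Proof.
by move=> q q' E; apply/eqP; rewrite eqEsubset -!(lift_sub f) E subxx.
Qed.

Lemma lift_proper T S (f : arr T S) q q' : (lift f q \proper lift f q') = (q \proper q').
Proof. by rewrite !properE !lift_sub. Qed.

Lemma lift_eq0 T S (f : arr T S) q : (lift f q == set0) = (q == set0).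
Proof. by rewrite -(lift0 f) (inj_eq (@lift_inj _ _ f)). Qed.

Lemma lift_disjoint T S (f : arr T S) q q' :
 [disjoint vtx T @: lift f q & vtx T @: lift f q'] = [disjoint vtx S @: q & vtx S @: q'].
Proof.
apply/idP/idP => /pred0P H; apply/pred0P => v /=.
 have [w <-] := phi_surj (arr0 f) v; by have := H w; rewrite /= !vtx_lift.
by rewrite !vtx_lift; have := H (phi f v).
Qed.

Lemma compat_lift T S (f : arr T S) q q' : compat (lift f q) (lift f q') = compat q q'.
Proof. by rewrite /compat !lift_sub lift_disjoint. Qed.

Lemma full_vtx S v : full S != set0 -> v \in vtx S @: full S.
Proof.
case/set0Pn=> h hf; have c := iffLR (conn_full S) (objC S) v (vtx S h).
case/connectP: c => -[_ /= <-|z p /= /andP[/erelP[k kf [<- _]] _] _]; exact: imset_f.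
Qed.

Lemma full_nz T S (f : arr T S) k : (psi f k \in full T) = (k \in full S).
Proof. by rewrite !inE -(psi_opp (arr0 f)) (inj_eq (psi_inj (arr0 f))). Qed.

Lemma lift_full T S (f : arr T S) : full S != set0 -> lift f (full S) = full T.
Proof.
move=> S0; apply/setP => h; have [hn|/nzPn[k ->]] := boolP (h \in nz f).
 by rewrite nz_in_lift // full_vtx // (subsetP (nz_full (objO T) (arr0 f))).
by rewrite psi_lift full_nz.
Qed.

Lemma full0_nz T S (f : arr T S) : full S = set0 -> full T = nz f.
Proof.
move=> S0; apply/setP => h; have [hn|/nzPn[k ->]] := boolP (h \in nz f).
 by rewrite (subsetP (nz_full (objO T) (arr0 f))).
by rewrite full_nz S0 inE.
Qed.

(** A path in [S] is lifted edge by edge, and consecutive lifts are joined inside the fibers, which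
    are connected through half-edges absorbed by the lift. *)
Lemma qconn_lift T S (f : arr T S) q : qconn q -> opclosed (opp S) q -> qconn (lift f q).
Proof.
have f0 := arr0 f; move=> qc qo h h' hq hq'.
have vq : phi f (vtx T h) \in vtx S @: q by rewrite -vtx_lift imset_f.
have vq' : phi f (vtx T h') \in vtx S @: q by rewrite -vtx_lift imset_f.
have c : connect (eadj S q) (phi f (vtx T h)) (phi f (vtx T h')).
 by move: vq vq' => /imsetP[k kq ->] /imsetP[k' kq' ->]; apply: qc.
have step v w : phi f v \in vtx S @: q -> phi f v = phi f w -> connect (eadj T (lift f q)) v w.
 move=> vv vw; have c' := arr_conn (arrO f) vw.
 suff [] : phi f w = phi f v /\ connect (eadj T (lift f q)) v w by [].
 apply: (connect_ind (P := fun w => phi f w = phi f v /\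
  connect (eadj T (lift f q)) v w) c'); first by split; last exact: connect0.
 move=> a b [av ca] /erelP[k kn [ka kb]]; split. by rewrite -kb -(nz_eq f0 kn) ka.
 apply: connect_trans ca _; rewrite -ka -kb; apply: connect1 (erel1 _ _ _). by rewrite nz_in_lift // ka av.
suff H : phi f (vtx T h') \in vtx S @: q /\
  forall w, phi f w = phi f (vtx T h') -> connect (eadj T (lift f q)) (vtx T h) w. by apply: H.2.
apply: (connect_ind (P := fun s => s \in vtx S @: q /\
 forall w, phi f w = s -> connect (eadj T (lift f q)) (vtx T h) w) c). by split=> // w E; apply: step.
move=> a b [aq H] /erelP[k kq [ka kb]]; split; first by rewrite -kb imset_f ?qo.
move=> w wb; apply: connect_trans (H (vtx T (psi f k)) _) _; first by rewrite (phi_vtx f0).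
apply: (@connect_trans _ _ (vtx T (opp T (psi f k)))). by apply: connect1 (erel1 _ _ _); rewrite psi_lift.
apply: step; rewrite -(psi_opp f0) (phi_vtx f0) ?kb //.
by rewrite -kb imset_f ?qo.
Qed.

Lemma tube_lift T S (f : arr T S) q : tube q -> tube (lift f q).
Proof.
have f0 := arr0 f; move=> /tubeP[q0 qf qo qc]; apply/tubeP; split.
- by rewrite lift_eq0.
- apply/subsetP => h; have [hn _|/nzPn[k ->]] := boolP (h \in nz f). by rewrite (subsetP (nz_full (objO T) f0)).
 by rewrite psi_lift full_nz => /(subsetP qf).
- move=> h; have [hn|/nzPn[k ->]] := boolP (h \in nz f).
  rewrite !nz_in_lift ?(nz_eq f0 hn) //; exact: nz_closed (objO T) f0 _ hn.
 by rewrite -(psi_opp f0) !psi_lift; apply: qo.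
- exact: qconn_lift.
Qed.

Section ElementaryLift.
Variables (T S : obj O) (f : arr T S) (i : 'I_(nv S)) (F : obj O).
Variables (iv : 'I_(nv F) -> 'I_(nv T)) (ih : 'I_(nh F) -> 'I_(nh T)).
Hypotheses (fe : elementary f i F) (I : fiber_incl f i iv ih).
Let f0 := arr0 f.

Lemma nz_i h : h \in nz f -> phi f (vtx T h) = i. Proof. exact: elem_nz fe. Qed.

Lemma ih_full : ih @: full F = nz f.
Proof. by apply: fiber_nz I _ => h; apply: nz_i. Qed.

Lemma full_nz_set (q : {set 'I_(nh F)}) : q \subset full F -> ih @: q \subset nz f.
Proof. by move=> qf; rewrite -ih_full imsetS. Qed.

Lemma vtx_incl (q : {set 'I_(nh F)}) : vtx T @: (ih @: q) = iv @: (vtx F @: q).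
Proof.
by rewrite -!imset_comp; apply: eq_imset => h; rewrite /= (fi_vtx I).
Qed.

Lemma compat_incl (q q' : {set 'I_(nh F)}) : compat (ih @: q) (ih @: q') = compat q q'.
Proof.
rewrite /compat !vtx_incl; congr [|| _, _ | _].
- apply/subsetP/subsetP => H h hq. by have := H _ (imset_f ih hq); rewrite mem_imset //; apply: ih_inj I.
 by case/imsetP: hq => k /H kq ->; apply: imset_f.
- apply/subsetP/subsetP => H h hq. by have := H _ (imset_f ih hq); rewrite mem_imset //; apply: ih_inj I.
 by case/imsetP: hq => k /H kq ->; apply: imset_f.
- by rewrite imset_disjoint //; apply: iv_inj I.
Qed.

Lemma incl_proper (q q' : {set 'I_(nh F)}) : (ih @: q \proper ih @: q') = (q \proper q').
Proof.
have S1 (p p' : {set 'I_(nh F)}) : (ih @: p \subset ih @: p') = (p \subset p'). apply/subsetP/subsetP => H h hq.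
  by have := H _ (imset_f ih hq); rewrite mem_imset //; apply: ih_inj I.
 by case/imsetP: hq => k /H kq ->; apply: imset_f.
by rewrite !properE !S1.
Qed.

Lemma incl_sub (q q' : {set 'I_(nh F)}) : (ih @: q \subset ih @: q') = (q \subset q').
Proof.
apply/subsetP/subsetP => H h hq. by have := H _ (imset_f ih hq); rewrite mem_imset //; apply: ih_inj I.
by case/imsetP: hq => k /H kq ->; apply: imset_f.
Qed.

Lemma incl_full (q : {set 'I_(nh F)}) : (ih @: q \subset nz f) = (q \subset full F).
Proof. by rewrite -ih_full incl_sub. Qed.

Lemma opp_incl h : h \in full F -> opp T (ih h) = ih (opp F h).
Proof. by move=> hf; rewrite (ih_opp I) -(full_fiber (objO T) f0 I) hf. Qed.

Lemma tube_incl (q : {set 'I_(nh F)}) : q \subset full F -> tube (ih @: q) = tube q.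
Proof.
move=> qf; have ihi := ih_inj I.
have E : opclosed (opp T) (ih @: q) <-> opclosed (opp F) q. split=> H h => [hq|/imsetP[k kq ->]].
  by have := H _ (imset_f ih hq); rewrite opp_incl ?(subsetP qf) // mem_imset.
 by rewrite opp_incl ?(subsetP qf) // mem_imset //; apply: H.
have conE a b : connect (eadj T (ih @: q)) (iv a) (iv b) <-> connect (eadj F q) a b. split=> c.
  suff [b' /(iv_inj I)->//] : exists2 b', iv b = iv b' & connect (eadj F q) a b'.
  apply: (connect_ind (P := fun u => exists2 b', u = iv b' & connect (eadj F q) a b') c).
   by exists a => //; apply: connect0. move=> x y [b' -> cb] /erelP[_ /imsetP[h hp ->] [hx hy]].
  exists (vtx F (opp F h)); first by rewrite -hy opp_incl ?(subsetP qf) // (fi_vtx I).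
  apply: connect_trans cb _; apply/connect1/erelP; exists h => //; split=> //.
  by apply: (iv_inj I); rewrite (fi_vtx I). apply: connect_map c _ => x y /erelP[h hp [<- <-]].
 rewrite !(fi_vtx I) -opp_incl ?(subsetP qf) //. by apply: connect1 (erel1 _ _ _); apply: imset_f.
apply/tubeP/tubeP => -[q0 qf' qo qc]; split=> //.
- by apply: contraNneq q0 => ->; rewrite imset0.
- exact/E.
- move=> h h' hq hq'; apply/conE; rewrite !(fi_vtx I); apply: qc; exact: imset_f.
- by rewrite imset_eq0.
- by apply: subset_trans (nz_full (objO T) f0); rewrite incl_full.
- exact/E.
- move=> _ _ /imsetP[h hq ->] /imsetP[h' hq' ->]; rewrite -!(fi_vtx I). exact/conE/qc.
Qed.

Lemma tube_nz : tube (nz f).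
Proof.
rewrite -ih_full tube_incl //; apply/tubeP; split=> //.
- by have [_ _ + _] := fe; rewrite (nedge_gt0 (objO F)).
- exact: full_closed (objO F).
- by move=> h h' _ _; apply: (iffLR (conn_full F) (objC F)).
Qed.

Lemma vtx_nz v : (v \in vtx T @: nz f) = (phi f v == i).
Proof.
apply/imsetP/eqP => [[h /nz_i hn ->]//|vi].
have [w wE] := iv_ex I vi.
have F0 : full F != set0 by have [_ _ + _] := fe; rewrite (nedge_gt0 (objO F)).
have /imsetP[h hf hw] := full_vtx w F0.
by exists (ih h); rewrite -?(full_fiber (objO T) f0 I) // wE hw (fi_vtx I).
Qed.

Lemma nz_sub_lift (q : {set 'I_(nh S)}) : i \in vtx S @: q -> nz f \subset lift f q.
Proof. by move=> iq; apply/subsetP => h hn; rewrite nz_in_lift // nz_i. Qed.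

Lemma lift_notouch (q : {set 'I_(nh S)}) : i \notin vtx S @: q -> lift f q = psi f @: q.
Proof.
move=> iq; apply/setP => h; have [hn|/nzPn[k ->]] := boolP (h \in nz f).
 rewrite nz_in_lift // nz_i // (negbTE iq); apply/esym/negbTE/negP => /imsetP[k _ hk].
 by rewrite hk (negbTE (psi_nz f k)) in hn.
by rewrite psi_lift mem_imset //; apply: psi_inj f0.
Qed.

Lemma compat_lift_incl q (q2 : {set 'I_(nh F)}) : q2 \subset full F -> compat (lift f q) (ih @: q2).
Proof.
move=> q2f; rewrite /compat; have [iq|iq] := boolP (i \in vtx S @: q).
 by rewrite (subset_trans (full_nz_set q2f) (nz_sub_lift iq)) orbT.
apply/orP; right; apply/orP; right; apply/pred0P => v /=; rewrite vtx_lift.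
apply/negbTE/negP => /andP[vq]; rewrite vtx_incl => /imsetP[w _ vw].
by move: vq; rewrite vw (phi_iv I) (negbTE iq).
Qed.

Lemma lift_not_nz q : q != set0 -> ~~ (lift f q \subset nz f).
Proof.
case/set0Pn=> k kq; apply/subsetPn; exists (psi f k); last exact: psi_nz.
by rewrite psi_lift.
Qed.

(** Outside [nz f] there is nothing to prove. A half-edge of [nz f] belongs to [q] exactly when [q]
    reaches the vertex [i] from outside, and connectedness of [q] provides such a contact. *)
Lemma lift_preim (q : {set 'I_(nh T)}) : q \subset full T -> opclosed (opp T) q -> qconn q -> ~~ (q \subset nz f) ->
 (nz f \subset q) || [disjoint vtx T @: nz f & vtx T @: q] -> q = lift f (psi f @^-1: q).
Proof.
move=> qf qo qc /subsetPn[h0 hq0 hn0] H; apply/setP => h.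
have [hn|/nzPn[k ->]] := boolP (h \in nz f); last by rewrite psi_lift inE.
rewrite nz_in_lift // nz_i //; case/orP: H => [nq|dj]. rewrite (subsetP nq) //; apply/esym.
 (* A half-edge of [q] outside [nz f] attached to the contracted part is needed: either [h0] or the
    one by which a path to [h0] leaves that part. *)
 have c := qc _ _ (subsetP nq _ hn) hq0. have [h0n|h0n] := boolP (vtx T h0 \in vtx T @: nz f).
  have /nzPn[k kE] := hn0; apply/imsetP; exists k; first by rewrite inE -kE.
  by move: h0n; rewrite vtx_nz kE (phi_vtx f0) => /eqP. have [a [b [an bn _ /erelP[k kq [ka kb]]]]] :=
  @connect_cross _ _ (mem (vtx T @: nz f)) _ _ c (imset_f _ hn) h0n. have kn : k \notin nz f.
  by apply: contra bn => kn; rewrite -kb imset_f // (nz_closed (objO T) f0).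
 have /nzPn[l lE] := kn; apply/imsetP; exists l; first by rewrite inE -lE.
 by move: an; rewrite vtx_nz -ka lE (phi_vtx f0) => /eqP.
have hq : h \notin q. apply/negP => hq; move/pred0P: dj => /(_ (vtx T h)) /=. by rewrite !imset_f.
rewrite (negbTE hq); apply/esym/negbTE/negP => /imsetP[k]; rewrite inE => kq ki.
move/pred0P: dj => /(_ (vtx T (psi f k))) /=.
by rewrite vtx_nz (phi_vtx f0) -ki eqxx imset_f.
Qed.

Lemma tube_preim (q : {set 'I_(nh T)}) : tube q -> ~~ (q \subset nz f) -> tube (psi f @^-1: q).
Proof.
move=> /tubeP[q0 qf qo qc] qn; apply/tubeP; split.
- have /subsetPn[h hq /nzPn[k kE]] := qn. by apply/set0Pn; exists k; rewrite inE -kE.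
- by apply/subsetP => k; rewrite inE => /(subsetP qf); rewrite full_nz.
- by move=> k; rewrite !inE (psi_opp f0); apply: qo.
- move=> k k'; rewrite !inE => kq kq'; have c := qc _ _ kq kq'.
 rewrite -!(phi_vtx f0); apply: connect_map c _ => a b /erelP[h hq [<- <-]].
 have [hn|/nzPn[l lE]] := boolP (h \in nz f). by rewrite (nz_eq f0 hn); apply: connect0.
 rewrite lE -(psi_opp f0) !(phi_vtx f0); apply: connect1 (erel1 _ _ _). by rewrite inE -lE.
Qed.

(** The dichotomy on which unique decomposition rests: relative to a contraction, a compatible tube
    lives either in the fiber or in the target. *)
Lemma tube_cases (q : {set 'I_(nh T)}) : tube q -> compat q (nz f) ->
 (exists q2, [/\ tube q2, q2 \subset full F & q = ih @: q2]) \/ (exists2 q1, tube q1 & q = lift f q1).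
Proof.
move=> qt qn; have [q0 qf qo qc] := tubeP _ qt.
have [sub|sub] := boolP (q \subset nz f); [left|right]. have E : q = ih @: (ih @^-1: q).
  apply/setP => h; apply/idP/imsetP => [hq|[k + ->]]; last by rewrite inE.
  have [k hk] : exists k, h = ih k by apply: (ih_ex I); apply/nz_i/(subsetP sub). by exists k; rewrite // inE -hk.
 have sf : ih @^-1: q \subset full F by rewrite -incl_full -E.
 by exists (ih @^-1: q); split=> //; rewrite -tube_incl // -E.
exists (psi f @^-1: q); first exact: tube_preim.
apply: lift_preim => //; move: qn; rewrite /compat (negbTE sub) /=.
by rewrite disjoint_sym.
Qed.

Definition join_nest (N1 : {set {set 'I_(nh S)}}) (N2 : {set {set 'I_(nh F)}}) := lift f @: N1 :|: himg ih @: N2.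

Lemma nest_sub T' (N : {set {set 'I_(nh (T' : obj O))}}) q : nest N -> q \in N -> q \subset full T'.
Proof. by case/nestP=> t _ _ /t/tubeP[]. Qed.

Lemma full_F : full F != set0.
Proof. by have [_ _ + _] := fe; rewrite (nedge_gt0 (objO F)). Qed.

Lemma nz_join N1 N2 : nest N2 -> nz f \in join_nest N1 N2.
Proof.
case/nestP=> _ _ /(_ full_F) fN; rewrite inE; apply/orP; right.
by apply/imsetP; exists (full F); rewrite // /himg ih_full.
Qed.

Lemma nest_join N1 N2 : nest N1 -> nest N2 -> nest (join_nest N1 N2).
Proof.
move=> n1 n2; have [t1 c1 f1] := nestP _ n1; have [t2 c2 f2] := nestP _ n2.
have s2 q : q \in N2 -> q \subset full F by apply: nest_sub.
apply/nestP; split.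
- move=> q; rewrite inE => /orP[/imsetP[q1 /t1 qt ->]|/imsetP[q2 q2N ->]]. exact: tube_lift.
 by rewrite tube_incl ?s2 // t2.
- move=> q q'; rewrite !inE. case/orP=> /imsetP[q1 q1N ->]; case/orP=> /imsetP[q1' q1N' ->].
 + by rewrite compat_lift c1.
 + by rewrite compat_lift_incl ?s2.
 + by rewrite compat_sym compat_lift_incl ?s2.
 + by rewrite compat_incl c2.
- move=> _; rewrite inE; have [S0|S0] := eqVneq (full S) set0; last first. by rewrite -(lift_full f S0) imset_f ?f1.
 by have := nz_join N1 n2; rewrite (full0_nz f S0) inE.
Qed.

(** Inverse to [nest_join]: a nesting that contains the contracted tube separates, by [tube_cases],
    into an outer and an inner nesting. *)
Lemma nest_split N : nest N -> nz f \in N -> exists N1 N2, [/\ nest N1, nest N2 & N = join_nest N1 N2].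
Proof.
move=> nN nzN; have [t c ff] := nestP _ nN.
pose N1 := [set q1 | lift f q1 \in N & q1 != set0].
pose N2 := [set q2 : {set 'I_(nh F)} | ih @: q2 \in N & q2 \subset full F].
have t1 q1 : q1 \in N1 -> tube q1. rewrite inE => /andP[/t qt q0]; have := tube_preim qt (lift_not_nz q0).
 have -> // : psi f @^-1: lift f q1 = q1. by apply/setP => k; rewrite inE psi_lift.
exists N1, N2; split.
- apply/nestP; split=> //.
 + move=> q q'; rewrite !inE => /andP[qN _] /andP[qN' _]. by rewrite -(compat_lift f) c.
 + move=> S0; rewrite inE S0 andbT lift_full // ff //. by rewrite -(lift_full f S0) lift_eq0.
- apply/nestP; split.
 + by move=> q; rewrite inE => /andP[/t + qf]; rewrite tube_incl.
 + move=> q q'; rewrite !inE => /andP[qN _] /andP[qN' _]. by rewrite -compat_incl c.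
 + by move=> _; rewrite inE ih_full nzN subxx.
- apply/setP => q; rewrite inE; apply/idP/orP => [qN|]. have := tube_cases (t _ qN) (c _ _ qN nzN).
  case=> [[q2 [q2t q2f qE]]|[q1 q1t qE]]; [right|left]; apply/imsetP. by exists q2; rewrite // inE -qE qN q2f.
  by exists q1; rewrite // inE -qE qN; case/tubeP: q1t. by case=> /imsetP[q']; rewrite inE => /andP[+ _] ->.
Qed.

(** The corollas of a joined nesting are those of its two parts: contracted edges absorbed by a lift
    are removed again, because the smaller tube [nz f] belongs to the nesting. *)
Lemma resid_lift N1 N2 q : nest N1 -> nest N2 -> q \in N1 ->
 resid (join_nest N1 N2) (lift f q) = psi f @: resid N1 q.
Proof.
move=> n1 n2 qN; have [t1 _ _] := nestP _ n1; have [_ _ f2] := nestP _ n2.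
have q0 : q != set0 by case/tubeP: (t1 _ qN).
apply/setP => h; have [hn|/nzPn[k ->]] := boolP (h \in nz f). have -> : (h \in psi f @: resid N1 q) = false.
  by apply/negbTE/negP => /imsetP[k _ hk]; rewrite hk (negbTE (psi_nz f k)) in hn.
 rewrite inE nz_in_lift // nz_i //; case iq: (i \in _); rewrite ?andbF // andbT.
 apply/negbTE; rewrite negbK; apply/bigcupP; exists (nz f) => //.
 by rewrite nz_join // properE nz_sub_lift // lift_not_nz.
rewrite mem_imset; last exact: psi_inj f0.
rewrite !in_setD psi_lift; congr (~~ _ && _); apply/bigcupP/bigcupP => [[q' /andP[]]|[q' /andP[qN' qp] kq]].
 rewrite inE => /orP[/imsetP[q1 q1N ->]|/imsetP[q2 q2N ->]].
  by rewrite lift_proper psi_lift => qp kq; exists q1; rewrite ?q1N. have q2f := nest_sub n2 q2N.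
 by move=> _ /(subsetP (full_nz_set q2f)); rewrite (negbTE (psi_nz f k)).
by exists (lift f q'); rewrite ?psi_lift // lift_proper qp inE imset_f.
Qed.

Lemma resid_incl N1 N2 q : nest N1 -> nest N2 -> q \in N2 -> resid (join_nest N1 N2) (ih @: q) = ih @: resid N2 q.
Proof.
move=> n1 n2 qN; have [t1 _ _] := nestP _ n1.
have ihi := ih_inj I; have qf := nest_sub n2 qN.
apply/setP => h; apply/idP/imsetP => [|[k kr ->]].
 rewrite inE => /andP[hN /imsetP[k kq hk]]; exists k => //; rewrite inE kq andbT.
 apply: contra hN => /bigcupP[q' /andP[qN' qp] kq']; apply/bigcupP; exists (ih @: q').
  by rewrite incl_proper qp andbT inE (imset_f (himg ih)) ?orbT. by rewrite hk imset_f.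
move: kr; rewrite !inE mem_imset // => /andP[kN ->]; rewrite andbT.
apply: contra kN => /bigcupP[q' /andP[]].
rewrite inE => /orP[/imsetP[q1 q1N ->]|/imsetP[q2 q2N ->]]. have q10 : q1 != set0 by case/tubeP: (t1 _ q1N).
 move=> /proper_sub sub; have := lift_not_nz q10. by rewrite (subset_trans sub (full_nz_set qf)).
rewrite incl_proper mem_imset // => qp kq; apply/bigcupP; exists q2 => //.
by rewrite q2N.
Qed.

Lemma maximal_join N1 N2 : nest N1 -> nest N2 -> maximal (join_nest N1 N2) = maximal N1 && maximal N2.
Proof.
move=> n1 n2; have ihi := ih_inj I; have pi := psi_inj f0.
have pimg : injective (fun A : {set 'I_(nh S)} => psi f @: A) by apply: imset_inj.
have iimg : injective (fun A : {set 'I_(nh F)} => ih @: A) by apply: imset_inj.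
have e1 k : psi f @: [set k; opp S k] = [set psi f k; opp T (psi f k)]. by rewrite imsetU1 imset_set1 (psi_opp f0).
have e2 k : k \in full F -> ih @: [set k; opp F k] = [set ih k; opp T (ih k)].
 by move=> kf; rewrite imsetU1 imset_set1 opp_incl.
have in1 q : q \in N1 -> lift f q \in join_nest N1 N2 by move=> qN; rewrite inE imset_f.
have in2 q : q \in N2 -> ih @: q \in join_nest N1 N2. by move=> qN; rewrite inE (imset_f (himg ih)) ?orbT.
apply/idP/andP => [/forall_inP m|[/forall_inP m1 /forall_inP m2]]. split; apply/forall_inP => q qN.
  have /existsP[h /eqP] := m _ (in1 _ qN); rewrite resid_lift // => E.
  have : h \in psi f @: resid N1 q by rewrite E !inE eqxx.
  case/imsetP=> k kr hk; apply/existsP; exists k; apply/eqP/pimg. by rewrite /= E hk -e1.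
 have /existsP[h /eqP] := m _ (in2 _ qN); rewrite resid_incl // => E.
 have : h \in ih @: resid N2 q by rewrite E !inE eqxx.
 case/imsetP=> k kr hk; apply/existsP; exists k; apply/eqP/iimg.
 rewrite /= E hk -e2 // (subsetP (nest_sub n2 qN)) //. by move: kr; rewrite inE => /andP[].
apply/forall_inP => q; rewrite inE => /orP[/imsetP[q1 qN ->]|/imsetP[q2 qN ->]].
 have /existsP[k /eqP kE] := m1 _ qN; apply/existsP; exists (psi f k). by rewrite resid_lift // kE e1.
have /existsP[k /eqP kE] := m2 _ qN; apply/existsP; exists (ih k).
rewrite resid_incl // kE e2 // (subsetP (nest_sub n2 qN)) //.
have : k \in resid N2 q2 by rewrite kE !inE eqxx.
by rewrite inE => /andP[].
Qed.

Lemma eset_join : eset T = himg (psi f) @: eset S :|: himg ih @: eset F.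
Proof.
apply/setP => A; rewrite inE; apply/imsetP/orP => [[h hf ->]|[]].
- have [hn|/nzPn[k hk]] := boolP (h \in nz f); [right|left]; apply/imsetP.
  have [k hk] : exists k, h = ih k by apply: (ih_ex I); apply: nz_i.
  have kf : k \in full F by rewrite (full_fiber (objO T) f0 I) -hk. exists [set k; opp F k]; first exact: imset_f.
  by rewrite /himg imsetU1 imset_set1 -opp_incl // hk.
 exists [set k; opp S k]; first by apply: imset_f; rewrite -(full_nz f) -hk.
 by rewrite /himg imsetU1 imset_set1 (psi_opp f0) hk.
- case/imsetP=> _ /imsetP[k kf ->] ->; exists (psi f k); rewrite ?full_nz //.
 by rewrite /himg imsetU1 imset_set1 (psi_opp f0).
- case/imsetP=> _ /imsetP[k kf ->] ->; exists (ih k). rewrite (subsetP (nz_full (objO T) f0)) //.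
  by rewrite -(full_fiber (objO T) f0 I). by rewrite /himg imsetU1 imset_set1 opp_incl.
Qed.

Lemma join_disjoint N1 N2 : nest N1 -> nest N2 -> [disjoint lift f @: N1 & himg ih @: N2].
Proof.
move=> n1 n2; have [t1 _ _] := nestP _ n1.
apply/pred0P => q /=; apply/negbTE/negP => /andP[/imsetP[q1 q1N ->] /imsetP[q2 q2N E]].
have q10 : q1 != set0 by case/tubeP: (t1 _ q1N).
have := lift_not_nz q10; rewrite E (full_nz_set (nest_sub n2 q2N)) //.
Qed.

Lemma eset_disjoint : [disjoint himg (psi f) @: eset S & himg ih @: eset F].
Proof.
apply/pred0P => A /=; apply/negbTE/negP => /andP[/imsetP[_ /imsetP[k kf ->] ->]].
case/imsetP=> _ /imsetP[l lf ->]; rewrite /himg !imsetU1 !imset_set1 => E.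
have : psi f k \in [set ih l; ih (opp F l)] by rewrite -E !inE eqxx.
have ln : ih l \in nz f by rewrite -(full_fiber (objO T) f0 I).
have ln' : ih (opp F l) \in nz f. by rewrite -opp_incl // (nz_closed (objO T) f0).
by rewrite !inE => /orP[] /eqP E'; [move: ln|move: ln']; rewrite -E' (negbTE (psi_nz f k)).
Qed.
End ElementaryLift.

Section IsoLift.
Variables (T S : obj O) (f : arr T S).
Hypothesis fi : iso f.
Let f0 := arr0 f.
Let fn : nz f = set0. Proof. exact/iso_nz. Qed.

Lemma lift_iso q : lift f q = psi f @: q.
Proof.
apply/setP => h; rewrite inE in_set fn in_set0 orbF //.
Qed.

Lemma nest_iso N : nest N -> nest (lift f @: N).
Proof.
case/nestP=> t c ff; apply/nestP; split.
- by move=> _ /imsetP[q /t qt ->]; apply: tube_lift.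
- by move=> _ _ /imsetP[q qN ->] /imsetP[q' qN' ->]; rewrite compat_lift c.
- have [S0|S0] := eqVneq (full S) set0; first by rewrite (full0_nz f S0) fn eqxx.
 by rewrite -(lift_full f S0) imset_f ?ff.
Qed.

Lemma maximal_iso N : maximal N -> maximal (lift f @: N).
Proof.
move/forall_inP=> m; apply/forall_inP => _ /imsetP[q qN ->].
have /existsP[k /eqP kE] := m _ qN; apply/existsP; exists (psi f k).
have -> : resid (lift f @: N) (lift f q) = lift f (resid N q). apply/setP => h; have [l ->] := iso_psi_surj h fi.
 rewrite psi_lift !in_setD psi_lift; congr (~~ _ && _).
 apply/bigcupP/bigcupP => [[_ /andP[/imsetP[q' qN' ->] qp]]|[q' /andP[qN' qp] lq]].
  by rewrite psi_lift => lq; exists q'; rewrite // qN' -(lift_proper f).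
 by exists (lift f q'); rewrite ?psi_lift // imset_f // lift_proper.
by rewrite kE lift_iso imsetU1 imset_set1 (psi_opp f0).
Qed.

Lemma eset_iso : eset T = himg (psi f) @: eset S.
Proof.
apply/setP => A; apply/imsetP/imsetP => [[h hf ->]|[_ /imsetP[k kf ->] ->]].
 have [k hk] := iso_psi_surj h fi; exists [set k; opp S k]. by apply: imset_f; rewrite -(full_nz f) -hk.
 by rewrite /himg imsetU1 imset_set1 (psi_opp f0) hk.
by exists (psi f k); rewrite ?full_nz // /himg imsetU1 imset_set1 (psi_opp f0).
Qed.
End IsoLift.
End Lift.

(** * Graded subspaces of exterior algebras *)

Section GradedSub.
Variables (K : fieldType) (I : finType) (V : pred {set I}) (d : {set I} -> int).
Implicit Types (A : {set I}) (y : ext K I).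

(** Coordinates are indexed by the valid sets alone. Computations take place in the whole exterior
    algebra, reached by [emb] and left by [prj]. *)
Definition gcar := {ffun {A | V A} -> K^o}.
Definition gcar_proj n (x : gcar) : gcar := [ffun a => if d (val a) == n then x a else 0].

Lemma gcar_proj_lin n : linear (gcar_proj n).
Proof.
move=> a x y; apply/ffunP => b; rewrite !ffunE.
by case: ifP => // _; rewrite scaler0 addr0.
Qed.

Lemma gcar_projE m n x : gcar_proj m (gcar_proj n x) = if m == n then gcar_proj n x else 0.
Proof.
apply/ffunP => b; case: (eqVneq m n) => [->|mn]; rewrite !ffunE; first by case: (_ == n).
by case: eqP => // ->; rewrite (negbTE mn).
Qed.

Lemma gcar_sum x : exists2 s : seq int, uniq s & x = \sum_(n <- s) gcar_proj n x.
Proof.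
exists (undup [seq d (val b) | b <- enum {: {A | V A}}]); first exact: undup_uniq.
apply/ffunP => b; rewrite sum_ffunE (bigD1_seq (d (val b))) ?undup_uniq //=; last first.
 by rewrite mem_undup; apply: map_f; rewrite mem_enum.
rewrite !ffunE eqxx big1 ?addr0 // => n; rewrite ffunE eq_sym => /negbTE -> //.
Qed.

Definition gsub : gvs K := Gvs gcar_proj_lin gcar_projE gcar_sum.

Definition emb (x : gsub) : ext K I := [ffun A => if insub A is Some a then (x : gcar) a else 0].
Definition prj (y : ext K I) : gsub := [ffun a => y (val a)] : gcar.

Lemma emb_lin : linear emb.
Proof.
move=> a x y; apply/ffunP => A; rewrite !ffunE.
by case: insubP => [b _ _|_]; rewrite ?ffunE // scaler0 addr0.
Qed.

Lemma emb_prj y : emb (prj y) = [ffun A => if V A then y A else 0].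
Proof.
apply/ffunP => A; rewrite !ffunE.
by case: insubP => [b Vb <-|/negbTE -> //]; rewrite ffunE (valP b).
Qed.

Lemma embK x : prj (emb x) = x.
Proof. by apply/ffunP => a; rewrite !ffunE valK. Qed.

Lemma emb_inj : injective emb.
Proof. exact: can_inj embK. Qed.

Lemma prjK y : supp V y -> emb (prj y) = y.
Proof.
move=> s; rewrite emb_prj; apply/ffunP => A; rewrite ffunE.
by case: ifP => // /negbT nV; apply/esym/eqP; apply: contraNT nV => /s.
Qed.

Lemma emb_supp x : supp V (emb x).
Proof.
move=> A; rewrite ffunE; case: insubP => [b Vb _ _|_]; first exact: Vb.
by rewrite eqxx.
Qed.

Lemma homog_emb n (x : gsub) : homog n x <-> supp (fun A => d A = n) (emb x).
Proof.
split=> [h A|s]. rewrite -h ffunE; case: insubP => [b _ <-|_]; last by rewrite eqxx.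
 by rewrite ffunE; case: (d (val b) =P n) => // _; rewrite eqxx.
apply/ffunP => b; rewrite ffunE; case: eqP => // nb.
apply/esym/eqP; apply: contra_notT nb => xb; apply: s.
by rewrite ffunE valK.
Qed.

Lemma emb_gproj n (x : gsub) : emb (gproj n x) = [ffun A => if d A == n then emb x A else 0].
Proof.
apply/ffunP => A; rewrite !ffunE.
by case: insubP => [b _ <-|_]; rewrite ?ffunE // if_same.
Qed.

Lemma gsub_fin : fin_dim gsub.
Proof.
exists [seq [ffun b => (b == a)%:R] : gsub | a <- enum {: {A | V A}}] => x.
exists (fun i => oapp (x : gcar) 0 (onth (enum {: {A | V A}}) i)).
rewrite -(big_mkord xpredT
 (fun i => oapp (x : gcar) 0 (onth (enum {: {A | V A}}) i) *: [seq [ffun b => (b == a)%:R] : gsub | a <- enum {: {A | V A}}]`_i)).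
rewrite size_map; apply/ffunP => b; rewrite sum_ffunE big_mkord.
have bi : (index b (enum {: {A | V A}}) < size (enum {: {A | V A}}))%N by rewrite index_mem mem_enum.
rewrite (bigD1 (Ordinal bi)) //= big1 => [|i ib]. rewrite addr0 (nth_map b) // !ffunE nth_index ?mem_enum //.
 by rewrite onthE (nth_map b) //= nth_index ?mem_enum // eqxx; apply/esym/mulr1.
rewrite (nth_map b) // !ffunE.
case: eqP => [e|_]; last exact: mulr0.
case/eqP: ib; apply: val_inj => /=; rewrite e index_uniq ?enum_uniq //.
Qed.
End GradedSub.
Notation embl := (@emb_lin _ _ _ _).

(** A basis vector up to a nonzero scalar, so that the signs of [wedge] and [emap] need not be
    followed where only uniqueness up to scalars matters. *)
Definition bas (K : fieldType) (I : finType) (A : {set I}) (y : ext K I) : Prop :=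
 exists2 a : K, a != 0 & y = a *: delta K A.

Section Bas.
Variable K : fieldType.
Implicit Types I J : finType.

Lemma sgn_neq0 (b : bool) : (-1) ^+ b != 0 :> K.
Proof. by case: b; rewrite ?expr0 ?expr1 ?oppr_eq0 oner_neq0. Qed.

Lemma basZ I (A : {set I}) (y : ext K I) a : a != 0 -> bas A y -> bas A (a *: y).
Proof. by move=> a0 [b b0 ->]; exists (a * b); rewrite ?scalerA // mulf_neq0. Qed.

Lemma bas_delta I (A : {set I}) : bas A (delta K A).
Proof. by exists 1; rewrite ?oner_neq0 ?scale1r. Qed.

Lemma delta_neq0 I (A : {set I}) : delta K A != 0.
Proof. by apply/eqP => /ffunP /(_ A)/eqP; rewrite !ffunE eqxx oner_eq0. Qed.

Lemma bas_eq I (A B : {set I}) (y : ext K I) : bas A y -> bas B y -> A = B.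
Proof.
move=> [a a0 ->] [b b0] /ffunP /(_ A)/eqP; rewrite !ffunE eqxx.
case: (eqVneq A B) => // _; rewrite /GRing.scale /= mulr1 mulr0 => /eqP e.
by rewrite e eqxx in a0.
Qed.

Lemma bas_neq0 I (A : {set I}) (y : ext K I) : bas A y -> y != 0.
Proof. by move=> [a a0 ->]; rewrite scaler_eq0 negb_or a0 delta_neq0. Qed.

Lemma bas_wedge I (A B : {set I}) (x y : ext K I) : [disjoint A & B] ->
 bas A x -> bas B y -> bas (A :|: B) (wedge x y).
Proof.
move=> dis [a a0 ->] [b b0 ->]; have [c cE] := delta_wedge K dis.
rewrite (linZ (wedge_linl _)) (linZ (wedge_linr _)) cE !scalerA.
by exists (a * b * (-1) ^+ c) => //; rewrite !mulf_neq0 ?sgn_neq0.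
Qed.

Lemma bas_emap I J (p : I -> J) (A : {set I}) (x : ext K I) : {in A &, injective p} ->
 bas A x -> bas (p @: A) (emap p x).
Proof.
move=> pi [a a0 ->]; have [c cE] := emap_delta K pi.
rewrite (linZ (@emap_lin K _ _ _)) cE scalerA.
by exists (a * (-1) ^+ c); rewrite // mulf_neq0 ?sgn_neq0.
Qed.
End Bas.

(** * Operads of nestings *)

(** The flag separates an edge from the tube consisting of that edge, since both can occur in the
    same set. *)
Definition sym (T : graph) : finType := (bool * {set 'I_(nh T)})%type.
Definition edges (T : graph) (A : {set sym T}) := [set e | (false, e) \in A].
Definition tubes (T : graph) (A : {set sym T}) := [set q | (true, q) \in A].

(* The spaces of the operads below are spanned by sets of odd symbols: if [fedge],
   all edges of the graph; if [ftube], the tubes of a nesting, which is maximal if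
   [fmax].  A tube has degree [fdeg]. *)
Record flags := Flags { fedge : bool; ftube : bool; fmax : bool; fdeg : int }.

Definition valid (fl : flags) (T : graph) (A : {set sym T}) : bool :=
 (edges A == if fedge fl then eset T else set0) &&
 if ftube fl then nest (tubes A) && (fmax fl ==> maximal (tubes A)) else tubes A == set0.

Definition deg (fl : flags) (T : graph) (A : {set sym T}) : int := #|edges A|%:Z + fdeg fl * #|tubes A|%:Z.

(** An edge is carried along [psi], whereas a tube must absorb the contracted edges that it touches;
    hence [lift] for tubes. *)
Definition smap (T S : graph) (f : gmap T S) (s : sym S) : sym T := (s.1, if s.1 then lift f s.2 else psi f @: s.2).

Definition imap (T F : graph) (ih : 'I_(nh F) -> 'I_(nh T)) (s : sym F) : sym T := (s.1, ih @: s.2).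

Lemma symU (T : graph) (A B : {set sym T}) :
 edges (A :|: B) = edges A :|: edges B /\ tubes (A :|: B) = tubes A :|: tubes B.
Proof. by split; apply/setP => e; rewrite !inE. Qed.

Lemma edges_smap (T S : graph) (f : gmap T S) (A : {set sym S}) : edges (smap f @: A) = himg (psi f) @: edges A.
Proof.
apply/setP => e; rewrite inE; apply/imsetP/imsetP => [[[[] q] // qA [->]]|[q]]. by exists q; rewrite ?inE.
by rewrite inE => qA ->; exists (false, q).
Qed.

Lemma tubes_smap (T S : graph) (f : gmap T S) (A : {set sym S}) : tubes (smap f @: A) = lift f @: tubes A.
Proof.
apply/setP => e; rewrite inE; apply/imsetP/imsetP => [[[[] q] // qA [->]]|[q]]. by exists q; rewrite ?inE.
by rewrite inE => qA ->; exists (true, q).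
Qed.

Lemma edges_imap (T F : graph) (ih : 'I_(nh F) -> 'I_(nh T)) (A : {set sym F}) :
 edges (imap ih @: A) = himg ih @: edges A.
Proof.
apply/setP => e; rewrite inE; apply/imsetP/imsetP => [[[[] q] // qA [->]]|[q]]. by exists q; rewrite ?inE.
by rewrite inE => qA ->; exists (false, q).
Qed.

Lemma tubes_imap (T F : graph) (ih : 'I_(nh F) -> 'I_(nh T)) (A : {set sym F}) :
 tubes (imap ih @: A) = himg ih @: tubes A.
Proof.
apply/setP => e; rewrite inE; apply/imsetP/imsetP => [[[[] q] // qA [->]]|[q]]. by exists q; rewrite ?inE.
by rewrite inE => qA ->; exists (true, q).
Qed.

Lemma sym_eq (T : graph) (A B : {set sym T}) : edges A = edges B -> tubes A = tubes B -> A = B.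
Proof.
move=> /setP e /setP t; apply/setP => -[[] q]. by have := t q; rewrite !inE.
by have := e q; rewrite !inE.
Qed.

Lemma card_sym (T : graph) (A : {set sym T}) : #|A| = (#|edges A| + #|tubes A|)%N.
Proof.
pose B (b : bool) := [set (b, q) | q in [set q | (b, q) \in A]].
have Bc b : #|B b| = #|[set q | (b, q) \in A]| by apply: card_imset => q q' [].
have -> : A = B false :|: B true. apply/setP => -[b q]; rewrite inE; apply/idP/orP.
  by case: b => qA; [right|left]; apply/imsetP; exists q; rewrite ?inE.
 by case=> /imsetP[q']; rewrite inE => q'A [-> ->].
rewrite cardsU disjoint_setI0 ?cards0 ?subn0. rewrite !Bc; congr (_ + _)%N; apply: eq_card => q; rewrite !inE.
  apply/idP/orP=> [h|]; first by left; apply/imsetP; exists q; rewrite ?inE.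
  by case=> /imsetP[q']; rewrite inE => h [] // ->.
 apply/idP/orP=> [h|]; first by right; apply/imsetP; exists q; rewrite ?inE.
 by case=> /imsetP[q']; rewrite inE => h [] // ->.
apply/pred0P => s /=; apply/negbTE/negP => /andP[/imsetP[q _ ->] /imsetP[q' _]] //.
Qed.

Lemma smap_inj O (T S : obj O) (f : arr T S) : injective (smap f).
Proof.
move=> [[] q] [[] q'] //= [] h; congr pair; first exact: (lift_inj (f := f)).
exact: imset_inj (psi_inj (arr0 f)) _ _ h.
Qed.

Lemma imap_inj (T F : graph) (ih : 'I_(nh F) -> 'I_(nh T)) : injective ih -> injective (imap ih).
Proof. by move=> ii [b q] [b' q'] [-> /(imset_inj ii) ->]. Qed.

Section Induced.
Variable O : opcat.
Implicit Types T S P F G H : obj O.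

Lemma smap_comp T S P (f : arr T S) (g : arr S P) (gf : gmap T P) : gf = gcomp g f -> smap gf =1 smap f \o smap g.
Proof.
move=> E [[] q]; rewrite /smap /=; first by rewrite (lift_comp _ E).
by rewrite E -imset_comp; congr pair; apply: eq_imset => h; rewrite /= ffunE.
Qed.

Lemma smap_gid (T : graph) : smap (gid T) =1 id.
Proof.
move=> [[] q]; rewrite /smap /= ?lift_gid //; congr pair.
by rewrite -[RHS]imset_id; apply: eq_imset => h; rewrite ffunE.
Qed.

Section Ind.
Variables (T S P : obj O) (f : arr T S) (g : arr S P) (gf : arr T P).
Hypothesis gfE : amap gf = gcomp g f.
Variables (i : 'I_(nv P)) (H G : obj O).
Variables (iv : 'I_(nv H) -> 'I_(nv T)) (ih : 'I_(nh H) -> 'I_(nh T)).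
Variables (jv : 'I_(nv G) -> 'I_(nv S)) (jh : 'I_(nh G) -> 'I_(nh S)).
Hypotheses (I : fiber_incl gf i iv ih) (J : fiber_incl g i jv jh).
Variable fi : arr H G.
Hypothesis fiv : forall w, jv (phi fi w) = phi f (iv w).
Hypothesis fih : forall h, ih (psi fi h) = psi f (jh h).

Lemma smap_induced : imap ih \o smap fi =1 smap f \o imap jh.
Proof.
have im (q : {set 'I_(nh G)}) : ih @: (psi fi @: q) = psi f @: (jh @: q).
 by rewrite -!imset_comp; apply: eq_imset => h /=; rewrite fih.
move=> [[] q]; rewrite /imap /smap /= ?im //; congr pair.
rewrite /lift imsetU im; congr (_ :|: _); apply/setP => h; rewrite inE.
have vj : vtx S @: (jh @: q) = jv @: (vtx G @: q).
 by rewrite -!imset_comp; apply: eq_imset => k /=; rewrite (fi_vtx J).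
apply/imsetP/andP => [[k]|[hn hq]]. rewrite inE (nz_induced gfE I J fih) => /andP[kn kq] ->; split=> //.
 by rewrite vj -(fi_vtx I) -fiv imset_f.
have [k hk] : exists k, h = ih k. apply: (ih_ex I); move: hq; rewrite vj => /imsetP[v _ hv].
 by rewrite (phi_comp _ gfE) hv (phi_iv J).
exists k => //; rewrite inE (nz_induced gfE I J fih) -hk hn /=.
by move: hq; rewrite vj hk -(fi_vtx I) -fiv mem_imset //; apply: iv_inj J.
Qed.
End Ind.

Lemma elem_uniq T S (f : arr T S) i F i' : elementary f i F -> elementary f i' F -> i = i'.
Proof.
move=> [_ fF F0 _] [_ _ _ tr]; apply/eqP; apply/negPn/negP => ii.
have [[_ o] _] := tr i F ii fF.
have : nedge F = 0%N by apply: eq_card0 => h; rewrite !inE o ltnn.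
by move=> E; rewrite E in F0.
Qed.

Lemma incl_uniq T S (f : arr T S) i F iv ih iv' ih' :
 @fiber_incl T S f i F iv ih -> @fiber_incl T S f i F iv' ih' -> ih =1 ih'.
Proof.
move=> I I' h.
have [E ->] := incr_unique (fi_ih_incr I) (fi_ih_incr I') (fun h => etrans (fi_ih_im I h) (esym (fi_ih_im I' h))).
by congr ih'; apply: ord_inj.
Qed.

Lemma incr_ext n m (e e' : 'I_n -> 'I_m) : (forall i j : 'I_n, (i < j)%N -> (e i < e j)%N) ->
 (forall i j : 'I_n, (i < j)%N -> (e' i < e' j)%N) -> codom e =i codom e' -> e =1 e'.
Proof.
by move=> h h' c i; have [E ->] := incr_unique h h' c; congr e'; apply: ord_inj.
Qed.

Lemma imap_ext (T F : graph) (ih ih' : 'I_(nh F) -> 'I_(nh T)) : ih =1 ih' -> imap ih =1 imap ih'.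
Proof. by move=> e [b q]; rewrite /imap /=; congr pair; apply: eq_imset. Qed.
End Induced.

(** * The operad attached to a choice of flags *)

Section Mod.
Variables (K : fieldType) (fl : flags) (O : opcat).
Implicit Types T S P F G H X U u : obj O.

Definition mobj (T : graph) : gvs K := gsub K (@valid fl T) (@deg fl T).

Lemma valid_join T S (f : arr T S) i F iv ih (A : {set sym S}) (B : {set sym F}) :
 elementary f i F -> @fiber_incl T S f i F iv ih -> valid fl A -> valid fl B ->
 valid fl (smap f @: A :|: imap ih @: B) /\ deg fl (smap f @: A :|: imap ih @: B) = deg fl A + deg fl B.
Proof.
move=> fe I /andP[/eqP eA tA] /andP[/eqP eB tB].
have [eU tU] := symU (smap f @: A) (imap ih @: B).
have ii : injective (himg ih) by apply/imset_inj/(ih_inj I).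
have ip : injective (himg (psi f)) by apply/imset_inj/(psi_inj (arr0 f)).
have ce : #|edges (smap f @: A :|: imap ih @: B)| = (#|edges A| + #|edges B|)%N.
 rewrite eU edges_smap edges_imap cardsU disjoint_setI0 ?cards0 ?subn0; last first.
  by rewrite eA eB; case: (fedge fl) => /=; [exact: eset_disjoint I|rewrite imset0 -setI_eq0 set0I eqxx].
 by rewrite !card_imset.
have ct : #|tubes (smap f @: A :|: imap ih @: B)| = (#|tubes A| + #|tubes B|)%N.
 rewrite tU tubes_smap tubes_imap cardsU disjoint_setI0 ?cards0 ?subn0; last first.
  move: tA tB; case: (ftube fl) => [/andP[nA _] /andP[nB _]|/eqP -> _]. apply: (join_disjoint fe I nA nB).
  by rewrite imset0 -setI_eq0 set0I eqxx. by rewrite !card_imset //; apply: lift_inj.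
split; last by rewrite /deg ce ct !PoszD mulrDr addrACA.
apply/andP; split. rewrite eU edges_smap edges_imap eA eB; case: (fedge fl) => /=; last by rewrite !imset0 setU0.
 by rewrite (eset_join fe I).
rewrite tU tubes_smap tubes_imap; move: tA tB; case: (ftube fl) => [|/eqP -> /eqP ->].
 move=> /andP[nA mA] /andP[nB mB]; rewrite (nest_join fe I nA nB) /=.
 by apply/implyP => m; rewrite (maximal_join fe I nA nB) (implyP mA m) (implyP mB m).
by rewrite !imset0 setU0.
Qed.

Lemma valid_iso T S (f : arr T S) (A : {set sym S}) : iso f -> valid fl A ->
 valid fl (smap f @: A) /\ deg fl (smap f @: A) = deg fl A.
Proof.
move=> fi /andP[/eqP eA tA].
have ip : injective (himg (psi f)) by apply/imset_inj/(psi_inj (arr0 f)).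
split; last first. by rewrite /deg edges_smap tubes_smap !card_imset //; apply: lift_inj.
apply/andP; split. by rewrite edges_smap eA; case: (fedge fl) => /=; rewrite ?imset0 // (eset_iso fi).
rewrite tubes_smap; move: tA; case: (ftube fl) => [/andP[nA mA]|/eqP ->]; last by rewrite imset0.
by rewrite nest_iso //=; apply/implyP => m; apply: maximal_iso; rewrite // (implyP mA m).
Qed.

(** [circ] receives neither the vertex nor the inclusion of the fiber, so these are chosen;
    [elem_uniq] and [incl_uniq] make the result independent of the choice. For maps that are not
    elementary a constant function is returned. *)
Definition isym T S F (f : arr T S) : sym F -> sym T := if pselect (exists g, exists i iv ih,
   [/\ elementary f i F, @fiber_incl T S f i F iv ih & g = imap ih])
 is left e then projT1 (cid e) else fun=> (false, set0).

Lemma isymE T S F (f : arr T S) i iv ih : elementary f i F ->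
 @fiber_incl T S f i F iv ih -> @isym T S F f =1 imap ih.
Proof.
move=> fe I; rewrite /isym; case: pselect => [e|[]]; last by exists (imap ih), i, iv, ih.
case: (cid e) => g /= [i' [iv' [ih' [fe' I' ->]]]].
have E := elem_uniq fe fe'; subst i'.
apply: imap_ext; exact: incl_uniq I' I.
Qed.

Definition mpact T S (f : arr T S) (x : mobj S) : mobj T := prj _ _ (emap (smap f) (emb x)).
Definition Mod : operad K O := @Operad K O (@Presheaf K O mobj mpact)
  (fun T S F f x y => prj _ _ (wedge (emap (smap f) (emb x)) (emap (@isym T S F f) (emb y))))
  (fun U => prj _ _ (delta K set0)).

Lemma emb_act T S (f : arr T S) (x : Mod S) : iso f -> emb (pact f x : Mod T) = emap (smap f) (emb x).
Proof.
move=> fi; apply: prjK; refine (supp_emap (@emb_supp _ _ _ _ x) _) => A vA _.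
by have [] := valid_iso fi vA.
Qed.

Lemma emb_circ T S (f : arr T S) i F iv ih (x : Mod S) (y : Mod F) :
 elementary f i F -> @fiber_incl T S f i F iv ih ->
 emb (circ f x y : Mod T) = wedge (emap (smap f) (emb x)) (emap (imap ih) (emb y)).
Proof.
move=> fe I; rewrite -(eq_emap (isymE fe I)); apply: prjK.
apply: (@supp_wedge K _ (fun A => exists2 A0, valid fl A0 & A = smap f @: A0)
           (fun A => exists2 A0, valid fl A0 & A = imap ih @: A0)).
- by refine (supp_emap (@emb_supp _ _ _ _ x) _) => A vA _; exists A.
- refine (supp_emap (@emb_supp _ _ _ _ y) _) => A vA _; exists A => //. exact: eq_imset (isymE fe I).
- by move=> _ _ [A vA ->] [B vB ->] _; have [] := valid_join fe I vA vB.
Qed.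

Lemma valid_lt (U : obj O) (A : {set sym U}) : full U = set0 -> valid fl A = (A == set0).
Proof.
move=> U0; have e0 : eset U = set0 by apply/setP => e; rewrite /eset U0 imset0 inE.
apply/idP/eqP => [/andP[/eqP eA tA]|->]. apply: sym_eq. by rewrite eA e0 if_same; apply/setP => e; rewrite !inE.
 have -> : tubes (set0 : {set sym U}) = set0 by apply/setP => q; rewrite !inE.
 move: tA; case: (ftube fl) => [/andP[/nestP[t _ _] _]|/eqP //].
 apply/setP => q; rewrite [RHS]inE; apply/negbTE/negP => /t /tubeP[]. by rewrite U0 subset0 => /negP q0 /q0.
have es : edges (set0 : {set sym U}) = set0 by apply/setP => q; rewrite !inE.
have ts : tubes (set0 : {set sym U}) = set0 by apply/setP => q; rewrite !inE.
rewrite /valid es ts e0 if_same eqxx /=; case: (ftube fl) => //.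
apply/andP; split; last by apply/implyP => _; apply/forall_inP => q; rewrite inE.
by apply/nestP; split=> [q|q q'|]; rewrite ?inE // U0 eqxx.
Qed.

Lemma deg0 (U : graph) : deg fl (set0 : {set sym U}) = 0.
Proof.
have es : edges (set0 : {set sym U}) = set0 by apply/setP => q; rewrite !inE.
have ts : tubes (set0 : {set sym U}) = set0 by apply/setP => q; rewrite !inE.
by rewrite /deg es ts !cards0 mulr0.
Qed.

Lemma loc_full U : loc_terminal U -> full U = set0.
Proof. by case=> _ o; apply/setP => h; rewrite !inE o eqxx. Qed.

Lemma emb_eta U : loc_terminal U -> emb (eta Mod U) = delta K set0.
Proof.
move=> /loc_full U0; have h := valid_lt (set0 : {set sym U}) U0; rewrite eqxx in h.
by apply: prjK => A; rewrite ffunE; case: (A =P set0) => [-> _|_]; [exact: h|rewrite eqxx].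
Qed.

Lemma homog_supp T n (x : Mod T) : homog n x <-> supp (fun A => valid fl A /\ deg fl A = n) (emb x).
Proof.
rewrite homog_emb; split=> s A xA; last by case: (s A xA).
by split; [apply: emb_supp xA|apply: s].
Qed.

Lemma Mod_presheaf : is_presheaf Mod.
Proof.
split.
- move=> T S f fi a x y; apply: emb_inj. by rewrite emb_lin !(emb_act _ fi) emb_lin emap_lin.
- move=> T S f fi n x /homog_supp s; apply/homog_emb; rewrite (emb_act _ fi).
 by refine (supp_emap s _) => A [vA <-] _; have [] := valid_iso fi vA.
- move=> T f fE x; apply: emb_inj; rewrite emb_act; last first. by exists f; rewrite fE gcompf1.
 by rewrite fE (eq_emap (@smap_gid T)) emap_id.
- move=> T S P f g h fi gi hE x; apply: emb_inj. rewrite !emb_act ?emap_comp //; last exact: iso_comp hE.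
 exact/eq_emap/smap_comp.
Qed.

Lemma sgn_abs (n : int) : sgn K n = (-1) ^+ `|n|%N.
Proof.
by case: n => n; rewrite /sgn /exprz //= -exprVn invrN1.
Qed.

Hypothesis flo : fdeg fl = 1 \/ fdeg fl = -1.

(** Every symbol has degree 1 or -1, so the parity of the degree is the parity of the number of
    symbols and Koszul signs become signs of the exterior algebra. *)
Lemma deg_odd T (A : {set sym T}) : odd `|deg fl A|%N = odd #|A|.
Proof. by rewrite /deg card_sym; case: flo => ->; lia. Qed.

Lemma supp_parity T n (x : Mod T) : homog n x -> supp (fun A : {set sym T} => odd #|A| = odd `|n|%N) (emb x).
Proof. by move=> /homog_supp s A /s[_ <-]; rewrite deg_odd. Qed.

Lemma elem_comp T S P (f : arr T S) (g : arr S P) (gf : arr T P) j i F G H :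
 elementary f j F -> elementary g i G -> phi g j = i -> amap gf = gcomp g f -> is_fiber gf i H -> elementary gf i H.
Proof.
move=> fe ge gj gfE fH; have /elemP[fm _ _ ft] := fe; have /elemP[gm _ _ gt] := ge.
have pE v := phi_comp v gfE; have sE v := psi_comp v gfE.
apply/elemP; split=> //.
- by move=> w w' ww; rewrite !pE; apply/gm/fm.
- have [iv [ih I]] := fH; have [_ [av [ah A]] F0 _] := fe.
 move: F0; rewrite (nedge_gt0 (objO F)) (nedge_gt0 (objO H)) => /set0Pn[k kF]; apply/set0Pn.
 have hn : ah k \in nz f by rewrite -(full_fiber (objO T) (arr0 f) A). have [h hE] : exists h, ah k = ih h.
  by apply: (ih_ex I); rewrite pE (elem_nz fe hn).
 exists h; rewrite (full_fiber (objO T) (arr0 gf) I) -hE gfE in_nz_comp ?hn //. exact: arr0.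
- move=> v vi; have [g1 g2 g3] := gt v vi. have fj w : phi g w = v -> w != j.
  by move=> gw; apply: contraNneq vi => wj; rewrite -gw wj gj. split.
 + move=> w w'; rewrite !pE => gw gw'; have ww := g1 _ _ gw gw'.
  by have [f1 _ _] := ft _ (fj _ gw); apply: f1; rewrite ?ww.
 + move=> h; rewrite pE => gw; rewrite gfE in_nz_comp; last exact: arr0.
  have [_ f2 _] := ft _ (fj _ gw); have hn := f2 h erefl. rewrite negb_or hn /=; apply/negP => /imsetP[k kn hk].
  by have := g2 k; rewrite -(phi_vtx (arr0 f)) -hk => /(_ gw); rewrite kn.
 + move=> h h' hv hv' hh; rewrite !sE. have gv : phi g (vtx S (psi g h)) = v by rewrite (phi_vtx (arr0 g)).
  have gv' : phi g (vtx S (psi g h')) = v by rewrite (phi_vtx (arr0 g)).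
  have [_ _ f3] := ft _ (fj _ gv); apply: f3 => //; last exact: g3. exact: g1.
Qed.

Lemma elem_incr T R (f : arr T R) j F (k k' : 'I_(nh R)) : elementary f j F ->
 vtx R k != j -> (k < k')%N -> vtx R k' != j -> (psi f k < psi f k')%N.
Proof.
move=> /elemP[fm _ _ ft] kj kk kj'; have [e|ne] := eqVneq (vtx R k) (vtx R k').
 by have [_ _ f3] := ft _ kj; apply: f3.
have vk : (vtx R k < vtx R k')%N.
 by rewrite ltn_neqAle (vtx_mono (objO R) (ltnW kk)) andbT; apply: contraNneq ne => /ord_inj ->.
rewrite ltnNge; apply/negP => /(vtx_mono (objO T)) /fm.
by rewrite !(phi_vtx (arr0 f)) leqNgt vk.
Qed.

(** The fiber [G] of [g'] stays away from the vertex at which [f'] contracts, so lifting its tubes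
    is a plain image; both sides are then increasing enumerations of the same half-edges of [T]. *)
Lemma par_incl T R' R'' S (f' : arr T R') (g' : arr R' S) (f'' : arr T R'') (g'' : arr R'' S)
  j i l F G av ah bv bh : gcomp g' f' = gcomp g'' f'' -> elementary f' j F -> phi g' j <> i ->
 @fiber_incl R' S g' i G av ah -> @fiber_incl T R'' f'' l G bv bh ->
 phi g'' l = i -> tf g'' i -> smap f' \o imap ah =1 imap bh.
Proof.
move=> gf fe ij A B gl [g1 g2 g3].
have e v : phi g' (phi f' v) = phi g'' (phi f'' v). by have := f_equal (fun x => phi x v) gf; rewrite !ffunE.
have nj k : vtx R' (ah k) != j. by apply/eqP => E; apply: ij; rewrite -E (phi_ih A).
have H : (fun h => psi f' (ah h)) =1 bh. apply: incr_ext => [h h' hh|h h' hh|h].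
 - by apply: (elem_incr fe) => //; apply: (fi_ih_incr A).
 - exact: (fi_ih_incr B).
 - rewrite (fi_ih_im B); apply/codomP/eqP => [[k ->]|hl].
   apply: g1 => //; rewrite -e (phi_vtx (arr0 f')) (phi_ih A) //.
  have gh : phi g' (phi f' (vtx T h)) = i by rewrite e hl.
  have hj : phi f' (vtx T h) != j by apply/eqP => E; apply: ij; rewrite -E.
  have /elemP[_ _ _ ft] := fe; have [_ f2 _] := ft _ hj. have /nzPn[k hk] := f2 h erefl.
  have [k' kk] : exists k', k = ah k'. by apply: (ih_ex A); rewrite -(phi_vtx (arr0 f')) -hk.
  by exists k'; rewrite hk kk.
have im (q : {set 'I_(nh G)}) : psi f' @: (ah @: q) = bh @: q.
 by rewrite -imset_comp; apply: eq_imset => h /=; rewrite H.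
move=> [[] q]; rewrite /smap /imap /= ?im //; congr pair.
rewrite -im (lift_notouch fe) //; apply/negP => /imsetP[_ /imsetP[k _ ->]] E.
by have := nj k; rewrite E eqxx.
Qed.

Lemma iso_lt u U (b : arr u U) : loc_terminal u -> iso b.
Proof.
move=> ul; apply/iso_nz/eqP; rewrite -subset0 -(loc_full ul).
exact: nz_full (objO u) (arr0 b).
Qed.

Lemma Mod_operad : is_operad Mod.
Proof.
split.
- exact: Mod_presheaf.
- move=> T S f i F fe y a x x'; have [_ [iv [ih I]] _ _] := fe; apply: emb_inj.
 by rewrite emb_lin !(emb_circ _ _ fe I) emb_lin emap_lin wedge_linl.
- move=> T S f i F fe x a y y'; have [_ [iv [ih I]] _ _] := fe; apply: emb_inj.
 by rewrite emb_lin !(emb_circ _ _ fe I) emb_lin emap_lin wedge_linr.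
- move=> T S f i F fe m n x y /homog_supp sx /homog_supp sy.
 have [_ [iv [ih I]] _ _] := fe; apply/homog_emb; rewrite (emb_circ _ _ fe I).
 apply: (@supp_wedge K _ (fun A => exists2 A0, valid fl A0 /\ deg fl A0 = m & A = smap f @: A0)
           (fun A => exists2 A0, valid fl A0 /\ deg fl A0 = n & A = imap ih @: A0)).
 + by refine (supp_emap sx _) => A vA _; exists A.
 + by refine (supp_emap sy _) => A vA _; exists A.
 + by move=> _ _ [A [vA <-] ->] [B [vB <-] ->] _; have [] := valid_join fe I vA vB.
- move=> U [Ul _]; apply/homog_supp => A xA; split; first exact: emb_supp xA.
 by move: xA; rewrite emb_eta // ffunE; case: (A =P set0) => [-> _|_]; [exact: deg0|rewrite eqxx].
- move=> T S P F G H f g gf j i fi fe ge gj gfE [iv [ih I]] [iv' [ih' [jv [jh [I' J fiv fih]]]]] x y z.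
 have ie : ih =1 ih' := incl_uniq I I'. have [_ [av [ah A]] _ _] := fe. have gj' : phi g j = i by [].
 have [j' [jj' fie]] := elementary_induced gfE I' J fiv fih fe gj.
 subst j; have [c [d [D cE dE]]] := fiber_induced gfE I' J fiv fih A. have gfe : elementary gf i H.
  by apply: elem_comp fe ge gj' gfE _; exists iv', ih'.
 apply: emb_inj; rewrite (emb_circ _ _ gfe I') (emb_circ _ _ fie D) (emb_circ _ _ fe A) (emb_circ _ _ ge J).
 rewrite !emap_wedge !emap_comp -wedgeA. rewrite (eq_emap (smap_comp gfE)); congr (wedge _ (wedge _ _)).
  exact/eq_emap/(smap_induced gfE I' J fiv fih).
 by apply: eq_emap => -[b q]; rewrite /imap /= -imset_comp; congr pair; apply: eq_imset => h /=; rewrite dE.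
- move=> T R' R'' S F G f' g' f'' g'' j i l k gf fe' ge' fe'' ge'' gl ik gj m n x y z hy hz.
 have [_ [av [ah A]] _ _] := fe'; have [_ [bv [bh B]] _ _] := fe''.
 have [_ [cv [ch C]] _ _] := ge'; have [_ [dv [dh D]] _ _] := ge''. apply: emb_inj; rewrite (linZ embl).
 rewrite (emb_circ _ _ fe' A) (emb_circ _ _ ge' C) (emb_circ _ _ fe'' B) (emb_circ _ _ ge'' D).
 rewrite !emap_wedge !emap_comp -!wedgeA sgn_abs abszM.
 have tf'' : tf g'' i by have /elemP[_ _ _ t] := ge''; apply: t; apply/eqP.
 have tf' : tf g' k by have /elemP[_ _ _ t] := ge'; apply/t/eqP => E; apply: ik.
 rewrite (eq_emap (par_incl gf fe' _ C B gl tf'')); last by rewrite gj => E; apply: ik.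
 rewrite (eq_emap (par_incl (esym gf) fe'' _ D A gj tf')); last by rewrite gl.
 have par (H : obj O) (p : sym H -> sym T) d (t : Mod H) : homog d t ->
   supp (fun A : {set sym T} => odd #|A| = odd `|d|%N) (emap p (emb t)).
  by move=> /supp_parity s; refine (supp_emap s _) => Q QE pi; rewrite card_in_imset.
 have comm : smap f' \o smap g' =1 smap f'' \o smap g''.
  move=> s; rewrite -(smap_comp (gf := gcomp g' f') erefl) gf. by rewrite (smap_comp (gf := gcomp g'' f'') erefl).
 rewrite (eq_emap comm) -[in LHS](linZ (wedge_linr _)); congr wedge.
 (* The sign in the parallel axiom is that of exchanging factors of degrees [m] and [n] in the
    exterior product. *)
 by rewrite (wedge_comm (par _ _ _ _ hy) (par _ _ _ _ hz)).
- move=> T F u U b f i ul Ut fe y; have [_ [iv [ih I]] _ _] := fe.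
 have [lg lgE] : exists lg, ograph F = @relegs T lg. by apply: lt_relegs; exists u, f, i; split=> //; exists iv, ih.
 have E : emb (circ f (pact b (eta Mod U)) y : Mod T) = emap (imap ih) (emb y). have [Ul _] := Ut.
  by rewrite (emb_circ _ _ fe I) (emb_act _ (iso_lt b ul)) (emb_eta Ul) !emap0 wedge0.
 (* Once [F] is replaced by [relegs lg], the spaces at [T] and at [F] are convertible, because
    [legs] does not enter them; so [erefl] proves their equality. *)
 case: F lgE y iv ih I fe E => F Fo /= lgE; subst F => y iv ih I fe E.
 exists erefl; apply: (@emb_inj _ _ _ _) => /=. have ihE : ih =1 id.
  apply: incr_ext => //; first exact: (fi_ih_incr I).
  move=> h; rewrite (fi_ih_im I); apply/eqP/codomP => [_|_]; first by exists h.
  by case: ul => u1 _; apply: ord_inj; case: (phi f _) (i) => a + [b' +] /=; rewrite u1; case: a b' => [|?] [|?].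
 rewrite [LHS]E (eq_emap (p := imap ih) (r := id)) ?emap_id // => -[c q].
 by rewrite /imap /= (eq_imset _ ihE) imset_id.
- move=> T' T'' S' S'' F F' F'' w s f' f'' h wj i j wi si hE hE' fe' fe'' fF [iv [ih [jv [jh [I J wv wh]]]]] x y.
 have [_ [av [ah A]] _ _] := fe'. have [_ [bv [bh B]] F0 _] := fe''. have bj : bh =1 jh := incl_uniq B J.
 have sij : phi s i = j. move: F0; rewrite (nedge_gt0 (objO F'')) => /set0Pn[k kF].
  have kn : bh k \in nz f'' by rewrite -(full_fiber (objO T'') (arr0 f'') B). have hn : psi w (bh k) \in nz f'.
   have : psi w (bh k) \in nz h by rewrite hE (nz_iso_comp _ wi) imset_f.
   rewrite hE' (in_nz_comp _ (arr0 f')) => /orP[//|/imsetP[k' + _]]. by have /iso_nz -> := si; rewrite inE.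
  rewrite -(elem_nz fe' hn) -(phi_comp _ hE') (phi_comp _ hE) (phi_vtx (arr0 w)). exact: elem_nz fe'' kn.
 have vE v : (phi h v == j) = (phi f' v == i). by rewrite (phi_comp _ hE') -sij (inj_eq (iso_phi_inj si)).
 have nE : nz h = nz f'. apply/setP => k; rewrite hE' (in_nz_comp _ (arr0 f')); have /iso_nz -> := si.
  by rewrite imset0 in_set0 orbF. have [lg lgE] : exists lg, ograph F' = @relegs F lg.
  by apply: fiber_relegs I A vE _ => k _; rewrite nE. have wji : iso wj.
  apply/iso_nz/setP => k; rewrite (nz_induced hE I J wh); have /iso_nz -> := wi. by rewrite !inE.
 have E : emb (pact w (circ f'' x y) : Mod T') =
   wedge (emap (smap f') (emb (pact s x : Mod S'))) (emap (imap ih) (emb (pact wj y : Mod F))).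
  rewrite emb_act // (emb_circ _ _ fe'' B) emap_wedge !emb_act // !emap_comp.
  rewrite -(eq_emap (smap_comp hE)) -(eq_emap (smap_comp hE')); congr wedge.
  rewrite (eq_emap (smap_induced hE I J wv wh)) -!emap_comp; congr emap. exact/eq_emap/imap_ext.
 case: F' lgE fe' av ah A vE => F' Fo' /= lgE; subst F' => fe' av ah A _.
 exists (pact wj y : Mod F); first by exists erefl.
 apply: emb_inj; rewrite [LHS]E (emb_circ _ _ fe' A); congr wedge.
 apply/eq_emap/imap_ext/incr_ext; [exact: (fi_ih_incr I)|exact: (fi_ih_incr A)|].
 move=> k; rewrite (fi_ih_im I) (fi_ih_im A) (phi_comp _ hE') -sij. by rewrite (inj_eq (iso_phi_inj si)).
Qed.

Lemma Mod_one : one_connected Mod.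
Proof.
split=> [|U Ut]; first exact: Mod_operad.
have eU : emb (eta Mod U) = delta K set0 by apply: emb_eta; case: Ut.
exists (fun x : Mod U => emb x set0) => [a|x]. by rewrite (linZ embl) eU !ffunE eqxx; apply: mulr1.
apply: emb_inj; rewrite (linZ embl) eU [RHS]ext_delta (bigD1 set0) //= big1 ?addr0 //.
move=> A A0; suff -> : emb x A = 0 by rewrite scale0r.
apply/eqP; apply: contraNT A0 => /emb_supp; rewrite valid_lt // loc_full //.
by case: Ut.
Qed.
End Mod.

(** * Values up to a change of the global order *)

Section Casts.
Variables (K : fieldType) (O : opcat).
Implicit Types (T S P F G H X U : obj O) (M : presheaf K O).

Lemma gcast_lin (V W : gvs K) (E : V = W) : linear (gcast E).
Proof. by case: _ / E. Qed.

Lemma same_inj M T F (x x' : M T) (y y' : M F) : same x y -> same x' y' -> x = x' <-> y = y'.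
Proof.
move=> [E <-] [E' <-]; rewrite (Prop_irrelevance E' E); split=> [->//|].
by move: x x'; rewrite /gcast; case: _ / E.
Qed.

Lemma same_refl M T (x y : M T) : same x y -> x = y.
Proof. by move=> [E <-]; rewrite (Prop_irrelevance E erefl). Qed.

Lemma same_ex M T F (y : M F) : M T = M F -> exists x : M T, same x y.
Proof.
move=> E; suff [x xE] : exists x, gcast E x = y by exists x; exists E.
by move: y; rewrite /gcast; case: _ / E => y; exists y.
Qed.

Lemma homogZ (V : gvs K) n a (x : V) : homog n x -> homog n (a *: x).
Proof. by rewrite /homog => h; rewrite (linZ (@gproj_lin K V n)) h. Qed.

Lemma homog_proj (V : gvs K) n (x : V) : homog n (gproj n x).
Proof. by rewrite /homog gprojE eqxx. Qed.

Lemma homog_other (V : gvs K) m n (x : V) : homog n x -> m != n -> gproj m x = 0.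
Proof. by move=> <- mn; rewrite gprojE (negbTE mn). Qed.

Lemma gproj_map (V W : gvs K) (f : V -> W) : linear f ->
 (forall n x, homog n x -> homog (n + 0) (f x)) -> forall n x, f (gproj n x) = gproj n (f x).
Proof.
move=> fl fh n x; have [s us xE] := gproj_sum x.
rewrite {2}xE (lin_sum fl) (lin_sum (@gproj_lin K W n)).
have h m y : homog m y -> homog m (f y) by move=> /fh; rewrite addr0.
have [ns|ns] := boolP (n \in s). rewrite (bigD1_seq n) //= big1 => [|m mn]; last first.
  by rewrite (homog_other (h m _ (homog_proj m x))) // eq_sym. by rewrite addr0 h //; apply: homog_proj.
rewrite (gproj_notin xE ns) (lin0 fl) big_seq big1 // => m ms.
rewrite (homog_other (h m _ (homog_proj m x))) //.
by apply: contraNneq ns => ->.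
Qed.

Lemma sgnK n : sgn K n * sgn K n = 1.
Proof. by rewrite sgn_abs -expr2 sqrr_sign. Qed.

Lemma full_lt X : full X = set0 -> loc_terminal X.
Proof.
move=> X0; split; last first. by move=> h; apply/eqP; have := in_set0 h; rewrite -X0 inE => /negbT/negPn.
have e0 : nedge X = 0%N by apply/(nedge_eq0 (objO X)).
by have := conn_nv (objO X) (objC X); case: (objO X) => v0 _ _ _ _; rewrite e0; lia.
Qed.

Lemma iso_full X Y (f : arr X Y) : iso f -> full X = set0 <-> full Y = set0.
Proof.
move=> fi; split=> [X0|Y0]; apply/setP => h; rewrite in_set0. by rewrite -(full_nz f) X0 in_set0.
by have [k ->] := iso_psi_surj h fi; rewrite full_nz Y0 in_set0.
Qed.

Lemma ord_one (n : nat) (x y : 'I_n) : n = 1%N -> x = y.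
Proof. by move=> n1; subst n; rewrite (ord1 x) (ord1 y). Qed.

(** Since the legs of a trivial object are listed in local order, [psi b] preserves the numbering of
    half-edges, and incidence and labels then agree. It identifies the units at the ends of [b]. *)
Lemma triv_eq U U' (b : arr U U') : trivial U -> trivial U' -> U = U'.
Proof.
move=> [[n1 o1] l1] [[n1' o1'] l1'].
have pE k : nat_of_ord (psi b k) = k. have lE := psi_legs (arr0 b); rewrite l1 l1' in lE.
 have nE : nh U' = nh U by rewrite -(size_enum_ord (nh U')) -(size_map (psi b)) lE size_enum_ord.
 have := f_equal (fun s => nth (psi b k) s k) lE. rewrite (nth_map k) ?size_enum_ord // nth_ord_enum => ->.
 by rewrite nth_enum_ord // -nE.
have nE : nh U = nh U'. by have := f_equal size (psi_legs (arr0 b)); rewrite l1 l1' size_map !size_enum_ord.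
have gE w w' : genus U w = genus U' w'. rewrite (ord_one w' (phi b w) n1'); apply/esym/tf_genus; split.
 - by move=> a a' _ _; exact: ord_one.
 - by move=> h _; have /iso_nz -> := iso_lt b (conj n1 o1); rewrite inE.
 - by move=> h h' _ _; rewrite !pE.
have oE := arr_outpE b.
suff E : ograph U = ograph U'. case: U U' b E {n1 o1 l1 n1' o1' l1' pE nE gE oE} => T To [T' To'] /= _ E; subst T'.
 by congr Obj; apply: Prop_irrelevance.
move: n1 o1 l1 n1' o1' l1' nE gE (psi b : _ -> _) pE oE.
case: (ograph U) => n m v o l g p; case: (ograph U') => n' m' v' o' l' g' p' /=.
move=> n1 o1 l1 n1' o1' l1' nE gE ps pE oE; subst n n' m' l l'.
congr Graph; apply/ffunP => h.
- exact: ord_one.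
- by rewrite o1 o1'.
- exact: gE.
- by rewrite -(oE h); congr (p _); apply/esym/ord_inj.
Qed.
End Casts.

(** * Contractions and composition *)

Section Equiv.
Variables (K : fieldType) (O : opcat) (E : presheaf K O).
Hypothesis Ec : is_coll E.
Implicit Types (T S P F G H X U : obj O) (M : operad K O).

Lemma op_unit_eta M U U' (b : arr U U') : is_presheaf M -> trivial U -> trivial U' -> pact b (eta M U') = eta M U.
Proof.
move=> Mp Ut Ut'; have UE := triv_eq b Ut Ut'; subst U'.
have bi : iso b by apply: iso_lt; case: Ut.
apply: (pact_id Mp); apply: gmap_eq => [h|v]. have := f_equal (fun s => nth h s h) (psi_legs (arr0 b)).
 have [_ ->] := Ut. by rewrite (nth_map h) ?size_enum_ord // nth_ord_enum => ->; rewrite ffunE.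
by rewrite ffunE; case: Ut => [[n1 _] _]; apply: ord_one.
Qed.

Lemma iso_coll_0 T S (f : arr T S) (x : E S) : iso f -> x <> 0 -> pact f x <> 0.
Proof.
move=> fi x0 fx; apply: x0; have [g [gi gf fg]] := iso_inv fi.
have [d dE] := id_arr S.
rewrite -(pact_id Ec dE x) (@pact_comp _ _ _ Ec _ _ _ g f d gi fi); last by rewrite dE fg.
by rewrite fx; apply/lin0/(pact_lin Ec gi).
Qed.

Lemma pactK (M : presheaf K O) T S (f : arr T S) (g : arr S T) : is_presheaf M -> iso f -> iso g ->
 gcomp f g = gid S -> forall x : M S, pact g (pact f x) = x.
Proof.
move=> Mp fi gi fg x; have [d dE] := id_arr S.
by rewrite -{2}(pact_id Mp dE x) (@pact_comp _ _ _ Mp _ _ _ g f d gi fi) // dE fg.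
Qed.

Lemma elem_target T' T'' S' S'' F' F'' (w : arr T' T'') (s : arr S' S'') (f' : arr T' S')
  (f'' : arr T'' S'') i j : iso w -> iso s -> gcomp s f' = gcomp f'' w ->
 elementary f' i F' -> elementary f'' j F'' -> phi s i = j.
Proof.
move=> wi si sq fe' fe''; have [_ [bv [bh B]] F0 _] := fe''.
move: F0; rewrite (nedge_gt0 (objO F'')) => /set0Pn[k kF].
have kn : bh k \in nz f'' by rewrite -(full_fiber (objO T'') (arr0 f'') B).
have hn : psi w (bh k) \in nz f'. have : psi w (bh k) \in nz (gcomp s f') by rewrite sq (nz_iso_comp _ wi) imset_f.
 rewrite (in_nz_comp _ (arr0 f')) => /orP[//|/imsetP[k' + _]]. by have /iso_nz -> := si; rewrite inE.
rewrite -(elem_nz fe' hn) -(phi_comp (h := gcomp s f') _ erefl) sq ffunE (phi_vtx (arr0 w)).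
exact: elem_nz fe'' kn.
Qed.

Lemma equiv_gen T' T'' S' S'' F' F'' (w : arr T' T'') (s : arr S' S'') (f' : arr T' S')
  (f'' : arr T'' S'') i j (e' : E F') : iso w -> iso s -> gcomp s f' = gcomp f'' w ->
 elementary f' i F' -> elementary f'' j F'' -> e' <> 0 ->
 exists2 e'' : E F'', e'' <> 0 & forall M (f : family E M), is_operad M -> coll_map f ->
  forall x : M S'', pact w (circ f'' x (f _ e'')) = circ f' (pact s x) (f _ e').
Proof.
move=> wi si sq fe' fe'' e0; have sij := elem_target wi si sq fe' fe''.
have [h hE] := comp_arr w f''; have hE' : amap h = gcomp s f' by rewrite hE sq.
have [_ [av [ah A]] F0 _] := fe'; have [_ [bv [bh B]] _ _] := fe''.
have [F [iv [ih I]]] := fiber_objE h j.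
have [wj [wv wh]] := induced_ex hE I B.
have nE : nz h = nz f'. apply/setP => k; rewrite hE' (in_nz_comp _ (arr0 f')); have /iso_nz -> := si.
 by rewrite imset0 in_set0 orbF.
have [lg lgE] : exists lg, ograph F' = @relegs F lg. apply: fiber_relegs I A _ _ => [v|k _]; last by rewrite nE.
 by rewrite (phi_comp _ hE') -sij (inj_eq (iso_phi_inj si)).
have lt := relegs_lt_fiber lgE.
have wji : iso wj. apply/iso_nz/setP => k; rewrite (nz_induced hE I B wh); have /iso_nz -> := wi. by rewrite !inE.
have [wk [wki wk1 wk2]] := iso_inv wji.
have [e ee] := same_ex e' (coll_eq Ec lt).
have e1 : e <> 0. move=> E0; apply: e0; have [EE EE'] := ee; rewrite -EE' E0. exact/lin0/gcast_lin.
exists (pact wk e) => [|M f Mo fc x]; first exact: iso_coll_0.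
have [y' y1 y2] := op_equiv Mo wi si hE hE' fe' fe'' (ex_intro _ iv (ex_intro _ ih I))
 (ex_intro _ iv (ex_intro _ ih (ex_intro _ bv (ex_intro _ bh (And4 I B wv wh))))) x (f _ (pact wk e)).
rewrite y2; congr circ.
move: y1; have [fp fs] := fc; rewrite -(pmap_act fp wji) (pactK (coll_presheaf Ec) wki wji wk1) => y1.
have F0' : (0 < nedge F)%N. have : nedge F' = nedge F by rewrite lgE. by move=> <-.
exact/(same_inj y1 (fs _ _ F0' lt _ _ ee)).
Qed.

(* A composite along one contraction of [q] is a composite along any other. *)
Lemma transfer X T S F (l : arr X T) (t : arr T S) i T' S' F' (l' : arr X T')
  (t' : arr T' S') i' (e : E F) : iso l -> iso l' -> elementary t i F ->
 elementary t' i' F' -> nz (gcomp t l) = nz (gcomp t' l') -> e <> 0 ->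
 exists (s : arr S' S) (e' : E F'), [/\ iso s, e' <> 0 &
  forall M (f : family E M), is_operad M -> coll_map f -> forall x : M S,
  pact l (circ t x (f _ e)) = pact l' (circ t' (pact s x) (f _ e'))].
Proof.
move=> li li' te te' nE e0; have [w [s [wi si wl st]]] := contr_unique li li' nE.
have [s' [si' s1 s2]] := iso_inv si.
have [e' e0' H] := equiv_gen wi si st te te' e0.
exists s', e'; split=> // M f Mo fc x.
rewrite (@pact_comp _ _ _ Mo _ _ _ l w l' li wi) ?wl //; congr pact.
by rewrite H // (pactK Mo si' si s1).
Qed.
End Equiv.

(** * Free operads of nestings *)

Section Free.
Variables (K : fieldType) (O : opcat) (fl : flags).
Hypothesis flo : fdeg fl = 1 \/ fdeg fl = -1.
Hypothesis flt : ftube fl.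
Implicit Types (T S P F G H X U : obj O).

Notation N := (Mod K fl O).

Definition topS (T : graph) : {set sym T} := [set s | if s.1 then s.2 == full T else fedge fl && (s.2 \in eset T)].

Lemma edges_top T : edges (topS T) = if fedge fl then eset T else set0.
Proof. by apply/setP => e; rewrite !inE /=; case: (fedge fl); rewrite ?inE. Qed.

Lemma tubes_top T : tubes (topS T) = [set full T].
Proof. by apply/setP => e; rewrite !inE. Qed.

Definition bs T (x : N T) (A : {set sym T}) : Prop := bas A (emb x).

Lemma bs_valid T (x : N T) A : bs x A -> valid fl A.
Proof.
move=> [a a0 xE]; apply: (@emb_supp _ _ _ _ x); rewrite xE !ffunE eqxx.
by apply: contra a0 => /eqP <-; apply/eqP/esym/mulr1.
Qed.

Lemma bs_homog T (x : N T) A : bs x A -> homog (deg fl A) x.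
Proof.
move=> [a a0 xE]; apply/homog_emb; rewrite xE => B; rewrite !ffunE.
by case: (B =P A) => [-> //|_]; rewrite scaler0 eqxx.
Qed.

Lemma join_sym_disjoint T S (f : arr T S) i F iv ih (A : {set sym S}) (B : {set sym F}) :
 elementary f i F -> @fiber_incl T S f i F iv ih -> valid fl A -> valid fl B ->
 [disjoint smap f @: A & imap ih @: B].
Proof.
move=> fe I /andP[/eqP eA tA] /andP[/eqP eB tB].
rewrite flt in tA tB; have /andP[nA _] := tA; have /andP[nB _] := tB.
apply/pred0P => s /=; apply/negbTE/negP => /andP[/imsetP[[b q] qA ->]].
case/imsetP=> -[b' q'] qB []; case: b qA => qA bE; subst b'.
 move=> qE; have := join_disjoint fe I nA nB => /pred0P /(_ (lift f q)) /negP; apply.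
 by rewrite /= imset_f ?inE //= qE; apply: imset_f; rewrite inE.
move=> qE; case: (fedge fl) eA eB => eA eB; last first. by have := in_set0 q; rewrite -eA inE qA.
have := eset_disjoint I => /pred0P /(_ (psi f @: q)) /negP; apply.
by rewrite -eA -eB /= (imset_f (himg (psi f))) ?inE //= qE (imset_f (himg ih)) ?inE.
Qed.

Lemma bs_circ T S (f : arr T S) i F iv ih (x : N S) (y : N F) A B :
 elementary f i F -> @fiber_incl T S f i F iv ih -> bs x A -> bs y B ->
 bs (circ f x y : N T) (smap f @: A :|: imap ih @: B).
Proof.
move=> fe I xA yB; rewrite /bs (emb_circ _ _ fe I); apply: bas_wedge.
- exact: join_sym_disjoint fe I (bs_valid xA) (bs_valid yB).
- by apply: bas_emap xA => s s' _ _; apply: smap_inj.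
- by apply: bas_emap yB => s s' _ _; apply/imap_inj/(ih_inj I).
Qed.

Lemma card_join T S (f : arr T S) i F iv ih (A : {set sym S}) (B : {set sym F}) :
 elementary f i F -> @fiber_incl T S f i F iv ih -> valid fl A -> valid fl B ->
 #|tubes (smap f @: A :|: imap ih @: B)| = (#|tubes A| + #|tubes B|)%N.
Proof.
move=> fe I /andP[_ +] /andP[_]; rewrite flt => /andP[nA _] /andP[nB _].
have [_ ->] := symU (smap f @: A) (imap ih @: B).
rewrite tubes_smap tubes_imap cardsU disjoint_setI0 ?cards0 ?subn0; last first.
 by apply: (join_disjoint fe I nA nB).
by rewrite !card_imset //; [apply: imset_inj (ih_inj I)|apply: lift_inj].
Qed.

Lemma join_inj T S (f : arr T S) i F iv ih (A A' : {set sym S}) (B : {set sym F}) :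
 elementary f i F -> @fiber_incl T S f i F iv ih -> valid fl A -> valid fl A' -> valid fl B ->
 smap f @: A :|: imap ih @: B = smap f @: A' :|: imap ih @: B -> A = A'.
Proof.
move=> fe I vA vA' vB /(f_equal (fun C => C :\: imap ih @: B)); rewrite !setDUl setDv !setU0.
have d C : valid fl C -> smap f @: C :\: imap ih @: B = smap f @: C.
 by move=> vC; apply/setDidPl/(join_sym_disjoint fe I vC vB).
rewrite !d //; apply: imset_inj; exact: smap_inj.
Qed.

Definition mkst (T : graph) (Q : {set {set 'I_(nh T)}}) : {set sym T} :=
 [set s | if s.1 then s.2 \in Q else fedge fl && (s.2 \in eset T)].

Lemma edges_mk (T : graph) (Q : {set {set 'I_(nh T)}}) : edges (mkst Q) = if fedge fl then eset T else set0.
Proof. by apply/setP => e; rewrite !inE /=; case: (fedge fl); rewrite ?inE. Qed.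

Lemma tubes_mk (T : graph) (Q : {set {set 'I_(nh T)}}) : tubes (mkst Q) = Q.
Proof. by apply/setP => e; rewrite !inE. Qed.

Lemma split_state T S (f : arr T S) i F iv ih (A : {set sym T}) :
 elementary f i F -> @fiber_incl T S f i F iv ih -> valid fl A -> nz f \in tubes A ->
 exists B C, [/\ valid fl B, valid fl C & A = smap f @: B :|: imap ih @: C].
Proof.
move=> fe I /andP[/eqP eA]; rewrite flt => /andP[nA mA] nzA.
have [N1 [N2 [n1 n2 NE]]] := nest_split fe I nA nzA.
have v (m1 : fmax fl ==> maximal N1) (m2 : fmax fl ==> maximal N2) : valid fl (mkst N1) && valid fl (mkst N2).
 by rewrite /valid !edges_mk !tubes_mk flt n1 n2 !eqxx /= m1 m2.
have [m1 m2] : (fmax fl ==> maximal N1) /\ (fmax fl ==> maximal N2). move: mA; rewrite NE (maximal_join fe I n1 n2).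
 by case: (fmax fl) => //= /andP[].
have /andP[v1 v2] := v m1 m2; exists (mkst N1), (mkst N2); split=> //.
have [eU tU] := symU (smap f @: mkst N1) (imap ih @: mkst N2).
apply: sym_eq; last by rewrite tU tubes_smap tubes_imap !tubes_mk.
rewrite eU edges_smap edges_imap !edges_mk eA; case: (fedge fl) => /=. exact: eset_join fe I.
by rewrite !imset0 setU0.
Qed.

Lemma bs_act T S (f : arr T S) (x : N S) A : iso f -> bs x A -> bs (pact f x : N T) (smap f @: A).
Proof.
move=> fi xA; rewrite /bs (emb_act _ fi).
by apply: bas_emap xA => s s' _ _; apply: smap_inj.
Qed.

Lemma bsZ T (x : N T) A a : a != 0 -> bs x A -> bs (a *: x) A.
Proof. by move=> a0 xA; rewrite /bs (linZ embl); apply: basZ. Qed.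

Lemma bs_eq T (x : N T) A B : bs x A -> bs x B -> A = B.
Proof. exact: bas_eq. Qed.

Lemma bs_prop T (x y : N T) A : bs x A -> bs y A -> exists2 c, c != 0 & y = c *: x.
Proof.
move=> [a a0 xE] [b b0 yE]; exists (b / a); first by rewrite mulf_neq0 ?invr_eq0.
by apply: emb_inj; rewrite (linZ embl) xE yE scalerA divfK.
Qed.

Lemma circZl (L : operad K O) T S (g : arr T S) i F a (x : L S) (y : L F) : is_operad L ->
 elementary g i F -> circ g (a *: x) y = a *: circ g x y :> L T.
Proof. by move=> Lo ge; apply: (linZ (op_linl Lo ge y)). Qed.

Lemma circ_linl (L : operad K O) T S (g : arr T S) i F a (u v : L S) (y : L F) : is_operad L ->
 elementary g i F -> circ g (a *: u + v) y = a *: circ g u y + circ g v y :> L T.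
Proof. by move=> Lo ge; apply: (op_linl Lo ge y). Qed.

Lemma circ_linr (L : operad K O) T S (g : arr T S) i F a (x : L S) (u v : L F) : is_operad L ->
 elementary g i F -> circ g x (a *: u + v) = a *: circ g x u + circ g x v :> L T.
Proof. by move=> Lo ge; apply: (op_linr Lo ge x). Qed.

Lemma pactZ (L : operad K O) T S (g : arr T S) a (x : L S) : is_operad L ->
 iso g -> pact g (a *: x) = a *: pact g x.
Proof. by move=> Lo gi; apply: (linZ (pact_lin (op_presheaf Lo) gi)). Qed.

Lemma bs_eta U : loc_terminal U -> bs (eta N U) set0.
Proof. by move=> Ul; rewrite /bs emb_eta //; apply: bas_delta. Qed.

Variables (E : presheaf K O) (io : family E N).
Arguments io : clear implicits.
Hypothesis Ec : is_coll E.
Hypothesis ioc : coll_map io.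
Hypothesis ioi : forall T, injective (io T).
Hypothesis ios : forall T (e : E T), e <> 0 -> bs (io T e) (topS T).
Hypothesis ioo : forall T, (0 < nedge T)%N -> (fmax fl -> nedge T = 1%N) -> exists e : E T, e <> 0.

Let No : is_operad N. Proof. exact: Mod_operad. Qed.
Let Np : is_presheaf N. Proof. exact: op_presheaf. Qed.
Let iol T : linear (io T). Proof. by have [p _] := ioc; exact: (@pmap_lin _ _ _ _ _ _ p T). Qed.

(** * Composites of generators together with their values *)

Section Gen.
Variables (M : operad K O) (f : family E M).
Arguments f : clear implicits.
Hypothesis M1 : one_connected M.
Hypothesis fc : coll_map f.
Let Mo : is_operad M. Proof. by case: M1. Qed.
Let Mp : is_presheaf M. Proof. exact: op_presheaf. Qed.
Let fl' T : linear (f T). Proof. by have [p _] := fc; exact: (@pmap_lin _ _ _ _ _ _ p T). Qed.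

(* The graph, on multiples of basis vectors, of the extension of [f]. *)
Inductive Gen : forall X, N X -> M X -> Prop :=
| Gen_eta U : trivial U -> Gen (eta N U) (eta M U)
| Gen_gen X (e : E X) : e <> 0 -> Gen (io X e) (f X e)
| Gen_scale X a x m : a != 0 -> @Gen X x m -> Gen (a *: x) (a *: m)
| Gen_act X Y (h : arr X Y) x m : iso h -> @Gen Y x m -> @Gen X (pact h x) (pact h m)
| Gen_circ X S F (t : arr X S) i x m y n : elementary t i F ->
  @Gen S x m -> @Gen F y n -> @Gen X (circ t x y) (circ t m n).

Lemma Gen_bs X x m : @Gen X x m -> exists A, bs x A.
Proof.
elim=> {X x m}.
- by move=> U [Ul _]; exists set0; apply: bs_eta.
- by move=> X e e0; exists (topS X); apply: ios.
- by move=> X a x m a0 _ [A xA]; exists A; apply: bsZ.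
- by move=> X Y h x m hi _ [A xA]; exists (smap h @: A); apply: bs_act.
- move=> X S F t i x m y n te _ [A xA] _ [B yB]. have [_ [iv [ih I]] _ _] := te.
 by exists (smap t @: A :|: imap ih @: B); apply: bs_circ te I xA yB.
Qed.

(** Both elements have one common degree: as [io] is injective and commutes with degree projections,
    a generator with homogeneous image is homogeneous. *)
Lemma Gen_homog X x m : @Gen X x m -> exists n, homog n x /\ homog n m.
Proof.
elim=> {X x m}.
- by move=> U Ut; exists 0; split; [apply: op_eta_deg No _ Ut|apply: op_eta_deg Mo _ Ut].
- move=> X e e0; exists (deg fl (topS X)); have h := bs_homog (ios e0); split=> //.
 have [p _] := ioc; have [p' _] := fc. have : homog (deg fl (topS X)) e.
  by apply: (@ioi X); rewrite (gproj_map (@iol X)) //; apply: (pmap_deg p). by move=> /(pmap_deg p'); rewrite addr0.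
- by move=> X a x m a0 _ [n [h h']]; exists n; split; apply: homogZ.
- move=> X Y h x m hi _ [n [h1 h2]]; exists n. by split; [apply: (pact_deg Np)|apply: (pact_deg Mp)].
- move=> X S F t i x m y n te _ [a [h1 h2]] _ [b [h3 h4]]; exists (a + b).
 by split; [apply: (op_deg No te)|apply: (op_deg Mo te)].
Qed.

Lemma circ_nz X S F (t : arr X S) i : elementary t i F -> nz t != set0.
Proof.
move=> te; have [_ [iv [ih I]] F0 _] := te; rewrite -(ih_full te I) imset_eq0.
by rewrite -(nedge_gt0 (objO F)).
Qed.

Lemma Gen_lt X U (b : arr X U) x m : loc_terminal X -> trivial U -> @Gen X x m ->
 exists2 a, a != 0 & x = a *: pact b (eta N U) /\ m = a *: pact b (eta M U).
Proof.
move=> Xl Ut G; elim: G U b Xl Ut => {X x m}.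
- move=> U Ut U' b _ Ut'; exists 1; first exact: oner_neq0. by rewrite !scale1r !op_unit_eta.
- move=> X e e0 U b Xl; case: e0; apply: (coll_red Ec). by apply/(nedge_eq0 (objO X))/loc_full.
- move=> X a x m a0 _ IH U b Xl Ut; have [c c0 [-> ->]] := IH U b Xl Ut.
 by exists (a * c); rewrite ?mulf_neq0 // !scalerA.
- move=> X Y h x m hi _ IH U b Xl Ut; have [g [gi gh hg]] := iso_inv hi.
 have Yl : loc_terminal Y by apply/full_lt/(iso_full hi)/loc_full. have [b' b'E] := comp_arr g b.
 have [c c0 [-> ->]] := IH U b' Yl Ut; exists c => //.
 have bE : amap b = gcomp b' h by rewrite b'E -gcompA gh gcompf1.
 rewrite !(@pact_comp _ _ _ _ _ _ _ h b' b hi (iso_lt b' Yl) bE) //.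
 by rewrite (linZ (pact_lin Np hi)) (linZ (pact_lin Mp hi)).
- move=> X S F t i x m y n te _ _ _ _ U b Xl; have := circ_nz te.
 have := nz_full (objO X) (arr0 t); rewrite loc_full // subset0 => /eqP ->. by rewrite eqxx.
Qed.

Lemma full_circ X S F (t : arr X S) i iv ih (A : {set sym S}) (B : {set sym F}) :
 elementary t i F -> @fiber_incl X S t i F iv ih -> valid fl B -> nz t \in tubes (smap t @: A :|: imap ih @: B).
Proof.
move=> te I /andP[_]; rewrite flt => /andP[/nestP[_ _ h] _].
rewrite inE in_setU; apply/orP; right; apply/imsetP; exists (true, full F). by have := h (full_F te); rewrite inE.
by rewrite /imap /= (ih_full te I).
Qed.

(** With no tube besides [full X] the composite contains a single generator: in a composition step
    the outer factor lives on a graph without edges, hence is a multiple of a unit and is removed by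
    the unit axiom. *)
Lemma Gen_top X x m A : @Gen X x m -> bs x A -> full X != set0 -> tubes A \subset [set full X] ->
 exists e, [/\ e <> 0, x = io X e & m = f X e].
Proof.
move=> G; elim: G A => {X x m}.
- by move=> U [/loc_full -> _] A _; rewrite eqxx.
- by move=> X e e0 A _ _ _; exists e.
- move=> X a x m a0 _ IH A xA X0 At. have [e [e0 -> ->]] : exists e, [/\ e <> 0, x = io X e & m = f X e].
  apply: IH X0 At; rewrite -[x](scalerK a0); apply: bsZ xA; by rewrite invr_eq0.
 exists (a *: e); split; rewrite ?(linZ (@iol X)) ?(linZ (@fl' X)) //.
 by move/eqP; rewrite scaler_eq0 (negbTE a0) => /eqP.
- move=> X Y h x m hi G IH A xA X0 At. have [B xB] := Gen_bs G; have AE := bs_eq xA (bs_act hi xB).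
 have Y0 : full Y != set0 by apply: contra X0 => /eqP Y0; apply/eqP/(iso_full hi).
 have [e [e0 -> ->]] : exists e, [/\ e <> 0, x = io Y e & m = f Y e].
  apply: (IH _ xB Y0); apply/subsetP => q qB; rewrite inE -(inj_eq (lift_inj (f := h))) lift_full //.
  by apply/eqP/set1P/(subsetP At); rewrite AE tubes_smap imset_f. exists (pact h e); split; first exact: iso_coll_0.
  by have [p _] := ioc; rewrite (pmap_act p). by have [p _] := fc; rewrite (pmap_act p).
- move=> X S F t i x m y n te G1 _ G2 IH2 A xA X0 At. have [B1 xB1] := Gen_bs G1; have [B2 xB2] := Gen_bs G2.
 have [_ [iv [ih I]] F0 _] := te. have AE := bs_eq xA (bs_circ te I xB1 xB2). have nzX : nz t = full X.
  apply/set1P/(subsetP At); rewrite AE; apply: full_circ te I (bs_valid xB2). have Sl : loc_terminal S.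
  apply: full_lt; apply/setP => k; rewrite in_set0 -(full_nz t) -nzX. exact/negbTE/psi_nz.
 have [U [b [Ut _ _]]] := terminal_ex S. have [a a0 [xE mE]] := Gen_lt b Sl Ut G1.
 have [e [e0 yE nE]] : exists e, [/\ e <> 0, y = io F e & n = f F e].
  apply: IH2 xB2 (full_F te) _; apply/subsetP => q qB; rewrite inE. have : ih @: q \in [set full X].
   apply: (subsetP At); rewrite AE inE in_setU; apply/orP; right.
   by apply/imsetP; exists (true, q) => //; move: qB; rewrite inE.
  by rewrite in_set1 -nzX -(ih_full te I) (inj_eq (imset_inj (ih_inj I))).
 have lt : lt_fiber X F by exists S, t, i; split=> //; exists iv, ih. have [e' ee] := same_ex e (coll_eq Ec lt).
 have X1 : (0 < nedge X)%N by rewrite (nedge_gt0 (objO X)). have [_ iS] := ioc; have [_ fS] := fc.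
 exists (a *: e'); split.
 + move/eqP; rewrite scaler_eq0 (negbTE a0) /= => /eqP e'0; apply: e0.
  by have [EE <-] := ee; rewrite e'0; apply/lin0/gcast_lin.
 + rewrite (linZ (@iol X)) xE (linZ (op_linl No te _)); congr (_ *: _).
  by apply/(same_inj (op_unit No b Sl Ut te _) (iS _ _ X1 lt _ _ ee)).
 + rewrite (linZ (@fl' X)) mE (linZ (op_linl Mo te _)); congr (_ *: _).
  by apply/(same_inj (op_unit Mo b Sl Ut te _) (fS _ _ X1 lt _ _ ee)).
Qed.

(** Such a tube marks a generator that can be composed first, inside all others. *)
Definition minT X (A : {set sym X}) (q : {set 'I_(nh X)}) : Prop :=
 [/\ q \in tubes A, q != full X & forall q', q' \in tubes A -> ~~ (q' \proper q)].

(** The element and its value are split along the same contraction with the same generator inside,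
    so that they can be compared simultaneously. *)
Definition dec X (x : N X) (m : M X) T S F (l : arr X T) (t : arr T S) : Prop :=
 exists y n (e : E F), [/\ @Gen S y n, e <> 0, x = pact l (circ t y (io F e)) & m = pact l (circ t n (f F e))].

Lemma dec_transfer X (x : N X) m T S F (l : arr X T) (t : arr T S) i T' S' F' (l' : arr X T')
  (t' : arr T' S') i' : iso l -> iso l' -> elementary t i F -> elementary t' i' F' ->
 nz (gcomp t l) = nz (gcomp t' l') -> @dec X x m T S F l t -> @dec X x m T' S' F' l' t'.
Proof.
move=> li li' te te' nE [y [n [e [G e0 -> ->]]]].
have [s [e' [si e0' H]]] := transfer Ec li li' te te' nE e0.
exists (pact s y), (pact s n), e'; split=> //; first exact: Gen_act. exact: H.
exact: H.
Qed.

Lemma tube_of X x m A q : @Gen X x m -> bs x A -> q \in tubes A -> tube q.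
Proof.
move=> G xA; have /andP[_] := bs_valid xA; rewrite flt => /andP[/nestP[t _ _] _].
exact: t.
Qed.

Lemma nz_comp_iso X Y (P : graph) (h : arr X Y) (g : gmap Y P) : iso h -> nz (gcomp g h) = psi h @: nz g.
Proof.
move=> hi; apply/setP => k; rewrite (in_nz_comp _ (arr0 h)); have /iso_nz -> := hi.
by rewrite in_set0.
Qed.

(** Any minimal tube can be brought to the innermost place, by induction on the construction of the
    composite. A tube of the outer factor is moved by the parallel axiom, one of the inner factor by
    the sequential axiom. This takes the place of a normal form for composites. *)
Lemma Gen_dec X x m A q : @Gen X x m -> bs x A -> minT A q -> exists T S F (l : arr X T) (t : arr T S) i,
  [/\ iso l, elementary t i F, nz (gcomp t l) = q & @dec X x m T S F l t].
Proof.
move=> G; elim: G A q => {X x m}.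
- move=> U [Ul _] A q xA [qA _ _]; move: qA. by rewrite (bs_eq xA (bs_eta Ul)) !inE.
- move=> X e e0 A q xA [qA q0 _]; move: qA. by rewrite (bs_eq xA (ios e0)) tubes_top inE (negbTE q0).
- move=> X a x m a0 G IH A q xA mq. have xA' : bs x A. by rewrite -[x](scalerK a0); apply: bsZ xA; rewrite invr_eq0.
 have [T [S [F [l [t [i [li te nE [y [n [e [G' e0 -> ->]]]]]]]]]]] := IH A q xA' mq.
 exists T, S, F, l, t, i; split=> //; exists (a *: y), (a *: n), e; split=> //.
 + exact: Gen_scale.
 + by rewrite (linZ (op_linl No te _)) (linZ (pact_lin Np li)).
 + by rewrite (linZ (op_linl Mo te _)) (linZ (pact_lin Mp li)).
- move=> X Y h x m hi G IH A q xA [qA q0 qm]. have [B xB] := Gen_bs G; have AE := bs_eq xA (bs_act hi xB).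
 have [q1 q1B qE] : exists2 q1, q1 \in tubes B & q = lift h q1. by apply/imsetP; rewrite -tubes_smap -AE.
 have [T [S [F [l [t [i [li te nE [y [n [e [G' e0 -> ->]]]]]]]]]]] : exists T S F (l : arr Y T) (t : arr T S) i,
  [/\ iso l, elementary t i F, nz (gcomp t l) = q1 & @dec Y x m T S F l t].
  apply: (IH B) => //; split=> // [|q' q'B]. apply: contra q0 => /eqP q1E; rewrite qE q1E lift_full //.
   by have := tube_of G xB q1B => /tubeP[]; rewrite q1E.
  by rewrite -(lift_proper h) -qE; apply: qm; rewrite AE tubes_smap imset_f. have [l' l'E] := comp_arr h l.
 have l'i : iso l' by apply: iso_comp hi li l'E. exists T, S, F, l', t, i; split=> //.
  by rewrite l'E gcompA (nz_comp_iso _ hi) nE qE (lift_iso hi).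
 exists y, n, e; split=> //; first by rewrite (pact_comp Np hi li l'E). by rewrite (pact_comp Mp hi li l'E).
- move=> X S0 F0 t0 i0 y1 m1 y2 m2 te G1 IH1 G2 IH2 A q xA [qA q0 qm].
 have [B1 yB1] := Gen_bs G1; have [B2 yB2] := Gen_bs G2. have [_ [iv [ih I]] F00 _] := te.
 have AE := bs_eq xA (bs_circ te I yB1 yB2).
 have nzA : nz t0 \in tubes A by rewrite AE; apply: full_circ te I (bs_valid yB2).
 have tA : tubes A = lift t0 @: tubes B1 :|: himg ih @: tubes B2.
  by have [_ tU] := symU (smap t0 @: B1) (imap ih @: B2); rewrite AE tU tubes_smap tubes_imap. have ihI := ih_inj I.
 have t1A q' : q' \in tubes B1 -> lift t0 q' \in tubes A. by move=> q'B; rewrite tA inE imset_f.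
 have t2A q' : q' \in tubes B2 -> ih @: q' \in tubes A. by move=> q'B; rewrite tA inE (imset_f (himg ih)) ?orbT.
 have B2f q' : q' \in tubes B2 -> q' \subset full F0. by move=> q'B; have /tubeP[] := tube_of G2 yB2 q'B.
 move: (qA); rewrite tA inE => /orP[/imsetP[q1 q1B qE]|/imsetP[q2 q2B qE]].
 (* A minimal tube from the outer factor cannot contain [nz t0], so it avoids the vertex [i0] and
    the two contractions can be exchanged. *)
 + have tq1 := tube_of G1 yB1 q1B. have i0q : i0 \notin vtx S0 @: q1.
   apply/negP => iq; have := qm _ nzA; rewrite qE properE (nz_sub_lift te iq) //=.
   by rewrite lift_not_nz //; case/tubeP: tq1. have mq1 : minT B1 q1. split=> // [|q' q'B].
    apply: contra q0 => /eqP q1E; rewrite qE q1E lift_full //. by case/tubeP: tq1; rewrite q1E.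
   by rewrite -(lift_proper t0) -qE qm ?t1A. have [T1 [S1 [F1 [l1 [t1 [i1 [li1 te1 nE1 D1]]]]]]] := IH1 _ _ yB1 mq1.
  have [T [R' [R'' [S [G [l [r [f' [g' [f'' [g'' [h [j [i [l0 [k H]]]]]]]]]]]]]]]] := refine_out te tq1 i0q.
  case: H => [[li ri hE hE'] [gf nq] [fe' ge' fe'' ge''] [gl ik gj] fh].
  have [y [n [e [Gy e0 y1E m1E]]]] : @dec S0 y1 m1 R' S G r g'.
   by apply: dec_transfer li1 ri te1 ge' _ D1; rewrite nE1 nq.
  have [av [ah Ah]] := fh; have [_ [bv [bh Bh]] _ _] := fe'. have [wj [wv wh]] := induced_ex hE Ah Bh.
  have wi : iso wj. apply/iso_nz/setP => k'; rewrite (nz_induced hE Ah Bh wh); have /iso_nz -> := li.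
   by rewrite !inE. have [wk [wki wk1 wk2]] := iso_inv wi.
  have ind : is_induced l f' h j wj by exists av, ah, bv, bh. have step (L : operad K O) z w : is_operad L ->
    circ t0 (pact r z) w = pact l (circ f' z (pact wk w)) :> L X.
   move=> Lo; have [w' /same_refl <- ->] := op_equiv Lo li ri hE hE' te fe' fh ind z (pact wk w).
   by rewrite (pactK (op_presheaf Lo) wki wi wk1). have nE : nz (gcomp f'' l) = q.
   rewrite (nz_iso_comp _ li) qE (lift_notouch te i0q) -nq (nz_iso_comp _ ri). have -> : nz f'' = psi f' @: nz g'.
    have cE v : phi g' (phi f' v) = phi g'' (phi f'' v). by have := f_equal (fun x => phi x v) gf; rewrite !ffunE.
    have cn h' : (h' \in nz f') || (h' \in psi f' @: nz g') = (h' \in nz f'') || (h' \in psi f'' @: nz g'').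
     by rewrite -(in_nz_comp _ (arr0 f')) gf (in_nz_comp _ (arr0 f'')).
    apply/setP => h'; apply/idP/imsetP => [hn|[k' kn ->]].
     have := cn h'; rewrite hn /= => /orP[hn'|/imsetP[k' kn ->]]; last by exists k'.
     by case: ik; rewrite -gj -gl -(elem_nz fe' hn') -(elem_nz fe'' hn) cE.
    have := cn (psi f' k'); rewrite imset_f // orbT => /esym/orP[//|/imsetP[k'' kn' E']].
    case: ik; rewrite -(elem_nz ge' kn) -(elem_nz ge'' kn') -(phi_vtx (arr0 f')) E' cE.
    by rewrite (phi_vtx (arr0 f'')). rewrite -!imset_comp; apply: eq_imset => k' /=.
   by rewrite -(psi_comp _ hE) (psi_comp _ hE'). have [a [hy2 hm2]] := Gen_homog (Gen_act wki G2).
  have [b [he hfe]] := Gen_homog (Gen_gen e0). exists T, R'', G, l, f'', l0; split=> //.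
  (* The sign of the parallel axiom is put into both components, so that the element and its value
     stay rescaled together. *)
  exists (sgn K (a * b) *: circ g'' y (pact wk y2)), (sgn K (a * b) *: circ g'' n (pact wk m2)), e.
  have s0 : sgn K (a * b) != 0.
   by apply/eqP => s0; have := sgnK K (a * b); rewrite s0 mulr0 => /eqP; rewrite eq_sym oner_eq0. split=> //.
  * apply: Gen_scale => //; apply: Gen_circ ge'' Gy _; exact: Gen_act.
  * rewrite y1E (step _ _ _ No) (circZl _ _ _ No fe'').
   by rewrite -(op_assoc_par No gf fe' ge' fe'' ge'' gl ik gj _ hy2 he) scalerA sgnK scale1r.
  * rewrite m1E (step _ _ _ Mo) (circZl _ _ _ Mo fe'').
   by rewrite -(op_assoc_par Mo gf fe' ge' fe'' ge'' gl ik gj _ hm2 hfe) scalerA sgnK scale1r.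
 (* A minimal tube from the inner factor: either it is the whole fiber, whose factor is then one
    generator by [Gen_top], or it lies strictly inside and [refine_in] applies. *)
 + rewrite /himg in qE; have [q2E|q2f] := eqVneq q2 (full F0).
   have [e [e0 y2E m2E]] : exists e, [/\ e <> 0, y2 = io F0 e & m2 = f F0 e].
    apply: Gen_top G2 yB2 (full_F te) _; apply/subsetP => q' q'B; rewrite inE.
    have := qm _ (t2A _ q'B); rewrite qE (incl_proper I) q2E properEneq (B2f _ q'B) andbT. by rewrite negbK.
   have [d dE] := id_arr X. have di : iso d by exists d; rewrite dE gcompf1.
   exists X, S0, F0, d, t0, i0; split=> //. by rewrite dE gcompf1 qE q2E; apply: esym (ih_full te I).
   exists y1, m1, e; split; [exact: G1|exact: e0|by rewrite (pact_id Np dE) y2E|]. by rewrite (pact_id Mp dE) m2E.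
  have mq2 : minT B2 q2. by split=> // q' q'B; have := qm _ (t2A _ q'B); rewrite qE (incl_proper I).
  have [T2 [S2 [F2 [l2 [t2 [i2 [li2 te2 nE2 D2]]]]]]] := IH2 _ _ yB2 mq2.
  have tq : tube q by have := tube_of (Gen_circ te G1 G2) xA qA. have qp : q \proper nz t0.
   rewrite properEneq qE -(ih_full te I) (inj_eq (imset_inj ihI)) q2f /=. exact/imsetS/B2f.
  have [T [S [F [G [H [l [t [g [xi [j [fi [li HH]]]]]]]]]]]] := refine_in te tq qp.
  case: HH => [[l_i t_e g_e gj] [xiE xil xi_e ind] [indl li_i [j' fi_e]] nE]. have nE' : nz (gcomp fi li) = q2.
   have [iv1 [ih1 [jv1 [jh1 [I1 J1 v1 h1]]]]] := indl. have [iv2 [ih2 [jv2 [jh2 [I2 J2 v2 h2]]]]] := ind.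
   have e1 : ih =1 ih1 := incl_uniq I I1. have e2 : jh1 =1 ih2 := incl_uniq J1 I2.
   apply: (imset_inj ihI); rewrite -qE -nE (nz_iso_comp _ li_i) (nz_iso_comp _ l_i).
   apply/setP => h; apply/imsetP/imsetP => [[_ /imsetP[k kn ->] ->]|[h' hn ->]].
    exists (jh1 k); last by rewrite e1 h1. by move: kn; rewrite (nz_induced xiE I2 J2 h2) e2.
   have [k hk] : exists k, h' = ih2 k. by apply: (ih_ex I2); rewrite (phi_comp _ xiE) (elem_nz t_e hn).
   exists (psi li k); last by rewrite e1 h1 e2 hk. by apply: imset_f; rewrite (nz_induced xiE I2 J2 h2) -hk.
  have [y [n [e [Gy e0 y2E m2E]]]] : @dec F0 y2 m2 H G F li fi.
   by apply: dec_transfer li2 li_i te2 fi_e _ D2; rewrite nE2 nE'. have [d dE] := id_arr S0.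
  have di : iso d by exists d; rewrite dE gcompf1. have sq1 : amap t0 = gcomp xi l by rewrite xil.
  have sq2 : amap t0 = gcomp d t0 by rewrite dE gcomp1f. have fib : is_fiber t0 i0 F0 by exists iv, ih.
  have [_ fib2 _ _] := xi_e. have step (L : operad K O) z w : is_operad L ->
    circ t0 z (pact li w) = pact l (circ xi z w) :> L X.
   move=> Lo; have [w' /same_refl <- ->] := op_equiv Lo l_i di sq1 sq2 te xi_e fib indl z w.
   by rewrite (pact_id (op_presheaf Lo) dE). exists T, S, F, l, t, j; split=> //.
  exists (circ g y1 y), (circ g m1 n), e; split=> //.
  * exact: Gen_circ g_e G1 Gy.
  * by rewrite y2E (step _ _ _ No) (op_assoc_seq No t_e g_e gj xiE fib2 ind).
  * by rewrite m2E (step _ _ _ Mo) (op_assoc_seq Mo t_e g_e gj xiE fib2 ind).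
Qed.

Lemma state_cases X (A : {set sym X}) : valid fl A -> tubes A \subset [set full X] \/ exists q, minT A q.
Proof.
move=> /andP[_]; rewrite flt => /andP[/nestP[t _ _] _].
have [s|/subsetPn[q qA qf]] := boolP (tubes A \subset [set full X]); first by left.
right; rewrite inE in qf; have P0 : (q \in tubes A) && (q != full X) by rewrite qA.
case: (@arg_minnP _ q (fun q => (q \in tubes A) && (q != full X)) (fun q => #|q|) P0).
move=> q0 /andP[q0A q0f] m; exists q0; split=> // q' q'A; apply/negP => pr.
have := m q'; rewrite q'A /= => h; have := proper_card pr; rewrite ltnNge h //.
apply: contraTneq pr => ->; rewrite properE negb_and negbK.
by have /tubeP[_ -> _ _] := t _ q0A; rewrite orbT.
Qed.

Lemma valid_top X (A : {set sym X}) : valid fl A -> full X != set0 -> tubes A \subset [set full X] -> A = topS X.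
Proof.
move=> /andP[/eqP eA]; rewrite flt => /andP[/nestP[_ _ h] _] X0 s.
apply: sym_eq; first by rewrite edges_top.
rewrite tubes_top; apply/eqP; rewrite eqEsubset s /= sub1set; exact: h.
Qed.

(** Well-definedness of the extension, by induction on the number of tubes: both composites are
    split at the same minimal tube and along the same contraction, and by [join_inj] their outer
    factors have the same symbols. *)
Lemma Gen_fun X x m x' m' A : @Gen X x m -> @Gen X x' m' -> bs x A -> bs x' A ->
 exists c, x' = c *: x /\ m' = c *: m.
Proof.
move: {2}#|tubes A|.+1 (ltnSn #|tubes A|) => k.
elim: k => // k IH in X x m x' m' A *; rewrite ltnS => Ak G G' xA xA'.
have vA := bs_valid xA.
have [X0|X0] := eqVneq (full X) set0. have Xl := full_lt X0; have [U [b [Ut _ _]]] := terminal_ex X.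
 have [a a0 [-> ->]] := Gen_lt b Xl Ut G; have [a' a0' [-> ->]] := Gen_lt b Xl Ut G'.
 by exists (a' / a); rewrite !scalerA divfK.
have [s|[q mq]] := state_cases vA.
 have [e [e0 xE ->]] := Gen_top G xA X0 s; have [e' [e0' xE' ->]] := Gen_top G' xA' X0 s.
 have [c c0 cE] := bs_prop xA xA'; exists c; split=> //. rewrite -(linZ (@fl' X)); congr (f X _); apply: (@ioi X).
 by rewrite -xE' cE xE (linZ (@iol X)).
have [T [S [F [l [t [i [li te nE [y [n [e [Gy e0 xE mE]]]]]]]]]]] := Gen_dec G xA mq.
have [T' [S' [F' [l' [t' [i' [li' te' nE' D]]]]]]] := Gen_dec G' xA' mq.
have [y' [n' [e' [Gy' e0' xE' mE']]]] : @dec X x' m' T S F l t.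
 by apply: dec_transfer li' li te' te _ D; rewrite nE nE'.
have [B yB] := Gen_bs Gy; have [B' yB'] := Gen_bs Gy'.
have [_ [iv [ih I]] _ _] := te.
have AE : A = smap l @: (smap t @: B :|: imap ih @: topS F).
 by apply: bs_eq xA _; rewrite xE; apply: bs_act li _; apply: bs_circ te I yB (ios e0).
have AE' : A = smap l @: (smap t @: B' :|: imap ih @: topS F).
 by apply: bs_eq xA' _; rewrite xE'; apply: bs_act li _; apply: bs_circ te I yB' (ios e0').
have vF := bs_valid (ios e0).
have BE : B' = B. apply: (join_inj te I (bs_valid yB') (bs_valid yB) vF).
 by apply: (imset_inj (smap_inj (f := l))); rewrite -AE'.
rewrite BE in yB'.
have Bk : (#|tubes B| < k)%N. apply: leq_trans Ak; rewrite AE tubes_smap card_imset; last exact: lift_inj.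
 by rewrite (card_join te I (bs_valid yB) vF) tubes_top cards1 addn1.
have [c [yc nc]] := IH _ _ _ _ _ B Bk Gy Gy' yB yB'.
have [d d0 dE] := bs_prop (ios e0) (ios e0').
have eE : e' = d *: e by apply: (@ioi F); rewrite dE (linZ (@iol F)).
exists (c * d); rewrite xE xE' mE mE' yc nc eE (linZ (@iol F)) (linZ (@fl' F)).
rewrite (circZl _ _ _ No te) (circZl _ _ _ Mo te) (linZ (op_linr No te _)) (linZ (op_linr Mo te _)).
by rewrite !scalerA (pactZ _ _ No li) (pactZ _ _ Mo li).
Qed.
End Gen.

(** Any tube other than [full X] splits the nesting into two smaller ones. The vector [x] is chosen
    before [M] and [f], so that one basis of composites serves for all extensions. *)
Lemma Gen_total X (A : {set sym X}) : valid fl A -> exists2 x : N X, bs x A &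
 forall (M : operad K O) (f : family E M), one_connected M -> coll_map f -> exists m, @Gen M f X x m.
Proof.
move: {2}#|tubes A|.+1 (ltnSn #|tubes A|) => k.
elim: k => // k IH in X A *; rewrite ltnS => Ak vA.
have [X0|X0] := eqVneq (full X) set0. have Xl := full_lt X0; have [U [b [Ut _ _]]] := terminal_ex X.
 have bi := iso_lt b Xl. exists (pact b (eta N U)). have := bs_act bi (bs_eta (proj1 Ut)); rewrite imset0.
  by have := valid_lt fl A X0; rewrite vA => /esym/eqP ->.
 by move=> M f _ _; exists (pact b (eta M U)); apply: Gen_act bi (Gen_eta f Ut).
have [s|[q [qA q0 _]]] := state_cases vA. have AE := valid_top vA X0 s. have [e e0] : exists e : E X, e <> 0.
  apply: ioo; first by rewrite (nedge_gt0 (objO X)).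
  (* When nestings are maximal, a nesting consisting of [full X] alone forces [X] to have a single
     edge, so that [ioo] supplies a generator. *)
  move=> mx; move: vA; rewrite AE /valid tubes_top flt mx /= => /and3P[_ _ /forall_inP /(_ (full X))].
  rewrite inE eqxx => /(_ isT) /existsP[h /eqP hE]. have : resid [set full X] (full X) = full X.
   rewrite /resid big1 ?setD0 // => q /andP[]; rewrite inE => /eqP ->. by rewrite properxx.
  move=> rE; have fE : full X = [set h; opp X h] by rewrite -hE rE. have hf : h \in full X by rewrite fE !inE eqxx.
  have := card_full (objO X); rewrite fE cards2; move: hf; rewrite inE eq_sym => -> /=; lia.
 exists (io X e); first by rewrite AE; apply: ios. by move=> M f _ _; exists (f X e); apply: Gen_gen.
have tq : tube q. by move: vA => /andP[_]; rewrite flt => /andP[/nestP[t _ _] _]; apply: t.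
have [T [S [F [l [t [i [li te nE]]]]]]] := contr_ex tq.
have [_ [iv [ih I]] F0 _] := te.
have [l' [li' l1 l2]] := iso_inv li.
have qE : q = lift l (nz t) by rewrite -nE (nz_iso_comp _ li) (lift_iso li).
have [vA' _] := valid_iso li' vA.
have nzA : nz t \in tubes (smap l' @: A). rewrite tubes_smap; apply/imsetP; exists q => //; rewrite qE.
 by rewrite -(lift_comp _ (esym l2)) lift_gid.
have [B [C [vB vC BC]]] := split_state te I vA' nzA.
have AE : A = smap l @: (smap t @: B :|: imap ih @: C).
 rewrite -BC -imset_comp -[LHS]imset_id; apply: eq_imset => s. by rewrite -(smap_comp (esym l1)) smap_gid.
have cA : #|tubes A| = (#|tubes B| + #|tubes C|)%N. rewrite AE tubes_smap card_imset; last exact: lift_inj.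
 exact: card_join te I vB vC.
have pos (Y : obj O) (D : {set sym Y}) : valid fl D -> full Y != set0 -> (0 < #|tubes D|)%N.
 move=> /andP[_]; rewrite flt => /andP[/nestP[_ _ h] _] Y0. by apply/card_gt0P; exists (full Y); apply: h.
have S0 : full S != set0. apply: contra q0 => /eqP S0; rewrite qE; apply/eqP; rewrite (lift_iso li).
 apply/setP => h; have [k' ->] := iso_psi_surj h li; rewrite full_nz.
 by rewrite mem_imset ?(full0_nz t S0) //; apply: psi_inj (arr0 l).
have Bk : (#|tubes B| < k)%N by apply: leq_trans Ak; rewrite cA -addn1 leq_add2l pos ?(full_F te).
have Ck : (#|tubes C| < k)%N by apply: leq_trans Ak; rewrite cA -add1n leq_add2r pos.
have [x xB Gx] := IH _ B Bk vB; have [y yC Gy] := IH _ C Ck vC.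
exists (pact l (circ t x y)). by rewrite AE; apply: bs_act li _; apply: bs_circ te I xB yC.
move=> M f M1 fc; have [m Gm] := Gx M f M1 fc; have [n Gn] := Gy M f M1 fc.
by exists (pact l (circ t m n)); apply: Gen_act li (Gen_circ te Gm Gn).
Qed.

Lemma Mod_ind X (P : N X -> Prop) : P 0 -> (forall a x y, P x -> P y -> P (a *: x + y)) ->
 (forall x A, bs x A -> P x) -> forall x, P x.
Proof.
move=> P0 Pl Pb x; pose d (a : {A | valid fl A}) : N X := prj _ _ (delta K (val a)).
have -> : x = \sum_a (x : gcar K (@valid fl X)) a *: d a.
 apply/ffunP => a; rewrite sum_ffunE (bigD1 a) //= big1 => [|b ba]. by rewrite !ffunE eqxx addr0; apply/esym/mulr1.
 by rewrite !ffunE (inj_eq val_inj) eq_sym (negbTE ba); apply: mulr0.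
have Pd a : P (d a). apply: (Pb _ (val a)); rewrite /bs /d prjK; first exact: bas_delta.
 by move=> B; rewrite ffunE; case: (B =P val a) => [-> _|_]; [exact: valP|rewrite eqxx].
by apply: (big_rec P) => // a y _ Py; apply: Pl.
Qed.

Lemma lin_gen (M : operad K O) (f : family E M) X (W : lmodType K) (g h : N X -> W) :
 one_connected M -> coll_map f -> linear g -> linear h -> (forall x m, @Gen M f X x m -> g x = h x) -> g =1 h.
Proof.
move=> M1 fc gl hl H; apply: Mod_ind; first by rewrite (lin0 gl) (lin0 hl).
 by move=> a x y gx gy; rewrite gl hl gx gy.
move=> x A xA; have [y yA Gy] := Gen_total (bs_valid xA).
have [m Gm] := Gy M f M1 fc; have [c c0 ->] := bs_prop yA xA.
by rewrite (linZ gl) (linZ hl) (H _ _ Gm).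
Qed.

Lemma omap_gen (M : operad K O) (f : family E M) (g : family N M) : operad_map g ->
 (forall T x, g T (io T x) = f T x) -> forall X x m, @Gen M f X x m -> g X x = m.
Proof.
move=> gm gf X x m; elim=> {X x m}.
- by move=> U Ut; apply: omap_eta gm _ Ut.
- by move=> X e _; apply: gf.
- by move=> X a x m a0 _ <-; rewrite (linZ (pmap_lin gm (T := X))).
- by move=> X Y h x m hi _ <-; rewrite (pmap_act gm hi).
- by move=> X S F t i x m y n te _ <- _ <-; rewrite (omap_circ gm te).
Qed.

Lemma Mod_free : is_free io.
Proof.
split=> [||M f M1 fc]; [exact: Mod_one|exact: ioc|].
have Mo : is_operad M by case: M1.
split; last first. move=> g g' gm gm' gf gf' T; apply: (lin_gen M1 fc).
 - exact: (pmap_lin gm (T := T)).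
 - exact: (pmap_lin gm' (T := T)).
 - by move=> x m G; rewrite (omap_gen gm gf G) (omap_gen gm' gf' G).
pose d X (a : {A | valid fl A}) : N X := prj _ _ (delta K (val a)).
have dE X (a : {A : {set sym X} | valid fl A}) : bs (d X a) (val a). rewrite /bs /d prjK; first exact: bas_delta.
 by move=> B; rewrite ffunE; case: (B =P val a) => [-> _|_]; [exact: valP|rewrite eqxx].
have Gd X (a : {A : {set sym X} | valid fl A}) : exists m, @Gen M f X (d X a) m.
 have [x xA Gx] := Gen_total (valP a); have [m Gm] := Gx M f M1 fc. have [c c0 ->] := bs_prop xA (dE X a).
 by exists (c *: m); apply: Gen_scale.
pose mm X a := projT1 (cid (Gd X a)).
have mmP X a : Gen f (d X a) (mm X a) by rewrite /mm; case: (cid _).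
(* Linear extension of values chosen on the basis. By [Gen_fun] it agrees with every pair in [Gen],
   and from this the axioms of an operad map are read off. *)
pose g X (x : N X) : M X := \sum_a (x : gcar K (@valid fl X)) a *: mm X a.
have gl X : linear (g X). move=> a x y; rewrite /g scaler_sumr -big_split; apply: eq_bigr => b _ /=.
 by rewrite !ffunE scalerDl scalerA.
have gG X x m : @Gen M f X x m -> g X x = m. move=> G; have [A xA] := Gen_bs G; have vA := bs_valid xA.
 pose a : {A : {set sym X} | valid fl A} := exist _ A vA. have [c [-> ->]] := Gen_fun M1 fc (mmP X a) G (dE X a) xA.
 rewrite (linZ (gl X)); congr (_ *: _); rewrite /g (bigD1 a) //= big1 => [|b ba].
  by rewrite !ffunE eqxx scale1r addr0. by rewrite !ffunE (inj_eq val_inj) (negbTE ba) scale0r.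
exists g; last first. move=> T x; have [->|/eqP x0] := eqVneq x 0; last exact: gG (Gen_gen f x0).
 have [p _] := fc; rewrite (lin0 (@iol T)) (lin0 (gl T)). by rewrite (lin0 (pmap_lin p (T := T))).
split; first split.
- exact: gl.
- move=> T n x; rewrite addr0 => h; rewrite /homog -{2}h. have ll : linear (fun x : N T => gproj n (g T x)).
  exact: lin_comp (gl T) (@gproj_lin K (M T) n). have lr : linear (fun x : N T => g T (gproj n x)).
  exact: lin_comp (@gproj_lin K (N T) n) (gl T). apply: (lin_gen M1 fc ll lr) => y m G /=; rewrite (gG _ _ _ G).
 have [k [h1 h2]] := Gen_homog M1 fc G. have [->|nk] := eqVneq n k.
  exact: etrans h2 (esym (etrans (f_equal (g T) h1) (gG _ _ _ G))).
 have z1 : gproj n y = 0 := homog_other h1 nk; have z2 := homog_other h2 nk.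
 exact: etrans z2 (esym (etrans (f_equal (g T) z1) (lin0 (gl T)))).
- move=> T S t ti x; have Mp := op_presheaf Mo.
 apply: (lin_gen M1 fc (lin_comp (pact_lin Np ti) (gl T)) (lin_comp (gl S) (pact_lin Mp ti))).
 by move=> y m G /=; rewrite (gG _ _ _ G) (gG _ _ _ (Gen_act ti G)).
- move=> T S t i F te x y. have lx (y' : N F) : linear (fun x : N S => g T (circ t x y' : N T)).
  by move=> a u v; rewrite -gl; congr (g T _); exact: circ_linl No te.
 have rx (y' : N F) : linear (fun x : N S => circ t (g S x) (g F y') : M T).
  by move=> a u v; rewrite gl; exact: circ_linl Mo te. apply: (lin_gen M1 fc (lx y) (rx y)) => {}x m G.
 have ly : linear (fun y : N F => g T (circ t x y : N T)).
  by move=> a u v; rewrite -gl; congr (g T _); exact: circ_linr No te.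
 have ry : linear (fun y : N F => circ t (g S x) (g F y) : M T).
  by move=> a u v; rewrite gl; exact: circ_linr Mo te. apply: (lin_gen M1 fc ly ry) => {}y n G'.
 by rewrite (gG _ _ _ G) (gG _ _ _ G') (gG _ _ _ (Gen_circ te G G')).
- by move=> U Ut; apply: gG; apply: Gen_eta.
Qed.
End Free.

(** * Acyclic matchings *)

Section Morse.
Variables (K : fieldType) (I : finType) (V : pred {set I}).
Implicit Types (A B : {set I}) (x y : ext K I).

Definition restr y : ext K I := [ffun A => if V A then y A else 0].
(** Multiplication by the sum of all symbols, followed by truncation to valid sets: each admissible
    symbol is added in turn. *)
Definition dif x : ext K I := restr (\sum_i emul i x).

Lemma restr_lin : linear restr.
Proof.
move=> a x y; apply/ffunP => A; rewrite !ffunE.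
by case: (V A); rewrite ?scaler0 ?addr0.
Qed.

Lemma dif_lin : linear dif.
Proof.
move=> a x y; rewrite /dif -restr_lin; congr restr.
rewrite scaler_sumr -big_split; apply: eq_bigr => i _ /=; exact: emul_lin.
Qed.

Lemma restr_id x : supp V x -> restr x = x.
Proof.
move=> s; apply/ffunP => A; rewrite ffunE; case: ifP => // /negbT nV.
by apply/esym/eqP; apply: contraNT nV => /s.
Qed.

Lemma sum_emulE x B : (\sum_i emul i x) B = \sum_(i in B) (-1) ^+ pos i B * x (B :\ i).
Proof.
rewrite sum_ffunE [RHS]big_mkcond; apply: eq_bigr => i _; rewrite ffunE //.
Qed.

Lemma difE x B : dif x B = if V B then \sum_(i in B) (-1) ^+ pos i B * x (B :\ i) else 0.
Proof. by rewrite ffunE sum_emulE. Qed.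

Lemma dif_supp x : supp V (dif x).
Proof. by move=> A; rewrite difE; case: ifP => // _; rewrite eqxx. Qed.

Hypothesis K2 : 2%:R != 0 :> K.
Hypothesis H0 : forall A i j, V A -> V (i |: (j |: A)) -> V (j |: A).

(** Without truncation the square is a symmetric sum of anticommuting operators, equal to its own
    negative. By [H0] a set lying between two valid ones is valid, so the intermediate truncation
    loses no term. *)
Lemma dif_dif x : supp V x -> dif (dif x) = 0.
Proof.
move=> s; pose y := \sum_i emul i x.
have -> : dif (dif x) = restr (\sum_i emul i y). apply/ffunP => B; rewrite difE ffunE sum_emulE; case: ifP => // VB.
 apply: eq_bigr => i iB; congr (_ * _); rewrite [LHS]ffunE -/y.
 case: ifP => // /negbT nV; apply/esym/eqP; apply: contraNT nV.
 rewrite sum_emulE => y0; have [j jB xj] : exists2 j, j \in B :\ i & x (B :\ i :\ j) != 0.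
  apply/exists_inP; apply: contraNT y0; rewrite negb_exists_in => /forall_inP h.
  by rewrite big1 // => j /h; rewrite negbK => /eqP ->; rewrite mulr0.
 have := @H0 _ i j (s _ xj); rewrite (setD1K jB) (setD1K iB); exact.
have -> : \sum_i emul i y = 0; last first. by apply/ffunP => B; rewrite !ffunE if_same.
rewrite /y; under eq_bigr => i _ do rewrite (lin_sum (@emul_lin K _ _)).
have E : \sum_i \sum_j emul i (emul j x) = - \sum_i \sum_j emul i (emul j x).
 rewrite [LHS]exchange_big -sumrN; apply: eq_bigr => i _; rewrite -sumrN. by apply: eq_bigr => j _; rewrite emulC.
have : 2%:R *: (\sum_i \sum_j emul i (emul j x)) = 0. by rewrite scaler_nat mulr2n {2}E subrr.
by move/eqP; rewrite scaler_eq0 (negbTE K2) => /eqP.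
Qed.

(* The matching pairs [A] with [A] minus, or plus, [t A]. *)
Variables (r : {set I} -> nat) (t : {set I} -> I) (L : nat).
(** [r] is a level that does not decrease when a symbol is added; toggling [t A] keeps the level,
    and [t] is the same for all extensions within a level. Hence the matching can be used one level
    at a time. *)
Hypothesis H1 : forall A i, V A -> V (i |: A) -> (r A <= r (i |: A))%N.
Hypothesis H2 : forall A, V A -> (r A < L)%N -> [/\ V (t A |: A), V (A :\ t A),
 r (t A |: A) = r A & r (A :\ t A) = r A].
Hypothesis H3 : forall A i, V A -> V (i |: A) -> r (i |: A) = r A -> (r A < L)%N -> t (i |: A) = t A.

Lemma toggle_t A : V A -> (r A < L)%N -> t (t A |: A) = t A /\ t (A :\ t A) = t A.
Proof.
move=> VA rL; have [v1 v2 r1 r2] := H2 VA rL; split; first exact: H3.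
have [tA|tA] := boolP (t A \in A); last by rewrite (setDidPl _) // disjoint_sym disjoints1.
have := @H3 (A :\ t A) (t A); rewrite setD1K // => h; symmetry; apply: h => //.
by rewrite r2.
Qed.

Lemma sign_swap i j B : i \in B -> j \notin B ->
 (-1) ^+ pos j B * (-1) ^+ pos i (j |: B) = - ((-1) ^+ pos i B * (-1) ^+ pos j (B :\ i)) :> K.
Proof.
move=> iB jB; have ij : i != j by apply: contraNneq jB => <-.
rewrite (pos_split j i B) (pos_split i j (j |: B)) iB setU11 setU1K //= !exprD.
have : ((index i (enum I) < index j (enum I)) (+) (index j (enum I) < index i (enum I)))%N.
 case: ltngtP => // e; case/eqP: ij. by rewrite -[i](nth_index i (mem_enum I i)) e nth_index ?mem_enum.
case: (_ < _)%N => /=; last by move=> -> /=; rewrite expr1 expr0; ring.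
by move/negbTE => -> /=; rewrite expr1 expr0; ring.
Qed.

(** Subtracting a boundary clears level [k]: the correction [y] is supported on that level, and
    [dif y] reproduces [x] there without touching lower levels. *)
Lemma morse_step x k : (k < L)%N -> supp (fun A => V A /\ k <= r A)%N x -> dif x = 0 ->
 exists2 y, supp V y & supp (fun A => V A /\ k < r A)%N (x - dif y).
Proof.
move=> kL s dx.
(* The contracting homotopy of the matching: the coefficient of [B] is that of its partner
   [t B |: B], with the sign of removing [t B]. *)
pose y : ext K I := [ffun B => if [&& V B, r B == k & t B \notin B] then (-1) ^+ pos (t B) B * x (t B |: B) else 0].
have yP B : y B != 0 -> [/\ V B, r B = k & t B \notin B].
 by rewrite ffunE; case: ifP => [/and3P[v /eqP rk tB]|_]; [split|rewrite eqxx].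
exists y => [B /yP[]//|B].
have [VB|nV] := boolP (V B); last first. have x0 : x B = 0 by apply/eqP; apply: contraNT nV => /s[].
 by rewrite !ffunE x0 (negbTE nV) subrr eqxx.
have [rk|rk|rk] := ltngtP (r B) k.
- have x0 : x B = 0 by apply/eqP; apply: contraTT rk => /s[_]; rewrite -leqNgt.
 rewrite 2!ffunE x0 difE VB big1 ?oppr0 ?addr0 ?eqxx // => i iB. suff -> : y (B :\ i) = 0 by rewrite mulr0.
 apply/eqP; apply: contraTT rk => /yP[v <- _]; rewrite -leqNgt.
 by have := @H1 (B :\ i) i v; rewrite setD1K //; apply.
- by move=> _; split.
- suff E : dif y B = x B by rewrite 2!ffunE E subrr eqxx. rewrite difE VB; have rL : (r B < L)%N by rewrite rk.
 have [v1 v2 r1 r2] := H2 VB rL; have [t1 t2] := toggle_t VB rL.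
 have tE i : i \in B -> y (B :\ i) != 0 -> t (B :\ i) = t B.
  move=> iB /yP[v rk' _]; have := @H3 (B :\ i) i v; rewrite setD1K // => h. by rewrite h // ?rk' ?rk.
 have [tB|tB] := boolP (t B \in B). rewrite (bigD1 (t B)) //= [X in _ + X]big1 ?addr0 => [|i /andP[iB it]].
   rewrite /y ffunE v2 r2 rk eqxx t2 setD11 /= setD1K // -{2}(setD1K tB) posU1.
   by rewrite mulrA -expr2 sqrr_sign mul1r. suff -> : y (B :\ i) = 0 by rewrite mulr0.
  apply/eqP/negPn/negP => y0; have [_ _] := yP _ y0. by rewrite (tE _ iB y0) !inE tB andbT eq_sym it.
 (* If [t B] is absent from [B], the cycle equation at [t B |: B] expresses [x B] through the other
    coefficients, which are exactly those entering [dif y B]. *)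
 have := f_equal (fun z : ext K I => z (t B |: B)) dx.
 rewrite difE v1 ffunE (big_setU1 _ tB) /= setU1K // posU1 => e.
 have xE : x B = - \sum_(i in B) (-1) ^+ pos (t B) B * ((-1) ^+ pos i (t B |: B) * x ((t B |: B) :\ i)).
  have -> : x B = (-1) ^+ pos (t B) B * ((-1) ^+ pos (t B) B * x B). by rewrite mulrA -expr2 sqrr_sign mul1r.
  rewrite -mulr_sumr -mulrN; congr (_ * _). by apply: etrans (esym (opprK _)) _; congr (- _); apply: addr0_eq e.
 rewrite xE -sumrN; apply: eq_bigr => i iB. have it : i != t B by apply: contraNneq tB => <-.
 have sE : (t B |: B) :\ i = t B |: (B :\ i).
  by apply/setP => j; rewrite !inE; case: (eqVneq j (t B)) => [->|]; rewrite ?andbT //= eq_sym it.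
 rewrite mulrA (sign_swap iB tB) mulNr opprK -mulrA sE; congr (_ * _).
 rewrite /y ffunE; case: ifP => [/and3P[v /eqP rk' _]|]. have := @H3 (B :\ i) i v; rewrite setD1K // => h.
  by rewrite -h // ?rk' ?rk. move=> /negbT nc; suff -> : x (t B |: (B :\ i)) = 0 by rewrite mulr0.
 apply/eqP; apply: contraNT nc => /s[v kr].
 have vi : V (i |: (t B |: (B :\ i))) by rewrite -sE setD1K // !inE iB orbT. have ri : r (t B |: (B :\ i)) = k.
  apply/eqP; rewrite eqn_leq kr andbT; have := H1 v vi. by rewrite -sE setD1K ?r1 ?rk // !inE iB orbT.
 have tt : t (t B |: (B :\ i)) = t B. have := H3 v vi; rewrite -sE setD1K ?r1 ?rk //; last by rewrite !inE iB orbT.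
  by rewrite sE ri t1 => /(_ erefl kL) <-. have tBi : t B \notin B :\ i by rewrite !inE negb_and (negbTE tB) orbT.
 have [_ v3 _ r3] := H2 v (eq_ind_r (fun m => (m < L)%N) kL ri).
 have [_ t3] := toggle_t v (eq_ind_r (fun m => (m < L)%N) kL ri). move: v3 r3 t3; rewrite tt setU1K // => -> -> ->.
 by rewrite ri eqxx tBi.
Qed.

Lemma morse x : supp V x -> dif x = 0 -> exists2 y, supp V y & supp (fun A => V A /\ L <= r A)%N (x - dif y).
Proof.
move=> s dx.
have H k : (k <= L)%N -> exists2 y, supp V y & supp (fun A => V A /\ k <= r A)%N (x - dif y).
 elim: k => [_|k IH kL]. exists 0; first by move=> A; rewrite ffunE eqxx. by rewrite (lin0 dif_lin) subr0 => A /s.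
 have [y sy sxy] := IH (ltnW kL). have dxy : dif (x - dif y) = 0.
  by rewrite (linD dif_lin) (linN dif_lin) dx dif_dif // subrr. have [z sz sxz] := morse_step kL sxy dxy.
 exists (y + z); first by rewrite -[y]scale1r; apply: supp_lin. by rewrite (linD dif_lin) opprD addrA.
exact: H.
Qed.
End Morse.

(** * Nestings of a set of edges *)

Section CNest.
Variable T : graph.
Hypothesis To : ordered T.
Implicit Types (Z q p : {set 'I_(nh T)}) (N : {set {set 'I_(nh T)}}) (h k : 'I_(nh T)).

Definition comp Z h := [set k in Z | connect (eadj T Z) (vtx T h) (vtx T k)].

(** Removing an edge may disconnect a graph, so the induction needs nestings of arbitrary sets of
    edges; the components of [Z] play the role of [full T]. *)
Definition cnest Z N : bool := [&& [forall q in N, tube q && (q \subset Z)],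
   [forall q in N, forall q' in N, compat q q'] & [forall h in Z, comp Z h \in N]].

Lemma cnestP Z N : reflect [/\ forall q, q \in N -> tube q /\ q \subset Z,
 forall q q', q \in N -> q' \in N -> compat q q' & forall h, h \in Z -> comp Z h \in N] (cnest Z N).
Proof.
apply: (iffP and3P) => [[/forall_inP t /forall_inP c /forall_inP z]|[t c z]]; split=> //.
- by move=> q /t /andP.
- by move=> q q' qN q'N; have /forall_inP := c q qN; apply.
- by apply/forall_inP => q /t [-> ->].
- by apply/forall_inP => q qN; apply/forall_inP => q' q'N; apply: c.
- exact/forall_inP.
Qed.

Lemma mem_comp Z h : h \in Z -> h \in comp Z h.
Proof. by move=> hZ; rewrite inE hZ connect0. Qed.

Lemma comp_sub Z h : comp Z h \subset Z.
Proof. by apply/subsetP => k; rewrite inE => /andP[]. Qed.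

Section Closed.
Variable Z : {set 'I_(nh T)}.
Hypotheses (Zo : opclosed (opp T) Z) (Zf : Z \subset full T).

Lemma comp_vtx h v : h \in Z -> connect (eadj T Z) (vtx T h) v -> exists2 k, k \in comp Z h & vtx T k = v.
Proof.
move=> hZ c; apply: (connect_ind (P := fun v => exists2 k, k \in comp Z h & vtx T k = v) c).
 by exists h; rewrite ?mem_comp.
move=> a b [k + kE] /erelP[m mZ [mE mE']]; rewrite inE => /andP[kZ ck].
exists (opp T m); rewrite // inE Zo //=; apply: connect_trans ck _.
by rewrite kE -mE; apply/connect1/erel1.
Qed.

Lemma comp_tube h : h \in Z -> tube (comp Z h).
Proof.
move=> hZ; apply/tubeP; split.
- by apply/set0Pn; exists h; apply: mem_comp.
- exact: subset_trans (comp_sub Z h) Zf.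
- move=> k; rewrite !inE => /andP[kZ ck]; rewrite Zo //=. by apply: connect_trans ck _; apply/connect1/erel1.
- have H v : connect (eadj T Z) (vtx T h) v -> connect (eadj T (comp Z h)) (vtx T h) v.
  move=> c; suff [] : connect (eadj T Z) (vtx T h) v /\ connect (eadj T (comp Z h)) (vtx T h) v by [].
  apply: (connect_ind (P := fun v => connect (eadj T Z) (vtx T h) v /\
   connect (eadj T (comp Z h)) (vtx T h) v) c) => // a b [ca ca'] ab.
  split; first by apply: connect_trans ca _; apply: connect1.
  have /erelP[m mZ [mE <-]] := ab; apply: connect_trans ca' _; rewrite -mE.
  by apply/connect1/erel1; rewrite inE mZ mE. move=> k k'; rewrite !inE => /andP[_ ck] /andP[_ ck'].
 apply: connect_trans (H _ ck'); rewrite (erel_sym (vtx T) (oppK To)); first exact: H.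
 move=> m; rewrite !inE => /andP[mZ cm]; rewrite Zo //=. by apply: connect_trans cm _; apply/connect1/erel1.
Qed.

Lemma tube_comp q h k : tube q -> q \subset Z -> k \in q -> vtx T k = vtx T h -> h \in Z -> q \subset comp Z h.
Proof.
move=> /tubeP[_ _ qo qc] qZ kq kh hZ; apply/subsetP => m mq.
by rewrite inE (subsetP qZ) //= -kh; apply: sub_erel qZ (qc _ _ kq mq).
Qed.

Lemma comp_compat q h : tube q -> q \subset Z -> h \in Z -> compat (comp Z h) q.
Proof.
move=> qt qZ hZ; rewrite /compat; case: (boolP [disjoint _ & _]); first by rewrite !orbT.
case/pred0Pn=> v /= /andP[/imsetP[k kc ->] /imsetP[m mq E]].
have kZ := subsetP (comp_sub Z h) k kc.
have -> : comp Z h = comp Z k; last by rewrite (tube_comp qt qZ mq (esym E) kZ) orbT.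
apply/setP => l; rewrite !inE; congr (_ && _).
move: kc; rewrite inE => /andP[_ ck].
by rewrite (same_connect (erel_sym (vtx T) (oppK To) Zo) ck).
Qed.
End Closed.

(** ** Removing an edge *)

Section Remove.
Variables (Z : {set 'I_(nh T)}) (h0 : 'I_(nh T)).
Hypotheses (Zo : opclosed (opp T) Z) (Zf : Z \subset full T) (hZ : h0 \in Z).
Let oK := oppK To.

Definition edge := [set h0; opp T h0].
Definition touch q := (vtx T h0 \in vtx T @: q) || (vtx T (opp T h0) \in vtx T @: q).
(* The edge [h0] together with the tubes next to it. *)
Definition hull N := edge :|: \bigcup_(q in N | (h0 \notin q) && touch q) q.

Let Q := comp Z h0.
Let Z' := Z :\: edge.
Let ohZ : opp T h0 \in Z. Proof. exact: Zo. Qed.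

Lemma edge_opp : opclosed (opp T) edge.
Proof. by move=> h; rewrite !inE => /orP[] /eqP ->; rewrite ?oK eqxx ?orbT. Qed.

Lemma remove_closed : opclosed (opp T) Z'.
Proof.
move=> h; rewrite inE => /andP[hn hz]; rewrite inE Zo // andbT.
by apply: contra hn => /edge_opp; rewrite oK.
Qed.

Lemma hull_sub N N' : N \subset N' -> hull N \subset hull N'.
Proof.
move=> /subsetP s; apply: setUS; apply/bigcupsP => q /and3P[qN q0 qt].
by apply: (bigcup_max q) => //; rewrite s // q0.
Qed.

(** The hull depends only on tubes that avoid [h0], whereas the toggled tube contains [h0]. *)
Lemma hull_toggle N q : h0 \in q -> hull (q |: N) = hull N /\ hull (N :\ q) = hull N.
Proof.
move=> hq; split; apply/eqP; rewrite eqEsubset; apply/andP; split;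
 try by apply: hull_sub; rewrite ?subsetUr ?subD1set.
 apply: setUS; apply/bigcupsP => p /and3P[+ p0 pt]; rewrite !inE => /orP[/eqP pE|pN]. by rewrite pE hq in p0.
 by apply: (bigcup_max p) => //; rewrite pN p0.
apply: setUS; apply/bigcupsP => p /and3P[pN p0 pt]; apply: (bigcup_max p) => //.
by rewrite !inE pN p0 pt !andbT; apply: contraNneq p0 => ->.
Qed.

Section Nest.
Variable N : {set {set 'I_(nh T)}}.
Hypothesis cN : cnest Z N.
Let tN q : q \in N -> tube q. Proof. by move=> qN; have /cnestP[t _ _] := cN; case: (t q qN). Qed.
Let ZN q : q \in N -> q \subset Z. Proof. by move=> qN; have /cnestP[t _ _] := cN; case: (t q qN). Qed.
Let kN q q' : q \in N -> q' \in N -> compat q q'.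
Proof. by have /cnestP[_ c _] := cN; apply: c. Qed.

Lemma touchP q : touch q -> exists2 k, k \in q & vtx T k \in vtx T @: edge.
Proof.
by case/orP=> /imsetP[k kq E]; exists k; rewrite // -E imset_f // !inE eqxx ?orbT.
Qed.

Lemma edge_in q : q \in N -> h0 \in q -> edge \subset q.
Proof.
move=> qN hq; have /tubeP[_ _ qo _] := tN qN; apply/subsetP => k.
by rewrite !inE => /orP[] /eqP -> //; apply: qo.
Qed.

Lemma near_sub q p : q \in N -> h0 \in q -> p \in N -> h0 \notin p -> touch p -> p \subset q.
Proof.
move=> qN hq pN hp /touchP[k kp /imsetP[m me E]].
have mq := subsetP (edge_in qN hq) m me.
have /or3P[//|s|d] := kN pN qN; first by rewrite (subsetP s _ hq) in hp.
have := disjoint_setI0 d => /setP /(_ (vtx T k)); rewrite !inE imset_f //=.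
by rewrite E imset_f.
Qed.

Lemma hull_in q : q \in N -> h0 \in q -> hull N \subset q.
Proof.
move=> qN hq; rewrite subUset edge_in //=; apply/bigcupsP => p /and3P[pN p0 pt].
exact: near_sub.
Qed.

Lemma Q_in : Q \in N.
Proof. by have /cnestP[_ _ c] := cN; apply: c. Qed.

Lemma hull_Q : hull N \subset Q.
Proof. by apply: hull_in Q_in _; apply: mem_comp. Qed.

Lemma hull_edge h : h \in hull N -> connect (eadj T (hull N)) (vtx T h0) (vtx T h).
Proof.
have e0 : connect (eadj T (hull N)) (vtx T h0) (vtx T (opp T h0)). by apply/connect1/erel1; rewrite !inE eqxx.
rewrite inE => /orP[|/bigcupP[p pP hp]]. by rewrite !inE => /orP[] /eqP ->.
have /and3P[pN p0 pt] := pP; have /tubeP[_ _ _ pc] := tN pN.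
have [k kp /imsetP[m me E]] := touchP pt.
have ps : p \subset hull N by apply: subset_trans (subsetUr _ _); apply: (bigcup_max p).
have : connect (eadj T (hull N)) (vtx T k) (vtx T h) by apply: sub_erel ps (pc _ _ kp hp).
apply: connect_trans; rewrite E; move: me; rewrite !inE => /orP[] /eqP -> //.
Qed.

Lemma hull_tube : tube (hull N).
Proof.
have op : opclosed (opp T) (hull N). move=> h; rewrite !inE => /orP[|/bigcupP[p pP hp]].
  by move=> he; rewrite -!in_set1 -in_setU (edge_opp _) // !inE. apply/orP; right; apply/bigcupP; exists p => //.
 by have /and3P[pN _ _] := pP; have /tubeP[_ _ po _] := tN pN; apply: po.
apply/tubeP; split=> //.
- by apply/set0Pn; exists h0; rewrite !inE eqxx.
- by apply: subset_trans hull_Q (subset_trans (comp_sub Z h0) Zf).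
- move=> h h' hh hh'; apply: connect_trans (hull_edge hh'). by rewrite (erel_sym (vtx T) oK op); apply: hull_edge.
Qed.

(** Tubes through [h0] contain the hull, tubes next to the edge lie inside it, and a tube away from
    the edge is vertex-disjoint from the hull unless a tube forming the hull contains it. *)
Lemma hull_compat q : q \in N -> compat q (hull N).
Proof.
move=> qN; have [hq|hq] := boolP (h0 \in q); first by rewrite /compat hull_in ?orbT.
have [qt|qt] := boolP (touch q). rewrite /compat; suff -> : q \subset hull N by [].
 by apply: subset_trans (subsetUr _ _); apply: (bigcup_max q); rewrite // qN hq.
have [s|ns] := boolP (q \subset hull N); first by rewrite /compat s.
rewrite /compat (negbTE ns) /=; apply/orP; right; apply/pred0P => v /=.
apply/negbTE/negP => /andP[/imsetP[k kq ->] /imsetP[m + E]]; rewrite inE => /orP[|].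
 have kt : vtx T m \in vtx T @: q by rewrite -E imset_f.
 by rewrite !inE => /orP[] /eqP mE; case/negP: qt; rewrite /touch -mE kt ?orbT.
case/bigcupP=> p pP mp; have /and3P[pN p0 pt] := pP.
have ps : p \subset hull N by apply: subset_trans (subsetUr _ _); apply: (bigcup_max p).
have /or3P[s|s|d] := kN qN pN.
- by rewrite (subset_trans s ps) in ns.
- case/negP: qt; have /orP[/imsetP[l lp lE]|/imsetP[l lp lE]] := pt. by rewrite /touch lE imset_f // (subsetP s).
 by rewrite /touch lE [X in _ || X]imset_f ?orbT // (subsetP s).
- have := disjoint_setI0 d => /setP /(_ (vtx T k)); rewrite !inE imset_f //=. by rewrite E imset_f.
Qed.

(** The hull may be added since it is compatible with every tube. It may be removed since the only
    component of [Z] through [h0] is [Q], which differs from the hull. *)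
Lemma cnest_toggle : hull N != Q -> cnest Z (hull N |: N) && cnest Z (N :\ hull N).
Proof.
move=> hQ; have hc q := @hull_compat q; have /cnestP[_ _ z] := cN.
apply/andP; split; apply/cnestP; split.
- move=> q; rewrite !inE => /orP[/eqP ->|qN]; last by split; [apply: tN|apply: ZN].
 by split; [apply: hull_tube|apply: subset_trans hull_Q (comp_sub Z h0)].
- move=> q q'; rewrite !inE => /orP[/eqP ->|qN] /orP[/eqP ->|q'N].
 + by rewrite /compat subxx.
 + by rewrite compat_sym hc.
 + exact: hc.
 + exact: kN.
- by move=> h /z hN; rewrite inE hN orbT.
- by move=> q; rewrite !inE => /andP[_ qN]; split; [apply: tN|apply: ZN].
- by move=> q q'; rewrite !inE => /andP[_ qN] /andP[_ q'N]; apply: kN.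
- move=> h hz; rewrite !inE z // andbT; apply: contra hQ => /eqP E. have hh : h0 \in hull N by rewrite !inE eqxx.
 rewrite -E in hh *; rewrite /Q; apply/eqP/setP => l; rewrite !inE; congr (_ && _).
 move: hh; rewrite inE => /andP[_ c]. by rewrite (same_connect (erel_sym (vtx T) oK Zo) c).
Qed.

Lemma comp_remove h : h \in Z -> h \notin Q -> comp Z' h = comp Z h.
Proof.
move=> hz hQ; apply/setP => k; rewrite !inE; apply/andP/andP => -[].
 by case/andP=> _ kz c; split=> //; apply: sub_erel c; apply: subsetDl.
have notQ v : connect (eadj T Z) (vtx T h) v -> ~~ connect (eadj T Z) (vtx T h0) v.
 move=> c; apply: contra hQ => c'; rewrite inE hz /=.
 by apply: connect_trans c' _; rewrite (erel_sym (vtx T) oK Zo).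
have inZ' m : m \in Z -> connect (eadj T Z) (vtx T h) (vtx T m) -> m \in Z'.
 move=> mz /notQ mn; rewrite inE mz andbT; apply: contra mn; rewrite !inE.
 by case/orP=> /eqP -> //; apply/connect1/erel1.
move=> kz c; split; first by have := inZ' k kz c; rewrite !inE.
suff [] : connect (eadj T Z) (vtx T h) (vtx T k) /\ connect (eadj T Z') (vtx T h) (vtx T k) by [].
apply: (connect_ind (P := fun v => connect (eadj T Z) (vtx T h) v /\
 connect (eadj T Z') (vtx T h) v) c) => // a b [ca ca'] ab.
split; first by apply: connect_trans ca _; apply: connect1.
have /erelP[m mz [mE <-]] := ab; apply: connect_trans ca' _; rewrite -mE.
by apply/connect1/erel1/inZ'; rewrite ?mE.
Qed.

(** If the hull fills its component [Q], then [Q] is the only tube through [h0]. Dropping it leaves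
    a nesting of the remaining edges, whose components next to the edge are the largest tubes
    there. *)
Lemma unmatched : Q \subset hull N -> cnest Z' (N :\ Q).
Proof.
move=> Qh; have /cnestP[_ _ z] := cN; apply/cnestP; split.
- move=> q; rewrite !inE => /andP[qQ qN]; split; first exact: tN. have hq : h0 \notin q.
  apply: contra qQ => hq; rewrite eqEsubset (subset_trans Qh (hull_in qN hq)) andbT.
  exact: (tube_comp (tN qN) (ZN qN) hq erefl hZ).
 apply/subsetP => k kq; rewrite inE (subsetP (ZN qN)) // andbT !inE.
 have /tubeP[_ _ qo _] := tN qN; apply: contra hq => /orP[] /eqP kE; rewrite -?kE //.
 by rewrite -[h0]oK -kE; apply: qo.
- by move=> q q'; rewrite !inE => /andP[_ qN] /andP[_ q'N]; apply: kN.
- move=> h hz'; have hz : h \in Z by move: hz'; rewrite inE => /andP[].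
 have h0c : h0 \notin comp Z' h by rewrite !inE eqxx. rewrite !inE; apply/andP; split.
  by apply: contraNneq h0c => ->; apply: mem_comp. have [hQ|hQ] := boolP (h \in Q); last by rewrite comp_remove ?z.
 (* The component of [h] in [Z'] is the largest tube next to the edge containing [h]: a half-edge of
    the component that leaves it would, by [Qh], lie in another tube next to the edge, which
    compatibility makes larger. *)
 pose P p := [&& p \in N, h0 \notin p, touch p & h \in p]. have [p0 p0P] : exists p, P p.
  have := subsetP Qh h hQ; rewrite inE => /orP[he|/bigcupP[p /and3P[pN p0 pt] hp]]. by move: hz'; rewrite inE he.
  by exists p; apply/and4P. case: (@arg_maxnP _ p0 P (fun p => #|p|) p0P) => p /and4P[pN hp pt hhp] pm.
 suff -> : comp Z' h = p by []. have pZ' : p \subset Z'.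
  apply/subsetP => k kp; rewrite inE (subsetP (ZN pN)) // andbT !inE.
  have /tubeP[_ _ po _] := tN pN; apply: contra hp => /orP[] /eqP kE; rewrite -?kE //.
  by rewrite -[h0]oK -kE; apply: po. apply/eqP; rewrite eqEsubset (tube_comp (tN pN) pZ' hhp erefl hz') andbT.
 apply/subsetP => k kc; apply/negPn/negP => kp. have cQ m : m \in comp Z' h -> m \in Q.
  rewrite !inE => /andP[/andP[_ mz] cm]; rewrite mz /=.
  move: hQ; rewrite inE => /andP[_ c]; apply: connect_trans c _. by apply: sub_erel cm; apply: subsetDl.
 have [m [mc mv mp]] : exists m, [/\ m \in comp Z' h, vtx T m \in vtx T @: p & m \notin p].
  have [kv|kv] := boolP (vtx T k \in vtx T @: p); first by exists k. have hc : h \in comp Z' h by apply: mem_comp.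
  have /tubeP[_ _ _ cc] := comp_tube remove_closed (subset_trans (subsetDl _ _) Zf) hz'.
  have [a [b [av bv _ /erelP[m mc [mE mE']]]]] := connect_cross (cc _ _ hc kc) (imset_f _ hhp) kv.
  exists m; split=> //; first by rewrite mE. apply: contra bv => mp; rewrite -mE'; apply: imset_f.
  by have /tubeP[_ _ po _] := tN pN; apply: po.
 have := subsetP Qh m (cQ m mc); rewrite inE => /orP[me|/bigcupP[p' /and3P[p'N p'0 p't] mp']].
  by move: mc; rewrite inE => /andP[]; rewrite inE me. have /or3P[s|s|d] := kN p'N pN.
 + by rewrite (subsetP s _ mp') in mp.
 + have Pp' : P p' by rewrite /P p'N p'0 p't (subsetP s _ hhp).
  have /proper_card : p \proper p' by rewrite properE s; apply/subsetPn; exists m.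
  by rewrite ltnNge => /negP; apply; apply: pm.
 + have := disjoint_setI0 d => /setP /(_ (vtx T m)); rewrite !inE imset_f //=. by rewrite mv.
Qed.
End Nest.

(** Converse to [unmatched]: every nesting of [Z'] becomes an unmatched nesting of [Z] on adding
    [Q], because all components into which [Q] falls apart touch the removed edge. *)
Lemma matched N : cnest Z' N -> [/\ cnest Z (Q |: N), Q \notin N & Q \subset hull (Q |: N)].
Proof.
move=> /cnestP[t c z].
have tZ q : q \in N -> q \subset Z by move=> /t[_ s]; apply: subset_trans s (subsetDl _ _).
have Qh : h0 \in Q by apply: mem_comp.
split.
- apply/cnestP; split.
 + move=> q; rewrite !inE => /orP[/eqP ->|qN]; last by split; [case: (t q qN)|apply: tZ].
  by split; [apply: comp_tube|apply: comp_sub].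
 + move=> q q'; rewrite !inE => /orP[/eqP ->|qN] /orP[/eqP ->|q'N].
  * by rewrite /compat subxx.
  * by apply: comp_compat; rewrite ?tZ //; case: (t _ q'N).
  * by rewrite compat_sym; apply: comp_compat; rewrite ?tZ //; case: (t _ qN).
  * exact: c.
 + move=> h hz; rewrite !inE; have [hQ|hQ] := boolP (h \in Q).
   apply/orP; left; apply/eqP/setP => k; rewrite !inE; congr (_ && _). move: hQ; rewrite inE => /andP[_ e].
   by rewrite (same_connect (erel_sym (vtx T) oK Zo) e).
  rewrite -(comp_remove hz hQ) z ?orbT // !inE hz andbT; apply: contra hQ.
  by case/orP=> /eqP -> //; rewrite inE ohZ; apply/connect1/erel1.
- by apply/negP => /t[_ /subsetP /(_ h0 Qh)]; rewrite !inE eqxx.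
- apply/subsetP => k kQ; rewrite inE; have [//|ke] := boolP (k \in edge).
 have kz : k \in Z by move: kQ; rewrite inE => /andP[]. have kz' : k \in Z' by rewrite inE ke.
 apply/bigcupP; exists (comp Z' k); last exact: mem_comp. rewrite !inE z // orbT eqxx /=.
 have H v : connect (eadj T Z') (vtx T k) v -> v \in vtx T @: comp Z' k.
  by move=> /(comp_vtx remove_closed kz')[m mc <-]; apply: imset_f.
 have [c0|c0] := boolP (connect (eadj T Z') (vtx T k) (vtx T h0)); first by rewrite /touch H.
 have ck : connect (eadj T Z) (vtx T k) (vtx T h0).
  by rewrite (erel_sym (vtx T) oK Zo); move: kQ; rewrite inE => /andP[].
 (* A path from [k] to [h0] in [Z] leaves the component of [k] in [Z'] through the removed edge, so
    that component touches it. *)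
 have [a [b [aW bW _ /erelP[m mz [mE mE']]]]] :=
  connect_cross (A := [pred v | connect (eadj T Z') (vtx T k) v]) ck (connect0 _ _) c0. have me : m \in edge.
  apply/negPn/negP => me; case/negP: bW; rewrite inE /=; apply: connect_trans aW _.
  by rewrite -mE -mE'; apply/connect1/erel1; rewrite inE me.
 have mc : vtx T m \in vtx T @: comp Z' k by rewrite mE; apply: H.
 by move: me; rewrite !inE => /orP[] /eqP E; rewrite /touch -E mc ?orbT.
Qed.
End Remove.
End CNest.

(** * Homology of the complex of nestings *)

Section NestHomology.
Variables (K : fieldType) (T : graph).
Hypothesis K2 : 2%:R != 0 :> K.
Hypothesis To : ordered T.
Implicit Types (Z q : {set 'I_(nh T)}) (A B : {set sym T}).

Lemma tubesU q A : tubes ((true, q) |: A) = q |: tubes A.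
Proof. by apply/setP => p; rewrite !inE xpair_eqE. Qed.
Lemma tubesD q A : tubes (A :\ (true, q)) = tubes A :\ q.
Proof. by apply/setP => p; rewrite !inE xpair_eqE. Qed.
Lemma edgesU q A : edges ((true, q) |: A) = edges A.
Proof. by apply/setP => p; rewrite !inE xpair_eqE. Qed.
Lemma edgesD q A : edges (A :\ (true, q)) = edges A.
Proof. by apply/setP => p; rewrite !inE xpair_eqE. Qed.
Lemma sym_sub A B : A \subset B -> edges A \subset edges B /\ tubes A \subset tubes B.
Proof. by move=> /subsetP s; split; apply/subsetP => q; rewrite !inE; apply: s. Qed.

Definition cval Z A : bool := (edges A == eset T) && cnest Z (tubes A).

(** Tubes and compatibility are inherited from the larger set, the required components and edges
    from the smaller one. This gives the convexity needed for the square of the differential. *)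
Lemma cval_mid Z A B C : cval Z A -> cval Z C -> A \subset B -> B \subset C -> cval Z B.
Proof.
move=> /andP[/eqP eA /cnestP[_ _ zA]] /andP[/eqP eC /cnestP[tC cC _]] /sym_sub[eAB tAB] /sym_sub[eBC /subsetP tBC].
apply/andP; split; first by rewrite eqEsubset -{1}eC eBC -eA eAB.
apply/cnestP; split=> [q /tBC /tC//|q q' /tBC qC /tBC q'C|h /zA hA]. exact: cC.
exact: (subsetP tAB).
Qed.

Lemma cval_H0 Z A i j : cval Z A -> cval Z (i |: (j |: A)) -> cval Z (j |: A).
Proof. by move=> vA vB; apply: cval_mid vA vB _ _; rewrite subsetUr. Qed.

Lemma nest_cnest N : connected T -> cnest (full T) N = nest N.
Proof.
move=> Tc; have cE h : h \in full T -> comp (full T) h = full T.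
 move=> hf; apply/setP => k; rewrite inE; have [kf|//] := boolP (k \in full T).
 by have := proj1 (conn_full T) Tc (vtx T h) (vtx T k).
apply/cnestP/nestP => -[t c z]; split=> //.
- by move=> q /t[].
- by case/set0Pn=> h hf; rewrite -(cE h hf) z.
- by move=> q qN; split; [apply: t|have /tubeP[] := t q qN].
- by move=> h hf; rewrite cE // z //; apply/set0Pn; exists h.
Qed.

Section Step.
Variables (Z : {set 'I_(nh T)}) (h0 : 'I_(nh T)).
Hypotheses (Zo : opclosed (opp T) Z) (Zf : Z \subset full T) (hZ : h0 \in Z).
Let Q := comp Z h0.
Let Z' := Z :\: edge h0.
Let s0 : sym T := (true, Q).

(** [morse] with the hull as the toggled tube and its number of half-edges as the level: the sets
    that survive at level [#|Q|] are those whose hull is all of [Q]. *)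
Lemma reduce (x : ext K (sym T)) : supp (cval Z) x -> dif (cval Z) x = 0 -> exists2 y, supp (cval Z) y &
  supp (fun A => cval Z A /\ Q \subset hull h0 (tubes A)) (x - dif (cval Z) y).
Proof.
move=> sx dx.
pose t A : sym T := (true, hull h0 (tubes A)).
have tt A : h0 \in hull h0 (tubes A) by rewrite !inE eqxx.
have hull_U i A : hull h0 (tubes A) \subset hull h0 (tubes (i |: A)).
 by apply: hull_sub; have [] := sym_sub (subsetUr [set i] A).
have sQ A : cval Z A -> hull h0 (tubes A) \subset Q. by case/andP=> _ cA; apply: hull_Q.
have ht A q : h0 \in q -> hull h0 (tubes ((true, q) |: A)) = hull h0 (tubes A) /\
  hull h0 (tubes (A :\ (true, q))) = hull h0 (tubes A). by move=> hq; rewrite tubesU tubesD; apply: hull_toggle.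
have [|||y sy sxy] := @morse K _ (cval Z) K2 (@cval_H0 Z) (fun A => #|hull h0 (tubes A)|) t #|Q| _ _ _ x sx dx.
- by move=> A i _ _; apply: subset_leq_card.
- move=> A vA lQ; have [h1 h2] := ht A _ (tt A); rewrite /t h1 h2; split=> //.
  apply/andP; rewrite edgesU tubesU; case/andP: vA => -> cA; split=> //.
  have hQ : hull h0 (tubes A) != Q by apply: contraTneq lQ => ->; rewrite ltnn.
  by have /andP[] := cnest_toggle To Zo Zf hZ cA hQ.
 apply/andP; rewrite edgesD tubesD; case/andP: vA => -> cA; split=> //.
 have hQ : hull h0 (tubes A) != Q by apply: contraTneq lQ => ->; rewrite ltnn.
 by have /andP[] := cnest_toggle To Zo Zf hZ cA hQ.
- move=> A i _ _ e _; congr pair; apply/esym/eqP. by rewrite eqEcard hull_U e leqnn.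
- exists y => // A /sxy[vA lA]; split=> //. by have := eqEcard (hull h0 (tubes A)) Q; rewrite sQ // lA => /eqP ->.
Qed.

Lemma cval_unmatched A : cval Z A -> Q \subset hull h0 (tubes A) -> s0 \in A /\ cval Z' (A :\ s0).
Proof.
move=> /andP[eA cA] Qh; split; first by have := Q_in hZ cA; rewrite inE.
by rewrite /cval edgesD tubesD eA; apply: unmatched Qh.
Qed.

Lemma cval_matched A : cval Z' A -> [/\ cval Z (s0 |: A), s0 \notin A & Q \subset hull h0 (tubes (s0 |: A))].
Proof.
move=> /andP[eA cA]; rewrite /cval edgesU tubesU eA.
by have [-> h ->] := matched To Zo Zf hZ cA; split=> //; move: h; rewrite inE.
Qed.

Lemma emul_cval (w : ext K (sym T)) : supp (cval Z') w -> supp (cval Z) (emul s0 w).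
Proof.
move=> sw B; rewrite ffunE; case: ifP => sB; last by rewrite eqxx.
rewrite mulf_eq0 negb_or => /andP[_ /sw v]; have [v' _ _] := cval_matched v.
by rewrite setD1K in v'.
Qed.

(** Multiplication by [s0] anticommutes with adding symbols. The two truncations agree because
    adding a symbol to an unmatched set can only enlarge the hull, so the set stays unmatched. *)
Lemma dif_emul (w : ext K (sym T)) : supp (cval Z') w -> dif (cval Z) (emul s0 w) = - emul s0 (dif (cval Z') w).
Proof.
move=> sw; have E : \sum_i emul i (emul s0 w) = - emul s0 (\sum_i emul i w).
 rewrite (lin_sum (@emul_lin K _ _)) -sumrN; apply: eq_bigr => i _; exact: emulC.
rewrite /dif E; apply/ffunP => B; rewrite ffunE.
have -> : (- emul s0 (\sum_i emul i w)) B = - (emul s0 (\sum_i emul i w) B) by rewrite ffunE.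
have -> : (- emul s0 (restr (cval Z') (\sum_i emul i w))) B =
 - (emul s0 (restr (cval Z') (\sum_i emul i w)) B) by rewrite ffunE.
rewrite /emul [in LHS]ffunE [in RHS]ffunE; have [sB|sB] := boolP (s0 \in B); last by rewrite !oppr0 if_same.
rewrite [X in _ = - (_ * X)]ffunE -/(emul s0).
have [->|n0] := eqVneq ((\sum_i emul i w) (B :\ s0)) 0. by rewrite !if_same mulr0 oppr0 if_same.
suff -> : cval Z B = cval Z' (B :\ s0) by case: ifP => _ //; rewrite mulr0 oppr0.
apply/idP/idP => [vB|v]; last first. by have [v' _ _] := cval_matched v; rewrite setD1K in v'.
have [j jB wj] : exists2 j, j \in B :\ s0 & w (B :\ s0 :\ j) != 0.
 apply/exists_inP; apply: contraNT n0; rewrite sum_emulE negb_exists_in => /forall_inP h.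
 by rewrite big1 // => j /h; rewrite negbK => /eqP ->; rewrite mulr0.
have [_ _ Qh] := cval_matched (sw _ wj).
have [|//] := cval_unmatched vB; apply: subset_trans Qh _; apply: hull_sub.
apply: (proj2 (sym_sub _)); rewrite subUset sub1set sB /=.
exact: subset_trans (subD1set _ _) (subD1set _ _).
Qed.

(** Unmatched sets all contain [s0], so [x] is divisible by it. Multiplication by [s0] is injective
    on sets without [s0], which transfers the cycle condition to the quotient. *)
Lemma step_inv (x : ext K (sym T)) : dif (cval Z) x = 0 ->
 supp (fun A => cval Z A /\ Q \subset hull h0 (tubes A)) x ->
 exists x', [/\ supp (cval Z') x', x = emul s0 x' & dif (cval Z') x' = 0].
Proof.
move=> dx sx.
pose x' : ext K (sym T) := [ffun B : {set sym T} => if (s0 \notin B) && cval Z' B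
 then (-1) ^+ pos s0 B * x (s0 |: B) else 0].
have sx' : supp (cval Z') x'. by move=> B; rewrite ffunE; case: ifP => [/andP[]//|_]; rewrite eqxx.
have xE : x = emul s0 x'. apply/ffunP => B; rewrite ffunE; case: ifP => [sB|/negbT sB]; last first.
  by apply/eqP; apply: contraNT sB => /sx[v Qh]; have [] := cval_unmatched v Qh.
 rewrite ffunE setD11 /=; have [n0|n0] := eqVneq (x B) 0. by rewrite setD1K // n0; case: ifP => _; rewrite !mulr0.
 have [v Qh] := sx B n0; have [_ ->] := cval_unmatched v Qh.
 have pE : pos s0 B = pos s0 (B :\ s0) by rewrite -{1}(setD1K sB) posU1.
 by rewrite setD1K // pE mulrA -expr2 sqrr_sign mul1r.
exists x'; split=> //; have e0 : emul s0 (dif (cval Z') x') = 0.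
 by apply/eqP; rewrite -oppr_eq0 -dif_emul // -xE dx.
apply/ffunP => B; rewrite [RHS]ffunE; apply/eqP; apply/negPn/negP => n0.
have [_ sB _] := cval_matched (dif_supp n0).
have := f_equal (fun z : ext K (sym T) => z (s0 |: B)) e0.
rewrite ffunE setU11 setU1K // [RHS]ffunE => /eqP; rewrite mulf_eq0 (negbTE n0) orbF.
by rewrite signr_eq0.
Qed.
End Step.

(** Induction on [Z]: up to a boundary, a cycle for [Z] is [s0] times a cycle for [Z] minus an edge.
    When [Z] is empty only the set of all edges remains. The lemma bounds the homology from above
    only. *)
Lemma nest_homology Z : opclosed (opp T) Z -> Z \subset full T ->
 exists z : ext K (sym T), forall x, supp (cval Z) x -> dif (cval Z) x = 0 ->
 exists y k, supp (cval Z) y /\ x = dif (cval Z) y + k *: z.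
Proof.
move=> Zo Zf.
suff [z [_ _ H]] : exists z : ext K (sym T), [/\ supp (cval Z) z, dif (cval Z) z = 0 &
  forall x, supp (cval Z) x -> dif (cval Z) x = 0 ->
  exists y k, supp (cval Z) y /\ x = dif (cval Z) y + k *: z] by exists z.
move: {2}#|Z|.+1 (ltnSn #|Z|) => n; elim: n => // n IH in Z Zo Zf *; rewrite ltnS => Zn.
have [Z0|[h0 hZ]] := set_0Vmem Z. pose A0 : {set sym T} := [set s | if s.1 then false else s.2 \in eset T].
 have A0E A : cval Z A -> A = A0. case/andP=> /eqP eA /cnestP[t _ _]; apply: sym_eq.
   by rewrite eA; apply/setP => e; rewrite !inE.
  apply/setP => q; rewrite [RHS]inE [in RHS]inE /=; apply/negbTE/negP => /t[/tubeP[q0 _ _ _]].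
  by rewrite Z0 subset0 => /eqP E; rewrite E eqxx in q0. have sA x : supp (cval Z) x -> x = x A0 *: delta K A0.
  move=> sx; rewrite {1}[x]ext_delta (bigD1 A0) //= big1 ?addr0 // => A AA. suff -> : x A = 0 by rewrite scale0r.
  by apply/eqP; apply: contraNT AA => /sx /A0E ->. have v0 : cval Z A0.
  apply/andP; split; first by apply/eqP/setP => e; rewrite !inE.
  by apply/cnestP; split=> [q|q q'|h]; rewrite ?Z0 !inE. exists (delta K A0); split.
 - by move=> A; rewrite ffunE; case: (A =P A0) => [-> //|_]; rewrite eqxx.
 - apply/ffunP => B; rewrite difE [RHS]ffunE; case: ifP => // /A0E ->.
  rewrite big1 // => i iA; rewrite ffunE; case: eqP => [E|_]; last by rewrite mulr0.
  by have := setD11 i A0; rewrite E iA.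
 - move=> x /sA xE _; exists 0, (x A0); split; first by move=> A; rewrite ffunE eqxx.
  by rewrite (lin0 (@dif_lin _ _ _)) add0r.
have Zo' := remove_closed To (h0 := h0) Zo.
have Zf' : Z :\: edge h0 \subset full T by apply: subset_trans (subsetDl _ _) Zf.
have Zn' : (#|Z :\: edge h0| < n)%N. apply: leq_trans Zn; apply: proper_card; rewrite properE subsetDl /=.
 by apply/subsetPn; exists h0; rewrite // !inE eqxx.
have [z [sz dz H]] := IH _ Zo' Zf' Zn'.
pose s0 : sym T := (true, comp Z h0).
exists (emul s0 z); split.
- exact: emul_cval.
- by rewrite dif_emul // dz (lin0 (@emul_lin _ _ _)) oppr0.
move=> x sx dx; have [y sy sxy] := reduce Zo Zf hZ sx dx.
have dxy : dif (cval Z) (x - dif (cval Z) y) = 0.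
 rewrite (linD (@dif_lin _ _ _)) (linN (@dif_lin _ _ _)) dx dif_dif ?subrr //. exact: cval_H0.
have [x' [sx' xE dx']] := step_inv Zo Zf hZ dxy sxy.
have [y' [k [sy' x'E]]] := H x' sx' dx'.
exists (y - emul s0 y'), k; split. rewrite addrC -scaleN1r; apply: supp_lin => //; exact: emul_cval.
rewrite (linD (@dif_lin _ _ _)) (linN (@dif_lin _ _ _)) dif_emul // opprK.
by rewrite -(linZ (@emul_lin _ _ _)) -addrA -(linD (@emul_lin _ _ _)) -x'E -xE subrKC.
Qed.
End NestHomology.

(** * Duals of collections *)

Section Leggy.
Variables (K : fieldType) (O : opcat).
Implicit Types (T S F G H X : obj O) (N M : presheaf K O).

Lemma nedge_iso T S (f : arr T S) : iso f -> nedge T = nedge S.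
Proof.
move=> /iso_nz fn; have := nedge_sum (objO T) (objO S) (arr0 f); rewrite fn cards0; lia.
Qed.

Lemma nedge_lt T F : lt_fiber T F -> nedge T = nedge F.
Proof. by move=> /lt_relegs[lg ->]. Qed.

(* The conditions on a collection that concern changes of the global order. *)
Record leggy N : Prop := { leggy_eq : forall T F, lt_fiber T F -> N T = N F;
 leggy_act : forall T' T'' t (f' : arr T' T'') (g'' : arr T'' t) (g' : arr T' t) i F' F'' (f'' : arr F' F''),
  loc_terminal t -> iso f' -> amap g' = gcomp g'' f' ->
  is_fiber g' i F' -> is_fiber g'' i F'' -> is_induced f' g'' g' i f'' ->
  forall (x : N T'') (y : N F''), same x y -> same (pact f' x) (pact f'' y)
}.

Definition gsame (V W : gvs K) (x : V) (y : W) := exists E : V = W, gcast E x = y.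

Lemma gsame_ex' (V W : gvs K) (x : V) : V = W -> exists y : W, gsame x y.
Proof. by move=> E; subst W; exists x; exists erefl. Qed.

Lemma dual_same b b' (V W : gvs K) (a : gdual b V) (a' : gdual b' W) : V = W -> b = b' ->
 gsame a a' <-> forall x y, gsame x y -> dapp a x = dapp a' y.
Proof.
move=> E e; subst W b'; split=> [[E <-] x y [E' <-]|h].
 by rewrite (Prop_irrelevance E erefl) (Prop_irrelevance E' erefl).
by exists erefl; apply: dual_eq => x; apply: h; exists erefl.
Qed.

Lemma susp_same d (V W : gvs K) (x : V) (y : W) : V = W -> gsame (x : gsusp d V) (y : gsusp d W) <-> gsame x y.
Proof.
move=> E; subst W; split=> -[E <-]; exists erefl; by rewrite (Prop_irrelevance E erefl).
Qed.

Lemma induced_iso T' T'' t (f' : arr T' T'') (g'' : arr T'' t) (g' : arr T' t)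
  i F' F'' (f'' : arr F' F'') : iso f' -> amap g' = gcomp g'' f' -> is_induced f' g'' g' i f'' -> iso f''.
Proof.
move=> fi gE [iv [ih [jv [jh [I J wv wh]]]]].
apply/iso_nz/setP => k; rewrite (nz_induced gE I J wh); have /iso_nz -> := fi.
by rewrite !inE.
Qed.

Lemma lt_incl T t (g : arr T t) i F iv ih : loc_terminal t ->
 @fiber_incl T t g i F iv ih -> forall lg, ograph F = @relegs T lg ->
 (forall v, iv v = v :> nat) /\ (forall h, ih h = h :> nat).
Proof.
move=> [t1 _] I lg; case: F iv ih I => F Fo /= iv ih I E; subst F.
have gi v : phi g v == i by apply/eqP/ord_one.
split. have : iv =1 id; last by move=> e v; rewrite e. apply: incr_ext => //; first exact: (fi_iv_incr I).
 by move=> v; rewrite (fi_iv_im I) gi; apply/esym/codomP; exists v.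
have : ih =1 id; last by move=> e h; rewrite e.
apply: incr_ext => //; first exact: (fi_ih_incr I).
by move=> h; rewrite (fi_ih_im I) gi; apply/esym/codomP; exists h.
Qed.

Lemma mod_leggy fl : leggy (Mod K fl O).
Proof.
split=> [T F /lt_relegs[lg]|]. by case: F => F Fo /= ->.
move=> T' T'' t f' g'' g' i F' F'' f'' tl fi gE fF' fF'' ind x y.
have lt' : lt_fiber T' F' by exists t, g', i.
have lt'' : lt_fiber T'' F'' by exists t, g'', i.
have [lg' e'] := lt_relegs lt'; have [lg'' e''] := lt_relegs lt''.
have fi'' := induced_iso fi gE ind.
have [iv [ih [jv [jh [I J wv wh]]]]] := ind.
have [vI hI] := lt_incl tl I e'; have [vJ hJ] := lt_incl tl J e''.
case: F' e' f'' iv ih I vI hI wv wh fi'' {fF' ind lt'} => F' Fo' /= e'; subst F'.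
case: F'' e'' jv jh J vJ hJ y {fF'' lt''} => F'' Fo'' /= e''; subst F''.
move=> jv jh J vJ hJ y f'' iv ih I vI hI wv wh fi'' [E <-].
rewrite (Prop_irrelevance E erefl) /=; exists erefl => /=.
suff e : smap f' =1 smap (amap f'' : gmap (relegs lg') (relegs lg'')).
 by rewrite /mpact; congr prj; apply: (eq_emap e).
have pE (h : 'I_(nh T'')) : psi f'' h = psi f' h. have := wh h; have -> : jh h = h by apply: ord_inj; rewrite hJ.
 by move=> <-; apply: ord_inj; rewrite hI.
have qE (v : 'I_(nv T')) : phi f'' v = phi f' v. have := wv v; have -> : iv v = v by apply: ord_inj; rewrite vI.
 by move=> <-; apply: ord_inj; rewrite vJ.
move=> [[] q]; rewrite /smap /=; congr pair; last first. by apply: eq_imset => h; rewrite pE.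
have nE : nz f'' = nz f' by have /iso_nz -> := fi''; have /iso_nz -> := fi.
rewrite /lift nE; congr (_ :|: _); first by apply: eq_imset => h; rewrite pE.
by apply/setP => h; rewrite !in_set qE.
Qed.

Section Dual.
Variables (b : bool) (N : presheaf K O).
Hypotheses (Np : is_presheaf N).
Let D := dual_presheaf b N.

Lemma pact_proj T S (f : arr T S) n (x : N S) : iso f -> pact f (gproj n x) = gproj n (pact f x).
Proof.
move=> fi; apply: gproj_map; first exact: pact_lin.
by move=> m y h; rewrite addr0; apply: (pact_deg Np).
Qed.

(** The linear form sought by [xget] exists: it is [a] composed with the action of the inverse
    isomorphism. *)
Lemma dual_pactE T S (f : arr T S) (a : D S) : iso f -> forall x : N S, dapp (pact f a : D T) (pact f x) = dapp a x.
Proof.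
move=> fi; have [g [gi gf fg]] := iso_inv fi.
have /asboolP[al [s as_] ab] := dual_funP (a : dualT _ _).
have P : (fun x : N T => dapp a (pact g x)) \in dual_pred (b || (0 < nedge T)%N) (V := N T). apply/asboolP; split.
 - by move=> c x y; rewrite /dapp (pact_lin Np gi) al.
 - by exists s => n x ns; rewrite (pact_proj _ _ gi); apply: as_.
 - by rewrite (nedge_iso fi) => nb x; apply: ab.
have H := @classical_sets.xgetPex (D T) (0 : D T) (fun a' => forall x : N S, dapp a' (pact f x) = dapp a x).
apply: H; exists (Dual P) => x; rewrite /dapp /= (pactK Np fi gi fg) //.
Qed.

Lemma dual_ext T S (f : arr T S) (a a' : D T) : iso f ->
 (forall x : N S, dapp a (pact f x) = dapp a' (pact f x)) -> a = a'.
Proof.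
move=> fi h; have [g [gi gf fg]] := iso_inv fi; apply: dual_eq => x.
by rewrite -(pactK Np gi fi gf x); apply: h.
Qed.

Lemma dual_homog (V : gvs K) c n (a : gdual c V) : homog n a <-> forall x, dapp a (gproj n x) = dapp a x.
Proof.
split=> [h x|h]; last exact: dual_eq.
by rewrite -{2}h.
Qed.

Lemma dual_is_presheaf : is_presheaf D.
Proof.
split.
- move=> T S f fi c a a'; apply: (dual_ext fi) => x. have E : dapp (c *: pact f a + pact f a' : D T) (pact f x) =
  c * dapp (pact f a : D T) (pact f x) + dapp (pact f a' : D T) (pact f x) by []. by rewrite E !dual_pactE.
- move=> T S f fi n a /dual_homog h; apply/dual_homog => x.
 have [g [gi gf fg]] := iso_inv fi; rewrite -(pactK Np gi fi gf x). by rewrite -(pact_proj _ _ fi) !dual_pactE.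
- move=> T f fE a; have fi : iso f by exists f; rewrite fE gcompf1.
 apply: (dual_ext fi) => x; rewrite dual_pactE //. by rewrite (pact_id Np fE).
- move=> T S P f g h fi gi hE a; have hi := iso_comp fi gi hE. apply: (dual_ext hi) => x; rewrite dual_pactE //.
 by rewrite (pact_comp Np fi gi hE) !dual_pactE.
Qed.

Lemma dual_leggy : leggy N -> leggy D.
Proof.
move=> Nl; split=> [T F lt|]. by rewrite /= (leggy_eq Nl lt) (nedge_lt lt).
move=> T' T'' t f' g'' g' i F' F'' f'' tl fi gE fF' fF'' ind a a'.
have lt' : lt_fiber T' F' by exists t, g', i.
have lt'' : lt_fiber T'' F'' by exists t, g'', i.
have E' := leggy_eq Nl lt'; have E'' := leggy_eq Nl lt''.
have fi'' := induced_iso fi gE ind.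
move=> /(dual_same _ _ E'' (f_equal (fun n => b || (0 < n)%N) (nedge_lt lt''))) h.
apply/(dual_same _ _ E' (f_equal (fun n => b || (0 < n)%N) (nedge_lt lt'))) => x y xy.
have [g [gi gf fg]] := iso_inv fi.
have [y0 xy0] := gsame_ex' (pact g x) E''.
have := leggy_act Nl tl fi gE fF' fF'' ind xy0; rewrite (pactK Np gi fi gf) => xy'.
have -> : y = pact f'' y0 by apply/(same_inj xy xy').
by rewrite -{1}(pactK Np gi fi gf x) !dual_pactE //; apply: h.
Qed.
End Dual.

Lemma susp_presheaf d N : is_presheaf N -> is_presheaf (susp d N).
Proof.
move=> Np; split.
- by move=> T S f fi; apply: (pact_lin Np fi).
- by move=> T S f fi n x; apply: (pact_deg Np fi).
- by move=> T f fE x; apply: (pact_id Np fE).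
- by move=> T S P f g h fi gi hE x; apply: (pact_comp Np fi gi hE).
Qed.

Lemma susp_leggy d N : leggy N -> leggy (susp d N).
Proof.
move=> Nl; split=> [T F lt|]; first by rewrite /= (leggy_eq Nl lt).
move=> T' T'' t f' g'' g' i F' F'' f'' tl fi gE fF' fF'' ind x y.
have lt' : lt_fiber T' F' by exists t, g', i.
have lt'' : lt_fiber T'' F'' by exists t, g'', i.
move=> /(susp_same _ _ _ (leggy_eq Nl lt'')) h.
by apply/(susp_same _ _ _ (leggy_eq Nl lt')); exact: (leggy_act Nl tl fi gE fF' fF'' ind h).
Qed.

Lemma leggy_coll N : is_presheaf N -> leggy N -> (forall T, nedge T = 0%N -> forall x : N T, x = 0) -> is_coll N.
Proof. by move=> Np Nl N0; split=> //; [apply: leggy_eq|apply: leggy_act]. Qed.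

(** * The generating collection *)

(** The coordinate of a row of length 0 or 1. It is injective in both cases, so identities in
    [one_edge] are checked after applying it. *)
Definition tot (n : bool) (x : 'rV[K]_n) : K := \sum_i x 0 i.

Lemma tot_lin n : linear (@tot n : _ -> K^o).
Proof.
move=> a x y; rewrite /tot scaler_sumr -big_split; apply: eq_bigr => i _.
by rewrite !mxE.
Qed.

Lemma tot_inj n : injective (@tot n).
Proof.
case: n => x y; rewrite /tot; last by move=> _; apply/rowP => -[].
by rewrite !big_ord1 => e; apply/rowP => i; rewrite (ord1 i).
Qed.

Lemma tot_conform (n m : bool) (x : 'rV[K]_m) : n = m -> tot (conform_mx (0 : 'rV_n) x) = tot x.
Proof. by move=> e; subst m; rewrite conform_mx_id. Qed.

Lemma tot_false (x : 'rV[K]_false) : tot x = 0.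
Proof. by rewrite /tot big_ord0. Qed.

Definition one (n : bool) : 'rV[K]_n := const_mx 1.
Lemma tot_one : tot (one true) = 1.
Proof. by rewrite /tot big_ord1 mxE. Qed.

Lemma row_tot (n : bool) (x : 'rV[K]_n) : x = tot x *: one n.
Proof.
apply: tot_inj; rewrite (linZ (@tot_lin n)); case: n x => x; last by rewrite !tot_false scaler0.
by rewrite tot_one; apply/esym/mulr1.
Qed.

Lemma one_edge_tot T S (f : arr T S) (x : one_edge K O S) : iso f ->
 tot (pact f x : 'rV_(nedge T == 1%N)) = tot (x : 'rV_(nedge S == 1%N)).
Proof. by move=> fi; apply: tot_conform; rewrite (nedge_iso fi). Qed.

Lemma one_edge_presheaf : is_presheaf (one_edge K O).
Proof.
split.
- move=> T S f fi a x y; apply: tot_inj; rewrite (one_edge_tot _ fi).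
 by rewrite (@tot_lin (nedge S == 1%N)) (@tot_lin (nedge T == 1%N)) !(one_edge_tot _ fi).
- move=> T S f fi n x; rewrite /homog /= /deg0_proj; case: (n == 0) => // <-.
 apply: tot_inj; rewrite (one_edge_tot _ fi) (lin0 (@tot_lin (nedge S == 1%N))).
 by rewrite (lin0 (@tot_lin (nedge T == 1%N))).
- move=> T f fE x; apply: tot_inj; apply: one_edge_tot. by exists f; rewrite fE gcompf1.
- move=> T S P f g h fi gi hE x; apply: tot_inj.
 by rewrite (one_edge_tot _ fi) (one_edge_tot _ gi) (one_edge_tot _ (iso_comp fi gi hE)).
Qed.

Lemma one_edge_leggy : leggy (one_edge K O).
Proof.
split=> [T F lt|]; first by rewrite /= (nedge_lt lt).
move=> T' T'' t f' g'' g' i F' F'' f'' tl fi gE fF' fF'' ind x y.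
have lt' : lt_fiber T' F' by exists t, g', i.
have lt'' : lt_fiber T'' F'' by exists t, g'', i.
have [lg' e'] := lt_relegs lt'; have [lg'' e''] := lt_relegs lt''.
case: F' e' f'' {fF' ind lt'} => F' Fo' /= e'; subst F'.
case: F'' e'' y {fF'' lt''} => F'' Fo'' /= e''; subst F''.
move=> y f'' [E <-]; rewrite (Prop_irrelevance E erefl) /=; by exists erefl.
Qed.

Lemma one_edge_coll : is_coll (one_edge K O).
Proof.
apply: leggy_coll; [exact: one_edge_presheaf|exact: one_edge_leggy|].
move=> T T0 x; apply: tot_inj; rewrite (lin0 (@tot_lin (nedge T == 1%N))).
by move: x => /=; rewrite T0 => x; apply: tot_false.
Qed.

Lemma sdual_coll : is_coll (sdual (one_edge K O)).
Proof.
apply: leggy_coll.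
- exact/susp_presheaf/dual_is_presheaf/one_edge_presheaf.
- by apply: susp_leggy; apply: dual_leggy one_edge_presheaf one_edge_leggy.
- move=> T T0 x; apply: dual_eq => y. rewrite (coll_red one_edge_coll T0 y); exact: dual_fun0.
Qed.

Lemma bar_coll N : is_presheaf N -> leggy N -> is_coll (bar_gen N).
Proof.
move=> Np Nl; apply: leggy_coll.
- exact/susp_presheaf/dual_is_presheaf.
- by apply: susp_leggy; apply: dual_leggy.
- move=> T T0 x; apply: dual_eq => y. by have /asboolP[_ _ h] := dual_funP (x : dualT _ _); rewrite h // T0.
Qed.

(** * The terminal operad *)

Lemma terminal_one : one_connected (terminal_operad K O).
Proof.
split; last first. by move=> U _; exists id => x; rewrite /= ?[_ *: _]mulr1.
split.
- split=> //.
- by move=> T S f i F _ y a x x' /=; rewrite mulrDl; congr (_ + _); apply: esym (mulrA _ _ _).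
- by move=> T S f i F _ y a x x' /=; rewrite mulrDr; congr (_ + _); apply: mulrCA.
- move=> T S f i F _ m n x y; rewrite /homog /= /deg0_proj.
 case: (m =P 0) => [->|_]; last by move=> <- _; rewrite mul0r if_same.
 case: (n =P 0) => [->|_]; last by move=> _ <-; rewrite mulr0 if_same. by rewrite addr0 eqxx.
- by [].
- by move=> T S P F G H f g gf j i fi _ _ _ _ _ _ x y z /=; rewrite mulrA.
- move=> T R' R'' S F G f' g' f'' g'' j i l k _ _ _ _ _ _ _ _ m n x y z.
 rewrite /homog /= /deg0_proj; case: (m =P 0) => [-> _|_ <- _]; last by rewrite !(mulr0, mul0r) scaler0.
 case: (n =P 0) => [-> _|_ <-]; last by rewrite !(mulr0, mul0r) scaler0.
 by rewrite mulr0 /sgn expr0z scale1r mulrAC.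
- by move=> T F u U b f i _ _ _ y; exists erefl; rewrite /= mul1r.
- move=> T' T'' S' S'' F F' F'' w s f' f'' h wj i j _ _ _ _ _ _ _ _ x y. by exists y => //; exists erefl.
Qed.
End Leggy.

(** * Operads generated by graphs with one edge *)

Section OneEdge.
Variables (K : fieldType) (O : opcat).
Implicit Types (T S F G H X U : obj O).

Lemma full_one (T : graph) : ordered T -> nedge T = 1%N -> exists2 h, h \in full T & full T = [set h; opp T h].
Proof.
move=> To T1; have c := card_full To; rewrite T1 in c.
have [h hf] : exists h, h \in full T by apply/card_gt0P; rewrite c.
exists h => //; apply/esym/eqP; rewrite eqEcard c.
rewrite cards2 eq_sym; move: (hf); rewrite inE => -> /=; rewrite andbT.
apply/subsetP => k; rewrite in_set2 => /orP[] /eqP -> //.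
exact: full_closed To _ hf.
Qed.

Lemma eset_one (T : graph) : ordered T -> nedge T = 1%N -> eset T = [set full T].
Proof.
move=> To T1; have [h hf fE] := full_one To T1; apply/setP => e; rewrite inE.
apply/imsetP/eqP => [[k kf ->]|->]; last by exists h.
move: kf; rewrite {1}fE !inE => /orP[] /eqP ->; rewrite ?fE //.
by rewrite (oppK To) setUC.
Qed.

Lemma tube_full T : full T != set0 -> tube (full T).
Proof.
move=> T0; apply/tubeP; split=> //; first exact: full_closed (objO T).
by move=> h h' _ _; apply: (proj1 (conn_full T) (objC T)).
Qed.

Lemma full_iso T S (f : arr T S) : iso f -> psi f @: full S = full T.
Proof.
move=> fi; apply/setP => h; have [k ->] := iso_psi_surj h fi.
by rewrite mem_imset ?full_nz //; apply: psi_inj (arr0 f).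
Qed.

Lemma smap_full T S (f : arr T S) b : iso f -> smap f (b, full S) = (b, full T).
Proof. by move=> fi; rewrite /smap /= (lift_iso fi) full_iso // if_same. Qed.

(** On a graph with one edge, the edge and the outermost tube both consist of [full T]; the list [l]
    selects and orders the symbols of a generator. *)
Definition mtop (l : seq bool) (T : graph) : ext K (sym T) := mon K [seq (b, full T) | b <- l].

Lemma emap_mtop l T S (f : arr T S) : iso f -> emap (smap f) (mtop l S) = mtop l T.
Proof.
move=> fi; rewrite emap_mon -map_comp; congr (mon K _).
by apply: eq_map => b /=; rewrite smap_full.
Qed.

Lemma mtop_bas fl l T : uniq l -> fedge fl = (false \in l) -> ftube fl = (true \in l) ->
 nedge T = 1%N -> exists A, [/\ bas A (mtop l T), valid fl A,
  deg fl A = (false \in l)%:Z + fdeg fl * (true \in l)%:Z & ftube fl -> A = topS fl T].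
Proof.
move=> ul le lt T1; have T0 : full T != set0 by rewrite -(nedge_gt0 (objO T)) T1.
have eT := eset_one (objO T) T1.
exists [set:: [seq (b, full T) | b <- l]].
have inA b q : ((b, q) \in [set:: [seq (b, full T) | b <- l]]) = (b \in l) && (q == full T).
 rewrite inE; apply/mapP/andP => [[b' bl [-> ->]]|[bl /eqP ->]]; first by rewrite eqxx. by exists b.
have eA : edges [set:: [seq (b, full T) | b <- l]] = if false \in l then eset T else set0.
 by apply/setP => q; rewrite inE inA eT; case: (false \in l); rewrite !inE.
have tA : tubes [set:: [seq (b, full T) | b <- l]] = if true \in l then [set full T] else set0.
 by apply/setP => q; rewrite inE inA; case: (true \in l); rewrite !inE.
split.
- rewrite /mtop; have [|b ->] := @mon_uniq K _ [seq (b, full T) | b <- l]. by rewrite map_inj_uniq // => b b' [].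
 by exists ((-1) ^+ b); rewrite ?sgn_neq0.
- apply/andP; rewrite eA le eqxx tA lt; split=> //; case: (true \in l) => //. apply/andP; split.
  apply/nestP; split=> [q|q q'|_]; rewrite ?inE ?eqxx // => /eqP ->; first exact: tube_full.
  by move=> /eqP ->; rewrite /compat subxx. apply/implyP => _; apply/forall_inP => q; rewrite inE => /eqP ->.
 have [h hf fE] := full_one (objO T) T1; apply/existsP; exists h; rewrite -fE /resid big1 ?setD0 //.
 by move=> q' /andP[]; rewrite inE => /eqP ->; rewrite properxx.
- rewrite /deg eA tA eT; case: (_ \in l) (true \in l) => -[]; rewrite ?cards1 ?cards0 //.
- rewrite lt => tl; apply: sym_eq; first by rewrite eA edges_top le. by rewrite tA tl tubes_top.
Qed.

(* A coordinate on a collection with at most one-dimensional components,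
   concentrated on graphs with one edge and in degree [d]. *)
Record coord (E : presheaf K O) (c : forall T, E T -> K) (d : int) : Prop := {
 co_lin : forall T, linear (c T : E T -> K^o); co_inj : forall T, injective (c T);
 co_act : forall T S (f : arr T S) (x : E S), iso f -> c T (pact f x) = c S x;
 co_same : forall T F (x : E T) (y : E F), lt_fiber T F -> same x y -> c T x = c F y;
 co_red : forall T (x : E T), nedge T != 1%N -> c T x = 0; co_hom : forall T (x : E T), homog d x;
 co_ex : forall T, nedge T = 1%N -> exists x : E T, c T x = 1
}.

Lemma co_deg (E : presheaf K O) (c : forall T, E T -> K) (d : int) : coord c d ->
 forall T n (x : E T), homog n x -> c T x != 0 -> n = d.
Proof.
move=> co T n x hx c0; apply/eqP; apply: contraNT c0 => nd.
have x0 : x = 0 by rewrite -hx (homog_other (co_hom co x) nd).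
by rewrite x0; apply/eqP/(lin0 (@co_lin _ _ _ co T)).
Qed.

Section Generators.
Variables (E : presheaf K O) (c : forall T, E T -> K) (d : int).
Arguments c : clear implicits.
Hypothesis co : coord c d.
Variables (fl : flags) (l : seq bool).
Hypotheses (ul : uniq l) (le : fedge fl = (false \in l)) (lt : ftube fl = (true \in l)).
Hypothesis ld : d = (false \in l)%:Z + fdeg fl * (true \in l)%:Z.

Definition geni T (x : E T) : Mod K fl O T := prj _ _ (c T x *: mtop l T).
Arguments geni : clear implicits.

Lemma emb_geni T x : emb (geni T x) = c T x *: mtop l T.
Proof.
apply: prjK => A; have [T1|T1] := eqVneq (nedge T) 1%N; last first. by rewrite (co_red co _ T1) scale0r ffunE eqxx.
have [B [[a a0 ->] vB _ _]] := mtop_bas ul le lt T1.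
rewrite !ffunE; case: (A =P B) => [-> //|_]; by rewrite !scaler0 eqxx.
Qed.

Lemma geni_coll : coll_map geni.
Proof.
split; first split.
- move=> T a x y; apply: emb_inj; rewrite emb_lin !emb_geni (co_lin co). by rewrite scalerDl -scalerA.
- move=> T n x hx; rewrite addr0; apply/homog_emb; rewrite emb_geni => A.
 have [T1|T1] := eqVneq (nedge T) 1%N; last first. by rewrite (co_red co _ T1) scale0r ffunE eqxx.
 have [c0|c0] := eqVneq (c T x) 0; first by rewrite c0 scale0r ffunE eqxx.
 have [B [[a a0 ->] _ dB _]] := mtop_bas ul le lt T1.
 rewrite !ffunE; case: (A =P B) => [-> _|_]; last by rewrite !scaler0 eqxx. by rewrite dB -ld (co_deg co hx c0).
- move=> T S g gi x; apply: emb_inj; rewrite (emb_act _ gi) !emb_geni.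
 by rewrite (linZ (@emap_lin K _ _ _)) (emap_mtop _ gi) (co_act co _ gi).
- move=> T F _ ltF x y xy; have [lg lgE] := lt_relegs ltF. have := co_same co ltF xy; rewrite /geni => ->.
 case: F lgE y {xy ltF} => F Fo /= lgE; subst F => y; by exists erefl.
Qed.

Hypotheses (mx : fmax fl) (ft : ftube fl) (flo : fdeg fl = 1 \/ fdeg fl = -1).
Hypothesis Ec : is_coll E.

Lemma co_neq0 T (x : E T) : x <> 0 -> c T x != 0 /\ nedge T = 1%N.
Proof.
move=> x0; have c0 : c T x != 0. apply/eqP => cx; apply: x0; apply: (co_inj co); rewrite cx.
 by rewrite (lin0 (@co_lin _ _ _ co T)).
split=> //; apply/eqP; apply: contraNT c0 => T1; by rewrite (co_red co).
Qed.

Lemma geni_inj T : injective (geni T).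
Proof.
move=> x y e; have := f_equal (@emb _ _ _ _) e; rewrite !emb_geni => {}e.
have [T1|T1] := eqVneq (nedge T) 1%N; last first. by apply: (co_inj co); rewrite !(co_red co).
have [B [[a a0 mE] _ _ _]] := mtop_bas ul le lt T1; apply: (co_inj co).
have := f_equal (fun z : ext K (sym T) => z B) e; rewrite mE !ffunE eqxx.
by rewrite !scalerA => /(mulIf (oner_neq0 _)) /(mulIf a0).
Qed.

Lemma geni_top T x : x <> 0 -> bs (geni T x) (topS fl T).
Proof.
move=> /co_neq0[c0 T1]; rewrite /bs emb_geni; apply: basZ => //.
by have [B [bB _ _ BE]] := mtop_bas ul le lt T1; rewrite -(BE ft).
Qed.

Lemma geni_ex T : (0 < nedge T)%N -> (fmax fl -> nedge T = 1%N) -> exists x : E T, x <> 0.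
Proof.
move=> _ /(_ mx) T1; have [x cx] := co_ex co T1; exists x => x0.
have := oner_neq0 K; rewrite -cx x0 (lin0 (@co_lin _ _ _ co T)).
by rewrite eqxx.
Qed.

Lemma geni_free : is_free geni.
Proof.
exact: (Mod_free flo ft Ec geni_coll geni_inj geni_top geni_ex).
Qed.
End Generators.
Arguments geni {E} c fl l T x.

Lemma one_edge_coord : @coord (one_edge K O) (fun T x => tot (x : 'rV_(nedge T == 1%N))) 0.
Proof.
split.
- by move=> T; apply: (@tot_lin K (nedge T == 1%N)).
- by move=> T; apply: tot_inj.
- by move=> T S f x fi; apply: one_edge_tot.
- move=> T F x y lt; have [lg lgE] := lt_relegs lt. case: F lgE y {lt} => F Fo /= lgE; subst F => y [E <-].
 by rewrite (Prop_irrelevance E erefl).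
- by move=> T x /negbTE T1; move: x => /=; rewrite T1 => x; apply: tot_false.
- by [].
- by move=> T T1; exists (one K (nedge T == 1%N)); rewrite T1 tot_one.
Qed.

Definition dual_coord T (b : sdual (one_edge K O) T) : K :=
 ev (b : gsusp 1 (gdual true (one_edge K O T))) (one K (nedge T == 1%N) : one_edge K O T).

Lemma ev_one T (b : sdual (one_edge K O) T) (e : one_edge K O T) :
 ev (b : gsusp 1 (gdual true (one_edge K O T))) e = tot (e : 'rV_(nedge T == 1%N)) * dual_coord b.
Proof.
have /asboolP[bl _ _] := dual_funP (b : dualT _ _).
rewrite {1}(row_tot (e : 'rV_(nedge T == 1%N))).
exact: (linZ bl (tot (e : 'rV_(nedge T == 1%N))) (one K (nedge T == 1%N) : one_edge K O T)).
Qed.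

Lemma sdual_coord : coord dual_coord 1.
Proof.
have Ep := one_edge_presheaf K O.
split.
- by [].
- move=> T b b' e; apply: dual_eq => x. by have := ev_one b x; have := ev_one b' x; rewrite /ev /dapp e => -> ->.
- move=> T S f x fi; rewrite /dual_coord.
 have -> : (one K (nedge T == 1%N) : one_edge K O T) = pact f (one K (nedge S == 1%N) : one_edge K O S).
  apply: tot_inj; rewrite (one_edge_tot _ fi) (nedge_iso fi) //. exact: (@dual_pactE K O true _ Ep T S f x fi).
- move=> T F x y lt; have [lg lgE] := lt_relegs lt. case: F lgE y {lt} => F Fo /= lgE; subst F => y [E <-].
 by rewrite (Prop_irrelevance E erefl).
- move=> T b T1; rewrite /dual_coord. have -> : (one K (nedge T == 1%N) : one_edge K O T) = 0.
  apply: tot_inj; rewrite (lin0 (@tot_lin K (nedge T == 1%N))). by rewrite (negbTE T1) tot_false. exact: dual_fun0.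
- by move=> T b; apply: dual_eq.
- move=> T T1; have P : (fun x : one_edge K O T => tot (x : 'rV_(nedge T == 1%N))) \in
   dual_pred (true || (0 < nedge T)%N) (V := one_edge K O T).
  apply/asboolP; split=> //; first exact: (@tot_lin K (nedge T == 1%N)).
  exists [:: 0] => n x; rewrite inE /= /deg0_proj => /negbTE ->. exact: (lin0 (@tot_lin K (nedge T == 1%N))).
 by exists (Dual P : gdual _ _); rewrite /dual_coord /ev /dapp /= T1 tot_one.
Qed.
End OneEdge.
Arguments geni {K O E} c fl l T x.

(** * Pairs of composable contractions *)

Section Pairs.
Variable O : opcat.
Implicit Types (T S F G H X U : obj O).

(** The edges contracted by a pair, seen in [X]. By [pi_equivE] and [pair_ex] they identify the
    classes of pairs with the tubes of [X] other than [full X]. *)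
Definition pp X (p : pipair X) : {set 'I_(nh X)} := nz (gcomp (pit p) (pil p)).

Lemma ppE X (p : pipair X) : pp p = psi (pil p) @: nz (pit p).
Proof. exact: (nz_iso_comp _ (pil_iso p)). Qed.

Lemma pp_tube X (p : pipair X) : tube (pp p) /\ pp p != full X.
Proof.
have li := pil_iso p; have te := pit_elem p; have [_ [iv [ih I]] _ _] := te.
split; first by rewrite ppE -(lift_iso li); apply: tube_lift; apply: tube_nz te I.
apply/negP => /eqP E; have := pi_edge p; rewrite (nedge_gt0 (objO _)) => /set0Pn[k kf].
have : psi (pil p) (psi (pit p) k) \in full X by rewrite !full_nz.
rewrite -E ppE mem_imset; last exact: psi_inj (arr0 _).
by rewrite (negbTE (psi_nz _ _)).
Qed.

Lemma pi_equivE X (p p' : pipair X) : pi_equiv p p' <-> pp p = pp p'.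
Proof.
split=> [[s1 [s2 [i1 i2 e1 e2]]]|E]. rewrite /pp -e1 gcompA -e2 -gcompA; have [g gE] := comp_arr (pil p) (pit p).
 rewrite -gE; apply/setP => h; rewrite (in_nz_comp _ (arr0 g)).
 by have /iso_nz -> := i2; rewrite imset0 in_set0 orbF.
have [w [s [wi si wl st]]] := contr_unique (pil_iso p) (pil_iso p') E.
by exists w, s.
Qed.

Lemma pair_ex X (q : {set 'I_(nh X)}) : tube q -> q != full X -> exists p : pipair X, pp p = q.
Proof.
move=> tq qf; have [T [S [F [l [t [i [li te nE]]]]]]] := contr_ex tq.
have S0 : (0 < nedge S)%N.
 rewrite (nedge_gt0 (objO S)); apply: contra qf => /eqP S0; rewrite -nE (nz_iso_comp _ li).
 by rewrite -(full0_nz t S0) full_iso.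
by exists (PiPair li te S0).
Qed.

Lemma reps_ex X : exists n (c : 'I_n -> pipair X), representatives c.
Proof.
pose P := [set q : {set 'I_(nh X)} | tube q && (q != full X)].
have H (i : 'I_#|P|) : exists p : pipair X, pp p = enum_val i.
 by have := enum_valP i; rewrite inE => /andP[tq qf]; apply: pair_ex.
exists #|P|, (fun i => projT1 (cid (H i))); split=> [p|i j].
 have [tp pf] := pp_tube p; have pP : pp p \in P by rewrite inE tp.
 exists (enum_rank_in pP (pp p)); apply/pi_equivE; case: (cid _) => p' /= ->. by rewrite enum_rankK_in.
by move=> /pi_equivE; case: (cid _) => p /= ->; case: (cid _) => p' /= -> /enum_val_inj.
Qed.

Lemma reps_uniq X n (c : 'I_n -> pipair X) i j : representatives c -> pp (c i) = pp (c j) -> i = j.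
Proof. by move=> [_ u] e; apply/u/pi_equivE. Qed.

Lemma reps_cover X n (c : 'I_n -> pipair X) q : representatives c -> tube q -> q != full X ->
 exists i, pp (c i) = q.
Proof.
move=> [cov _] tq qf; have [p pE] := pair_ex tq qf; have [i /pi_equivE e] := cov p.
by exists i; rewrite -e.
Qed.

(** The pairs on which generators with one edge can be nonzero; [X] then has exactly two edges. *)
Definition good X (p : pipair X) := (nedge (piS p) == 1%N) && (nedge (piF p) == 1%N).

Lemma pp_sub X (p : pipair X) : pp p \subset full X.
Proof. by have [/tubeP[]] := pp_tube p. Qed.

Lemma card_pp X (p : pipair X) : #|pp p| = (nedge (piF p) * 2)%N /\ #|full X :\: pp p| = (nedge (piS p) * 2)%N.
Proof.
have li := pil_iso p; have te := pit_elem p; have [_ [iv [ih I]] _ _] := te.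
have pi := psi_inj (arr0 (pil p)).
have c1 : #|pp p| = (nedge (piF p) * 2)%N.
 rewrite ppE card_imset // -(ih_full te I) card_imset; last exact: ih_inj I. exact: card_full (objO _).
split=> //; have := cardsID (pp p) (full X); rewrite (setIidPr (pp_sub p)).
rewrite (card_full (objO X)) (nedge_iso li) (nedge_sum (objO _) (objO _) (arr0 (pit p))).
by move: c1; rewrite ppE card_imset // => -> /eqP; rewrite addnC eqn_add2r => /eqP.
Qed.

Lemma goodE X (p : pipair X) : good p = (#|pp p| == 2%N) && (#|full X :\: pp p| == 2%N).
Proof.
have [-> ->] := card_pp p; rewrite -[X in _ = (_ == X) && (_ == X)]/(1 * 2)%N !eqn_pmul2r //.
by rewrite andbC.
Qed.

Lemma two_closed (T : graph) (q s : {set 'I_(nh T)}) : ordered T -> q \subset full T ->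
 opclosed (opp T) q -> #|q| = 2%N -> opclosed (opp T) s -> ~~ [disjoint q & s] -> q \subset s.
Proof.
move=> To qf qo q2 so /pred0Pn[h /= /andP[hq hs]].
have -> : q = [set h; opp T h]. apply/esym/eqP; rewrite eqEcard q2 cards2.
 have := subsetP qf h hq; rewrite inE eq_sym => -> /=; rewrite andbT.
 by apply/subsetP => k; rewrite in_set2 => /orP[] /eqP -> //; apply: qo.
by apply/subsetP => k; rewrite in_set2 => /orP[] /eqP -> //; apply: so.
Qed.

Lemma pair_tube (T : graph) (q : {set 'I_(nh T)}) : ordered T -> q \subset full T ->
 opclosed (opp T) q -> #|q| = 2%N -> tube q.
Proof.
move=> To qf qo q2; have /card_gt0P[h hq] : (0 < #|q|)%N by rewrite q2.
have qE : q = [set h; opp T h]. apply/eqP; rewrite eqEsubset; apply/andP; split; last first.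
  by apply/subsetP => k; rewrite in_set2 => /orP[] /eqP -> //; apply: qo.
 apply: two_closed => //; last by apply/pred0Pn; exists h; rewrite /= hq !inE eqxx.
 by move=> k; rewrite !in_set2 => /orP[] /eqP ->; rewrite ?oppK ?eqxx ?orbT.
have c : connect (eadj T q) (vtx T h) (vtx T (opp T h)) by apply/connect1/erel1.
have c' : connect (eadj T q) (vtx T (opp T h)) (vtx T h).
 by have := @erel1 _ _ (vtx T) (opp T) q _ (qo _ hq); rewrite oppK // => /connect1.
apply/tubeP; split=> //; first by apply/set0Pn; exists h.
by move=> k k'; rewrite {1 2}qE !in_set2 => /orP[] /eqP -> /orP[] /eqP ->.
Qed.

(* A graph with two edges has exactly two contractions. *)
Lemma good_two X n (c : 'I_n -> pipair X) i : representatives c -> good (c i) ->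
 exists j, [/\ i != j, good (c j), pp (c j) = full X :\: pp (c i) & forall k, k = i \/ k = j].
Proof.
move=> cr gi; have := gi; rewrite goodE => /andP[/eqP q2 /eqP r2].
have [tq qf] := pp_tube (c i); have /tubeP[_ qs qo _] := tq.
have ro : opclosed (opp X) (full X :\: pp (c i)).
 move=> h; rewrite !in_setD => /andP[hq hf]; rewrite (full_closed (objO X) hf) andbT.
 by apply: contra hq => /qo; rewrite (oppK (objO X)).
have rt := pair_tube (objO X) (subsetDl _ _) ro r2.
have rf : full X :\: pp (c i) != full X. apply/eqP => E; have /card_gt0P[h hq] : (0 < #|pp (c i)|)%N by rewrite q2.
 by have := subsetP qs h hq; rewrite -E inE hq.
have [j jE] := reps_cover cr rt rf; exists j.
have rE : full X :\: (full X :\: pp (c i)) = pp (c i) by rewrite setDDr setDv set0U (setIidPr qs).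
split=> //.
- apply/eqP => ij; move: r2; rewrite -jE -ij => _. have /card_gt0P[h hq] : (0 < #|pp (c i)|)%N by rewrite q2.
 by have := hq; rewrite {1}ij jE inE hq.
- by rewrite goodE jE r2 rE q2.
- move=> k; have [/tubeP[k0 ks ko _] kf] := pp_tube (c k).
 have [d1|n1] := boolP [disjoint pp (c i) & pp (c k)]; last first. have s1 := two_closed (objO X) qs qo q2 ko n1.
  have [d2|n2] := boolP [disjoint full X :\: pp (c i) & pp (c k)]; last first.
   have s2 := two_closed (objO X) (subsetDl _ _) ro r2 ko n2.
   case/negP: kf; rewrite eqEsubset ks /=; apply/subsetP => h hf.
   have [/(subsetP s1)//|hn] := boolP (h \in pp (c i)). by apply: (subsetP s2); rewrite inE hn.
  left; apply: (reps_uniq cr); apply/eqP; rewrite eqEsubset s1 andbT. apply/subsetP => h hk; apply/negPn/negP => hn.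
  have := disjoint_setI0 d2 => /setP /(_ h); rewrite in_setI in_setD hk hn. by rewrite (subsetP ks _ hk) inE.
 right; apply: (reps_uniq cr); rewrite jE. have s : pp (c k) \subset full X :\: pp (c i).
  by rewrite subsetD ks disjoint_sym.
 apply/eqP; rewrite eqEsubset s /=; apply: two_closed (objO X) (subsetDl _ _) ro r2 ko _.
 have [h hk] := set0Pn _ k0; apply/pred0Pn; exists h. by rewrite /= hk andbT (subsetP s).
Qed.
End Pairs.

(** * Quadratic elements *)

Section Weight2.
Variables (K : fieldType) (O : opcat).
Implicit Types (T S F G H X U : obj O).
Variables (E : presheaf K O) (c : forall T, E T -> K) (d : int).
Arguments c : clear implicits.
Hypothesis co : coord c d.
Variables (fl : flags) (l : seq bool).
Hypotheses (ul : uniq l) (le : fedge fl = (false \in l)) (lt : ftube fl = (true \in l)).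
Hypothesis ld : d = (false \in l)%:Z + fdeg fl * (true \in l)%:Z.
Hypotheses (mx : fmax fl) (ft : ftube fl) (flo : fdeg fl = 1 \/ fdeg fl = -1).
Hypothesis Ec : is_coll E.

Notation N := (Mod K fl O).
Notation io := (geni c fl l).
Let No : is_operad N. Proof. exact: Mod_operad. Qed.
Let Np : is_presheaf N. Proof. exact: op_presheaf. Qed.
Let ioc : coll_map io. Proof. exact: (geni_coll co ul le lt ld). Qed.
Let iol T : linear (io T). Proof. by have [p _] := ioc; exact: (@pmap_lin _ _ _ _ _ _ p T). Qed.
Let top T (x : E T) : x <> 0 -> bs (io T x) (topS fl T).
Proof. exact: (geni_top co ul le lt). Qed.

Lemma unit_ex T : exists u : E T, nedge T = 1%N -> c T u = 1.
Proof.
have [T1|T1] := eqVneq (nedge T) 1%N; last by exists 0 => e; rewrite e in T1.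
by have [u cu] := co_ex co T1; exists u.
Qed.

Definition unit T : E T := projT1 (cid (unit_ex T)).

Lemma c_unit T : nedge T = 1%N -> c T (unit T) = 1.
Proof. by rewrite /unit; case: (cid _). Qed.

Lemma unitE T (x : E T) : x = c T x *: unit T.
Proof.
apply: (co_inj co); have -> : c T (c T x *: unit T) = c T x * c T (unit T). exact: (linZ (@co_lin _ _ _ _ _ co T)).
have [T1|T1] := eqVneq (nedge T) 1%N; first by rewrite c_unit // mulr1.
by rewrite !(co_red co _ T1) mul0r.
Qed.

Definition zz X (p : pipair X) (x : E (piS p)) (y : E (piF p)) : N X :=
 pact (pil p) (circ (pit p) (io _ x) (io _ y)).
Arguments zz {X} p x y.

Lemma zzE X (p : pipair X) x y : zz p x y = (c _ x * c _ y) *: @zz X p (unit _) (unit _).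
Proof.
rewrite /zz {1}(unitE x) {1}(unitE y) !(linZ (@iol _)).
rewrite (circZl _ _ _ No (pit_elem p)) (linZ (op_linr No (pit_elem p) _)) scalerA.
exact: pactZ No (pil_iso p).
Qed.

Lemma zz_bad X (p : pipair X) x y : ~~ good p -> @zz X p x y = 0.
Proof.
rewrite /good negb_and => b; rewrite zzE; suff -> : c _ x * c _ y = 0 by rewrite scale0r.
by case/orP: b => b; [rewrite (co_red co _ b) mul0r|rewrite [X in _ * X](co_red co _ b) mulr0].
Qed.

Lemma zz_good X (p : pipair X) : good p ->
 exists2 A, bs (@zz X p (unit _) (unit _)) A & tubes A = [set full X; pp p].
Proof.
move=> /andP[/eqP S1 /eqP F1].
have u0 T : nedge T = 1%N -> unit T <> 0.
 move=> T1 u0; have := c_unit T1; rewrite u0 (lin0 (@co_lin _ _ _ _ _ co T)). by move/esym/eqP; rewrite oner_eq0.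
have li := pil_iso p; have te := pit_elem p; have [_ [iv [ih I]] _ _] := te.
exists (smap (pil p) @: (smap (pit p) @: topS fl (piS p) :|: imap ih @: topS fl (piF p))).
 apply: bs_act li _; apply: (bs_circ ft te I); apply: top; exact: u0.
have [_ tU] := symU (smap (pit p) @: topS fl (piS p)) (imap ih @: topS fl (piF p)).
rewrite tubes_smap tU tubes_smap tubes_imap !tubes_top !imset_set1 imsetU !imset_set1.
have S0 : full (piS p) != set0 by rewrite -(nedge_gt0 (objO _)) S1.
congr (_ |: [set _]). have T0 : full (piT p) != set0.
  by have [k kf] := set0Pn _ S0; apply/set0Pn; exists (psi (pit p) k); rewrite full_nz.
 by rewrite (lift_full _ S0) (lift_full _ T0).
by rewrite (lift_iso li) /himg (ih_full te I) -ppE.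
Qed.

Lemma two_tubes_good X (A : {set sym X}) (p : pipair X) : valid fl A -> tubes A = [set full X; pp p] -> good p.
Proof.
rewrite /valid ft mx => /and3P[_ _ /forall_inP m] tA; have [tp pf] := pp_tube p.
have /tubeP[_ qs _ _] := tp; rewrite goodE.
have two h : h \in full X -> #|[set h; opp X h]| = 2%N. by rewrite inE eq_sym cards2 => ->.
have rf : resid (tubes A) (full X) = full X :\: pp p.
 rewrite /resid tA; congr (_ :\: _); apply/setP => h; apply/bigcupP/idP.
  case=> q /andP[]; rewrite in_set2 => /orP[] /eqP -> //. by rewrite properxx.
 by move=> hp; exists (pp p); rewrite // in_set2 eqxx orbT /= properEneq pf.
have rp : resid (tubes A) (pp p) = pp p.
 rewrite /resid tA big1 ?setD0 // => q /andP[]; rewrite in_set2 => /orP[] /eqP ->.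
  by rewrite properE => /andP[fs]; case/negP: pf; rewrite eqEsubset qs. by rewrite properxx.
have c2 q : q \in tubes A -> resid (tubes A) q \subset full X -> #|resid (tubes A) q| = 2%N.
 move=> /m/existsP[h /eqP ->] s; apply: two; apply: (subsetP s); exact: set21.
apply/andP; split; apply/eqP. by rewrite -rp c2 // ?rp // tA set22.
by rewrite -rf c2 // ?rf ?subsetDl // tA set21.
Qed.

Lemma bs_zero T (x : N T) A B : bs x A -> A != B -> emb x B = 0.
Proof.
by move=> [a a0 ->] AB; rewrite !ffunE eq_sym (negbTE AB) scaler0.
Qed.

(** A nesting with two tubes consists of [full X] and the tube of exactly one class of pairs, so the
    basis vectors concerned are, up to scalars, the composites [zz] for good pairs. *)
Lemma weight2_zz X n (r : 'I_n -> pipair X) (z : N X) : representatives r ->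
 supp (fun A : {set sym X} => #|tubes A| = 2%N) (emb z) ->
 exists b : 'I_n -> K, z = \sum_i b i *: @zz X (r i) (unit _) (unit _).
Proof.
move=> rr sz.
have H i : exists b : K, forall A, valid fl A -> tubes A = [set full X; pp (r i)] ->
  b * emb (@zz X (r i) (unit _) (unit _)) A = emb z A. have [g|g] := boolP (good (r i)); last first.
  by exists 0 => A vA tA; case/negP: g; apply: two_tubes_good tA.
 have [B [a a0 zE] tB] := zz_good g; exists (emb z B / a) => A vA tA. have -> : A = B.
  have vB : valid fl B by apply: (bs_valid (x := @zz X (r i) (unit _) (unit _))); exists a.
  apply: sym_eq; last by rewrite tA tB. by move: vA vB => /andP[/eqP -> _] /andP[/eqP -> _].
 by rewrite zE !ffunE eqxx [_ *: _]mulr1 divfK.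
pose b i := projT1 (cid (H i)).
have bP i A : valid fl A -> tubes A = [set full X; pp (r i)] ->
  b i * emb (@zz X (r i) (unit _) (unit _)) A = emb z A. by rewrite /b; case: (cid (H i)) => b' /= h; apply: h.
exists b; apply: emb_inj; rewrite (lin_sum embl).
under eq_bigr => i _ do rewrite (linZ embl).
apply/ffunP => A; rewrite sum_ffunE.
have zero i : ~ (valid fl A /\ tubes A = [set full X; pp (r i)]) ->
  (b i *: emb (@zz X (r i) (unit _) (unit _))) A = 0.
 move=> nA; rewrite ffunE; have [g|g] := boolP (good (r i)); last first.
  by rewrite (zz_bad _ _ g) (lin0 embl) ffunE scaler0.
 have [B zB tB] := zz_good g; rewrite (bs_zero zB) ?scaler0 //.
 by apply: contra_notN nA => /eqP <-; split=> //; apply: (bs_valid zB).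
have [vA|nA] := boolP (valid fl A); last first.
 rewrite big1 => [|i _]; last by apply: zero => -[v]; rewrite v in nA.
 by apply/eqP; apply: contraNT nA => /emb_supp.
have [t2|t2] := eqVneq #|tubes A| 2%N; last first. rewrite big1 => [|i _].
  by apply/eqP; apply: contraNT t2 => /sz ->. apply: zero => -[_ tA]; case/eqP: t2; rewrite tA cards2.
 by have [_] := pp_tube (r i); rewrite eq_sym => ->.
have [i tA] : exists i, tubes A = [set full X; pp (r i)].
 have := vA; rewrite /valid ft => /and3P[_ /nestP[t _ f] _].
 have [q qA qf] : exists2 q, q \in tubes A & q != full X. have : ~~ (tubes A \subset [set full X]).
   by apply/negP => /subset_leq_card; rewrite t2 cards1. by case/subsetPn=> q qA; rewrite inE => qf; exists q.
 have [i iE] := reps_cover rr (t q qA) qf; exists i; rewrite iE. have X0 : full X != set0.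
  by apply: contraNneq qf => X0; have /tubeP[_ + _ _] := t q qA; rewrite X0 subset0.
 apply/esym/eqP; rewrite eqEcard t2 cards2 eq_sym qf andbT.
 by apply/subsetP => s; rewrite in_set2 => /orP[] /eqP -> //; apply: f.
rewrite (bigD1 i) //= [X in _ + X]big1 ?addr0 => [|j ji]. by apply/esym; rewrite [LHS]ffunE; apply: bP.
apply: zero => -[_ tA']; case/eqP: ji; apply: (reps_uniq rr).
have [_ jf] := pp_tube (r j).
have : pp (r j) \in [set full X; pp (r i)] by rewrite -tA tA' set22.
by rewrite in_set2 (negbTE jf) => /eqP.
Qed.

Lemma decomposes_ex X n (r : 'I_n -> pipair X) (z : N X) : representatives r ->
 supp (fun A : {set sym X} => #|tubes A| = 2%N) (emb z) -> exists t, @decomposes K O E N io X n r t z.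
Proof.
move=> rr sz; have [b zE] := weight2_zz rr sz.
(* The factor [sgn K (d * d)] cancels the Koszul sign built into [decomposes], both generators
   having degree [d]. *)
pose t i : seq (pure (E (piF (r i))) (E (piS (r i)))) :=
 [:: Pure (co_hom co ((sgn K (d * d) * b i) *: unit (piF (r i)))) (co_hom co (unit (piS (r i))))].
exists t; rewrite /decomposes {1}zE; apply: eq_bigr => i _; rewrite big_seq1.
change (b i *: zz (r i) (unit _) (unit _) = sgn K (d * d) *: zz (r i) (unit _) ((sgn K (d * d) * b i) *: unit _)).
rewrite [in RHS]zzE !scalerA.
have -> : c (piF (r i)) ((sgn K (d * d) * b i) *: unit (piF (r i))) =
  (sgn K (d * d) * b i) * c (piF (r i)) (unit (piF (r i))). exact: (linZ (@co_lin _ _ _ _ _ co (piF (r i)))).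
rewrite [sgn K _ * (_ * _)]mulrA.
have [g|g] := boolP (good (r i)); last by rewrite (zz_bad _ _ g) !scaler0.
have /andP[/eqP S1 /eqP F1] := g.
rewrite !c_unit //; congr (_ *: _).
by rewrite !mulrA !mulr1 ?mul1r sgnK mul1r.
Qed.

Lemma decomposes_weight X n (r : 'I_n -> pipair X) t (z : N X) :
 @decomposes K O E N io X n r t z -> @weight K O E N io 2 X z.
Proof.
move=> ->; have W0 : @weight K O E N io 2 X 0 by apply: weight_0.
have WD (x y : N X) : @weight K O E N io 2 X x -> @weight K O E N io 2 X y -> @weight K O E N io 2 X (x + y).
 by move=> wx wy; rewrite -[x]scale1r; apply: weight_lin.
apply: big_ind => // i _; apply: big_ind => // q _.
rewrite -[_ *: _]addr0; apply: weight_lin W0; apply: weight_act (pil_iso _) _.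
by apply: (@weight_circ _ _ _ _ _ 1 1) (pit_elem _) _ _; apply: weight_gen.
Qed.

(** A generator carries one tube and composition adds the numbers of tubes, so the weight is the
    number of tubes. *)
Lemma weight_supp k X (z : N X) : @weight K O E N io k X z -> supp (fun A : {set sym X} => #|tubes A| = k) (emb z).
Proof.
elim=> {k X z}.
- move=> U [Ul _] A; rewrite emb_eta // ffunE; case: (A =P set0) => [-> _|_]; last by rewrite eqxx.
 by apply: eq_card0 => q; rewrite !inE.
- move=> T x A; have [->|/eqP x0] := eqVneq x 0. by rewrite (lin0 (@iol T)) (lin0 embl) ffunE eqxx.
 have [a a0 ->] := top x0; rewrite !ffunE; case: (A =P topS fl T) => [->|_]; last by rewrite scaler0 eqxx.
 by rewrite tubes_top cards1.
- move=> k k' T S G f i x y fe wx sx wy sy; have [_ [iv [ih I]] _ _] := fe. rewrite (emb_circ _ _ fe I).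
 apply: (@supp_wedge K _ (fun A => exists2 A0, valid fl A0 /\ #|tubes A0| = k & A = smap f @: A0)
           (fun A => exists2 A0, valid fl A0 /\ #|tubes A0| = k' & A = imap ih @: A0)).
 + refine (supp_emap (P := fun A => valid fl A /\ #|tubes A| = k) _ _) => [A xA|A vA _]; last by exists A.
  by split; [apply: emb_supp xA|apply: sx].
 + refine (supp_emap (P := fun A => valid fl A /\ #|tubes A| = k') _ _) => [A xA|A vA _]; last by exists A.
  by split; [apply: emb_supp xA|apply: sy].
 + by move=> _ _ [A [vA <-] ->] [B [vB <-] ->] _; rewrite (card_join ft fe I).
- move=> k T S f x fi _ sx; rewrite (emb_act _ fi); refine (supp_emap sx _) => A <- _.
 by rewrite tubes_smap card_imset //; apply: lift_inj.
- by move=> k T A; rewrite (lin0 embl) ffunE eqxx.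
- by move=> k T a x y _ sx _ sy; rewrite emb_lin; apply: supp_lin.
Qed.
End Weight2.

(** * Quadratic generation of kernels *)

Section Kernel.
Variables (K : fieldType) (O : opcat).
Implicit Types (T S F G H X U : obj O).
Variables (E : presheaf K O) (c : forall T, E T -> K) (d : int).
Arguments c : clear implicits.
Hypothesis co : coord c d.
Variables (fl : flags) (l : seq bool).
Hypotheses (ul : uniq l) (le : fedge fl = (false \in l)) (lt : ftube fl = (true \in l)).
Hypothesis ld : d = (false \in l)%:Z + fdeg fl * (true \in l)%:Z.
Hypotheses (mx : fmax fl) (ft : ftube fl) (flo : fdeg fl = 1 \/ fdeg fl = -1).
Hypothesis Ec : is_coll E.

Notation N := (Mod K fl O).
Notation io := (geni c fl l).
Let No : is_operad N. Proof. exact: Mod_operad. Qed.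
Let ioc : coll_map io. Proof. exact: (geni_coll co ul le lt ld). Qed.
Let iol T : linear (io T). Proof. by have [p _] := ioc; exact: (@pmap_lin _ _ _ _ _ _ p T). Qed.
Let top T (x : E T) : x <> 0 -> bs (io T x) (topS fl T).
Proof. exact: (geni_top co ul le lt). Qed.
Let inj T : injective (io T). Proof. exact: (geni_inj co ul le lt). Qed.
Let ex T : (0 < nedge T)%N -> (fmax fl -> nedge T = 1%N) -> exists x : E T, x <> 0.
Proof. exact: (geni_ex co mx). Qed.

Variables (M : operad K O) (f : family E M) (p : family N M).
Arguments f : clear implicits.
Arguments p : clear implicits.
Hypothesis M1 : one_connected M.
Hypothesis fc : coll_map f.
Hypothesis pm : operad_map p.
Hypothesis pf : forall T e, p T (io T e) = f T e.
Notation GenX X := (@Gen K O fl E io M f X).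
Notation GenM := (Gen io f).
(** Together with [Mspan]: each component of [M] is a line spanned by the value of any composite.
    The terminal operad and the exterior operad of edges are both of this kind. *)
Hypothesis Mnz : forall X x m, GenX X x m -> m <> 0.
Hypothesis Mspan : forall X x m (m' : M X), GenX X x m -> exists k, m' = k *: m.
Let Mo : is_operad M. Proof. by case: M1. Qed.

Definition quad_rel T (x : N T) : Prop := @weight K O E N io 2 T x /\ p T x = 0.

Section Ideal.
Variable I : forall T, N T -> Prop.
Hypothesis Ii : ideal I.
Hypothesis IR : forall T x, quad_rel x -> @I T x.

Let I0 T : @I T 0. Proof. by have [s _] := Ii; apply: sub_0 s T. Qed.
Let Il T a (x y : N T) : I x -> I y -> I (a *: x + y).
Proof. by have [s _] := Ii; apply: (sub_lin s). Qed.

(** The same scalar relates the values in [M] and, modulo [I], the elements of the free operad. If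
    any two composites are related, then [I] contains the whole kernel. *)
Definition related X (x : N X) (m : M X) (x' : N X) (m' : M X) : Prop := exists k, m' = k *: m /\ I (x' - k *: x).

Lemma related_trans X (x1 x2 x3 : N X) (m1 m2 m3 : M X) :
 related x1 m1 x2 m2 -> related x2 m2 x3 m3 -> related x1 m1 x3 m3.
Proof.
move=> [k [-> h]] [k' [-> h']]; exists (k' * k); rewrite scalerA; split=> //.
have -> : x3 - (k' * k) *: x1 = k' *: (x2 - k *: x1) + (x3 - k' *: x2).
 by rewrite scalerBr scalerA [RHS]addrC addrA subrK.
exact: Il.
Qed.

Lemma related_eq X (x x' : N X) (m m' : M X) A : GenM x m -> GenM x' m' -> bs x A -> bs x' A -> related x m x' m'.
Proof.
move=> G G' xA xA'; have [k [-> ->]] := Gen_fun flo ft Ec ioc inj top M1 fc G G' xA xA'.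
by exists k; rewrite subrr.
Qed.

Definition has X (x : N X) (q : {set 'I_(nh X)}) := exists2 A, bs x A & q \in tubes A.
Definition is2 X (q : {set 'I_(nh X)}) := tube q /\ #|q| = 2%N.

Lemma full2 X h : h \in full X -> is2 [set h; opp X h].
Proof.
move=> hf; have q2 : #|[set h; opp X h]| = 2%N. by move: hf; rewrite inE eq_sym cards2 => ->.
split=> //; apply: pair_tube => //.
- exact: objO.
- by apply/subsetP => k; rewrite in_set2 => /orP[] /eqP -> //; apply: full_closed (objO X) _ hf.
- by move=> k; rewrite !in_set2 => /orP[] /eqP ->; rewrite ?(oppK (objO X)) ?eqxx ?orbT.
Qed.

Lemma is2_sub X (q q' : {set 'I_(nh X)}) : is2 q -> tube q' -> q' \subset q -> q' = q.
Proof.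
move=> [tq q2] /tubeP[q'0 _ q'o _] s; apply/eqP; rewrite eqEsubset s /=.
have /tubeP[_ qf qo _] := tq; apply: two_closed (objO X) qf qo q2 q'o _.
have [h hq'] := set0Pn _ q'0; apply/pred0Pn; exists h.
by rewrite /= hq' andbT (subsetP s).
Qed.

Lemma nedge_elem X T S F (a : arr X T) (t : arr T S) i : iso a -> elementary t i F ->
 nedge X = (nedge S + nedge F)%N.
Proof.
move=> ai te; have [_ [iv [ih J]] _ _] := te; rewrite (nedge_iso ai).
have := nedge_sum (objO T) (objO S) (arr0 t); rewrite -(ih_full te J).
rewrite card_imset ?(card_full (objO F)); last exact: ih_inj J.
by rewrite -mulnDl => /eqP; rewrite eqn_pmul2r // => /eqP.
Qed.

Lemma Gen_join X T S F (a : arr X T) (t : arr T S) i iv ih y n B w o C : iso a ->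
 elementary t i F -> @fiber_incl T S t i F iv ih -> GenX S y n -> bs y B -> GenX F w o -> bs w C ->
 [/\ GenM (pact a (circ t y w)) (pact a (circ t n o)),
  forall q, q \in tubes B -> has (pact a (circ t y w)) (lift a (lift t q)) &
  forall q, q \in tubes C -> has (pact a (circ t y w)) (lift a (ih @: q))].
Proof.
move=> ai te J Gy yB Gw wC.
have zA := bs_act ai (bs_circ ft te J yB wC).
have [_ tU] := symU (smap t @: B) (imap ih @: C).
split; first exact: Gen_act ai (Gen_circ te Gy Gw).
- move=> q qB; exists (smap a @: (smap t @: B :|: imap ih @: C)) => //.
 by rewrite tubes_smap imset_f // tU tubes_smap in_setU imset_f.
- move=> q qC; exists (smap a @: (smap t @: B :|: imap ih @: C)) => //.
 by rewrite tubes_smap imset_f // tU tubes_imap in_setU (imset_f (himg ih)) ?orbT.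
Qed.

Lemma unit_neq0 T : nedge T = 1%N -> unit co T <> 0.
Proof.
move=> T1 u0; have := c_unit co T1; rewrite u0 (lin0 (@co_lin _ _ _ _ _ co T)).
by move/esym/eqP; rewrite oner_eq0.
Qed.

(** The edge is contracted and a generator on it is composed with any composite of the quotient.
    Existence on smaller graphs is a hypothesis, so that the lemma can serve in the induction of
    [Gen_any]. *)
Lemma Gen_edge_aux X (q : {set 'I_(nh X)}) : is2 q -> (forall S, (nedge S < nedge X)%N -> exists x m, GenX S x m) ->
 exists x m, GenX X x m /\ has x q.
Proof.
move=> [tq q2] IH; have [qE|qf] := eqVneq q (full X).
 have X1 : nedge X = 1%N by have := card_full (objO X); rewrite -qE q2; lia.
 exists (io X (unit co X)), (f X (unit co X)); split; first by apply: Gen_gen; apply: unit_neq0.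
 by exists (topS fl X); [exact: top (unit_neq0 X1)|rewrite tubes_top qE set11].
have [T [S [F [a [t [i [ai te nE]]]]]]] := contr_ex tq.
have [_ [iv [ih J]] F0 _] := te; have nX := nedge_elem ai te.
have [|y [n Gy]] := IH S; first by rewrite nX -[X in (X < _)%N]addn0 ltn_add2l.
have F1 : nedge F = 1%N. have := card_full (objO F); rewrite -(card_imset _ (ih_inj J)) (ih_full te J).
 have : #|psi a @: nz t| = 2%N by rewrite -(nz_iso_comp _ ai) nE.
 by rewrite card_imset; [move=> ->; lia|exact: psi_inj (arr0 a)].
have [B yB] := Gen_bs ft top Gy; have u0 := unit_neq0 F1.
have [G _ h] := Gen_join ai te J Gy yB (Gen_gen io f u0) (top u0).
exists (pact a (circ t y (io F (unit co F)))), (pact a (circ t n (f F (unit co F)))); split=> //.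
have := h (full F); rewrite tubes_top set11 => /(_ isT).
by rewrite (ih_full te J) (lift_iso ai) -(nz_iso_comp _ ai) nE.
Qed.

Lemma Gen_any X : exists x m, GenX X x m.
Proof.
move: {2}(nedge X).+1 (ltnSn (nedge X)) => k; elim: k => // k IH in X *; rewrite ltnS => Xk.
have [X0|[h hf]] := set_0Vmem (full X). have Xl := full_lt X0; have [U [b [Ut _ _]]] := terminal_ex X.
 by exists (pact b (eta N U)), (pact b (eta M U)); apply: Gen_act (iso_lt b Xl) (Gen_eta io f Ut).
have [|x [m [G _]]] := @Gen_edge_aux X _ (full2 hf); last by exists x, m.
by move=> S Sk; apply: IH; apply: leq_trans Xk.
Qed.

Lemma Gen_edge X (q : {set 'I_(nh X)}) : is2 q -> exists x m, GenX X x m /\ has x q.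
Proof. by move=> q2; apply: Gen_edge_aux => // S _; apply: Gen_any. Qed.

Lemma has_minT X (A : {set sym X}) q : valid fl A -> q \in tubes A -> is2 q -> (1 < nedge X)%N -> minT A q.
Proof.
move=> vA qA q2 X1; have tA q' : q' \in tubes A -> tube q'.
 by move=> q'A; move: vA => /andP[_]; rewrite ft => /andP[/nestP[t _ _] _]; apply: t.
split=> //. apply: contraTneq X1 => qE; have [_ c2] := q2; have := card_full (objO X). by rewrite -qE c2; lia.
move=> q' q'A; apply/negP => pr; have := is2_sub q2 (tA _ q'A) (proper_sub pr) => E'.
by rewrite E' properxx in pr.
Qed.

Lemma min_is2 X (A : {set sym X}) q : valid fl A -> minT A q -> is2 q.
Proof.
move=> vA [qA qf qm]; move: vA; rewrite /valid ft mx => /and3P[_ /nestP[t _ _] /forall_inP m].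
have rq : resid (tubes A) q = q. by rewrite /resid big1 ?setD0 // => q' /andP[/qm/negP].
have tq := t _ qA; split=> //.
have /existsP[h /eqP] := m _ qA; rewrite rq => qE; rewrite qE.
have /tubeP[_ qs _ _] := tq; have : h \in full X by apply: (subsetP qs); rewrite qE set21.
by rewrite inE eq_sym cards2 => ->.
Qed.

Lemma weight_Gen X x m : GenX X x m -> @weight K O E N io (nedge X) X x.
Proof.
elim=> {X x m}.
- move=> U Ut; have -> : nedge U = 0%N by apply/(nedge_eq0 (objO U))/loc_full; case: Ut. exact: weight_eta.
- move=> X e e0; have [_ ->] := co_neq0 co e0; exact: weight_gen.
- move=> X a x m a0 _ w; rewrite -[_ *: _]addr0; apply: weight_lin w _; exact: weight_0.
- by move=> X Y h x m hi _ w; rewrite (nedge_iso hi); apply: weight_act.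
- move=> X S F t i x m y n te _ wx _ wy. have [e eE] := id_arr X; have ei : iso e by exists e; rewrite eE gcompf1.
 by rewrite (nedge_elem ei te); apply: weight_circ te wx wy.
Qed.

Lemma pGen X x m : GenX X x m -> p X x = m.
Proof. exact: omap_gen pm pf X x m. Qed.

(** With two edges the difference of two composites with matched values has weight two and lies in
    the kernel, so it is itself a relation. *)
Lemma related_two X x m x' m' : nedge X = 2%N -> GenX X x m -> GenM x' m' -> related x m x' m'.
Proof.
move=> X2 G G'; have [k mE] := Mspan m' G; exists k; split=> //; apply: IR; split.
 rewrite addrC -scaleNr -X2; apply: weight_lin; [exact: weight_Gen G|exact: weight_Gen G'].
have pl := pmap_lin pm (T := X).
by rewrite (linD pl) (linN pl) (linZ pl) (pGen G) (pGen G') mE subrr.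
Qed.

Lemma join_diff (L : operad K O) X T S F (a : arr X T) (t : arr T S) i (y y' : L S) (w w' : L F)
  k k' : is_operad L -> iso a -> elementary t i F -> pact a (circ t y' w') - (k * k') *: pact a (circ t y w) =
 pact a (circ t (y' - k *: y) w') + k *: pact a (circ t y (w' - k' *: w)) :> L X.
Proof.
move=> Lo ai te; rewrite -!(pactZ _ _ Lo ai) -(linN (pact_lin (op_presheaf Lo) ai)).
rewrite -!(linD (pact_lin (op_presheaf Lo) ai)); congr (pact a _).
rewrite [y' - _]addrC -[- (k *: y)]scaleNr (circ_linl _ _ _ _ Lo te).
rewrite [w' - _]addrC -[- (k' *: w)]scaleNr (circ_linr _ _ _ _ Lo te).
move: (circ t y' w' : L T) (circ t y w' : L T) (circ t y w : L T) => b' a' e'.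
by rewrite scalerDr scalerA mulrN !scaleNr [- _ + b']addrC [- _ + k *: a']addrC addrA subrK.
Qed.

Lemma related_join X T S F (a : arr X T) (t : arr T S) i (y : N S) (n : M S) (y' : N S) (n' : M S)
  (w : N F) (o : M F) (w' : N F) (o' : M F) : iso a -> elementary t i F -> related y n y' n' -> related w o w' o' ->
 @related X (pact a (circ t y w)) (pact a (circ t n o)) (pact a (circ t y' w')) (pact a (circ t n' o')).
Proof.
move=> ai te [k [-> h]] [k' [-> h']]; exists (k * k').
rewrite (circZl _ _ _ Mo te) (linZ (op_linr Mo te _)) scalerA (pactZ _ _ Mo ai); split=> //.
have [s ci] := Ii.
rewrite (join_diff _ _ _ _ _ _ No ai te) -[pact a (circ t (_ - _) _)]scale1r.
apply: Il. by apply: (sub_act s ai); apply: (ci _ _ _ _ _ te); left.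
rewrite -[_ *: _]addr0; apply: Il; last exact: I0.
by apply: (sub_act s ai); apply: (ci _ _ _ _ _ te); right.
Qed.

(** An edge that is a tube of both composites can be split off innermost from both along one
    contraction; the outer factors live on a smaller graph. *)
Lemma related_edge X x m x' m' q : (1 < nedge X)%N ->
 (forall S, (nedge S < nedge X)%N -> forall y n y' n', GenX S y n -> GenM y' n' -> related y n y' n') ->
 is2 q -> GenX X x m -> GenM x' m' -> has x q -> has x' q -> related x m x' m'.
Proof.
move=> X1 IH q2 G G' [A xA qA] [A' xA' qA'].
have mq := has_minT (bs_valid xA) qA q2 X1; have mq' := has_minT (bs_valid xA') qA' q2 X1.
have [T [S [F [a [t [i [ai te nE [y [n [e [Gy e0 -> ->]]]]]]]]]]] := Gen_dec flo ft Ec ioc inj top M1 fc G xA mq.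
have [T' [S' [F' [a' [t' [i' [ai' te' nE' D]]]]]]] := Gen_dec flo ft Ec ioc inj top M1 fc G' xA' mq'.
have [y' [n' [e' [Gy' e0' -> ->]]]] : dec io f x' m' F a t.
 by apply: (dec_transfer flo Ec ioc M1 fc ai' ai te' te _ D); rewrite nE nE'.
have Sk : (nedge S < nedge X)%N.
 have [_ _ F0 _] := te; by rewrite (nedge_elem ai te) -[X in (X < _)%N]addn0 ltn_add2l.
apply: (related_join ai te (IH S Sk _ _ _ _ Gy Gy')).
exact: related_eq (Gen_gen io f e0) (Gen_gen io f e0') (top e0) (top e0').
Qed.

Lemma iso_tube X T (a : arr X T) q : iso a -> tube q -> exists2 q', tube q' & q = lift a q'.
Proof.
move=> ai tq; have [b [bi ba ab]] := iso_inv ai; exists (lift b q); first exact: tube_lift.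
by rewrite -(lift_comp _ (esym ba)) lift_gid.
Qed.

Lemma card_lift_iso X T (a : arr X T) (q : {set 'I_(nh T)}) : iso a -> #|lift a q| = #|q|.
Proof. by move=> ai; rewrite (lift_iso ai) card_imset //; apply: psi_inj (arr0 a). Qed.

(** Induction on the number of edges. An innermost edge is chosen in each composite, and
    intermediate composites are built so that consecutive ones share an innermost edge or differ by
    a quadratic relation. *)
Lemma related_all X x m x' m' : GenX X x m -> GenM x' m' -> related x m x' m'.
Proof.
move: {2}(nedge X).+1 (ltnSn (nedge X)) => k; elim: k => // k IH in X x m x' m' *.
rewrite ltnS => Xk G G'.
have IH' S : (nedge S < nedge X)%N -> forall y n y' n', GenX S y n -> GenM y' n' -> related y n y' n'.
 by move=> Sk y n y' n'; apply: IH; apply: leq_trans Xk.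
have [A xA] := Gen_bs ft top G; have [A' xA'] := Gen_bs ft top G'.
have vA := bs_valid xA; have vA' := bs_valid xA'.
have [X0|X0] := eqVneq (full X) set0.
 apply: related_eq G G' xA _; move: vA vA'; rewrite !valid_lt // => /eqP -> /eqP E'. by rewrite -E'.
have topA (B : {set sym X}) : valid fl B -> tubes B \subset [set full X] -> nedge X = 1%N.
 move=> vB s; have BE := valid_top ft vB X0 s; move: vB; rewrite /valid ft mx BE tubes_top.
 move=> /and3P[_ _ /forall_inP /(_ (full X) (set11 _)) /existsP[h /eqP]].
 rewrite /resid big1 ?setD0 => [hE|q' /andP[]]; last by rewrite in_set1 => /eqP ->; rewrite properxx.
 have hf : h \in full X by rewrite hE set21.
 by have [_ c2] := full2 hf; have := card_full (objO X); rewrite {1}hE c2; lia.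
have [X1|X1] := leqP (nedge X) 1. have one (B : {set sym X}) : valid fl B -> B = topS fl X.
  move=> vB; apply: valid_top => //; have [//|[q mq]] := state_cases ft vB.
  have [tq q2] := min_is2 vB mq; have [_ qf _] := mq; have /tubeP[_ qs _ _] := tq.
  case/negP: qf; rewrite eqEcard qs q2 (card_full (objO X)); lia.
 by apply: related_eq G G' xA _; rewrite (one _ vA) -(one _ vA').
have [q mq] : exists q, minT A q. by have [/(topA _ vA) E1|//] := state_cases ft vA; rewrite E1 in X1.
have [q' mq'] : exists q, minT A' q. by have [/(topA _ vA') E1|//] := state_cases ft vA'; rewrite E1 in X1.
have q2 := min_is2 vA mq; have q2' := min_is2 vA' mq'.
have xq : has x q by exists A => //; case: mq.
have xq' : has x' q' by exists A' => //; case: mq'.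
have edge := related_edge X1 IH'.
have [X2|X2] := eqVneq (nedge X) 2%N; first exact: related_two X2 G G'.
have [tq c2] := q2; have [tq' c2'] := q2'.
have /tubeP[q0 qs qo qc] := tq; have /tubeP[q0' qs' qo' qc'] := tq'.
have [qq|qq] := eqVneq q q'; first by apply: edge q2 G G' xq _; rewrite qq.
(* Edges without a common vertex: contract [q] and take a composite of the quotient having the image
   of [q'] as a tube. Composed with the fiber it has both [q] and [q'] as tubes and so joins [x] to
   [x']. *)
have [dis|ndis] := boolP [disjoint vtx X @: q & vtx X @: q'].
 have [T [S [F [a [t [i [ai te nE]]]]]]] := contr_ex tq. have [_ [iv [ih J]] F0 _] := te.
 have [qT tqT qTE] := iso_tube ai tq'. have qE : q = lift a (nz t) by rewrite -nE (nz_iso_comp _ ai) (lift_iso ai).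
 have dT : [disjoint vtx T @: nz t & vtx T @: qT]. by rewrite -(lift_disjoint a) -qE -qTE.
 have cT : compat qT (nz t) by rewrite compat_sym /compat dT !orbT.
 have [[qF [_ qFs qFE]]|[qS tqS qSE]] := tube_cases te J tqT cT.
  have [h hq] : exists h, h \in qT by apply/set0Pn; case/tubeP: tqT.
  have hn : h \in nz t by rewrite -(ih_full te J); move: h hq; apply/subsetP; rewrite qFE imsetS.
  have := disjoint_setI0 dT => /setP /(_ (vtx T h)); rewrite in_setI !imset_f // in_set0. by [].
 have iq : i \notin vtx S @: qS. apply/negP => iq; have sub := nz_sub_lift te iq; rewrite -qSE in sub.
  have [h hn] : exists h, h \in nz t by apply/set0Pn; apply: circ_nz te.
  have := disjoint_setI0 dT => /setP /(_ (vtx T h)); rewrite in_setI !imset_f ?in_set0 //. exact: (subsetP sub).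
 have qS2 : is2 qS. split=> //; rewrite -c2' qTE (card_lift_iso _ ai) qSE (lift_notouch te iq).
  by rewrite card_imset //; apply: psi_inj (arr0 t). have [y [n [Gy [B yB qB]]]] := Gen_edge qS2.
 have [w [o [Gw [C wC fC]]]] : exists w o, GenM w o /\ exists2 C, bs w C & full F \in tubes C.
  have [w [o Gw]] := Gen_any F; have [C wC] := Gen_bs ft top Gw. exists w, o; split=> //; exists C => //.
  have := bs_valid wC; rewrite /valid ft => /and3P[_ /nestP[_ _ h] _]. exact: h (full_F te).
 have [Gz h1 h2] := Gen_join ai te J Gy yB Gw wC.
 have zq : has (pact a (circ t y w)) q by have := h2 _ fC; rewrite (ih_full te J) -qE.
 have zq' : has (pact a (circ t y w)) q' by have := h1 _ qB; rewrite -qSE -qTE.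
 exact: related_trans (edge _ _ _ _ _ q2 G Gz xq zq) (edge _ _ _ _ _ q2' Gz G' zq' xq').
(* Edges with a common vertex: their union is a tube whose fiber has two edges. Two composites that
   agree outside this fiber contain [q] and [q'] respectively, and [related_two] relates them inside
   it. *)
pose Q := q :|: q'.
have Qo : opclosed (opp X) Q. by move=> h; rewrite !in_setU => /orP[/qo|/qo'] ->; rewrite ?orbT.
have tQ : tube Q. have [v /andP[/imsetP[h hq vh] /imsetP[h' hq' vh']]] := pred0Pn ndis.
 have cQ b : b \in Q -> connect (eadj X Q) v (vtx X b). rewrite in_setU => /orP[bq|bq].
   by rewrite vh; apply: sub_erel (qc _ _ hq bq); apply: subsetUl.
  by rewrite vh'; apply: sub_erel (qc' _ _ hq' bq); apply: subsetUr. apply/tubeP; split=> //.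
 - by apply/set0Pn; exists h; rewrite in_setU hq.
 - by rewrite subUset qs.
 - move=> b b' bQ b'Q; apply: connect_trans (cQ b' b'Q).
  by rewrite (erel_sym (vtx X) (oppK (objO X)) Qo); apply: cQ.
have dq : [disjoint q & q']. apply/negPn/negP => nd; case/negP: qq. have s := two_closed (objO X) qs qo c2 qo' nd.
 by rewrite eqEcard s c2 c2'.
have Q4 : #|Q| = 4%N by rewrite cardsU disjoint_setI0 // cards0 c2 c2'.
have [T [S [F [a [t [i [ai te nE]]]]]]] := contr_ex tQ.
have [_ [iv [ih J]] F0 _] := te.
have QE : Q = lift a (nz t) by rewrite -nE (nz_iso_comp _ ai) (lift_iso ai).
have F2 : nedge F = 2%N. have := card_full (objO F); rewrite -(card_imset _ (ih_inj J)) (ih_full te J).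
 have := card_lift_iso (nz t) ai; rewrite -QE Q4 => <- e4; apply/eqP. by rewrite -(eqn_pmul2r (m := 2)) // -e4.
have onF r : is2 r -> r \subset Q -> exists2 rF : {set 'I_(nh F)}, is2 rF & r = lift a (ih @: rF).
 move=> [tr r2] rQ; have [rT trT rTE] := iso_tube ai tr.
 have rn : rT \subset nz t by rewrite -(lift_sub a) -rTE -QE. have cT : compat rT (nz t) by rewrite /compat rn.
 have [[rF [trF _ rFE]]|[rS trS rSE]] := tube_cases te J trT cT; last first.
  have := @lift_not_nz _ _ _ t rS; rewrite -rSE rn => /(_ _)/negP. by case; case/tubeP: trS.
 exists rF; last by rewrite -rFE.
 split=> //; rewrite -r2 rTE (card_lift_iso _ ai) rFE card_imset //; exact: ih_inj J.
have [qF qF2 qE] := onF q q2 (subsetUl _ _); have [qF' qF2' qE'] := onF q' q2' (subsetUr _ _).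
have [y [n Gy]] := Gen_any S; have [B yB] := Gen_bs ft top Gy.
have [w [o [Gw [C wC qC]]]] := Gen_edge qF2.
have [w' [o' [Gw' [C' wC' qC']]]] := Gen_edge qF2'.
have [Gz _ h1] := Gen_join ai te J Gy yB Gw wC.
have [Gz' _ h2] := Gen_join ai te J Gy yB Gw' wC'.
have zq := h1 _ qC; have zq' := h2 _ qC'; rewrite -qE in zq; rewrite -qE' in zq'.
apply: related_trans (edge _ _ _ _ _ q2 G Gz xq zq) _.
apply: related_trans _ (edge _ _ _ _ _ q2' Gz' G' zq' xq').
apply: related_join ai te (related_eq Gy Gy yB yB) _.
exact: related_two F2 Gw Gw'.
Qed.

(** Modulo [I] every element is a multiple of one composite [x] with the same factor as in [M]; as
    the value of [x] is nonzero, an element of the kernel has factor 0. *)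
Lemma kernel_ideal X (z : N X) : p X z = 0 -> I z.
Proof.
have [x [m G]] := Gen_any X; have m0 := Mnz G.
have pl := pmap_lin pm (T := X).
have [k [h e]] : exists k, I (z - k *: x) /\ p X z = k *: m.
 move: z; apply: (Mod_ind (P := fun z => exists k, I (z - k *: x) /\ p X z = k *: m)).
 - by exists 0; rewrite !scale0r subr0 (lin0 pl).
 - move=> a u v [k [hu pu]] [k' [hv pv]]; exists (a * k + k'). split; last by rewrite pl pu pv scalerDl -scalerA.
  have -> : a *: u + v - (a * k + k') *: x = a *: (u - k *: x) + (v - k' *: x).
   by rewrite scalerBr scalerA scalerDl opprD addrACA. exact: Il.
 - move=> y A yA; have [y' yA' Gy'] := Gen_total flo ft top ex (bs_valid yA).
  have [n Gn] := Gy' M f M1 fc; have [b b0 ->] := bs_prop yA' yA.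
  have Gy := Gen_scale b0 Gn; have [k [e h]] := related_all G Gy. by exists k; split=> //; rewrite -e (pGen Gy).
rewrite e => /eqP; rewrite scaler_eq0 => /orP[/eqP k0|/eqP//].
by move: h; rewrite k0 scale0r subr0.
Qed.
End Ideal.

Lemma kernel_is_ideal : ideal (fun T x => p T x = 0).
Proof.
have pp : presheaf_map 0 p by case: pm.
split; first split.
- by move=> T; apply/lin0/(pmap_lin pp).
- by move=> T a x y px py; rewrite (pmap_lin pp) px py scaler0 addr0.
- move=> T n x px; rewrite (gproj_map (pmap_lin pp (T := T))). by rewrite px; apply/lin0/gproj_lin.
 exact: pmap_deg pp T.
- by move=> T S g gi x px; rewrite (pmap_act pp gi) px; apply/lin0/(pact_lin (op_presheaf Mo) gi).
- move=> T S g i F ge x y [px|py]; rewrite (omap_circ pm ge). by rewrite px; apply/(lin0 (op_linl Mo ge _)).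
 by rewrite py; apply/(lin0 (op_linr Mo ge _)).
Qed.

Lemma quad_sub : sub_presheaf quad_rel.
Proof.
have [[k0 kl kp ka] _] := kernel_is_ideal.
split.
- by move=> T; split; [apply: weight_0|apply: k0].
- by move=> T a x y [wx px] [wy py]; split; [apply: weight_lin|apply: kl].
(* Degree projections are not among the constructors of [weight], but they preserve the number of
   tubes, and an element with two tubes is decomposable by [decomposes_ex]. *)
- move=> T n x [wx px]; split; last exact: kp.
 have [m [r rr]] := reps_ex T; have s := weight_supp co ul le lt ld ft wx.
 have s' : supp (fun A : {set sym T} => #|tubes A| = 2%N) (emb (gproj n x)).
  by move=> A; rewrite emb_gproj ffunE; case: ifP => _; [apply: s|rewrite eqxx].
 have [t dt] := decomposes_ex co ul le lt ld mx ft flo rr s'. exact: decomposes_weight dt.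
- by move=> T S g gi x [wx px]; split; [apply: weight_act|apply: ka].
Qed.

Lemma quad_quotient : is_quotient (gen_ideal quad_rel) p.
Proof.
split=> //. move=> T y; have [x [m G]] := Gen_any T; have [k ->] := Mspan y G.
 by exists (k *: x); rewrite (linZ (pmap_lin pm (T := T))) (pGen G).
move=> T x; split=> [px I Ii IR|]; first exact: kernel_ideal Ii IR _ _ px.
move=> h; apply: (h (fun T x => p T x = 0)) => [|S y [_ py]]; [exact: kernel_is_ideal|exact: py].
Qed.

Lemma quad_quadratic : quadratic io quad_rel p.
Proof.
split.
- by split; [exact: Ec|exact: (geni_free co ul le lt ld mx ft flo Ec)].
- exact: quad_sub.
- by move=> T x [].
- exact: M1.
- exact: quad_quotient.
Qed.
End Kernel.

(** * The Koszul dual *)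

(** [fF] gives the free operad on [one_edge], an edge and a tube of opposite degrees forming a
    generator of degree 0; [fN] gives the free operad on the suspended dual, with generators of
    degree 1; [fM] gives the exterior operad of edges. *)
Definition fF := Flags true true true (-1).
Definition fN := Flags false true true 1.
Definition fM := Flags true false false 1.

Section Dual.
Variables (K : fieldType) (O : opcat).
Implicit Types (T S F G H X U : obj O).

Notation E := (one_edge K O).
Notation E' := (sdual (one_edge K O)).
Definition ct T (x : one_edge K O T) : K := tot (x : 'rV_(nedge T == 1%N)).
Lemma ct_coord : coord ct 0. Proof. exact: one_edge_coord. Qed.
Notation cd := (@dual_coord K O).
Let cdc := @sdual_coord K O.
Notation MF := (Mod K fF O).
Notation MN := (Mod K fN O).
Notation MM := (Mod K fM O).
Definition io := geni ct fF [:: false; true].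
Definition io' := geni cd fN [:: true].
Definition f' := geni cd fM [:: false].
Notation f := (@one_edge_incl K O).
Notation Te := (terminal_operad K O).

Lemma io_free : is_free io.
Proof. by apply: (geni_free ct_coord) => //; [right|apply: one_edge_coll]. Qed.

Lemma io'_free : is_free io'.
Proof. by apply: (geni_free cdc) => //; [left|apply: sdual_coll]. Qed.

Lemma f'_coll : coll_map f'. Proof. by apply: (geni_coll cdc). Qed.
Lemma MM_one : one_connected MM. Proof. by apply: Mod_one; left. Qed.

Lemma f_coll : coll_map f.
Proof.
split; first split.
- by move=> T; apply: (@tot_lin K (nedge T == 1%N)).
- move=> T n x; rewrite addr0 /homog /= /deg0_proj; case: (n == 0) => // <-.
 by apply/esym/(lin0 (@tot_lin K (nedge T == 1%N))).
- by move=> T S g gi x; exact: (one_edge_tot x gi).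
- by move=> T F _ lt x y xy; exists erefl; apply: (co_same ct_coord lt xy).
Qed.

(** ** The exterior operad of edges *)

Definition eM (T : graph) : {set sym T} := [set s | ~~ s.1 && (s.2 \in eset T)].

Lemma eM_edges (T : graph) : edges (eM T) = eset T.
Proof. by apply/setP => e; rewrite !inE. Qed.
Lemma eM_tubes (T : graph) : tubes (eM T) = set0.
Proof. by apply/setP => e; rewrite !inE. Qed.

Lemma validM (T : graph) (A : {set sym T}) : valid fM A = (A == eM T).
Proof.
apply/idP/eqP => [/andP[/eqP eA /eqP tA]|->]. by apply: sym_eq; rewrite ?eM_edges ?eM_tubes.
by rewrite /valid eM_edges eM_tubes !eqxx.
Qed.

Lemma MM_bas T (m : MM T) : exists k, emb m = k *: delta K (eM T).
Proof.
exists (emb m (eM T)); rewrite {1}[emb m]ext_delta (bigD1 (eM T)) //= big1 ?addr0 // => A AA.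
suff -> : emb m A = 0 by rewrite scale0r.
by apply/eqP; apply: contraNT AA => /emb_supp; rewrite validM.
Qed.

Lemma eM_join T S (g : arr T S) i F iv ih : elementary g i F -> @fiber_incl T S g i F iv ih ->
 [disjoint smap g @: eM S & imap ih @: eM F] /\ smap g @: eM S :|: imap ih @: eM F = eM T.
Proof.
move=> ge I; split; last first. apply/eqP; rewrite -validM.
 by have [] := valid_join (fl := fM) ge I (A := eM S) (B := eM F); rewrite ?validM.
apply/pred0P => s /=; apply/negbTE/negP => /andP[/imsetP[[b q] + ->] /imsetP[[b' q']]].
rewrite !inE /= => /andP[/negbTE -> qS] /andP[/negbTE -> qF] [] e.
have := eset_disjoint I => /pred0P /(_ (psi g @: q)) /negP; apply.
by rewrite /= (imset_f (himg (psi g))) //= e (imset_f (himg ih)).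
Qed.

Lemma eM_iso T S (g : arr T S) : iso g -> smap g @: eM S = eM T.
Proof.
move=> gi; apply/eqP; rewrite -validM.
by have [] := valid_iso (fl := fM) gi (A := eM S); rewrite ?validM.
Qed.

Lemma bas_circM T S (g : arr T S) i F (x : MM S) (y : MM F) : elementary g i F ->
 bas (eM S) (emb x) -> bas (eM F) (emb y) -> bas (eM T) (emb (circ g x y : MM T)).
Proof.
move=> ge bx by_; have [_ [iv [ih I]] _ _] := ge; rewrite (emb_circ _ _ ge I).
have [d <-] := eM_join ge I; apply: bas_wedge d _ _. by apply: bas_emap bx => s s' _ _; apply: smap_inj.
by apply: bas_emap by_ => s s' _ _; apply/imap_inj/(ih_inj I).
Qed.

Lemma bas_actM T S (g : arr T S) (x : MM S) : iso g -> bas (eM S) (emb x) -> bas (eM T) (emb (pact g x : MM T)).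
Proof.
move=> gi bx; rewrite (emb_act _ gi) -(eM_iso gi).
by apply: bas_emap bx => s s' _ _; apply: smap_inj.
Qed.

Lemma genM_bas X x m : @Gen K O fN E' io' MM f' X x m -> bas (eM X) (emb m).
Proof.
elim=> {X x m}.
- move=> U [Ul _]; have -> : eM U = set0.
  by apply/setP => -[b q]; rewrite !inE /= /eset (loc_full Ul) imset0 inE andbF.
 by rewrite (emb_eta _ _ Ul); apply: bas_delta.
- move=> X e e0; have [c0 X1] := co_neq0 cdc e0. rewrite (emb_geni cdc) //; apply: basZ => //.
 have [|||A [bA vA _ _]] := @mtop_bas K O fM [:: false] X _ _ _ X1 => //. by move: vA; rewrite validM => /eqP <-.
- by move=> X a x m a0 _ b; rewrite (linZ embl); apply: basZ.
- by move=> X Y h x m hi _ b; apply: bas_actM.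
- by move=> X S F t i x m y n te _ b _ b'; apply: bas_circM te b b'.
Qed.

Lemma genM_nz X x m : @Gen K O fN E' io' MM f' X x m -> m <> 0.
Proof.
by move=> /genM_bas /bas_neq0 /eqP b m0; apply: b; rewrite m0 (lin0 embl).
Qed.

Lemma genM_span X x m (m' : MM X) : @Gen K O fN E' io' MM f' X x m -> exists k, m' = k *: m.
Proof.
move=> /genM_bas[a a0 mE]; have [b m'E] := MM_bas m'; exists (b / a).
by apply: emb_inj; rewrite (linZ embl) mE m'E scalerA divfK.
Qed.

Lemma genT_nz X x m : @Gen K O fF E io Te f X x m -> m <> 0.
Proof.
elim=> {X x m}.
- by move=> U _ /eqP; rewrite oner_eq0.
- by move=> X e e0 h; apply: e0; apply: (co_inj ct_coord); rewrite (lin0 (@co_lin _ _ _ _ _ ct_coord X)); exact: h.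
- by move=> X a x m a0 _ m0 /eqP; rewrite scaler_eq0 (negbTE a0) => /eqP.
- by [].
- move=> X S F t i x m y n te _ m0 _ n0 /eqP; rewrite mulf_eq0 => /orP[] /eqP //.
Qed.

Lemma genT_span X x m (m' : Te X) : @Gen K O fF E io Te f X x m -> exists k, m' = k *: m.
Proof.
by move=> /genT_nz/eqP m0; exists (m' / m); apply/esym; apply: (divfK m0).
Qed.

(** ** Orthogonality *)

Definition mw X (r : pipair X) : MM X :=
 pact (pil r) (circ (pit r) (f' (unit cdc (piS r))) (f' (unit cdc (piF r)))).

Lemma mw_good X (r : pipair X) : good r -> emb (mw r) = mon K [:: (false, full X :\: pp r); (false, pp r)].
Proof.
move=> /andP[/eqP S1 /eqP F1]; have li := pil_iso r; have te := pit_elem r.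
have [_ [iv [ih I]] _ _] := te.
rewrite (emb_act _ li) (emb_circ _ _ te I) !(emb_geni cdc) // !c_unit // !scale1r /mtop.
rewrite !emap_mon wedge_mon2 emap_mon /= /smap /imap /=; congr (mon K [:: (_, _); (_, _)]); last first.
 by rewrite (ih_full te I) -ppE.
rewrite -(full_iso li) ppE -imset_comp; apply/setP => h.
have [k ->] := iso_psi_surj h li; have pi := psi_inj (arr0 (pil r)).
rewrite in_setD !mem_imset //; apply/imsetP/andP => [[s sf /= /pi ->]|[kn kf]]. by rewrite psi_nz full_nz.
have [s sE] := nzPn (pit r) k kn; exists s; last by rewrite /= -sE.
by rewrite -(full_nz (pit r)) -sE.
Qed.

Lemma mw_neq0 X (r : pipair X) : good r -> mw r != 0.
Proof.
move=> g; apply/eqP => w0; have := mw_good g; rewrite w0 (lin0 embl).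
have [|b ->] := @mon_uniq K _ [:: (false, full X :\: pp r); (false, pp r)].
 rewrite /= andbT inE xpair_eqE /=; apply/eqP => e. have [/tubeP[/set0Pn[h hp] _ _ _] _] := pp_tube r.
 by have := hp; rewrite -e inE hp.
by move/esym/eqP; rewrite scaler_eq0 (negbTE (sgn_neq0 _ _)) (negbTE (delta_neq0 _ _)).
Qed.

(** The two contractions of a graph with two edges give the product of the same two odd edges in
    opposite orders. Against the equality of these composites in the terminal operad, this sign is
    the content of the duality. *)
Lemma mw_opp X (r r' : pipair X) : good r -> good r' -> pp r' = full X :\: pp r -> mw r' = - mw r.
Proof.
move=> g g' e; apply: emb_inj; rewrite (linN embl) !mw_good // e.
rewrite setDDr setDv set0U (setIidPr (pp_sub r)).
by rewrite (@mon_swap K _ [:: _] [:: _]) expr1 scaleN1r.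
Qed.

Lemma sum_two (V : nmodType) n (G : 'I_n -> V) i j : i != j -> (forall k, k = i \/ k = j) -> \sum_k G k = G i + G j.
Proof.
move=> ij all; rewrite (bigD1 i) //= (bigD1 j) 1?eq_sym //= big1 ?addr0 // => k /andP[ki kj].
by case: (all k) => e; rewrite e eqxx in ki kj.
Qed.

Section Perp.
Variables (p : family MF Te) (p' : family MN MM).
Arguments p : clear implicits.
Arguments p' : clear implicits.
Hypotheses (pm : operad_map p) (pf : forall T x, p T (io x) = f x).
Hypotheses (pm' : operad_map p') (pf' : forall T x, p' T (io' x) = f' x).

Variables (X : obj O) (n : nat) (r : 'I_n -> pipair X).
Hypothesis rr : representatives r.
Variables (t : forall i, seq (pure (E (piF (r i))) (E (piS (r i)))))
 (t' : forall i, seq (pure (E' (piF (r i))) (E' (piS (r i))))).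
Variables (z : MF X) (z' : MN X).
Hypotheses (dz : @decomposes K O E MF io X n r t z) (dz' : @decomposes K O E' MN io' X n r t' z').

Definition cA i : K := \sum_(q <- t i) ct (vl q) * ct (vr q).
Definition cB i : K := \sum_(q <- t' i) cd (vl q) * cd (vr q).

Lemma sgn_ct T G k (q : pure (E T) (E G)) : sgn K (k * dl q) * ct (vl q) = ct (vl q).
Proof.
have [->|c0] := eqVneq (ct (vl q)) 0; first by rewrite mulr0.
by rewrite (co_deg ct_coord (pure_homl q) c0) mulr0 /sgn expr0z mul1r.
Qed.

Lemma pE : p X z = \sum_i cA i.
Proof.
have pl := pmap_lin pm; rewrite dz (lin_sum (pl X)); apply: eq_bigr => i _.
rewrite (lin_sum (pl X)); apply: eq_bigr => q _.
rewrite (linZ (pl X)) (pmap_act pm (pil_iso (r i))) (omap_circ pm (pit_elem (r i))) !pf.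
change (sgn K (dl q * dr q) * (ct (vr q) * ct (vl q)) = ct (vl q) * ct (vr q)).
by rewrite [dl q * _]mulrC [ct (vr q) * _]mulrC mulrA sgn_ct.
Qed.

Lemma circ_f' i (x : E' (piF (r i))) (y : E' (piS (r i))) :
 pact (pil (r i)) (circ (pit (r i)) (f' y) (f' x)) = (cd x * cd y) *: mw (r i).
Proof.
have fl T : linear (@f' T) by have [q _] := f'_coll; apply: (pmap_lin q).
have Mo : is_operad MM by case: MM_one.
rewrite {1}(unitE cdc x) {1}(unitE cdc y) !(linZ (fl _)).
rewrite (circZl _ _ _ Mo (pit_elem _)) (linZ (op_linr Mo (pit_elem _) _)) scalerA mulrC.
exact: pactZ Mo (pil_iso _).
Qed.

(** The overall sign is the one in [decomposes] for two generators of degree 1. *)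
Lemma pE' : p' X z' = - \sum_i cB i *: mw (r i).
Proof.
have pl := pmap_lin pm'; rewrite dz' (lin_sum (pl X)) -sumrN; apply: eq_bigr => i _.
rewrite (lin_sum (pl X)) /cB scaler_suml -sumrN; apply: eq_bigr => q _.
rewrite (linZ (pl X)) (pmap_act pm' (pil_iso (r i))) (omap_circ pm' (pit_elem (r i))) !pf'.
rewrite circ_f' scalerA -scaleNr; congr (_ *: _).
have [->|c0] := eqVneq (cd (vl q)) 0; first by rewrite !mul0r mulr0 oppr0.
have [->|c1] := eqVneq (cd (vr q)) 0; first by rewrite !mulr0 oppr0.
rewrite (co_deg cdc (pure_homl q) c0) (co_deg cdc (pure_homr q) c1).
by rewrite mulr1 /sgn expr1z mulN1r.
Qed.

Lemma pairE : \sum_i \sum_(q' <- t' i) \sum_(q <- t i)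
  sgn K (dr q' * dl q) * (ev (vl q') (vl q) * ev (vr q') (vr q)) = \sum_i cA i * cB i.
Proof.
apply: eq_bigr => i _; rewrite mulrC /cB mulr_suml; apply: eq_bigr => q' _.
rewrite /cA mulr_sumr; apply: eq_bigr => q _.
rewrite !ev_one -!/(ct _) -[in RHS](sgn_ct (dr q') q); ring.
Qed.

Lemma cA_bad i : ~~ good (r i) -> cA i = 0.
Proof.
rewrite /good negb_and => b; rewrite /cA big1 // => q _.
by case/orP: b => b; [rewrite (co_red ct_coord (vr q) b) mulr0|rewrite (co_red ct_coord (vl q) b) mul0r].
Qed.

Lemma cB_bad i : ~~ good (r i) -> cB i = 0.
Proof.
rewrite /good negb_and => b; rewrite /cB big1 // => q _.
by case/orP: b => b; [rewrite (co_red cdc (vr q) b) mulr0|rewrite (co_red cdc (vl q) b) mul0r].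
Qed.

Lemma z_zero : (forall i, cA i = 0) -> z = 0.
Proof.
move=> A0; rewrite dz big1 // => i _.
transitivity (cA i *: zz ct fF [:: false; true] (unit ct_coord (piS (r i))) (unit ct_coord (piF (r i)))).
 rewrite /cA scaler_suml; apply: eq_bigr => q _.
 rewrite -/(zz ct fF [:: false; true] (vr q) (vl q)) (zzE ct_coord) // ?scalerA; last by right.
 by congr (_ *: _); rewrite [dl q * _]mulrC mulrCA sgn_ct mulrC.
by rewrite A0 scale0r.
Qed.

(** If [i] and [j] are the two good pairs, the first kernel condition reads [cA i + cA j = 0] and
    the second, because of [mw_opp], reads [cB i = cB j]. *)
Lemma orth : p X z = 0 -> p' X z' = 0 -> \sum_i cA i * cB i = 0.
Proof.
rewrite pE pE' => pz /eqP; rewrite oppr_eq0 => /eqP pz'.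
have [/existsP[i gi]|/existsPn ng] := boolP [exists i, good (r i)]; last first.
 by rewrite big1 // => i _; rewrite cA_bad ?mul0r.
have [j [ij gj ppj all]] := good_two rr gi.
move: pz pz'; rewrite !(sum_two _ ij all) (mw_opp gi gj ppj) scalerN -scalerBl => pz /eqP.
rewrite scaler_eq0 (negbTE (mw_neq0 gi)) orbF subr_eq0 => /eqP ->.
by rewrite -mulrDl pz mul0r.
Qed.

Lemma orth_conv : z <> 0 -> p X z = 0 -> \sum_i cA i * cB i = 0 -> p' X z' = 0.
Proof.
rewrite pE pE' => z0 pz k0.
have [/existsP[i gi]|/existsPn ng] := boolP [exists i, good (r i)]; last first.
 by rewrite big1 ?oppr0 // => i _; rewrite cB_bad ?scale0r.
have [j [ij gj ppj all]] := good_two rr gi.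
move: pz k0; rewrite !(sum_two _ ij all) (mw_opp gi gj ppj) scalerN -scalerBl => pz k0.
have Aj : cA j = - cA i by apply/eqP; rewrite -addr_eq0 addrC pz.
have Ai : cA i != 0. apply/eqP => A0; apply: z0; apply: z_zero => k. by case: (all k) => ->; rewrite ?Aj A0 ?oppr0.
move: k0; rewrite Aj mulNr -mulrBr => /eqP; rewrite mulf_eq0 (negbTE Ai) => /eqP ->.
by rewrite scale0r oppr0.
Qed.
End Perp.

Section PerpKernel.
Variables (p : family MF Te) (p' : family MN MM).
Arguments p : clear implicits.
Arguments p' : clear implicits.
Hypotheses (pm : operad_map p) (pf : forall T x, p T (io x) = f x).
Hypotheses (pm' : operad_map p') (pf' : forall T x, p' T (io' x) = f' x).

Notation R := (fun T (x : MF T) => @weight K O E MF io 2 T x /\ p T x = 0).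
Notation Z X r := (@zz K O E ct fF [:: false; true] X r (unit ct_coord _) (unit ct_coord _)).

Lemma R_dec X n (r : 'I_n -> pipair X) (z : MF X) : representatives r ->
 @weight K O E MF io 2 X z -> exists t, @decomposes K O E MF io X n r t z.
Proof.
move=> rr w; apply: (decomposes_ex ct_coord) => //; [by right|].
by apply: (weight_supp ct_coord _ _ _ _ _ w).
Qed.

Lemma R'_dec X n (r : 'I_n -> pipair X) (z : MN X) : representatives r ->
 @weight K O E' MN io' 2 X z -> exists t, @decomposes K O E' MN io' X n r t z.
Proof.
move=> rr w; apply: (decomposes_ex cdc) => //; [by left|].
by apply: (weight_supp cdc _ _ _ _ _ w).
Qed.

Lemma zz_weight X (r : pipair X) : @weight K O E MF io 2 X (Z X r).
Proof.
apply: weight_act (pil_iso _) _.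
by apply: (@weight_circ _ _ _ _ _ 1 1) (pit_elem _) _ _; apply: weight_gen.
Qed.

Lemma p_zz X (r : pipair X) : good r -> p X (Z X r) = 1 :> K.
Proof.
move=> /andP[/eqP S1 /eqP F1].
rewrite /zz (pmap_act pm (pil_iso r)) (omap_circ pm (pit_elem r)) !pf.
change (ct (unit ct_coord (piS r)) * ct (unit ct_coord (piF r)) = 1).
by rewrite !c_unit // mulr1.
Qed.

(** On a graph with two edges, relations of the terminal operad form the line of differences of the
    two composites, and its annihilator is the kernel of [p']. On other graphs there are no good
    pairs and both coefficient families vanish. *)
Lemma perpE X (z' : MN X) : @perp K O E MF io MN io' R X z' <-> @weight K O E' MN io' 2 X z' /\ p' X z' = 0.
Proof.
have pl := pmap_lin pm (T := X).
split=> [H|[w pz'] z [wz pz]]; last first. have [n [r rr]] := reps_ex X.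
 have [t dz] := R_dec rr wz; have [t' dz'] := R'_dec rr w. exists n, r; split=> //; exists t', t; split=> //.
 by rewrite pairE (orth pm pf pm' pf' rr dz dz').
(* Pairing with zero already provides a decomposition of [z'], hence its weight. *)
have [n [r [rr [t' [t [dz' _ _]]]]]] := H 0 (conj (weight_0 io 2 X) (lin0 pl)).
split; first exact: decomposes_weight dz'.
have [/existsP[i gi]|/existsPn ng] := boolP [exists i, good (r i)]; last first.
 by rewrite (pE' pm' pf' dz') big1 ?oppr0 // => i _; rewrite cB_bad ?scale0r.
have [j [ij gj ppj all]] := good_two rr gi.
(* Both composites have value 1 in the terminal operad, so their difference is a relation; it is
   nonzero because the two nestings differ. *)
pose z := Z X (r i) - Z X (r j) : MF X.
have Rz : R X z. split. rewrite /z addrC -scaleN1r; apply: weight_lin; exact: zz_weight.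
 by rewrite /z (linD pl) (linN pl) !p_zz // subrr.
have z0 : z <> 0. move=> /eqP; rewrite subr_eq0 => /eqP e.
 have [A bA tA] := zz_good ct_coord (fl := fF) (l := [:: false; true]) isT erefl erefl isT gi.
 have [B bB tB] := zz_good ct_coord (fl := fF) (l := [:: false; true]) isT erefl erefl isT gj.
 rewrite e in bA; have AB := bs_eq bA bB. have : pp (r i) \in tubes B by rewrite -AB tA !inE eqxx orbT.
 have [/tubeP[/set0Pn[h hp] _ _ _] nf] := pp_tube (r i).
 rewrite tB !inE (negbTE nf) /= ppj => /eqP ee; move: (hp); rewrite ee inE hp. by [].
have [m [s [ss [u' [u [du' du k0]]]]]] := H z Rz.
by apply: (orth_conv pm pf pm' pf' ss du du' z0 Rz.2); rewrite -pairE -k0.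
Qed.
End PerpKernel.
End Dual.

(** * The dual dg operad *)

(** [fF] without maximality: there is now one generator, up to scalars, for every graph with an
    edge, of degree one less than the number of edges. *)
Definition fD := Flags true true false (-1).

Section DualDg.
Variables (K : fieldType) (O : opcat).
Hypothesis K2 : 2%:R != 0 :> K.
Implicit Types (T S F G H X U : obj O).

Notation MM := (Mod K fM O).
Notation D := (Mod K fD O).

Lemma eset_elem X T S F (l : arr X T) (t : arr T S) i : iso l -> elementary t i F ->
 #|eset X| = (#|eset S| + #|eset F|)%N.
Proof.
move=> li te; have [_ [iv [ih I]] _ _] := te.
rewrite (eset_iso li) card_imset; last exact: imset_inj (psi_inj (arr0 l)).
rewrite (eset_join te I) cardsU disjoint_setI0 ?(eset_disjoint I) // cards0 subn0.
by rewrite (card_imset _ (@imset_inj _ _ _ (psi_inj (arr0 t)))) (card_imset _ (@imset_inj _ _ _ (ih_inj I))).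
Qed.

Lemma card_eset_iso T S (f : arr T S) : iso f -> #|eset T| = #|eset S|.
Proof. by move=> fi; rewrite (eset_iso fi) card_imset //; exact/imset_inj/psi_inj/(arr0 f). Qed.

Definition eb T : MM T := prj _ _ (delta K (eM T)).

Lemma emb_eb T : emb (eb T) = delta K (eM T).
Proof. by apply: prjK; apply: supp_delta; rewrite validM. Qed.

Lemma MM_eb T (m : MM T) : m = (emb m (eM T) : K) *: eb T.
Proof.
apply: emb_inj; rewrite (linZ embl) emb_eb.
by have [k mE] := MM_bas m; rewrite mE !ffunE eqxx [k *: 1]mulr1.
Qed.

Definition co1 T (a : bar_gen MM T) : K := ev (a : gsusp (-1) (gdual _ (MM T))) (eb T).

Lemma ev_eb T (a : bar_gen MM T) (m : MM T) : ev (a : gsusp (-1) (gdual _ (MM T))) m = emb m (eM T) * co1 a.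
Proof.
have /asboolP[al _ _] := dual_funP (a : dualT _ _).
by rewrite {1}(MM_eb m); exact: (linZ al).
Qed.

Lemma co1_0 T (a : bar_gen MM T) : nedge T = 0%N -> co1 a = 0.
Proof.
have /asboolP[_ _ ab] := dual_funP (a : dualT _ _).
by move=> T0; apply: ab; rewrite T0.
Qed.

Lemma co1_inj T (a b : bar_gen MM T) : co1 a = co1 b -> a = b.
Proof.
by move=> e; apply: dual_eq => x; have := ev_eb a x; have := ev_eb b x; rewrite /ev /dapp e => -> ->.
Qed.

Lemma co1_lin T : linear (@co1 T : _ -> K^o).
Proof. by []. Qed.

Lemma eb_homog T : homog #|eset T|%:Z (eb T).
Proof.
apply/homog_emb; rewrite emb_eb => A; rewrite ffunE; case: (A =P eM T) => [-> _|_]; last by rewrite eqxx.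
by rewrite /deg eM_edges eM_tubes cards0 mulr0 addr0.
Qed.

Lemma co1_deg T n (a : bar_gen MM T) : homog n a -> co1 a != 0 -> n = #|eset T|%:Z - 1.
Proof.
move=> ha; have {ha}h : homog (n - (-1)) (a : gdual _ (MM T)) by exact: ha.
have h' := proj1 (dual_homog _ _) h (eb T).
move=> a0; apply/eqP; apply: contraNT a0 => nn; rewrite /co1 /ev -h'.
have ne : n - (-1) != #|eset T|%:Z by apply: contra nn => /eqP e; apply/eqP; rewrite -e; ring.
by rewrite (homog_other (eb_homog T) ne); apply/eqP; exact: dual_fun0.
Qed.

Lemma eb_act T S (f : arr T S) : iso f -> exists b : bool, pact f (eb S) = (-1) ^+ b *: eb T :> MM T /\
 emap (smap f) (delta K (eM S)) = (-1) ^+ b *: delta K (eM T).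
Proof.
move=> fi; have [b] := @emap_delta K _ _ (smap f) (eM S) (fun _ _ _ _ => @smap_inj _ _ _ _ _ _).
rewrite eM_iso // => bE; exists b; split=> //; apply: emb_inj.
by rewrite (emb_act _ fi) !emb_eb (linZ embl) emb_eb.
Qed.

Lemma co1_act T S (f : arr T S) (a : bar_gen MM S) : iso f ->
 co1 (pact f a) *: delta K (eM T) = co1 a *: emap (smap f) (delta K (eM S)).
Proof.
move=> fi; have [b [bE ->]] := eb_act fi.
have MMp : is_presheaf MM by exact: Mod_presheaf.
have e : co1 a = (-1) ^+ b * co1 (pact f a).
 have <- : ev (pact f a : bar_gen MM T) (pact f (eb S)) = co1 a by exact: (dual_pactE MMp _ fi).
 by rewrite bE ev_eb (linZ embl) emb_eb !ffunE eqxx [_ *: 1]mulr1.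
by rewrite e scalerA mulrAC -expr2 sqrr_sign mul1r.
Qed.

Lemma co1_same T F (x : bar_gen MM T) (y : bar_gen MM F) : lt_fiber T F -> same x y -> co1 x = co1 y.
Proof.
move=> lt; have [lg lgE] := lt_relegs lt.
case: F lgE y {lt} => F Fo /= lgE; subst F => y [E <-].
by rewrite (Prop_irrelevance E erefl).
Qed.

Definition dgn T : ext K (sym T) := wedge (delta K (eM T)) (mtop K [:: true] T).

Lemma mtop1 b T : mtop K [:: b] T = delta K [set (b, full T)].
Proof.
apply/ffunP => B; rewrite /mtop /= (emul_delta _ (b, full T) set0) inE setU0.
by rewrite (_ : pos _ _ = 0%N) ?scale1r //; apply: eq_card0 => j; rewrite !inE.
Qed.

Lemma dgn_bas T : bas (topS fD T) (dgn T).
Proof.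
have -> : topS fD T = eM T :|: [set (true, full T)].
 by apply: sym_eq; apply/setP => q; rewrite ?edges_top ?tubes_top !inE ?orbF.
rewrite /dgn mtop1; apply: bas_wedge; [|exact: bas_delta|exact: bas_delta].
by rewrite disjoint_sym disjoints1 !inE.
Qed.

Lemma validD T (A : {set sym T}) : valid fD A = cval (full T) A.
Proof. by rewrite /valid /cval /= andbT (nest_cnest _ (objC T)). Qed.

Lemma topD T : (0 < nedge T)%N -> valid fD (topS fD T).
Proof.
rewrite (nedge_gt0 (objO T)) => T0; apply/andP; rewrite edges_top eqxx tubes_top; split=> //=.
rewrite andbT; apply/nestP; split=> [q|q q'|_]; rewrite ?inE ?eqxx // => /eqP ->; first exact: tube_full.
by move=> /eqP ->; rewrite /compat subxx.
Qed.

(** Normalization of the generators. By [bin2_add] it is multiplicative up to [(-1) ^+ (eS * eF)],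
    the Koszul sign of the two tensor factors in [cooperation], and this makes the signs in
    [sign_id] cancel. *)
Definition sgE T : K := (-1) ^+ 'C(#|eset T|, 2).

Definition ioD T (a : bar_gen MM T) : D T := prj _ _ ((sgE T * co1 a) *: dgn T).
Arguments ioD : clear implicits.

Lemma emb_ioD T a : emb (ioD T a) = (sgE T * co1 a) *: dgn T.
Proof.
apply: prjK => A; have [T0|T0] := posnP (nedge T). by rewrite (co1_0 _ T0) mulr0 scale0r ffunE eqxx.
have [c c0 ->] := dgn_bas T; rewrite !ffunE; case: (A =P topS fD T) => [-> _|_]. exact: topD.
by rewrite !scaler0 eqxx.
Qed.

Lemma ioD_coll : coll_map ioD.
Proof.
split; first split.
- move=> T a x y; apply: emb_inj; rewrite emb_lin !emb_ioD co1_lin.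
 by rewrite scalerA -scalerDl; congr (_ *: _); rewrite mulrDr mulrCA.
- move=> T n x hx; rewrite addr0; apply/homog_emb; rewrite emb_ioD => A.
 have [c0|c0] := eqVneq (co1 x) 0; first by rewrite c0 mulr0 scale0r ffunE eqxx.
 have [c cn ->] := dgn_bas T; rewrite !ffunE; case: (A =P topS fD T) => [-> _|_]; last by rewrite !scaler0 eqxx.
 by rewrite (co1_deg hx c0) /deg edges_top tubes_top cards1 mulN1r.
- move=> T S g gi x; apply: emb_inj; rewrite (emb_act _ gi) !emb_ioD.
 rewrite (linZ (@emap_lin K _ _ _)) /dgn emap_wedge (emap_mtop _ _ gi).
 rewrite -!scalerA -!(linZ (@wedge_linl K _ _)) (co1_act _ gi). by rewrite /sgE (card_eset_iso gi).
- move=> T F _ ltF x y xy; have [lg lgE] := lt_relegs ltF. have := co1_same ltF xy; rewrite /ioD => ->.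
 case: F lgE y {xy ltF} => F Fo /= lgE; subst F => y; by exists erefl.
Qed.

Lemma sgE_neq0 T : sgE T != 0. Proof. by rewrite signr_eq0. Qed.

Lemma co1_neq0 T (a : bar_gen MM T) : a <> 0 -> co1 a != 0.
Proof. by move=> a0; apply/eqP => c0; apply: a0; apply: co1_inj. Qed.

Lemma ioD_top T (a : bar_gen MM T) : a <> 0 -> bs (ioD T a) (topS fD T).
Proof.
move=> /co1_neq0 c0; rewrite /bs emb_ioD; apply: basZ (dgn_bas T).
by rewrite mulf_neq0 ?sgE_neq0.
Qed.

Lemma ioD_inj T : injective (ioD T).
Proof.
move=> x y e; apply: co1_inj; have := f_equal (@emb _ _ _ _) e; rewrite !emb_ioD.
have [c c0 ->] := dgn_bas T; move/(f_equal (fun z : ext K (sym T) => z (topS fD T))).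
rewrite !ffunE eqxx !scalerA => /(mulIf (oner_neq0 _)) /(mulIf c0).
exact/mulfI/sgE_neq0.
Qed.

Lemma dual_ex T (k : K) : (0 < nedge T)%N ->
 exists a : dual_presheaf false MM T, (forall x, dapp (a : gdual _ (MM T)) x = emb x (eM T) * k) /\ homog #|eset T|%:Z a.
Proof.
move=> T0; have P : (fun x : MM T => emb x (eM T) * k) \in dual_pred (false || (0 < nedge T)%N) (V := MM T).
 apply/asboolP; split; last by rewrite T0. by move=> c x y; rewrite emb_lin !ffunE mulrDl -mulrA.
 exists [:: #|eset T|%:Z] => n x; rewrite inE => nn; rewrite [x]MM_eb.
 by rewrite (linZ (@gproj_lin _ _ n)) (homog_other (eb_homog T)) ?scaler0 ?(lin0 embl) ?ffunE ?mul0r // eq_sym.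
exists (Dual P); split=> //; apply/dual_homog => x; rewrite [x]MM_eb.
by rewrite (linZ (@gproj_lin _ _ _)) eb_homog.
Qed.

Lemma co1_ex T : (0 < nedge T)%N -> exists a : bar_gen MM T, co1 a = 1.
Proof.
move=> /(dual_ex 1)[a [aE _]]; exists a; rewrite /co1 /ev aE emb_eb !ffunE eqxx; exact: mulr1.
Qed.

Lemma ioD_free : is_free ioD.
Proof.
apply: Mod_free => //; [by right|..|exact: ioD_coll|exact: ioD_inj|exact: ioD_top|].
 apply: bar_coll; last exact: mod_leggy. exact: Mod_presheaf.
move=> T /co1_ex[a a1] _; exists a => a0; move: a1; rewrite a0 (lin0 (@co1_lin T)).
by move/esym/eqP; rewrite oner_eq0.
Qed.

End DualDg.

(** ** The differential *)

Lemma bin2_add m n : 'C(m + n, 2) = ('C(m, 2) + 'C(n, 2) + m * n)%N.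
Proof. by elim: m => [|m IH]; rewrite ?addn0 // addSn !binS !bin1 IH; lia. Qed.

Section Extensions.
Variables (K : fieldType) (I : finType) (V : pred {set I}).
Implicit Types (C : {set I}).

Definition exts C : {set I} := [set s | (s \notin C) && V (s |: C)].

Lemma dif_delta C : dif V (delta K C) = \sum_(s in exts C) emul s (delta K C).
Proof.
rewrite /dif (lin_sum (@restr_lin K I V)) [RHS]big_mkcond; apply: eq_bigr => s _.
rewrite inE emul_delta; case: (s \in C) => /=; first by rewrite (lin0 (@restr_lin K I V)).
rewrite (linZ (@restr_lin K I V)); case: ifP => v; last first.
 suff -> : restr V (delta K (s |: C)) = 0 by rewrite scaler0.
 by apply/ffunP => B; rewrite !ffunE; case: (B =P _) => [->|_]; [rewrite v|case: ifP].
by congr (_ *: _); apply: restr_id; apply: supp_delta.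
Qed.

Lemma supp_ind (P : {set I} -> Prop) (Q : ext K I -> Prop) : Q 0 ->
 (forall a x y, Q x -> Q y -> Q (a *: x + y)) -> (forall C, P C -> Q (delta K C)) -> forall x, supp P x -> Q x.
Proof.
move=> Q0 Ql Qd x sx; rewrite [x]ext_delta; apply: big_ind => // [u v qu qv|C _]. by rewrite -[u]scale1r; apply: Ql.
have [->|xC] := eqVneq (x C) 0; first by rewrite scale0r.
by rewrite -[_ *: _]addr0; apply: Ql => //; apply/Qd/sx.
Qed.
End Extensions.

Lemma emap_emul (K : fieldType) (I J : finType) (p : I -> J) (s : I) (x : ext K I) :
 emap p (emul s x) = emul (p s) (emap p x).
Proof.
by rewrite /emap evl_emul // => [i|i w|i j w]; [exact: emul_lin|exact: emul_nn|exact: emulC].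
Qed.

Lemma emul_wedgel (K : fieldType) (I : finType) (s : I) (x y : ext K I) : wedge (emul s x) y = emul s (wedge x y).
Proof.
by rewrite /wedge evl_emul // => [i|i w|i j w]; [exact: emul_lin|exact: emul_nn|exact: emulC].
Qed.

Section Differential.
Variables (K : fieldType) (O : opcat).
Hypothesis K2 : 2%:R != 0 :> K.
Implicit Types (T S F G H X U : obj O).

Notation MM := (Mod K fM O).
Notation D := (Mod K fD O).
Notation vD := (valid fD).
Let odD : fdeg fD = 1 \/ fdeg fD = -1. Proof. by right. Qed.
Let tD : ftube fD. Proof. by []. Qed.

Lemma validD_mid T (A B C : {set sym T}) : vD A -> vD C -> A \subset B -> B \subset C -> vD B.
Proof. by rewrite !validD; apply: cval_mid. Qed.

(** Reason for the Leibniz rule: an extension of a joined nesting still contains the contracted tube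
    and splits by [split_state], so the new symbol belongs to exactly one factor, and convexity
    makes it admissible there. *)
Lemma exts_join T S (f : arr T S) i F iv ih (A : {set sym S}) (B : {set sym F}) :
 elementary f i F -> @fiber_incl T S f i F iv ih -> vD A -> vD B ->
 exts (@valid fD T) (smap f @: A :|: imap ih @: B) =
  smap f @: exts (@valid fD S) A :|: imap ih @: exts (@valid fD F) B.
Proof.
move=> fe I vA vB; have pi : injective (smap f) := @smap_inj _ _ _ f.
have ri : injective (imap ih) by apply/imap_inj/(ih_inj I).
have dis A' B' : vD A' -> vD B' -> [disjoint smap f @: A' & imap ih @: B'] := join_sym_disjoint tD fe I.
have notb s s' A' B' : vD A' -> vD B' -> s \in A' -> s' \in B' -> smap f s <> imap ih s'.
 move=> vA' vB' sA sB e; have := dis _ _ vA' vB' => /pred0P /(_ (smap f s)).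
 by rewrite /= (imset_f (smap f)) // e (imset_f (imap ih)).
apply/setP => s; apply/idP/idP => [|/setUP[]/imsetP[j]].
- rewrite inE => /andP[sn vs]. have nzT : nz f \in tubes (s |: (smap f @: A :|: imap ih @: B)).
  have fF : (true, full F) \in B. have [_ _ F0 _] := fe; rewrite (nedge_gt0 (objO F)) in F0.
   have /andP[_ /andP[/nestP[_ _ n] _]] := vB; by have := n F0; rewrite inE.
  rewrite -(ih_full fe I) inE; apply/setU1P; right; apply/setUP; right. by apply/imsetP; exists (true, full F).
 have [A1 [B1 [vA1 vB1 E]]] := split_state tD fe I vs nzT. have sA : A \subset A1.
  apply/subsetP => a aA; have : smap f a \in s |: (smap f @: A :|: imap ih @: B).
   by apply/setU1P; right; apply/setUP; left; apply: imset_f.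
  rewrite E => /setUP[|/imsetP[b bB]]; first by rewrite mem_imset. by move=> e; case: (notb _ _ _ _ vA vB1 aA bB).
 have sB : B \subset B1. apply/subsetP => b bB; have : imap ih b \in s |: (smap f @: A :|: imap ih @: B).
   by apply/setU1P; right; apply/setUP; right; apply: imset_f.
  rewrite E => /setUP[/imsetP[a aA]|]; last by rewrite mem_imset.
  by move=> /esym e; case: (notb _ _ _ _ vA1 vB aA bB).
 have : s \in s |: (smap f @: A :|: imap ih @: B) by rewrite setU11.
 move: sn; rewrite inE negb_or => /andP[snA snB]; rewrite E => /setUP[]/imsetP[j jA sE].
  rewrite sE mem_imset // in snA; apply/setUP; left; rewrite sE imset_f // inE snA /=.
  by apply: (validD_mid vA vA1); rewrite ?subsetUr // subUset sub1set jA.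
 rewrite sE mem_imset // in snB; apply/setUP; right; rewrite sE imset_f // inE snB /=.
 by apply: (validD_mid vB vB1); rewrite ?subsetUr // subUset sub1set jA.
- rewrite inE => /andP[jn vj] ->; rewrite inE in_setU mem_imset // (negbTE jn) /=. apply/andP; split.
  by apply/imsetP => -[b bB]; apply: notb vj vB _ bB; apply: setU11.
 by rewrite setUA -imsetU1; have [] := valid_join fe I vj vB.
- rewrite inE => /andP[jn vj] ->; rewrite inE in_setU [in X in _ || X]mem_imset // (negbTE jn) orbF.
 apply/andP; split. by apply/imsetP => -[b bB] /esym; apply: notb vA vj bB _; apply: setU11.
 by rewrite setUCA -imsetU1; have [] := valid_join fe I vA vj.
Qed.

Lemma exts_iso T S (f : arr T S) (A : {set sym S}) : iso f ->
 exts (@valid fD T) (smap f @: A) = smap f @: exts (@valid fD S) A.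
Proof.
move=> fi; have [g [gi gf fg]] := iso_inv fi.
have pi : injective (smap f) := @smap_inj _ _ _ f.
have fgK s : smap f (smap g s) = s by have := smap_comp (esym gf) s; rewrite smap_gid.
have gfK s : smap g (smap f s) = s by have := smap_comp (esym fg) s; rewrite smap_gid.
apply/setP => s; rewrite -[s]fgK; move: (smap g s) => {}s.
rewrite mem_imset // !inE mem_imset // -imsetU1; congr (_ && _).
apply/idP/idP => v; last by have [] := valid_iso fi v.
have [] := valid_iso gi v; rewrite -imset_comp (_ : _ @: _ = s |: A) //.
by rewrite -[RHS]imset_id; apply: eq_imset; exact: gfK.
Qed.

Lemma dif_iso T S (f : arr T S) (x : ext K (sym S)) : iso f -> supp (@valid fD S) x ->
 dif (@valid fD T) (emap (smap f) x) = emap (smap f) (dif (@valid fD S) x).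
Proof.
move=> fi; have dl (W : graph) := @dif_lin K _ (@valid fD W).
have el := @emap_lin K _ _ (smap f).
move: x; apply: supp_ind => [|a u v qu qv|C vC].
- by rewrite !((lin0 el), (lin0 (dl _))).
- by rewrite el !dl el qu qv.
have pi : injective (smap f) := @smap_inj _ _ _ f.
have [b bE] := @emap_delta K _ _ (smap f) C (fun _ _ _ _ => @pi _ _).
rewrite bE (linZ (dl _)) !dif_delta exts_iso // big_imset; last by move=> ? ? _ _; apply: pi.
rewrite (lin_sum el) scaler_sumr; apply: eq_bigr => s _ /=.
by rewrite -(linZ (@emul_lin _ _ _)) -bE emap_emul.
Qed.

Lemma emul_wedger (I : finType) (s : I) l (y : ext K I) :
 emul s (wedge (mon K l) y) = (-1) ^+ size l *: wedge (mon K l) (emul s y).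
Proof. by rewrite !wedge_mon; apply: foldr_swap; [exact: emul_lin|exact: emulC]. Qed.

(** Added symbols are distributed over the factors by [exts_join]; one that goes to the second
    factor is moved past [x], which costs the parity of [x]. *)
Lemma dif_circ T S (f : arr T S) i F iv ih b (x : ext K (sym S)) (y : ext K (sym F)) :
 elementary f i F -> @fiber_incl T S f i F iv ih ->
 supp (fun A => @valid fD S A /\ odd #|A| = b) x -> supp (@valid fD F) y ->
 dif (@valid fD T) (wedge (emap (smap f) x) (emap (imap ih) y)) =
  wedge (emap (smap f) (dif (@valid fD S) x)) (emap (imap ih) y) +
  (-1) ^+ b *: wedge (emap (smap f) x) (emap (imap ih) (dif (@valid fD F) y)).
Proof.
move=> fe I; have pi : injective (smap f) := @smap_inj _ _ _ f.
have ri : injective (imap ih) by apply/imap_inj/(ih_inj I).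
have dl (W : graph) := @dif_lin K _ (@valid fD W).
have pl := @emap_lin K _ _ (smap f); have rl := @emap_lin K _ _ (imap ih).
have wl := @wedge_linl K (sym T); have wr := @wedge_linr K (sym T).
move: x; apply: supp_ind => [_|a u v qu qv sy|A [vA bA]].
- by rewrite !((lin0 pl), (lin0 (dl _)), (lin0 (wl _))) scaler0 addr0.
- rewrite (pl a u v) (wl _ a) (dl T a) qu // qv // (dl S a u v) (pl a) (wl _ a).
 rewrite (wl _ a (emap (smap f) u)) !scalerDr !scalerA [a * _]mulrC -!addrA; congr (_ + _). by rewrite addrCA.
move: y; apply: supp_ind => [|a u v qu qv|B vB].
- by rewrite !((lin0 rl), (lin0 (dl _)), (lin0 (wr _))) scaler0 addr0.
- rewrite (rl a u v) (wr _ a) (dl T a) qu qv (dl F a u v) (rl a) (wr _ a).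
 rewrite (wr _ a) !scalerDr !scalerA [a * _]mulrC -!addrA; congr (_ + _). by rewrite addrCA.
have [b1 b1E] := @emap_delta K _ _ (smap f) A (fun _ _ _ _ => @pi _ _).
have [b2 b2E] := @emap_delta K _ _ (imap ih) B (fun _ _ _ _ => @ri _ _).
have dis A' B' : valid fD A' -> valid fD B' -> [disjoint smap f @: A' & imap ih @: B'] := join_sym_disjoint tD fe I.
have [b3 b3E] := delta_wedge K (dis A B vA vB).
pose w := wedge (emap (smap f) (delta K A)) (emap (imap ih) (delta K B)).
have wE : w = ((-1) ^+ b1 * ((-1) ^+ b2 * (-1) ^+ b3)) *: delta K (smap f @: A :|: imap ih @: B).
 by rewrite /w b1E b2E (linZ (wl _)) (linZ (wr _)) b3E !scalerA ?mulrA.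
have dd : [disjoint smap f @: exts (@valid fD S) A & imap ih @: exts (@valid fD F) B].
 apply/pred0P => s /=; apply/negbTE/negP => /andP[/imsetP[j]]. rewrite inE => /andP[jn vj] -> /imsetP[k].
 rewrite inE => /andP[kn vk] e.
 have := dis _ _ vj vk; move/pred0P/(_ (smap f j)); rewrite /= (imset_f (smap f)) ?setU11 //.
 by rewrite e (imset_f (imap ih)) ?setU11.
rewrite -/w {1}wE (linZ (dl _)) dif_delta (exts_join fe I vA vB).
rewrite (eq_bigl _ _ (fun s => in_setU s _ _)) (bigU _ _ _ dd) /=.
rewrite !big_imset /=; [|by move=> ? ? _ _; apply: ri|by move=> ? ? _ _; apply: pi].
rewrite scalerDr; congr (_ + _). rewrite scaler_sumr dif_delta (lin_sum pl) (lin_sum (wl _)); apply: eq_bigr => s _.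
 by rewrite -(linZ (@emul_lin _ _ _)) -wE /w emap_emul emul_wedgel.
rewrite scaler_sumr dif_delta (lin_sum rl) (lin_sum (wr _)) scaler_sumr; apply: eq_bigr => s _.
rewrite -(linZ (@emul_lin _ _ _)) -wE /w -(mon_enum K A) emap_mon emul_wedger size_map -cardE.
by rewrite -signr_odd bA; congr (_ *: wedge _ _); rewrite emap_emul.
Qed.

(** With this sign the new tube, once moved past the edges and past [full X], appears in [pa_ioD]
    with the sign [(-1) ^+ #|eset X|] that [coop_pure] finds for the cooperations. *)
Definition pa T (x : D T) : D T := prj _ _ (- dif (@valid fD T) (emb x)).
Arguments pa : clear implicits.

Lemma emb_pa T x : emb (pa T x) = - dif (@valid fD T) (emb x).
Proof. by apply: prjK; rewrite -scaleN1r; apply: suppZ; apply: dif_supp. Qed.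

Lemma pa_lin T : linear (pa T).
Proof.
move=> a x y; apply: emb_inj; rewrite emb_lin !emb_pa emb_lin dif_lin.
by rewrite opprD scalerN.
Qed.

Lemma pa_pa T x : pa T (pa T x) = 0.
Proof.
apply: emb_inj; rewrite !emb_pa (linN (@dif_lin _ _ _)) dif_dif ?(lin0 embl) ?oppr0 //.
 by move=> A i j; rewrite !validD; apply: cval_H0.
exact: emb_supp.
Qed.

Lemma pa_deg T n (x : D T) : homog n x -> homog (n - 1) (pa T x).
Proof.
move=> /homog_supp hx; apply/homog_emb; rewrite emb_pa => B; rewrite ffunE oppr_eq0 difE.
case: ifP => [vB S0|]; last by rewrite eqxx.
have /existsP[s /andP[sB xs]] : [exists s, (s \in B) && (emb x (B :\ s) != 0)].
 apply: contraNT S0 => /existsPn h; rewrite big1 // => s sB.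
 by have := h s; rewrite sB /= negbK => /eqP ->; rewrite mulr0.
have [vs <-] := hx _ xs; rewrite /deg.
have /andP[/eqP eB _] := vB; have /andP[/eqP es _] := vs.
have := cardsD1 s B; rewrite sB (card_sym B) (card_sym (B :\ s)) eB es /= => c.
rewrite !mulN1r -addrA -opprD; congr (_ - _); apply/eqP; rewrite -PoszD eqz_nat; apply/eqP; lia.
Qed.

Lemma pa_act T S (f : arr T S) (x : D S) : iso f -> pa T (pact f x) = pact f (pa S x).
Proof.
move=> fi; apply: emb_inj; rewrite (emb_act _ fi) !emb_pa (emb_act _ fi).
by rewrite (dif_iso fi (@emb_supp _ _ _ _ x)) (linN (@emap_lin _ _ _ _)).
Qed.

Lemma pa_0 T (x : D T) : nedge T = 0%N -> pa T x = 0.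
Proof.
move=> /(nedge_eq0 (objO T)) T0; apply: emb_inj; rewrite emb_pa (lin0 embl).
apply/ffunP => B; rewrite !ffunE sum_emulE; case: ifP; rewrite ?oppr0 //.
by rewrite (valid_lt _ _ T0) => /eqP ->; rewrite big_set0 oppr0.
Qed.

Lemma pa_circ T S (g : arr T S) i F n (x : D S) (y : D F) : elementary g i F -> homog n x ->
 pa T (circ g x y) = sgn K (-1 * n) *: circ g x (pa F y) + circ g (pa S x) y.
Proof.
move=> ge /homog_supp hx; have [_ [iv [ih I]] _ _] := ge; apply: emb_inj.
rewrite emb_lin emb_pa !(emb_circ _ _ ge I) !emb_pa (dif_circ (b := odd `|n|%N) ge I); last first.
- exact: emb_supp.
- by move=> A /hx[vA <-]; rewrite deg_odd.
rewrite (linN (@emap_lin _ _ _ _)) (linN (@wedge_linr _ _ _)) (linN (@emap_lin _ _ _ _)).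
by rewrite (linN (@wedge_linl _ _ _)) mulN1r sgn_abs abszN signr_odd scalerN opprD addrC.
Qed.

Lemma pa_der : derivation (-1) pa.
Proof.
split; first split.
- exact: pa_lin.
- exact: pa_deg.
- by move=> T S g gi x; apply: pa_act.
- by move=> T T0 x; apply: pa_0.
- by move=> T S g i F ge n x y hx; exact: pa_circ ge hx.
Qed.

End Differential.

(** * The differential on generators *)

Section DualDgGen.
Variables (K : fieldType) (O : opcat).
Hypothesis K2 : 2%:R != 0 :> K.
Implicit Types (T S F G H X U : obj O).

Notation MM := (Mod K fM O).
Notation D := (Mod K fD O).
Notation ioD := (@ioD K O).
Notation pa := (@pa K O).
Let Do : is_operad D. Proof. by apply: Mod_operad; right. Qed.
Let Mo : is_operad MM. Proof. by apply: Mod_operad; left. Qed.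

Lemma mon_shuffle (I : finType) (l l' : seq I) u v :
 mon K ((l ++ [:: u]) ++ (l' ++ [:: v])) = (-1) ^+ size l' *: wedge (mon K (l ++ l')) (mon K [:: u; v]).
Proof.
have e : mon K (([:: u] ++ l') ++ [:: v]) = (-1) ^+ size l' *: mon K ((l' ++ [:: u]) ++ [:: v]).
 by rewrite -!(wedge_mon2 _ (_ ++ _)) (mon_swap _ [:: u] l') mul1n (linZ (@wedge_linl _ _ _)).
rewrite -catA -wedge_mon2 catA e.
rewrite (linZ (@wedge_linr _ _ _)); congr (_ *: _).
by rewrite !wedge_mon2 -!catA.
Qed.

Definition wM X (r : pipair X) : MM X := pact (pil r) (circ (pit r) (eb K (piS r)) (eb K (piF r))).

Lemma emb_wM X (r : pipair X) iv ih : @fiber_incl _ _ (pit r) (pii r) (piF r) iv ih ->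
 emb (wM r) = emap (smap (pil r)) (wedge (emap (smap (pit r)) (delta K (eM (piS r))))
  (emap (imap ih) (delta K (eM (piF r))))).
Proof. by move=> I; rewrite (emb_act _ (pil_iso r)) (emb_circ _ _ (pit_elem r) I) !emb_eb. Qed.

Lemma wM_sign X (r : pipair X) : exists b : bool, emb (wM r) = (-1) ^+ b *: delta K (eM X).
Proof.
have te := pit_elem r; have li := pil_iso r; have [_ [iv [ih I]] _ _] := te.
have ri : injective (imap ih) by apply/imap_inj/(ih_inj I).
have [dis jE] := eM_join te I.
have [b1 b1E] := @emap_delta K _ _ (smap (pit r)) (eM (piS r)) (fun _ _ _ _ => @smap_inj _ _ _ _ _ _).
have [b2 b2E] := @emap_delta K _ _ (imap ih) (eM (piF r)) (fun _ _ _ _ => @ri _ _).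
have [b3 b3E] := delta_wedge K dis.
have [b4 b4E] := @emap_delta K _ _ (smap (pil r)) (eM (piT r)) (fun _ _ _ _ => @smap_inj _ _ _ _ _ _).
exists (b1 (+) b2 (+) b3 (+) b4).
rewrite (emb_wM I) b1E b2E (linZ (@wedge_linl _ _ _)) (linZ (@wedge_linr _ _ _)) b3E jE.
rewrite !scalerA (linZ (@emap_lin _ _ _ _)) b4E (eM_iso li) scalerA !signr_addb.
by congr (_ *: _); ring.
Qed.

Lemma emb_ioD_circ X (r : pipair X) (a : bar_gen MM (piS r)) (b : bar_gen MM (piF r)) :
 emb (pact (pil r) (circ (pit r) (ioD a) (ioD b)) : D X) =
 (sgE K (piS r) * co1 a * (sgE K (piF r) * co1 b) * (-1) ^+ #|eset (piF r)|) *: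
  wedge (emb (wM r)) (mon K [:: (true, full X); (true, pp r)]).
Proof.
have te := pit_elem r; have li := pil_iso r; have [_ [iv [ih I]] _ _] := te.
rewrite (emb_wM I) (emb_act _ li) (emb_circ _ _ te I) !emb_ioD.
rewrite !(linZ (@emap_lin _ _ _ _)) (linZ (@wedge_linl _ _ _)) (linZ (@wedge_linr _ _ _)).
rewrite !(linZ (@emap_lin _ _ _ _)).
suff -> : emap (smap (pil r)) (wedge (emap (smap (pit r)) (dgn K (piS r))) (emap (imap ih) (dgn K (piF r)))) =
 (-1) ^+ #|eset (piF r)| *: wedge (emap (smap (pil r)) (wedge (emap (smap (pit r)) (delta K (eM (piS r))))
  (emap (imap ih) (delta K (eM (piF r)))))) (mon K [:: (true, full X); (true, pp r)]). by rewrite !scalerA.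
rewrite /dgn -!(mon_enum K (eM _)) /mtop !(wedge_mon2, emap_mon) /= !map_cat /= -!map_cat !map_cat /=.
have -> : smap (pil r) (smap (pit r) (true, full (piS r))) = (true, full X).
 have S0 : full (piS r) != set0 by rewrite -(nedge_gt0 (objO _)) (pi_edge r). have T0 : full (piT r) != set0.
  by have [k kf] := set0Pn _ S0; apply/set0Pn; exists (psi (pit r) k); rewrite full_nz.
 by rewrite /smap /= (lift_full _ S0) (lift_full _ T0).
have -> : smap (pil r) (imap ih (true, full (piF r))) = (true, pp r).
 by rewrite /smap /imap /= (lift_iso li) /himg (ih_full te I) -ppE.
rewrite mon_shuffle !size_map -cardE wedge_mon2; congr (_ ^+ _ *: _).
have := card_sym (eM (piF r)); rewrite eM_edges eM_tubes cards0 addn0 //.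
Qed.

Lemma card_eM (T : graph) : #|eM T| = #|eset T|.
Proof. by rewrite card_sym eM_edges eM_tubes cards0 addn0. Qed.

(** To a generator exactly one tube can be added for each class of pairs; the differential of a
    generator is therefore indexed as the sum over pi(X). *)
Lemma exts_top X n (c : 'I_n -> pipair X) : representatives c -> (0 < nedge X)%N ->
 exts (@valid fD X) (topS fD X) = [set (true, pp (c i)) | i in 'I_n].
Proof.
move=> rc X0; have vt := topD X0; apply/setP => -[b q]; rewrite inE; apply/andP/imsetP.
 move=> [sn vs]; have /andP[/eqP es /andP[/nestP[tu _ _] _]] := vs. case: b sn vs es tu => sn vs es tu; last first.
  have : q \in edges ((false, q) |: topS fD X) by rewrite inE setU11. by move: sn; rewrite es !inE /= => /negbTE ->.
 have tq : tube q by apply: tu; rewrite inE setU11. have qf : q != full X by move: sn; rewrite !inE.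
 by have [i <-] := reps_cover rc tq qf; exists i.
move=> [i _ [-> ->]]; have [tp pf] := pp_tube (c i); split; first by rewrite !inE.
have /andP[/eqP et /andP[/nestP[tt ct ft] _]] := vt; apply/andP; rewrite edgesU tubesU et eqxx; split=> //.
rewrite tubes_top in tt ct ft *; rewrite andbT; have fs : pp (c i) \subset full X := pp_sub _.
apply/nestP; split=> [q' /setU1P[->//|/tt//]|q' q'' /setU1P[->|/set1P ->] /setU1P[->|/set1P ->]|/ft h].
- by rewrite /compat subxx.
- by rewrite /compat fs.
- by rewrite /compat fs orbT.
- by rewrite /compat subxx.
- by rewrite inE h orbT.
Qed.

Lemma neg_sign (x : K) m : - x * (-1) ^+ (m + 1) = x * (-1) ^+ m.
Proof. by rewrite addn1 exprS mulrA mulrN1 opprK. Qed.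

Lemma pa_ioD X n (c : 'I_n -> pipair X) (a : bar_gen MM X) : representatives c ->
 emb (pa (ioD a)) = \sum_i (sgE K X * co1 a * (-1) ^+ #|eset X|) *:
  wedge (delta K (eM X)) (mon K [:: (true, full X); (true, pp (c i))]).
Proof.
move=> rc; have [X0|X0] := posnP (nedge X). rewrite (pa_0 _ X0) (co1_0 _ X0) (lin0 embl) big1 // => i _.
 by rewrite mulr0 mul0r scale0r.
rewrite emb_pa emb_ioD (linZ (@dif_lin _ _ _)) -scaleNr.
have [k k0 dE] := dgn_bas K X.
rewrite {1}dE (linZ (@dif_lin _ _ _)) dif_delta (exts_top rc X0) big_imset /=; last first.
 by move=> i j _ _ [] e; apply: reps_uniq rc e.
rewrite !scaler_sumr; apply: eq_big => // i _.
rewrite -(linZ (@emul_lin _ _ _)) -dE /dgn -(mon_enum K (eM X)) /mtop.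
rewrite -[emul _ (emul _ (delta K set0))]/(mon K [:: (true, full X); (true, pp (c i))]) !wedge_mon2.
have -> : emul (true, pp (c i)) (mon K (enum (eM X) ++ [:: (true, full X)])) =
 mon K ([:: (true, pp (c i))] ++ (enum (eM X) ++ [:: (true, full X)])) by [].
rewrite (mon_swap _ [:: (true, pp (c i))]) size_cat mul1n -cardE card_eM /= -catA scalerA; congr (_ *: _).
exact: neg_sign.
Qed.

Lemma wM_coef X (r : pipair X) (y : MM (piS r)) (z : MM (piF r)) :
 emb (pact (pil r) (circ (pit r) y z) : MM X) (eM X) = emb y (eM (piS r)) * emb z (eM (piF r)) * emb (wM r) (eM X).
Proof.
rewrite {1}[y]MM_eb {1}[z]MM_eb (circZl _ _ _ Mo (pit_elem r)).
rewrite (linZ (op_linr Mo (pit_elem r) _)) scalerA (pactZ _ _ Mo (pil_iso r)).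
by rewrite (linZ embl) ffunE.
Qed.

Lemma sgn_nat (m : nat) : sgn K m = (-1) ^+ m.
Proof. by []. Qed.

Lemma sign_id (k : K) (b : bool) eS eF (sX sS sF : K) : sX = sS * sF * (-1) ^+ (eS * eF) ->
 (-1) ^+ eS * (sS * ((-1) ^+ b * k * (-1) ^+ (eS * eF)) * (sF * 1) * (-1) ^+ eF) * (-1) ^+ b =
 sX * k * (-1) ^+ (eS + eF).
Proof.
move=> ->; have := sqrr_sign K b; rewrite expr2 exprD => b2.
transitivity ((-1) ^+ eS * (sS * (k * (-1) ^+ (eS * eF)) * sF * (-1) ^+ eF) * ((-1) ^+ b * (-1) ^+ b)). by ring.
by rewrite b2; ring.
Qed.

Lemma sgE_add X T S F (l : arr X T) (t : arr T S) i : iso l -> elementary t i F ->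
 sgE K X = sgE K S * sgE K F * (-1) ^+ (#|eset S| * #|eset F|).
Proof. by move=> li te; rewrite /sgE (eset_elem li te) bin2_add !exprD. Qed.

Lemma coop_pure X (r : pipair X) (a : bar_gen MM X) :
 exists q : pure (dual_presheaf false MM (piS r)) (dual_presheaf false MM (piF r)),
 cooperation (pit r) (fun x => ev (a : gsusp (-1) (gdual _ (MM X))) (pact (pil r) x)) [:: q] /\
 sgn K (dl q) *: emb (pact (pil r) (circ (pit r) (ioD (down (vl q))) (ioD (down (vr q)))) : D X) =
  (sgE K X * co1 a * (-1) ^+ #|eset X|) *: wedge (delta K (eM X)) (mon K [:: (true, full X); (true, pp r)]).
Proof.
have te := pit_elem r; have li := pil_iso r.
have [b bE] := wM_sign r.
have F0 : (0 < nedge (piF r))%N by case: te.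
(* In the coefficient of [u], the sign [(-1) ^+ b] is that of the composite of the two basis
   vectors, and the last sign cancels the Koszul sign of evaluating a pure tensor; [v] is normalized
   to 1. *)
have [u [uE uh]] := dual_ex ((-1) ^+ b * co1 a * (-1) ^+ (#|eset (piS r)| * #|eset (piF r)|)) (pi_edge r).
have [v [vE vh]] := dual_ex (1 : K) F0.
have u1 : co1 (down u) = (-1) ^+ b * co1 a * (-1) ^+ (#|eset (piS r)| * #|eset (piF r)|).
 by rewrite /co1 /ev uE emb_eb ffunE eqxx mul1r.
have v1 : co1 (down v) = 1 by rewrite /co1 /ev vE emb_eb ffunE eqxx mul1r.
exists (Pure uh vh); split=> [y z|].
 have e1 : emb (wM r) (eM X) = (-1) ^+ b by rewrite bE !ffunE eqxx; exact: mulr1.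
 rewrite big_seq1 /= uE vE mulr1 ev_eb wM_coef e1 sgn_nat.
 have := sqrr_sign K (odd (#|eset (piS r)| * #|eset (piF r)|)); rewrite signr_odd expr2.
 set s := (-1) ^+ (_ * _); set yy := emb y _; set zz := emb z _; set c := co1 a => s2.
 transitivity ((s * s) * (yy * zz * (-1) ^+ b * c)); last by ring. by rewrite s2 mul1r.
rewrite emb_ioD_circ u1 v1 bE (linZ (@wedge_linl _ _ _)) !scalerA sgn_nat; congr (_ *: _).
rewrite (eset_elem li te) -(sign_id _ b (sgE_add li te)) //.
Qed.

Lemma dual_dg_pa : dual_dg ioD pa.
Proof.
split.
- exact: MM_one.
- by move=> T; apply: gsub_fin.
- exact: ioD_free.
- exact: pa_der.
- by move=> T x; apply: pa_pa.
- move=> X a; have [n [c rc]] := reps_ex X.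
 have [q qE] : exists q : forall i, pure (dual_presheaf false MM (piS (c i))) (dual_presheaf false MM (piF (c i))),
  forall i, cooperation (pit (c i)) (fun x => ev (a : gsusp (-1) (gdual _ (MM X))) (pact (pil (c i)) x)) [:: q i] /\
   sgn K (dl (q i)) *: emb (pact (pil (c i)) (circ (pit (c i)) (ioD (down (vl (q i)))) (ioD (down (vr (q i))))) : D X) =
   (sgE K X * co1 a * (-1) ^+ #|eset X|) *: wedge (delta K (eM X)) (mon K [:: (true, full X); (true, pp (c i))]).
  by exists (fun i => projT1 (cid (coop_pure (c i) a))) => i; case: (cid _).
 exists n, c, (fun i => [:: q i]); split=> [//|i|]; first by case: (qE i).
 apply: emb_inj; rewrite (pa_ioD a rc) (lin_sum embl); apply: eq_bigr => i _.
 by rewrite big_seq1 (linZ embl); case: (qE i).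
Qed.
End DualDgGen.

(** * Koszulness *)

Section Koszul.
Variables (K : fieldType) (O : opcat).
Hypothesis K2 : 2%:R != 0 :> K.
Implicit Types (T S F G H X U : obj O).

Notation MM := (Mod K fM O).
Notation D := (Mod K fD O).
Notation Te := (terminal_operad K O).
Notation ioD := (@ioD K O).
Notation pa := (@pa K O).
Let Do : is_operad D. Proof. by apply: Mod_operad; right. Qed.
Let odD : fdeg fD = 1 \/ fdeg fD = -1. Proof. by right. Qed.

(** The projection of the generators onto those of graphs with one edge, in coordinates. *)
Definition gD T (a : bar_gen MM T) : Te T := (nedge T == 1%N)%:R * co1 a : K.
Arguments gD : clear implicits.

Lemma gD1 T (a : bar_gen MM T) : nedge T = 1%N -> gD T a = co1 a.
Proof. by move=> T1; rewrite /gD T1 mul1r. Qed.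

Lemma gD0 T (a : bar_gen MM T) : nedge T != 1%N -> gD T a = 0.
Proof. by move=> /negbTE T1; rewrite /gD T1 mul0r. Qed.

Lemma delta_eM1 T : nedge T = 1%N -> delta K (eM T) = mtop K [:: false] T.
Proof.
move=> T1; rewrite mtop1; congr (delta K _); apply/setP => -[b q].
by rewrite !inE (eset_one (objO T) T1) inE xpair_eqE; case: b.
Qed.

Lemma emap_eM1 T S (f : arr T S) : iso f -> nedge T = 1%N -> emap (smap f) (delta K (eM S)) = delta K (eM T).
Proof. by move=> fi T1; rewrite !delta_eM1 ?emap_mtop // -(nedge_iso fi). Qed.

Lemma gD_coll : coll_map gD.
Proof.
split; first split.
- move=> T a x y; rewrite /gD co1_lin /=.
 change ((nedge T == 1%N)%:R * (a * co1 x + co1 y) = a * ((nedge T == 1%N)%:R * co1 x) + (nedge T == 1%N)%:R * co1 y).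
 by rewrite mulrDr mulrCA.
- move=> T n x hx; rewrite addr0 /homog /= /deg0_proj; case: eqP => // n0; rewrite /gD.
 have [T1|T1] := eqVneq (nedge T) 1%N; last by rewrite mul0r.
 have [->|c0] := eqVneq (co1 x) 0; first by rewrite mulr0.
 by case: n0; rewrite (co1_deg hx c0) (eset_one (objO T) T1) cards1 subrr.
- move=> T S g gi x; change ((nedge T == 1%N)%:R * co1 (pact g x) = (nedge S == 1%N)%:R * co1 x).
 rewrite -(nedge_iso gi); have [T1|T1] := eqVneq (nedge T) 1%N; last by rewrite !mul0r.
 rewrite !mul1r; have := co1_act x gi; rewrite (emap_eM1 gi T1).
 move/(f_equal (fun z : ext K (sym T) => z (eM T))); rewrite !ffunE eqxx => e.
 by have := e; rewrite [_ *: _]mulr1 [X in _ = X]mulr1.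
- move=> T F _ lt x y xy; exists erefl. by rewrite /gD (nedge_lt lt) (co1_same lt xy).
Qed.

Variable can : family D Te.
Arguments can : clear implicits.
Hypotheses (cm : operad_map can) (cE : forall T a, can T (ioD a) = gD T a).

Let cl T : linear (can T). Proof. exact: (pmap_lin cm). Qed.

Lemma f'_unit T : nedge T = 1%N -> f' (unit (sdual_coord K O) T) = eb K T.
Proof.
move=> T1; apply: emb_inj; rewrite emb_eb (delta_eM1 T1).
have -> : emb (f' (unit (sdual_coord K O) T)) = dual_coord (unit (sdual_coord K O) T) *: mtop K [:: false] T.
 by apply: (emb_geni (sdual_coord K O)).
by rewrite (c_unit _ T1) scale1r.
Qed.

Lemma wM_mw X (r : pipair X) : good r -> wM K r = mw K r.
Proof. by move=> /andP[/eqP S1 /eqP F1]; rewrite /mw /wM (f'_unit S1) (f'_unit F1). Qed.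

(** On graphs with one edge the forms have degree 1, so the sign [sgn K (dl q)] of the differential
    equals the Koszul sign in [cooperation], and the sum is an evaluation of [a]. *)
Lemma good_pairing X (r : pipair X) (a : bar_gen MM X) (t : seq (pure (dual_presheaf false MM (piS r)) (dual_presheaf false MM (piF r)))) :
 cooperation (pit r) (fun x => ev (a : gsusp (-1) (gdual _ (MM X))) (pact (pil r) x)) t ->
 \sum_(q <- t) sgn K (dl q) * (gD _ (down (vl q)) * gD _ (down (vr q)) : K) =
 (good r)%:R * ev (a : gsusp (-1) (gdual _ (MM X))) (wM K r) :> K.
Proof.
move=> h; rewrite /good; have [S1|S1] := eqVneq (nedge (piS r)) 1%N; last first.
 by rewrite mul0r big1 // => q _; rewrite (gD0 _ S1) mul0r mulr0.
have [F1|F1] := eqVneq (nedge (piF r)) 1%N; last first. by rewrite mul0r big1 // => q _; rewrite (gD0 _ F1) !mulr0.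
rewrite /= mul1r /wM h; apply: eq_bigr => q _; rewrite (gD1 _ S1) (gD1 _ F1).
have d1 T (v : dual_presheaf false MM T) d : nedge T = 1%N -> homog d v -> co1 (down v) != 0 -> d = 1.
 move=> T1 hv c0; have hv' : @homog K (bar_gen MM T) (d - 1) (down v). have e : d - 1 - (-1) = d by ring.
  by rewrite /homog /= e.
 have := co1_deg hv' c0; rewrite (eset_one (objO T) T1) cards1 subrr => /eqP; rewrite subr_eq0 => /eqP //.
change (sgn K (dl q) * (co1 (down (vl q)) * co1 (down (vr q))) =
 sgn K (dl q * dr q) * (co1 (down (vl q)) * co1 (down (vr q)))).
have [->|c0] := eqVneq (co1 (down (vr q))) 0; first by rewrite !mulr0.
by rewrite (d1 _ _ _ F1 (pure_homr q) c0) mulr1.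
Qed.

(** Only good pairs contribute. There are either none or two, and by [mw_opp] the two contributions
    cancel. *)
Lemma can_pa_ioD X (a : bar_gen MM X) : can X (pa (ioD a)) = 0.
Proof.
have [n [c [t [rc h ->]]]] := dual_dg_gen (dual_dg_pa O K2) a.
have step i : can X (\sum_(q <- t i) sgn K (dl q) *:
  pact (pil (c i)) (circ (pit (c i)) (ioD (down (vl q))) (ioD (down (vr q))))) =
  (good (c i))%:R * ev (a : gsusp (-1) (gdual _ (MM X))) (wM K (c i)) :> K.
 rewrite (lin_sum (@cl X)) -(good_pairing (h i)); apply: eq_bigr => q _.
 by rewrite (linZ (@cl X)) (pmap_act cm (pil_iso (c i))) (omap_circ cm (pit_elem (c i))) !cE.
rewrite (lin_sum (@cl X)) (eq_bigr _ (fun i _ => step i)).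
have [/existsP[i gi]|/existsPn ng] := boolP [exists i, good (c i)]; last first.
 by rewrite big1 // => i _; rewrite (negbTE (ng i)) mul0r.
have [j [ij gj ppj all]] := good_two rc gi.
rewrite (sum_two _ ij all) gi gj !mul1r !wM_mw // (mw_opp K gi gj ppj) !ev_eb.
have e (x : ext K (sym X)) B : (- x) B = - x B :> K by rewrite ffunE.
by rewrite (linN embl) e mulNr subrr.
Qed.

Lemma bar_nz T : (0 < nedge T)%N -> exists a : bar_gen MM T, a <> 0.
Proof.
move=> /(co1_ex K)[a a1]; exists a => a0; move: a1; rewrite a0 (lin0 (@co1_lin K O T)).
by move/esym/eqP; rewrite oner_eq0.
Qed.

(** Basis vectors are, up to scalars, composites of generators, so the derivation rule reduces the
    claim to [can_pa_ioD]. *)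
Lemma can_pa X (x : D X) : can X (pa x) = 0.
Proof.
have pl := @pa_lin K O; move: x; apply: Mod_ind => [|k x y px py|x A bA].
- by rewrite (lin0 (pl X)) (lin0 (@cl X)).
- by rewrite (pl X) (@cl X) px py scaler0 addr0.
have [x' bA' G'] := Gen_total odD isT (@ioD_top K O) (fun T h _ => bar_nz h) (bs_valid bA).
have [k _ ->] := bs_prop bA' bA; rewrite (linZ (pl X)) (linZ (@cl X)).
suff -> : can X (pa x') = 0 by rewrite scaler0.
have {G'} [m G] := G' Te gD (terminal_one K O) gD_coll.
elim: G => {X x x' A bA bA' k m}.
- by move=> U Ut; rewrite pa_0 ?(lin0 (@cl U)) //; apply/(nedge_eq0 (objO U))/loc_full; case: Ut.
- by move=> X a _; apply: can_pa_ioD.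
- by move=> X k x m _ _ h; rewrite (linZ (pl X)) (linZ (@cl X)) h scaler0.
- by move=> X Y g x m gi _ h; rewrite (pa_act _ gi) (pmap_act cm gi).
- move=> X S F t i x m y n te Gx hx Gy hy.
 have [d [hd _]] := Gen_homog odD (@ioD_coll K O) (@ioD_inj K O) (@ioD_top K O) (terminal_one K O) gD_coll Gx.
 rewrite (pa_circ _ te hd) (@cl X) !(omap_circ cm te) hx hy.
 change (sgn K (-1 * d) * (can S x * 0) + 0 * can F y = 0 :> K). by rewrite !mulr0 mul0r addr0.
Qed.

Lemma pa_ioD1 T (a : bar_gen MM T) : nedge T = 1%N -> pa (ioD a) = 0.
Proof.
move=> T1; have [n [c rc]] := reps_ex T; apply: emb_inj.
rewrite (pa_ioD a rc) (lin0 embl) big1 // => i _.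
have te := pit_elem (c i); have := nedge_elem (pil_iso (c i)) te; have := pi_edge (c i).
by have [_ _ F0 _] := te; rewrite T1; move: F0; lia.
Qed.

(** Compose generators on single edges, one contraction after the other: each is a cycle by
    [pa_ioD1], and [can] is nonzero on each. *)
Lemma cycle_ex X : exists (x : D X) n, [/\ homog n x, pa x = 0 & can X x <> 0].
Proof.
move: {2}(nedge X).+1 (ltnSn (nedge X)) => k; elim: k => // k IH in X *; rewrite ltnS => Xk.
have [X0|[h hf]] := set_0Vmem (full X). have Xl := full_lt X0; have [U [b [Ut _ _]]] := terminal_ex X.
 exists (pact b (eta D U)), 0; split; last 2 first.
 - by apply: pa_0; apply/(nedge_eq0 (objO X)).
 - by rewrite (pmap_act cm (iso_lt b Xl)) (omap_eta cm Ut); exact/eqP/oner_neq0.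
 - by apply: (pact_deg Do (iso_lt b Xl)); apply: (op_eta_deg Do).
have [tq q2] := full2 hf; have [T [S [F [l [t [i [li te nE]]]]]]] := contr_ex tq.
have [_ [iv [ih J]] F0 _] := te; have nX := nedge_elem li te.
have [|z [d [hz pz cz]]] := IH S; first by apply: leq_trans Xk; rewrite nX -[X in (X < _)%N]addn0 ltn_add2l.
have F1 : nedge F = 1%N. have := card_full (objO F); rewrite -(card_imset _ (ih_inj J)) (ih_full te J).
 have : #|psi l @: nz t| = 2%N by rewrite -(nz_iso_comp _ li) nE.
 by rewrite card_imset; [move=> ->; lia|exact: psi_inj (arr0 l)].
have [a a0] := bar_nz F0.
exists (pact l (circ t z (ioD a))), (d + deg fD (topS fD F)); split.
- apply: (pact_deg Do li); apply: (op_deg Do te) hz _; exact: bs_homog (ioD_top a0).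
- rewrite (pa_act _ li) (pa_circ _ te hz) pz (pa_ioD1 _ F1).
 rewrite (lin0 (op_linr Do te z)) (lin0 (op_linl Do te _)) scaler0 addr0. exact: lin0 (pact_lin Do li).
- rewrite (pmap_act cm li) (omap_circ cm te) cE (gD1 _ F1). by apply/eqP; apply: mulf_neq0 (co1_neq0 a0); apply/eqP.
Qed.

(** [nest_homology] leaves at most one class, and the cycle [x1] represents a nonzero one since
    [can] kills boundaries but not [x1]. Injectivity and surjectivity of [can] on homology both
    follow by comparing a cycle with [x1]. *)
Lemma can_quasi_iso : quasi_iso pa can.
Proof.
move=> T; have [x1 [_ [_ p1 c1]]] := cycle_ex T.
have vE : @valid fD T = cval (full T) by apply: funext => A; apply: validD.
have fo : opclosed (opp T) (full T) by exact: full_closed (objO T).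
have [z H] := nest_homology K2 (objO T) fo (subxx _).
have sv (x : D T) : supp (fun A => cval (full T) A) (emb x). by move=> A /(@emb_supp _ _ _ _ x); rewrite validD.
have H' (x : D T) : pa x = 0 -> exists y k, emb x = emb (pa y) + k *: z.
 move=> px; have [||y [k [sy ->]]] := H (emb x); first exact: sv.
  rewrite -vE; have := emb_pa x; rewrite px (lin0 embl) => /esym/eqP. by rewrite oppr_eq0 => /eqP.
 exists (prj _ _ (- y)), k; congr (_ + _); rewrite -vE emb_pa prjK; last first.
  by move=> A; rewrite ffunE oppr_eq0 => /sy; rewrite validD. by rewrite (linN (@dif_lin _ _ _)) opprK.
have [y1 [k1 E1]] := H' x1 p1.
have k10 : k1 != 0. apply/eqP => k0; apply: c1; have -> : x1 = pa y1.
  by apply: emb_inj; rewrite E1 k0 scale0r addr0. exact: can_pa.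
split=> [x px cx|w]; last first.
 exists (((w : K) / (can T x1 : K)) *: x1); first by rewrite (linZ (@pa_lin K O T)) p1 scaler0.
 by rewrite (linZ (@cl T)); apply: (@divfK K); apply/eqP.
have [y [k Ex]] := H' x px.
(* The multiple [k / k1] of [x1] removes the unknown vector [z] from the two expressions. *)
have xE : x = pa (y - (k / k1) *: y1) + (k / k1) *: x1. apply: emb_inj; rewrite (linD embl) (linZ embl).
 rewrite (linD (@pa_lin K O T)) (linN (@pa_lin K O T)) (linZ (@pa_lin K O T)).
 rewrite (linD embl) (linN embl) (linZ embl). by rewrite Ex E1 scalerDr scalerA divfK // addrA addrNK.
have k0 : k / k1 = 0. have := cx; rewrite {1}xE (linD (@cl T)) can_pa add0r (linZ (@cl T)) => /eqP.
 by rewrite scaler_eq0 => /orP[/eqP//|/eqP]; case/c1.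
by exists (y - (k / k1) *: y1); rewrite {1}xE k0 !scale0r !addr0.
Qed.
End Koszul.

Section TerminalKoszul.
Variables (K : fieldType) (O : opcat).
Hypothesis K2 : 2%:R != 0 :> K.
Implicit Types (T : obj O).

Notation MM := (Mod K fM O).
Notation Te := (terminal_operad K O).
Notation f := (@one_edge_incl K O).

Lemma quadT (p : family (Mod K fF O) Te) : operad_map p -> (forall T x, p T (io x) = f x) ->
 quadratic (@io K O) (fun T (x : Mod K fF O T) => @weight K O _ (Mod K fF O) (@io K O) 2 T x /\ p T x = 0) p.
Proof.
move=> pm pf.
apply: (@quad_quadratic K O _ (@ct K O) 0 (ct_coord K O) fF [:: false; true] isT erefl erefl
 erefl isT isT (or_intror erefl) (one_edge_coll K O) Te f p (terminal_one K O) (f_coll K O) pm pf).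
- exact: genT_nz.
- move=> X x m m'; exact: genT_span.
Qed.

Lemma quadM (p' : family (Mod K fN O) MM) : operad_map p' -> (forall T x, p' T (io' x) = f' x) ->
 quadratic (@io' K O) (fun T (x : Mod K fN O T) => @weight K O _ (Mod K fN O) (@io' K O) 2 T x /\ p' T x = 0) p'.
Proof.
move=> pm pf.
apply: (@quad_quadratic K O _ (@dual_coord K O) 1 (sdual_coord K O) fN [:: true] isT erefl erefl
 erefl isT isT (or_introl erefl) (sdual_coll K O) MM _ p' (MM_one K O) (f'_coll K O) pm pf).
- exact: genM_nz.
- move=> X x m m'; exact: genM_span.
Qed.

(** The element [e] is forced to have coordinate [gD a]; away from graphs with one edge both sides
    of the evaluation vanish. *)
Lemma can_gen T (p : family (Mod K fF O) Te) (p' : family (Mod K fN O) MM)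
 (can : family (Mod K fD O) Te) (a : bar_gen MM T) :
 (forall T x, p T (io x) = f x) -> (forall T x, p' T (io' x) = f' x) -> (forall T a, can T (ioD a) = gD a) ->
 exists2 e : one_edge K O T, can T (ioD a) = p T (io e) &
  forall b : sdual (one_edge K O) T, ev b e = ev a (p' T (io' b)).
Proof.
move=> pf pf' cE; pose e : one_edge K O T := (gD a : K) *: one K (nedge T == 1%N).
have te : tot (e : 'rV_(nedge T == 1%N)) = gD a :> K. rewrite /e (linZ (@tot_lin K (nedge T == 1%N))).
 have [T1|T1] := eqVneq (nedge T) 1%N; last by rewrite (gD0 a T1) scale0r. by rewrite tot_one; apply: mulr1.
exists e; first by rewrite cE pf; exact/esym.
move=> b; rewrite pf'; transitivity (tot (e : 'rV_(nedge T == 1%N)) * dual_coord b); first exact: ev_one.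
rewrite te ev_eb (_ : emb (f' b) = dual_coord b *: mtop K [:: false] T); last first.
 by apply: (emb_geni (sdual_coord K O)).
have [T1|T1] := eqVneq (nedge T) 1%N. rewrite (gD1 a T1) -(delta_eM1 K T1) !ffunE eqxx mulrC; congr (_ * _).
 by apply/esym/mulr1.
by rewrite (gD0 a T1) (co_red (sdual_coord K O) b T1) scale0r ffunE !mul0r.
Qed.

Lemma terminal_is_koszul : terminal_koszul K O.
Proof.
have [_ _ /(_ Te f (terminal_one K O) (f_coll K O)) [[p pm pf] _]] := io_free K O.
have [_ _ /(_ MM _ (MM_one K O) (f'_coll K O)) [[p' pm' pf'] _]] := io'_free K O.
have [_ _ /(_ Te _ (terminal_one K O) (gD_coll K O)) [[can cm cE] _]] := ioD_free K O.
exists (Mod K fF O), (@io K O), p; split.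
- exact: pf.
- exact: quadT pm pf.
- by move=> T [x x0]; case: (co_neq0 (ct_coord K O) x0).
exists (Mod K fN O), (@io' K O), MM, p', (Mod K fD O), (@ioD K O), (@pa K O), can; split.
(* The orthogonal relations are replaced, as a predicate, by the quadratic part of the kernel of
   [p'], for which [quadM] is available. *)
- have -> : perp (@io K O) (@io' K O) (fun T (x : Mod K fF O T) =>
   @weight K O _ (Mod K fF O) (@io K O) 2 T x /\ p T x = 0) =
  fun T (x : Mod K fN O T) => @weight K O _ (Mod K fN O) (@io' K O) 2 T x /\ p' T x = 0.
  apply: functional_extensionality_dep => T; apply: funext => z'; apply: propext. exact (perpE pm pf pm' pf' z').
 exact: quadM pm' pf'.
- exact: dual_dg_pa.
- split=> [//|T x]; exact (can_pa K2 cm cE x).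
- by move=> T a; apply: can_gen pf pf' cE.
- exact (can_quasi_iso K2 cm cE).
Qed.
End TerminalKoszul.

Theorem theorem9p6 (K : fieldType) (charK0 : [pchar K]%R =i pred0) :
 [/\ terminal_koszul K ggGrc, terminal_koszul K Tr, terminal_koszul K RTr & terminal_koszul K Whe].
Proof.
have K2 : 2%:R != 0 :> K by apply/negP => K2; have := charK0 2%N; rewrite inE /= K2.
by split; apply: terminal_is_koszul.
Qed.
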